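(* Let $H$ be a complex Hilbert space, let $K_1, K_2 \subset H$ be standard subspaces, and let $Q: K_1 \to K_2$ be a symplectomorphism. There exists an isomorphism of von Neumann algebras $\phi: A(K_1) \to A(K_2)$ such that $\phi(W(h)) = W(Qh)$ for all $h \in K_1$ if and only if both of the following hold: (i) $Q$ is bounded (with respect to the restrictions to $K_1$ and $K_2$ of the norm $\|\cdot\|$ of $H$); (ii) the operator $$\big[1+i R_1\big]^{\frac 12}-\big[ i R_1 + Q^\dagger Q\big]^{\frac 12}$$ is Hilbert-Schmidt on $K_1 + i K_1$ (with respect to the scalar product $\langle\cdot,\cdot\rangle_{s_1}$).
   Context: Scalar products $\langle\cdot,\cdot\rangle$ are linear in the second variable. Fock space and Weyl operators: for a complex Hilbert space $H$, $e^H = \bigoplus_{n\ge 0} H^{\otimes_S n}$ is the symmetric Fock space ($H^{\otimes_S 0}=\mathbb{C}$), with coherent vectors $e^x = \bigoplus_{n\ge 0} \frac{1}{\sqrt{n!}} x^{\otimes n}$, $x \in H$, which form a total set. The Weyl unitaries $W(x)$, $x \in H$, on $e^H$ are determined by $W(x) e^0 = e^{-\frac14\|x\|^2} e^{ix/\sqrt2}$ (here $e^{ix/\sqrt2}$ is the coherent vector of $ix/\sqrt 2$) and $W(x)W(y) = e^{-\frac i2 \mathrm{Im}\langle x,y\rangle} W(x+y)$. For a closed real subspace $K\subset H$, $A(K) = \{W(h) : h \in K\}''$ is a von Neumann algebra on $e^H$. Standard subspaces: a closed real subspace $K \subset H$ is standard if $K+iK$ is dense in $H$ and $K \cap iK =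 \{0\}$. Its Tomita operator is the closed, densely defined, conjugate linear operator $s: K+iK \to K+iK$, $s(h+ik) = h-ik$ ($h,k\in K$), with polar decomposition $s = j\delta^{1/2}$; $\delta$ is the modular operator. Put $R = i\frac{\delta-1}{\delta+1}$, a bounded skew-adjoint operator on $H$; it maps $K$ into $K$ and hence $K+iK$ into itself. The space $K+iK$ is a complex Hilbert space with the scalar product $\langle x,y\rangle_s = \langle x,y\rangle + \langle sy,sx\rangle$. For $K_1,K_2$ the corresponding objects are denoted $s_j,\delta_j,R_j$, $j=1,2$. A symplectomorphism $Q: K_1 \to K_2$ is a real linear bijection with $\mathrm{Im}\langle Qh,Qk\rangle = \mathrm{Im}\langle h,k\rangle$ for all $h,k \in K_1$. For a bounded real linear $T:K_1\to K_2$, $T^\dagger : K_2 \to K_1$ is the adjoint with respect to the real scalar products, i.e. $\mathrm{Re}\langle T^\dagger h,k\rangle = \mathrm{Re}\langle h,Tk\rangle$, $h\in K_2$, $k \in K_1$. $Q$ and $Q^\dagger$ are extended by $\mathbb{C}$-linearity to maps between $K_1+iK_1$ and $K_2+iK_2$. Square roots are positive square roots of bounded positive operators on the Hilbert space $(K_1+iK_1,\langle\cdot,\cdot\rangle_{s_1})$. *)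

(* Defs.v *)
From HB Require Import structures.
From mathcomp Require Import all_boot all_order all_fingroup all_algebra.
From mathcomp Require Import complex.
From mathcomp Require Import all_classical all_reals all_analysis.
Set Implicit Arguments.
Unset Strict Implicit.
Unset Printing Implicit Defensive.
Import Order.TTheory GRing.Theory Num.Theory.
Import numFieldNormedType.Exports.
Local Open Scope classical_set_scope.
Local Open Scope ring_scope.

(* Complex Hilbert spaces; [inner] is linear in its second argument.          *)
(* Positive definiteness follows from [inner_norm].                           *)
HB.mixin Record isHilbert (R : realType) H of CompleteNormedModule R[i] H := {
  inner : H -> H -> R[i];
  inner_linear : forall (x y z : H) (a : R[i]),
    inner x (a *: y + z) = a * inner x y + inner x z;
  inner_conj : forall x y : H, inner y x = ((inner x y)^*)%C;
  inner_norm : forall x : H, inner x x = `|x| ^+ 2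
}.

#[short(type="hilbertType")]
HB.structure Definition Hilbert (R : realType) :=
  {H of isHilbert R H & CompleteNormedModule R[i] H}.

Definition imI {R : realType} : R[i] := Complex 0 1.

Definition expIR {R : realType} (t : R) : R[i] := Complex (cos t) (sin t).

Section Spaces.
Variables (R : realType) (H : hilbertType R).
Implicit Types (K : set H) (x y z : H) (T : H -> H) (G : set (H * H)).

Definition real_subspace K :=
  [/\ K 0, (forall x y, K x -> K y -> K (x + y)) &
      forall (a : R) x, K x -> K (a%:C%C *: x)].

Definition complexify K : set H :=
  [set x | exists h k, [/\ K h, K k & x = h + imI *: k]].

Definition standard_subspace K :=
  [/\ real_subspace K, closed K, dense (complexify K) &
      forall x, K x -> K (imI *: x) -> x = 0].

(* Unbounded operators are represented by their graphs. *)

Definition graph_comp G1 G2 : set (H * H) :=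
  [set p | exists y, G2 (p.1, y) /\ G1 (y, p.2)].

Definition graph_adjoint G : set (H * H) :=
  [set p | forall q, G q -> inner q.2 p.1 = inner q.1 p.2].

(* Linearity and single-valuedness of G follow from the first two clauses. *)
Definition positive_selfadjoint G :=
  [/\ dense [set x | exists y, G (x, y)], graph_adjoint G = G &
      forall x y, G (x, y) -> 0 <= inner x y].

Definition antiunitary T :=
  [/\ forall (a : R[i]) x y, T (a *: x + y) = (a^*)%C *: T x + T y,
      forall x y, inner (T x) (T y) = inner y x &
      forall y, exists x, T x = y].

Definition tomita K : set (H * H) :=
  [set p | exists h k,
     [/\ K h, K k, p.1 = h + imI *: k & p.2 = h - imI *: k]].

(* G = j d. Tomita operators are injective with dense range, so the partial   *)
(* antiunitary factor of their polar decomposition is antiunitary.            *)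
Definition polar_decomposition G (j : H -> H) (d : set (H * H)) :=
  [/\ antiunitary j, positive_selfadjoint d &
      G = [set p | exists y, d (p.1, y) /\ p.2 = j y]].

(* delta = (delta^{1/2})^2, where delta^{1/2} is the (unique) positive factor *)
(* of the polar decomposition of the Tomita operator.                         *)
Definition modular_operator K : set (H * H) :=
  [set p | exists j d,
     polar_decomposition (tomita K) j d /\ graph_comp d d p].

(* i (delta - 1) (delta + 1)^{-1}: it maps delta u + u to i (delta u - u).    *)
Definition modular_R K : H -> H := fun x =>
  xget 0 [set z | exists u v,
    [/\ modular_operator K (u, v), x = v + u & z = imI *: (v - u)]].

(* <x, y>_s = <x, y> + <s y, s x> on the domain of s *)
Definition tomita_fun K : H -> H := fun x => xget 0 [set y | tomita K (x, y)].

Definition inner_s K x y : R[i] :=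
  inner x y + inner (tomita_fun K y) (tomita_fun K x).

Definition real_linear_on K T :=
  forall (a : R) x y, K x -> K y ->
    T (a%:C%C *: x + y) = a%:C%C *: T x + T y.

Definition symplectomorphism K1 K2 T :=
  [/\ set_bij K1 K2 T, real_linear_on K1 T &
      forall h k, K1 h -> K1 k ->
        complex.Im (inner (T h) (T k)) = complex.Im (inner h k)].

Definition bounded_real_on K T :=
  exists M : R, forall h, K h -> `|T h| <= M%:C%C * `|h|.

(* For T : K1 -> K2, the adjoint K2 -> K1 for the real scalar products. *)
Definition real_adjoint K1 T : H -> H := fun h =>
  xget 0 [set g | K1 g /\ forall k, K1 k ->
    complex.Re (inner g k) = complex.Re (inner h (T k))].

(* the C-linear extension to K + iK of T, given on K *)
Definition Cextend K T : H -> H := fun x =>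
  xget 0 [set z | exists h k,
    [/\ K h, K k, x = h + imI *: k & z = T h + imI *: T k]].

(* Operators on the Hilbert space with underlying vector space D (a complex   *)
(* subspace of H) and scalar product ip; values outside D are irrelevant.     *)

Section Operators.
Variables (D : set H) (ip : H -> H -> R[i]).

Definition bounded_operator_on T :=
  [/\ forall x, D x -> D (T x),
      forall (a : R[i]) x y, D x -> D y -> T (a *: x + y) = a *: T x + T y &
      exists M : R, forall x, D x -> ip (T x) (T x) <= M%:C%C * ip x x].

Definition positive_operator_on T :=
  bounded_operator_on T /\ forall x, D x -> 0 <= ip x (T x).

Definition positive_sqrt_on T S :=
  positive_operator_on S /\ forall x, D x -> S (S x) = T x.

Definition orthonormal_basis_on (E : set H) :=
  [/\ E `<=` D,
      forall e f, E e -> E f -> ip e f = (e == f)%:R &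
      forall x, D x -> (forall e, E e -> ip e x = 0) -> x = 0].

Definition hilbert_schmidt_on T :=
  bounded_operator_on T /\
  exists E, orthonormal_basis_on E /\
    (\esum_(e in E) (complex.Re (ip (T e) (T e)))%:E < +oo)%E.

End Operators.
End Spaces.

Section VonNeumann.
Variables (R : realType) (F : hilbertType R).
Implicit Types (S T : F -> F) (M N : set (F -> F)).

Definition bounded_operator T := linear T /\ continuous T.

Definition unitary T :=
  [/\ linear T, forall x y, inner (T x) (T y) = inner x y &
      forall y, exists x, T x = y].

Definition commutant M : set (F -> F) :=
  [set T | bounded_operator T /\ forall S, M S -> T \o S = S \o T].

Definition adjoint_operators S T := forall x y, inner (S x) y = inner x (T y).

(* isomorphisms of von Neumann algebras: bijective *-homomorphisms *)
Definition vN_isomorphism M N (phi : (F -> F) -> (F -> F)) :=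
  [/\ set_bij M N phi,
      forall (a : R[i]) S T, M S -> M T ->
        phi (fun v => a *: S v + T v) = (fun v => a *: phi S v + phi T v),
      forall S T, M S -> M T -> phi (S \o T) = phi S \o phi T &
      forall S T, M S -> M T -> adjoint_operators S T ->
        adjoint_operators (phi S) (phi T)].

End VonNeumann.

Section Fock.
Variable R : realType.

Definition Cspan (V : hilbertType R) (A : set V) : set V :=
  [set v | exists n (a : 'I_n -> R[i]) (u : 'I_n -> V),
     (forall i, A (u i)) /\ v = \sum_(i < n) a i *: u i].

Definition total (V : hilbertType R) (A : set V) := dense (Cspan A).

Variable H : hilbertType R.

(* The n-th Hilbert space tensor power of H, up to unitary equivalence: the   *)
(* completion of the algebraic one. Multilinearity of [tensor] follows from   *)
(* the two axioms.                                                            *)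
Record tensor_power (n : nat) := TensorPower {
  tensor_space :> hilbertType R;
  tensor : ('I_n -> H) -> tensor_space;
  tensor_inner : forall x y : 'I_n -> H,
    inner (tensor x) (tensor y) = \prod_(i < n) inner (x i) (y i);
  tensor_total : total (range tensor)
}.

(* Invariance under the unitaries that permute the factors, tested against    *)
(* elementary tensors.                                                        *)
Definition symmetric_tensor n (T : tensor_power n) : set T :=
  [set t | forall (s : 'S_n) (x : 'I_n -> H),
     inner (tensor T (x \o s)) t = inner (tensor T x) t].

(* The Hilbert space direct sum of the symmetric tensor powers of H, up to    *)
(* unitary equivalence; [fock_in n] is the inclusion of the n-th summand, and *)
(* its values outside the symmetric tensors are irrelevant.                   *)
Record fock_space := FockSpace {
  fock_carrier :> hilbertType R;
  fock_tensor : forall n, tensor_power n;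
  fock_in : forall n, fock_tensor n -> fock_carrier;
  fock_in_linear : forall n (a : R[i]) (t u : fock_tensor n),
    symmetric_tensor t -> symmetric_tensor u ->
    fock_in (a *: t + u) = a *: fock_in t + fock_in u;
  fock_in_inner : forall n (t u : fock_tensor n),
    symmetric_tensor t -> symmetric_tensor u ->
    inner (fock_in t) (fock_in u) = inner t u;
  fock_in_orthogonal : forall m n (t : fock_tensor m) (u : fock_tensor n),
    m != n -> symmetric_tensor t -> symmetric_tensor u ->
    inner (fock_in t) (fock_in u) = 0;
  fock_total : total
    [set v | exists n (t : fock_tensor n), symmetric_tensor t /\ v = fock_in t]
}.

Variable F : fock_space.

Definition coherent (x : H) : F :=
  limn (series (fun n => (Num.sqrt (n`!%:R : R))^-1%:C%C *:
                           fock_in (tensor (fock_tensor F n) (fun=> x)))).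

Definition weyl_operators (W : H -> F -> F) :=
  [/\ forall x, unitary (W x),
      forall x, W x (coherent 0) =
        (expR (- (complex.Re `|x| ^+ 2 / 4)))%:C%C *:
          coherent ((imI * (Num.sqrt 2)^-1%:C%C) *: x) &
      forall x y v, W x (W y v) =
        expIR (- (complex.Im (inner x y) / 2)) *: W (x + y) v].

Definition weyl_algebra (W : H -> F -> F) (K : set H) : set (F -> F) :=
  commutant (commutant [set W h | h in K]).

End Fock.

(* Main.v *)
(** Let X be the positive operator with X^2 = 2 / (1 + delta_1) and let j be the modular
    conjugation of K1, so that K1 is the image under X of the real vectors h = j h. Let V be
    the complex linear map that agrees with Q X on real vectors, and Y the positive square
    root of V* V. Transported by X from (K1 + i K1, <.,.>_s) to H, the square roots in (ii)
    are X and Y, so (ii) says that T = X - Y is Hilbert-Schmidt.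

    Necessity. The isomorphism preserves order and the vacuum is separating for A(K2), so
    there is C with |w1(a) - w2(phi a)|^2 <= C (Var_w1(a) + Var_w2(phi a)) for self-adjoint a,
    w1 and w2 being the vacuum states. Averages of cosines of multiples of h show that Q is
    bounded; observables of second order give, for real symmetric matrices c, a bound on
    |tr c (X^2 - Y^2)|^2. On compressions to finite-dimensional subspaces, the solution c of
    (X + Y) c + c (X + Y) = 2 T turns it into a uniform bound on the Hilbert-Schmidt norm of T.

    Sufficiency. If T is Hilbert-Schmidt, a squeezed vacuum turns the expectations of the
    W (X h) into Gaussians whose covariance differs from the vacuum covariance of the W (V h)
    by a Hilbert-Schmidt form, a difference of two nonnegative ones. Adding these as noise to
    the two covariances, both become the vacuum covariance of the W (i0 h) for one operator i0.
    Noise is an average over finitely many random displacements, and compactness yields nonzero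
    operators that intertwine W (X h), and likewise W (V h), with W (i0 h). Composing them by
    irreducibility of the Weyl operators gives enough operators that intertwine W (X h) with
    W (V h) to define phi. *)

(* The operators s and delta_1 are unbounded. All arguments use the bounded operators X and j X j
   instead; X, up to a factor sqrt 2, is an isometry of H onto K1 + i K1 for <.,.>_s. The symplectic
   condition says that Y^2 - X^2 has a real form on real vectors, so both directions concern one
   real quadratic form.

   A squeezing reproduces this form only to first order in T, and the exponential of a quadratic
   expression converges only for small operators. The second order terms, and a finite rank piece
   that is split off to make the rest small, are products of Hilbert-Schmidt operators. They have no
   sign, which is why noise is added on both sides.

   The isomorphism phi comes with its algebraic structure and no continuity; what can be used is
   that square roots stay in the algebra, hence that order is preserved. X and Y may lack
   eigenvectors, hence the compressions. A square root does not commute with compression, but its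
   polynomial approximations do on vectors whose iterates stay in the compressed space, at a rate
   that depends only on a bound for the operator. *)
Require Import Defs.
From HB Require Import structures.
From mathcomp Require Import all_boot all_order all_fingroup all_algebra.
From mathcomp Require Import complex.
From mathcomp Require Import all_classical all_reals all_analysis.
From mathcomp Require Import ring lra.
Set Implicit Arguments.
Unset Strict Implicit.
Unset Printing Implicit Defensive.
Import Order.TTheory GRing.Theory Num.Theory.
Import numFieldNormedType.Exports.
Local Open Scope classical_set_scope.
Local Open Scope ring_scope.
Local Notation Re := complex.Re.
Local Notation Im := complex.Im.
Local Notation "⟪ x , y ⟫" := (inner x y) (at level 0, format "⟪ x ,  y ⟫").

(** * Inner products *)

Section ComplexScalars.
Variable R : realType.
Implicit Types (a b : R[i]) (r : R).

Lemma ReD a b : Re (a + b) = Re a + Re b. Proof. by case: a b => ? ? []. Qed.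
Lemma ImD a b : Im (a + b) = Im a + Im b. Proof. by case: a b => ? ? []. Qed.
Lemma ReN a : Re (- a) = - Re a. Proof. by case: a. Qed.
Lemma ImN a : Im (- a) = - Im a. Proof. by case: a. Qed.
Lemma ReM a b : Re (a * b) = Re a * Re b - Im a * Im b.
Proof. by case: a b => ? ? []. Qed.
Lemma ImM a b : Im (a * b) = Re a * Im b + Im a * Re b.
Proof. by case: a b => ? ? []. Qed.
Lemma ReJ a : Re (a^*)%C = Re a. Proof. by case: a. Qed.
Lemma ImJ a : Im (a^*)%C = - Im a. Proof. by case: a. Qed.
Lemma ReC r : Re r%:C%C = r. Proof. by []. Qed.
Lemma ImC r : Im r%:C%C = 0. Proof. by []. Qed.
Lemma Re_imI : Re (imI : R[i]) = 0. Proof. by []. Qed.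
Lemma Im_imI : Im (imI : R[i]) = 1. Proof. by []. Qed.
Definition reim := (ReD, ImD, ReN, ImN, ReM, ImM, ReJ, ImJ, ReC, ImC, Re_imI, Im_imI).

Lemma complex_ext a b : Re a = Re b -> Im a = Im b -> a = b.
Proof. by case: a b => ? ? [? ?] /= -> ->. Qed.

Lemma JC r : (r%:C)^*%C = r%:C%C :> R[i].
Proof. by apply: complex_ext; rewrite !reim ?oppr0. Qed.
Lemma JM a b : ((a * b)^*)%C = (a^*)%C * (b^*)%C. Proof. exact: rmorphM. Qed.
Lemma JD a b : ((a + b)^*)%C = (a^*)%C + (b^*)%C. Proof. exact: rmorphD. Qed.
Lemma JN a : ((- a)^*)%C = - (a^*)%C. Proof. exact: rmorphN. Qed.
Lemma J1 : (1^*)%C = 1 :> R[i]. Proof. exact: rmorph1. Qed.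
Lemma J0 : (0^*)%C = 0 :> R[i]. Proof. exact: rmorph0. Qed.
Lemma JK a : ((a^*)^*)%C = a. Proof. exact: conjcK. Qed.
Lemma J_imI : (imI^*)%C = - imI :> R[i].
Proof. by apply: complex_ext; rewrite !reim ?oppr0. Qed.
Lemma imI2 : imI * imI = - 1 :> R[i].
Proof. by apply: complex_ext; rewrite !reim /= ?oppr0; ring. Qed.
Definition conjE := (JM, JD, JN, J1, J0, JK, J_imI, JC).

Lemma realCD r r' : (r + r')%:C%C = r%:C%C + r'%:C%C :> R[i]. Proof. exact: rmorphD. Qed.
Lemma realCM r r' : (r * r')%:C%C = r%:C%C * r'%:C%C :> R[i]. Proof. exact: rmorphM. Qed.

(* The norms of R[i] and of H have values in R[i]; sqc, nc and n2, hn below are real. *)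
Definition sqc a : R := Re a ^+ 2 + Im a ^+ 2.

Lemma sqc_ge0 a : 0 <= sqc a. Proof. by rewrite addr_ge0 ?sqr_ge0. Qed.
Lemma sqcM a b : sqc (a * b) = sqc a * sqc b.
Proof. rewrite /sqc !reim; ring. Qed.
Lemma sqcJ a : sqc (a^*)%C = sqc a. Proof. by rewrite /sqc !reim sqrrN. Qed.
Lemma sqcN a : sqc (- a) = sqc a. Proof. by rewrite /sqc !reim !sqrrN. Qed.
Lemma sqcC r : sqc r%:C%C = r ^+ 2. Proof. by rewrite /sqc /= expr0n addr0. Qed.
Lemma sqc_imI : sqc imI = 1. Proof. by rewrite /sqc /= expr0n add0r expr1n. Qed.
Lemma sqcE a : (sqc a)%:C%C = a * (a^*)%C.
Proof. by apply: complex_ext; rewrite !reim /sqc; ring. Qed.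
Lemma sqcEl a : (sqc a)%:C%C = (a^*)%C * a. Proof. by rewrite mulrC sqcE. Qed.
Lemma sqc_eq0 a : (sqc a == 0) = (a == 0).
Proof.
apply/eqP/eqP => [|->]; last by rewrite /sqc /= expr0n addr0.
move/eqP; rewrite paddr_eq0 ?sqr_ge0// !sqrf_eq0 => /andP[/eqP r0 /eqP i0].
exact: complex_ext.
Qed.
Lemma sqr_Re_le a : Re a ^+ 2 <= sqc a. Proof. by rewrite lerDl sqr_ge0. Qed.

Definition nc a : R := Num.sqrt (sqc a).
Lemma nc_ge0 a : 0 <= nc a. Proof. exact: sqrtr_ge0. Qed.
Lemma nc2 a : nc a ^+ 2 = sqc a. Proof. by rewrite sqr_sqrtr ?sqc_ge0. Qed.
Lemma normcE a : `|a| = (nc a)%:C%C.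
Proof. by rewrite normc_def. Qed.
Lemma ncM a b : nc (a * b) = nc a * nc b.
Proof. by rewrite /nc sqcM sqrtrM ?sqc_ge0. Qed.
Lemma ncJ a : nc (a^*)%C = nc a. Proof. by rewrite /nc sqcJ. Qed.
Lemma ncN a : nc (- a) = nc a. Proof. by rewrite /nc sqcN. Qed.
Lemma ncC r : nc r%:C%C = `|r|. Proof. by rewrite /nc sqcC sqrtr_sqr. Qed.
Lemma nc0 : nc 0 = 0. Proof. by rewrite (ncC 0) normr0. Qed.
Lemma nc1 : nc 1 = 1. Proof. by rewrite (ncC 1) normr1. Qed.
Lemma nc_eq0 a : (nc a == 0) = (a == 0).
Proof. by rewrite -sqc_eq0 -nc2 sqrf_eq0. Qed.
Lemma ncX a n : nc (a ^+ n) = nc a ^+ n.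
Proof. by elim: n => [|n IH]; rewrite ?expr0 ?nc1// !exprS ncM IH. Qed.
Lemma ncD a b : nc (a + b) <= nc a + nc b.
Proof. by have := ler_normD a b; rewrite !normcE -realCD lecR. Qed.
Lemma nc_sum I (s : seq I) (P : pred I) (F : I -> R[i]) :
  nc (\sum_(i <- s | P i) F i) <= \sum_(i <- s | P i) nc (F i).
Proof.
elim/big_rec2: _ => [|i x y _ h]; first by rewrite nc0.
by apply: le_trans (ncD _ _) _; rewrite lerD2l.
Qed.
Lemma Re_le_nc a : `|Re a| <= nc a.
Proof. by rewrite -sqrtr_sqr ler_wsqrtr// sqr_Re_le. Qed.
Lemma nc_expIR r : nc (expIR r) = 1.
Proof. by rewrite /nc /sqc /expIR/= cos2Dsin2 sqrtr1. Qed.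
Lemma ReZ r a : Re (r%:C%C * a) = r * Re a. Proof. by rewrite !reim mul0r subr0. Qed.
Lemma Re_sum I (s : seq I) (P : pred I) (F : I -> R[i]) :
  Re (\sum_(i <- s | P i) F i) = \sum_(i <- s | P i) Re (F i).
Proof. by elim/big_rec2: _ => [//|i x y _ <-]; rewrite reim. Qed.
Lemma expIRD r r' : expIR (r + r') = expIR r * expIR r' :> R[i].
Proof. by apply: complex_ext; rewrite !reim /= ?cosD ?sinD; ring. Qed.
Lemma expIR0 : expIR 0 = 1 :> R[i].
Proof. by rewrite /expIR cos0 sin0. Qed.
Lemma expIRN r : expIR (- r) = (expIR r)^*%C :> R[i].
Proof. by apply: complex_ext; rewrite !reim /= ?cosN ?sinN. Qed.
Lemma expIRK r : expIR r * expIR (- r) = 1 :> R[i].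
Proof. by rewrite -expIRD subrr expIR0. Qed.

End ComplexScalars.

Section Hilbert.
Variables (R : realType) (H : hilbertType R).
Implicit Types (x y z u v w : H) (a b : R[i]).

Definition n2 x : R := Re ⟪x, x⟫.
Definition rip x y : R := Re ⟪x, y⟫.

Lemma innerDr x y z : ⟪x, y + z⟫ = ⟪x, y⟫ + ⟪x, z⟫.
Proof. by have := inner_linear x y z 1; rewrite scale1r mul1r. Qed.
Lemma inner0r x : ⟪x, 0⟫ = 0.
Proof. by apply: (addrI ⟪x, 0⟫); rewrite -innerDr !addr0. Qed.
Lemma innerZr a x y : ⟪x, a *: y⟫ = a * ⟪x, y⟫.
Proof. by have := inner_linear x y 0 a; rewrite !addr0 inner0r addr0. Qed.
Lemma innerNr x y : ⟪x, - y⟫ = - ⟪x, y⟫.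
Proof. by rewrite -scaleN1r innerZr mulN1r. Qed.
Lemma innerBr x y z : ⟪x, y - z⟫ = ⟪x, y⟫ - ⟪x, z⟫.
Proof. by rewrite innerDr innerNr. Qed.
Lemma innerC x y : ⟪y, x⟫ = (⟪x, y⟫^*)%C. Proof. exact: inner_conj. Qed.
Lemma innerDl x y z : ⟪x + y, z⟫ = ⟪x, z⟫ + ⟪y, z⟫.
Proof. by rewrite innerC innerDr JD -!innerC. Qed.
Lemma innerZl a x y : ⟪a *: x, y⟫ = (a^*)%C * ⟪x, y⟫.
Proof. by rewrite innerC innerZr JM -innerC. Qed.
Lemma innerNl x y : ⟪- x, y⟫ = - ⟪x, y⟫.
Proof. by rewrite innerC innerNr JN -innerC. Qed.
Lemma innerBl x y z : ⟪x - y, z⟫ = ⟪x, z⟫ - ⟪y, z⟫.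
Proof. by rewrite innerDl innerNl. Qed.
Lemma inner0l x : ⟪0, x⟫ = 0.
Proof. by rewrite innerC inner0r J0. Qed.
Definition innE := (innerDr, innerDl, innerBr, innerBl, innerNr, innerNl,
  innerZr, innerZl, inner0r, inner0l).

Lemma inner_sumr I (s : seq I) (P : pred I) (F : I -> H) x :
  ⟪x, \sum_(i <- s | P i) F i⟫ = \sum_(i <- s | P i) ⟪x, F i⟫.
Proof. by elim/big_rec2: _ => [|i y z _ <-]; rewrite ?inner0r// innerDr. Qed.
Lemma inner_suml I (s : seq I) (P : pred I) (F : I -> H) x :
  ⟪\sum_(i <- s | P i) F i, x⟫ = \sum_(i <- s | P i) ⟪F i, x⟫.
Proof. by elim/big_rec2: _ => [|i y z _ <-]; rewrite ?inner0l// innerDl. Qed.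

Lemma inner_n2 x : ⟪x, x⟫ = (n2 x)%:C%C.
Proof.
apply: complex_ext; rewrite !reim //.
have /(congr1 (@complex.Im R)) := innerC x x; rewrite reim; lra.
Qed.

Lemma normHE x : `|x| = (Num.sqrt (n2 x))%:C%C.
Proof.
have h : 0 <= `|x| :> R[i] by [].
have /complex_realP[r hr] : `|x| \is Num.real by exact: ger0_real.
have := inner_norm x; rewrite inner_n2 hr -rmorphXn/= => /(congr1 (@complex.Re R))/= ->.
by move: h; rewrite hr ler0c => r0; rewrite sqrtr_sqr ger0_norm.
Qed.

Lemma n2_ge0 x : 0 <= n2 x.
Proof.
have [//|neg] := leP 0 (n2 x).
have := inner_norm x; rewrite normHE ltr0_sqrtr// expr0n /= => /(congr1 (@complex.Re R))/= h.
by move: neg; rewrite /n2 h ltxx.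
Qed.

Lemma n2_eq0 x : (n2 x == 0) = (x == 0).
Proof.
rewrite -[x == 0]normr_eq0 normHE.
rewrite -(rmorph0 (@real_complex R)) (inj_eq (@complexI _)) sqrtr_eq0.
by rewrite eq_le n2_ge0 andbT.
Qed.

Lemma n2_0 : n2 0 = 0. Proof. by apply/eqP; rewrite n2_eq0. Qed.

Lemma ripC x y : rip x y = rip y x.
Proof. by rewrite /rip innerC reim. Qed.
Lemma ripDr x y z : rip x (y + z) = rip x y + rip x z.
Proof. by rewrite /rip innerDr reim. Qed.
Lemma ripDl x y z : rip (x + y) z = rip x z + rip y z.
Proof. by rewrite /rip innerDl reim. Qed.
Lemma ripNr x y : rip x (- y) = - rip x y.
Proof. by rewrite /rip innerNr reim. Qed.
Lemma ripNl x y : rip (- x) y = - rip x y.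
Proof. by rewrite /rip innerNl reim. Qed.
Lemma ripBr x y z : rip x (y - z) = rip x y - rip x z.
Proof. by rewrite ripDr ripNr. Qed.
Lemma ripBl x y z : rip (x - y) z = rip x z - rip y z.
Proof. by rewrite ripDl ripNl. Qed.
Lemma ripZr (r : R) x y : rip x (r%:C%C *: y) = r * rip x y.
Proof. by rewrite /rip innerZr ReZ. Qed.
Lemma ripZl (r : R) x y : rip (r%:C%C *: x) y = r * rip x y.
Proof. by rewrite ripC ripZr ripC. Qed.
Lemma rip0r x : rip x 0 = 0. Proof. by rewrite /rip inner0r. Qed.
Lemma rip0l x : rip 0 x = 0. Proof. by rewrite /rip inner0l. Qed.
Definition ripE := (ripDr, ripDl, ripBr, ripBl, ripNr, ripNl, ripZr, ripZl, rip0r, rip0l).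
Lemma rip_n2 x : rip x x = n2 x. Proof. by []. Qed.
Lemma rip_sumr I (s : seq I) (P : pred I) (F : I -> H) x :
  rip x (\sum_(i <- s | P i) F i) = \sum_(i <- s | P i) rip x (F i).
Proof. by rewrite /rip inner_sumr Re_sum. Qed.
Lemma rip_iI x y : rip (imI *: x) (imI *: y) = rip x y.
Proof. by rewrite /rip !innE conjE mulrA mulrN imI2 opprK mul1r. Qed.

Lemma n2D x y : n2 (x + y) = n2 x + n2 y + 2 * rip x y.
Proof. by rewrite -rip_n2 !ripE (ripC y x) !rip_n2; ring. Qed.
Lemma n2B x y : n2 (x - y) = n2 x + n2 y - 2 * rip x y.
Proof. by rewrite -rip_n2 !ripE (ripC y x) !rip_n2; ring. Qed.
Lemma n2N x : n2 (- x) = n2 x. Proof. by rewrite -rip_n2 !ripE opprK. Qed.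
Lemma n2Z a x : n2 (a *: x) = sqc a * n2 x.
Proof. by rewrite /n2 !innE mulrA -sqcE ReZ. Qed.
Lemma n2BC x y : n2 (x - y) = n2 (y - x). Proof. by rewrite -n2N opprB. Qed.
Lemma parallelogram x y : n2 (x + y) + n2 (x - y) = 2 * n2 x + 2 * n2 y.
Proof. rewrite n2D n2B; ring. Qed.

Lemma rip_CS x y : rip x y ^+ 2 <= n2 x * n2 y.
Proof.
have [->|y0] := eqVneq y 0; first by rewrite rip0r expr0n n2_0 mulr0.
have ny : 0 < n2 y by rewrite lt_neqAle n2_ge0 eq_sym n2_eq0 y0.
have := n2_ge0 ((n2 y)%:C%C *: x - (rip x y)%:C%C *: y).
rewrite n2B !n2Z !ripE !sqcC => h.
have: 0 <= n2 y * (n2 x * n2 y - rip x y ^+ 2) by nra.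
by rewrite pmulr_rge0// subr_ge0.
Qed.

Lemma inner_CS x y : sqc ⟪x, y⟫ <= n2 x * n2 y.
Proof.
set c := ⟪x, y⟫.
have [c0|c0] := eqVneq c 0; first by rewrite c0 /sqc/= expr0n addr0 mulr_ge0 ?n2_ge0.
have h := rip_CS x ((c^*)%C *: y).
rewrite /rip innerZr -/c -sqcEl ReC n2Z sqcJ in h.
have s0 : 0 < sqc c by rewrite lt_neqAle sqc_ge0 eq_sym sqc_eq0 c0.
by rewrite -(ler_pM2l s0) -expr2 mulrCA.
Qed.

Lemma inner_ext x y : (forall w, ⟪w, x⟫ = ⟪w, y⟫) -> x = y.
Proof.
move=> h; apply/eqP; rewrite -subr_eq0 -n2_eq0.
by rewrite /n2 innerBr h subrr.
Qed.

Lemma inner_extl x y : (forall w, ⟪x, w⟫ = ⟪y, w⟫) -> x = y.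
Proof. by move=> h; apply: inner_ext => w; rewrite innerC h -innerC. Qed.

Definition hn x : R := Num.sqrt (n2 x).
Lemma hn_ge0 x : 0 <= hn x. Proof. exact: sqrtr_ge0. Qed.
Lemma hn2 x : hn x ^+ 2 = n2 x. Proof. by rewrite sqr_sqrtr ?n2_ge0. Qed.
Lemma hn_normE x : `|x| = (hn x)%:C%C. Proof. exact: normHE. Qed.
Lemma hnZ a x : hn (a *: x) = nc a * hn x.
Proof. by rewrite /hn n2Z sqrtrM ?sqc_ge0. Qed.
Lemma hnD x y : hn (x + y) <= hn x + hn y.
Proof. by have := ler_normD x y; rewrite !hn_normE -realCD lecR. Qed.
Lemma hnN x : hn (- x) = hn x. Proof. by rewrite /hn n2N. Qed.
Lemma hnB x y : hn (x - y) <= hn x + hn y.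
Proof. by rewrite -(hnN y) hnD. Qed.
Lemma hnBC x y : hn (x - y) = hn (y - x). Proof. by rewrite -hnN opprB. Qed.
Lemma hn0 : hn 0 = 0. Proof. by rewrite /hn n2_0 sqrtr0. Qed.
Lemma hn_eq0 x : (hn x == 0) = (x == 0). Proof. by rewrite -n2_eq0 -hn2 sqrf_eq0. Qed.
Lemma hn_sum I (s : seq I) (P : pred I) (F : I -> H) :
  hn (\sum_(i <- s | P i) F i) <= \sum_(i <- s | P i) hn (F i).
Proof.
elim/big_rec2: _ => [|i x y _ h]; first by rewrite hn0.
by apply: le_trans (hnD _ _) _; rewrite lerD2l.
Qed.
Lemma nc_inner x y : nc ⟪x, y⟫ <= hn x * hn y.
Proof. by rewrite /nc /hn -sqrtrM ?n2_ge0// ler_wsqrtr// inner_CS. Qed.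
Lemma rip_le x y : `|rip x y| <= hn x * hn y.
Proof. exact: le_trans (Re_le_nc _) (nc_inner _ _). Qed.
Lemma hn_le x (r : R) : 0 <= r -> (hn x <= r) = (n2 x <= r ^+ 2).
Proof. by move=> r0; rewrite -hn2 ler_pXn2r// nnegrE hn_ge0. Qed.
Lemma hn_le2 x y : (hn x <= hn y) = (n2 x <= n2 y).
Proof. by rewrite hn_le ?hn_ge0// hn2. Qed.
Lemma hn_triangle x y z : hn (x - z) <= hn (x - y) + hn (y - z).
Proof. by rewrite -[X in hn X](_ : (x - y) + (y - z) = _) ?hnD// addrA subrK. Qed.
Lemma n2_le_2 x y : n2 (x + y) <= 2 * n2 x + 2 * n2 y.
Proof. by rewrite -parallelogram lerDl n2_ge0. Qed.

Lemma hcvgP (u : nat -> H) x :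
  u @ \oo --> x <-> forall e : R, 0 < e -> exists N, forall n, (N <= n)%N -> hn (u n - x) < e.
Proof.
split=> [/cvgrPdist_lt h e e0|h].
  have /h[N _ hN] : 0 < e%:C%C :> R[i] by rewrite ltcR.
  by exists N => n /hN /=; rewrite hn_normE ltcR hnBC.
apply/cvgrPdist_lt => e e0.
have eR : e = (Re e)%:C%C.
  by apply/esym/RRe_real; exact: gtr0_real.
have [|N hN] := h (Re e); first by rewrite eR ltcR in e0.
exists N => // n /hN /=; by rewrite hn_normE eR ltcR hnBC.
Qed.

Lemma hcomplete (u : nat -> H) :
  (forall e : R, 0 < e -> exists N, forall n m, (N <= n)%N -> (N <= m)%N -> hn (u n - u m) < e) ->
  exists x, u @ \oo --> x.
Proof.
move=> h; suff /cauchy_cvgP /cvg_ex[l hl] : cauchy (u @ \oo) by exists l.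
apply/cauchy_ballP => e e0.
have eR : e = (Re e)%:C%C by apply/esym/RRe_real; exact: gtr0_real.
have [|N hN] := h (Re e); first by rewrite eR ltcR in e0.
exists (u @` [set n | (N <= n)%N], u @` [set n | (N <= n)%N]).
  by split; exists N => // n Nn; exists n.
move=> [x y] /= [[n Nn <-] [m Nm <-]].
by rewrite -ball_normE /ball_/= hn_normE eR ltcR hN.
Qed.

Lemma hcvg_unique (u : nat -> H) x y : u @ \oo --> x -> u @ \oo --> y -> x = y.
Proof. exact: cvg_unique. Qed.

Lemma rcvgP (u : nat -> R) (l : R) :
  u @ \oo --> l <-> forall e : R, 0 < e -> exists N, forall n, (N <= n)%N -> `|u n - l| < e.
Proof.
split=> [/cvgrPdist_lt h e /h[N _ hN]|h].
  by exists N => n /hN /=; rewrite distrC.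
by apply/cvgrPdist_lt => e /h[N hN]; exists N => // n /hN /=; rewrite distrC.
Qed.

Lemma hcvg_rip (u : nat -> H) x y : u @ \oo --> x -> (fun n => rip y (u n)) @ \oo --> rip y x.
Proof.
move/hcvgP => h; apply/rcvgP => e e0.
have p0 : 0 < hn y + 1 by rewrite ltr_wpDl ?hn_ge0.
have [|N hN] := h (e / (hn y + 1)); first by rewrite divr_gt0.
exists N => n /hN; rewrite ltr_pdivlMr// => hlt.
rewrite -ripBr; apply: le_lt_trans (rip_le _ _) (le_lt_trans _ hlt).
by rewrite mulrC ler_wpM2l ?hn_ge0// lerDl.
Qed.

Lemma hcvg_const (x : H) : (fun _ : nat => x) @ \oo --> x.
Proof. exact: cvg_cst. Qed.

Lemma rcvg_eq (u : nat -> R) (l m : R) : u @ \oo --> l -> u @ \oo --> m -> l = m.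
Proof. exact: cvg_unique. Qed.

Lemma hcvg_inner_eq (u : nat -> H) x y a :
  u @ \oo --> x -> (forall n, ⟪y, u n⟫ = a) -> ⟪y, x⟫ = a.
Proof.
move=> ux h; apply: complex_ext.
  have := hcvg_rip (y := y) ux.
  rewrite (_ : (fun n => _) = cst (Re a)); last by apply/funext => n; rewrite /rip h.
  by move=> /rcvg_eq/(_ (cvg_cst _)).
have := hcvg_rip (y := imI *: y) ux.
rewrite (_ : (fun n => _) = cst (Im a)); last first.
  by apply/funext => n; rewrite /rip innerZl h !reim; ring.
move=> /rcvg_eq/(_ (cvg_cst _)) <-.
by rewrite /rip innerZl !reim; ring.
Qed.

Lemma hn_cvg (u : nat -> H) x : u @ \oo --> x -> (fun n => hn (u n)) @ \oo --> hn x.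
Proof.
move/hcvgP => h; apply/rcvgP => e /h[N hN]; exists N => n /hN; apply: le_lt_trans.
have h1 : hn x <= hn (u n) + hn (u n - x).
  by rewrite hnBC -[X in hn X <= _](_ : u n + (x - u n) = _) ?hnD// addrC subrK.
have h2 : hn (u n) <= hn (u n - x) + hn x.
  by rewrite -[X in hn X <= _](_ : u n - x + x = _) ?hnD// subrK.
by rewrite ler_norml; apply/andP; split; lra.
Qed.

Lemma n2_cvg (u : nat -> H) x : u @ \oo --> x -> (fun n => n2 (u n)) @ \oo --> n2 x.
Proof.
move=> /hn_cvg h; rewrite -hn2.
rewrite (_ : (fun n => _) = (fun n => hn (u n)) \* (fun n => hn (u n))).
  by apply: cvgM.
by apply/funext => n; rewrite /= -hn2 expr2.
Qed.

Lemma dense_hn (S : set H) :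
  dense S <-> forall x (e : R), 0 < e -> exists2 y, S y & hn (x - y) < e.
Proof.
split=> [h x e e0|h].
  have [|//|y [/= hy Sy]] := h (ball x e%:C%C).
  - by exists x; apply: ballxx; rewrite ltcR.
  - exact: ball_open.
  by exists y => //; move: hy; rewrite -ball_normE /ball_/= hn_normE ltcR.
move=> O [x Ox] oO; have [e /= e0 he] := (@nbhs_ballP _ _ _ _).1 (open_nbhs_nbhs (conj oO Ox)).
have eR : e = (Re e)%:C%C by apply/esym/RRe_real; exact: gtr0_real.
have [|y Sy hy] := h x (Re e); first by rewrite eR ltcR in e0.
exists y; split => //; apply: he.
by rewrite -ball_normE /ball_/= hn_normE eR ltcR.
Qed.

Lemma closed_hcvg (S : set H) : closed S ->
  forall (u : nat -> H) x, (forall n, S (u n)) -> u @ \oo --> x -> S x.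
Proof. by move=> cS u x Su ux; apply: (closed_cvg _ cS) ux; exact: nearW. Qed.

End Hilbert.

Ltac hvec := apply: inner_ext => ?; rewrite !innE; ring.

(** * Bounded operators *)

Section Riesz.
Variables (R : realType) (H : hilbertType R).
Implicit Types (x y z u v w : H).

(* Minimizing |y|^2 - 2c over pairs (y, c) in the graph of the functional avoids
   any discussion of its domain. *)
Lemma riesz_graph (G : set (H * R)) (C : R) :
  G (0, 0) ->
  (forall p q, G p -> G q -> G (p.1 + q.1, p.2 + q.2)) ->
  (forall (a : R) p, G p -> G (a%:C%C *: p.1, a * p.2)) ->
  0 <= C -> (forall p, G p -> p.2 ^+ 2 <= C * n2 p.1) ->
  exists v, (forall p, G p -> rip v p.1 = p.2) /\
    (forall e : R, 0 < e -> exists2 p, G p & hn (v - p.1) < e).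
Proof.
move=> G0 GD GZ C0 GC.
pose J (p : H * R) := n2 p.1 - 2 * p.2.
have Jlb p : G p -> - C <= J p.
  move=> /GC h; rewrite /J.
  have n0 := n2_ge0 p.1; set n := n2 p.1 in h n0 *.
  have : (2 * p.2) ^+ 2 <= (n + C) ^+ 2 by have := sqr_ge0 (n - C); nra.
  have nC : 0 <= n + C by rewrite addr_ge0.
  have [p0|p0] := leP p.2 0; first by move=> _; lra.
  have p2 : 0 <= 2 * p.2 by lra.
  by rewrite ler_pXn2r// => h2; lra.
pose S := [set J p | p in G].
have S0 : has_inf S.
  split; first by exists (J (0, 0)); exists (0, 0).
  by exists (- C) => _ [p Gp <-]; exact: Jlb.
pose m := inf S.
have mle p : G p -> m <= J p.
  by move=> Gp; apply: ge_inf; [exact: S0.2|exists p].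
have /choice[f fP] (n : nat) : exists p, G p /\ J p < m + (n.+1%:R)^-1.
  have [|_ [p Gp <-] hp] := @inf_adherent R S (n.+1%:R^-1) _ S0; first by rewrite invr_gt0.
  by exists p.
have close p q : G p -> G q -> n2 (p.1 - q.1) <= 2 * (J p - m) + 2 * (J q - m).
  move=> Gp Gq; have := mle _ (GZ 2^-1 _ (GD _ _ Gp Gq)).
  rewrite /J/= n2Z sqcC; have := parallelogram p.1 q.1; lra.
have small (e : R) : 0 < e -> exists N, forall n, (N <= n)%N -> (n.+1%:R)^-1 < e.
  move=> e0; exists (Num.trunc e^-1) => n Nn.
  rewrite invf_plt ?posrE//; apply: lt_le_trans (truncnS_gt _) _.
  by rewrite ler_nat.
have [|v fv] := @hcomplete R H (fst \o f).
  move=> e e0; have [|N hN] := small (e ^+ 2 / 4); first by rewrite divr_gt0 ?exprn_gt0.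
  exists N => n k /hN hn' /hN hk'.
  rewrite /= -(@ltr_pXn2r _ 2)// ?nnegrE ?hn_ge0 ?ltW// hn2.
  have a1 : J (f n) < m + e ^+ 2 / 4 by apply: lt_trans (fP n).2 _; rewrite ltrD2l.
  have a2 : J (f k) < m + e ^+ 2 / 4 by apply: lt_trans (fP k).2 _; rewrite ltrD2l.
  have := close _ _ (fP n).1 (fP k).1.
  by move: (J (f n)) (J (f k)) a1 a2 => ? ? ? ? ?; lra.
exists v; split; last first.
  move=> e e0; have [N hN] := (hcvgP _ _).1 fv e e0.
  by exists (f N); [exact: (fP N).1|rewrite hnBC; exact: (hN N)].
move=> g Gg.
have ripcv := (rcvgP _ _).1 (hcvg_rip (y := g.1) fv).
(* First variation at the minimizer: moving by [t] along [g] cannot bring [J] below its infimum. *)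
have key (t : R) : 0 <= 2 * t * (rip v g.1 - g.2) + t ^+ 2 * n2 g.1.
  apply/ler_addgt0Pr => e e0.
  have e1 : 0 < e / (2 * (2 * `|t| + 1)).
    by rewrite divr_gt0// mulr_gt0// ltr_wpDl ?mulr_ge0.
  have [N1 hN1] := ripcv _ e1.
  have [|N2 hN2] := small (e / 2); first by rewrite divr_gt0.
  set n := maxn N1 N2.
  have h1 := hN1 n (leq_maxl _ _); have h2 := hN2 n (leq_maxr _ _).
  have := mle _ (GD _ _ (fP n).1 (GZ t _ Gg)).
  rewrite /J/= n2D n2Z sqcC !ripZr => hm.
  have hJ : J (f n) < m + e / 2 by apply: lt_trans (fP n).2 _; rewrite ltrD2l.
  rewrite /J in hJ.
  rewrite (ripC g.1 (f n).1) (ripC g.1 v) in h1.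
  have h3 : 2 * t * (rip (f n).1 g.1 - rip v g.1) <= e / 2.
    apply: le_trans (ler_norm _) _; rewrite !normrM ger0_norm//.
    move: h1; rewrite ltr_pdivlMr ?mulr_gt0 ?ltr_wpDl ?mulr_ge0//.
    have := normr_ge0 (rip (f n).1 g.1 - rip v g.1).
    by move: `|_| `|t| => ? ? ? ?; lra.
  by lra.
apply/eqP; rewrite -subr_eq0; apply/eqP; set d := rip v g.1 - g.2 in key *.
have n0 := n2_ge0 g.1; set n := n2 g.1 in key n0 *.
(* The minimizing [t] is [- d / n]; [n + 1] also covers [n = 0]. *)
have := key (- d / (n + 1)); have p0 : 0 < n + 1 by lra.
have -> : 2 * (- d / (n + 1)) * d + (- d / (n + 1)) ^+ 2 * n
  = - (d ^+ 2) * ((n + 2) / (n + 1) ^+ 2) by field; rewrite gt_eqF.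
rewrite mulNr oppr_ge0 => h.
have q0 : 0 < (n + 2) / (n + 1) ^+ 2 by rewrite divr_gt0 ?exprn_gt0//; lra.
have : d ^+ 2 <= 0 by rewrite -(pmulr_lle0 _ q0).
by move=> h2; apply/eqP; rewrite -sqrf_eq0 eq_le h2 sqr_ge0.
Qed.

(** The real part of the functional is represented first; its imaginary part then follows by
    evaluating at [imI *: y]. *)
Lemma riesz_graphC (G : set (H * R[i])) (C : R) :
  G (0, 0) ->
  (forall a p q, G p -> G q -> G (a *: p.1 + q.1, a * p.2 + q.2)) ->
  0 <= C -> (forall p, G p -> sqc p.2 <= C * n2 p.1) ->
  exists v, (forall p, G p -> ⟪v, p.1⟫ = p.2) /\
    (forall e : R, 0 < e -> exists2 p, G p & hn (v - p.1) < e).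
Proof.
move=> G0 GD C0 GC.
pose G' : set (H * R) := [set p | exists c, G (p.1, c) /\ p.2 = Re c].
have [|||||v [vG vc]] := @riesz_graph G' C.
- by exists 0.
- move=> [p1 p2] [q1 q2] [c /= [Gp ->]] [d /= [Gq ->]].
  exists (c + d); rewrite reim; split => //.
  by have := GD 1 _ _ Gp Gq; rewrite /= scale1r mul1r.
- move=> a [p1 p2] [c /= [Gp ->]]; exists (a%:C%C * c); rewrite ReZ; split => //.
  by have := GD a%:C%C _ _ Gp G0; rewrite /= !addr0.
- exact: C0.
- move=> [p1 p2] [c /= [Gp ->]]; apply: le_trans (sqr_Re_le _) (GC _ Gp).
exists v; split => [[y c] Gp|e /vc[[y r] [c [Gp _]] hlt]]; last by exists (y, c).
have h1 : Re ⟪v, y⟫ = Re c by apply: (vG (y, Re c)); exists c.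
have h2 : Re ⟪v, imI *: y⟫ = Re (imI * c).
  apply: (vG (imI *: y, Re (imI * c))); exists (imI * c); split => //.
  by have := GD imI _ _ Gp G0; rewrite /= !addr0.
apply: complex_ext => //.
by move: h2; rewrite innerZr !reim !mul0r !mul1r !sub0r => /oppr_inj.
Qed.

(** Riesz for the functional [rip x] on K. The representing vector is in K because [riesz_graph]
    also places it in the closure of the domain. *)
Lemma real_projection (K : set H) : real_subspace K -> closed K ->
  forall x, exists2 p, K p & forall k, K k -> rip (x - p) k = 0.
Proof.
move=> [K0 KD KZ] cK x.
have [|||||v [vG vc]] := @riesz_graph [set p | K p.1 /\ p.2 = rip x p.1] (n2 x).
- by split; rewrite //= rip0r.
- by move=> [p1 p2] [q1 q2] /= [? ->] [? ->]; rewrite ripDr; split=> //; exact: KD.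
- by move=> a [p1 p2] /= [? ->]; rewrite ripZr; split=> //; exact: KZ.
- exact: n2_ge0.
- by move=> [p1 p2] /= [_ ->]; exact: rip_CS.
exists v; last by move=> k Kk; rewrite ripBl (vG (k, rip x k))//= subrr.
have /choice[f fP] (n : nat) : exists p, K p /\ hn (v - p) < n.+1%:R^-1.
  by have [|[p1 p2] [/= ? _] ?] := vc n.+1%:R^-1; [rewrite invr_gt0|exists p1].
apply: (closed_hcvg cK (u := f)); first by move=> n; exact: (fP n).1.
apply/hcvgP => e e0; exists (Num.trunc e^-1) => n Nn.
rewrite hnBC; apply: lt_trans (fP n).2 _.
rewrite invf_plt ?posrE//; apply: lt_le_trans (truncnS_gt _) _.
by rewrite ler_nat.
Qed.

Lemma inv_nat_small (e : R) : 0 < e -> exists N, forall n, (N <= n)%N -> (n.+1%:R)^-1 < e.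
Proof.
move=> e0; exists (Num.trunc e^-1) => n Nn.
rewrite invf_plt ?posrE//; apply: lt_le_trans (truncnS_gt _) _.
by rewrite ler_nat.
Qed.

Lemma approx_ortho_eq0 (S : set H) x :
  (forall e : R, 0 < e -> exists2 y, S y & hn (x - y) < e) ->
  (forall y, S y -> ⟪y, x⟫ = 0) -> x = 0.
Proof.
move=> h o; apply/eqP; rewrite -hn_eq0 eq_le hn_ge0 andbT; apply/ler_addgt0Pr => e /h[y Sy hy].
rewrite add0r; apply: le_trans (ltW hy).
rewrite hn_le2 n2B; have -> : rip x y = 0 by rewrite ripC /rip o.
by rewrite mulr0 subr0 lerDl n2_ge0.
Qed.

(** Lists of coefficients and indices, so that the index type can be arbitrary, for instance pairs
    of an operator and a vector. *)
Definition lc I (w : I -> H) (s : seq (R[i] * I)) : H := \sum_(p <- s) p.1 *: w p.2.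

Lemma lc_cat I (w : I -> H) s t : lc w (s ++ t) = lc w s + lc w t.
Proof. by rewrite /lc big_cat. Qed.
Lemma lc_scale I (w : I -> H) a s : lc w [seq (a * p.1, p.2) | p <- s] = a *: lc w s.
Proof. by rewrite /lc big_map scaler_sumr; apply: eq_bigr => p _; rewrite scalerA. Qed.
Lemma lc_nil I (w : I -> H) : lc w [::] = 0. Proof. by rewrite /lc big_nil. Qed.
Lemma lc1 I (w : I -> H) a i : lc w [:: (a, i)] = a *: w i.
Proof. by rewrite /lc big_seq1. Qed.

Lemma n2_lc I (w : I -> H) (l : seq (R[i] * I)) : n2 (lc w l) =
  \sum_(p <- l) \sum_(q <- l) Re ((p.1^*)%C * q.1 * ⟪w p.2, w q.2⟫).
Proof.
rewrite /n2 /lc inner_suml Re_sum; apply: eq_bigr => p _.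
rewrite inner_sumr Re_sum; apply: eq_bigr => q _; congr (Re _).
by rewrite innerZl innerZr; ring.
Qed.

End Riesz.

Section Operators.
Variables (R : realType).
Implicit Types (H : hilbertType R).

Definition bdop H (T : H -> H) :=
  linear T /\ exists2 M : R, 0 <= M & forall x, hn (T x) <= M * hn x.

Section One.
Variable H : hilbertType R.
Implicit Types (S T A B : H -> H) (x y z : H).

Lemma linD T x y : linear T -> T (x + y) = T x + T y.
Proof. by move=> l; have := l 1 x y; rewrite !scale1r. Qed.
Lemma lin0 T : linear T -> T 0 = 0.
Proof. by move=> l; apply: (addrI (T 0)); rewrite -(linD _ _ l) !addr0. Qed.
Lemma linZ T (a : R[i]) x : linear T -> T (a *: x) = a *: T x.
Proof. by move=> l; have := l a x 0; rewrite (lin0 l) !addr0. Qed.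
Lemma linN T x : linear T -> T (- x) = - T x.
Proof. by move=> l; rewrite -scaleN1r (linZ _ _ l) scaleN1r. Qed.
Lemma linB T x y : linear T -> T (x - y) = T x - T y.
Proof. by move=> l; rewrite (linD _ _ l) (linN _ l). Qed.
Lemma lin_sum I (s : seq I) (P : pred I) (F : I -> H) T : linear T ->
  T (\sum_(i <- s | P i) F i) = \sum_(i <- s | P i) T (F i).
Proof.
by move=> l; elim/big_rec2: _ => [|i x y _ <-]; [rewrite lin0|rewrite linD].
Qed.
Lemma lin_lc I (w : I -> H) s T : linear T -> T (lc w s) = lc (T \o w) s.
Proof. by move=> l; rewrite /lc (lin_sum _ _ _ l); apply: eq_bigr => p _; rewrite linZ. Qed.

Lemma bounded_operatorP T : bounded_operator T <-> bdop T.
Proof.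
split=> [[l c]|[l [M M0 hM]]]; split => //.
  have /cvgrPdist_lt h := c 0.
  have /h : (0 : R[i]) < 1 by [].
  move=> /nbhs_ballP[e /= e0 he].
  have eR : e = (Re e)%:C%C by apply/esym/RRe_real; exact: gtr0_real.
  have r0 : 0 < Re e by rewrite eR ltcR in e0.
  set r := Re e in eR r0.
  exists (2 / r); first by rewrite divr_ge0 ?ltW.
  move=> x; have [->|x0] := eqVneq x 0; first by rewrite lin0// !hn0 mulr0.
  have nx : 0 < hn x by rewrite lt_neqAle hn_ge0 eq_sym hn_eq0 x0.
  set q := r / 2 / hn x; have q0 : 0 < q by rewrite !divr_gt0.
  have qx : q * hn x = r / 2 by rewrite /q divfK ?gt_eqF.
  have := he (q%:C%C *: x); rewrite -ball_normE /ball_/= sub0r normrN hn_normE eR ltcR.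
  rewrite hnZ ncC gtr0_norm// qx lin0// sub0r normrN linZ// hn_normE ltcR hnZ ncC gtr0_norm// => h1.
  rewrite -(ler_pM2l q0) mulrCA qx.
  have -> : 2 / r * (r / 2) = 1 by field; rewrite gt_eqF.
  by apply/ltW/h1; lra.
move=> x; apply/cvgrPdist_lt => e e0.
have eR : e = (Re e)%:C%C by apply/esym/RRe_real; exact: gtr0_real.
have r0 : 0 < Re e by rewrite eR ltcR in e0.
have M1 : 0 < M + 1 by rewrite ltr_wpDl.
apply/nbhs_ballP; exists (Re e / (M + 1))%:C%C => /=; first by rewrite ltcR divr_gt0.
move=> y; rewrite -ball_normE /ball_/= hn_normE ltcR ltr_pdivlMr// => h.
rewrite -linB// hn_normE eR ltcR; apply: le_lt_trans (hM _) (le_lt_trans _ h).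
by rewrite mulrC ler_wpM2l ?hn_ge0// lerDl.
Qed.

Lemma bdop_cvg T (u : nat -> H) x : bdop T -> u @ \oo --> x -> (T \o u) @ \oo --> T x.
Proof.
move=> /bounded_operatorP[_ c] ux.
exact: (@cvg_comp _ _ _ u T _ _ _ ux (c x)).
Qed.

Lemma bdop_id : bdop (idfun : H -> H).
Proof. by split => //; exists 1 => // x; rewrite mul1r. Qed.
Lemma bdop_comp S T : bdop S -> bdop T -> bdop (S \o T).
Proof.
move=> [lS [M M0 hM]] [lT [N N0 hN]]; split.
  by move=> a x y; rewrite /= lT lS.
exists (M * N); first exact: mulr_ge0.
by move=> x /=; apply: le_trans (hM _) _; rewrite -mulrA ler_wpM2l.
Qed.
Lemma bdop_lin S T (a b : R[i]) : bdop S -> bdop T -> bdop (fun x => a *: S x + b *: T x).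
Proof.
move=> [lS [M M0 hM]] [lT [N N0 hN]]; split.
  by move=> c x y; rewrite lS lT; hvec.
exists (nc a * M + nc b * N); first by rewrite addr_ge0 ?mulr_ge0 ?nc_ge0.
move=> x /=; apply: le_trans (hnD _ _) _; rewrite !hnZ mulrDl -!mulrA.
by rewrite lerD// ler_wpM2l ?nc_ge0.
Qed.
Lemma bdop_eq S T : bdop S -> S =1 T -> bdop T.
Proof. by move=> h /funext <-. Qed.
Lemma bdopD S T : bdop S -> bdop T -> bdop (fun x => S x + T x).
Proof. by move=> hS hT; apply: bdop_eq (bdop_lin 1 1 hS hT) _ => x; rewrite !scale1r. Qed.
Lemma bdopB S T : bdop S -> bdop T -> bdop (fun x => S x - T x).
Proof. by move=> hS hT; apply: bdop_eq (bdop_lin 1 (-1) hS hT) _ => x; rewrite scale1r scaleN1r. Qed.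
Lemma bdopZ S (a : R[i]) : bdop S -> bdop (fun x => a *: S x).
Proof. by move=> hS; apply: bdop_eq (bdop_lin a 0 hS hS) _ => x; rewrite scale0r addr0. Qed.

(* The adjoint of the operator mapping lc w to lc v, extended by 0. *)
Lemma family_operator I (w v : I -> H) (C : R) : 0 <= C ->
  (forall s, hn (lc v s) <= C * hn (lc w s)) ->
  exists S, [/\ bdop S, forall i x, ⟪w i, S x⟫ = ⟪v i, x⟫ &
    forall x (e : R), 0 < e -> exists2 y, range (lc w) y & hn (S x - y) < e].
Proof.
move=> C0 hC.
have /choice[S hS] x : exists y, (forall s, ⟪lc w s, y⟫ = ⟪lc v s, x⟫) /\
    forall e : R, 0 < e -> exists2 z, range (lc w) z & hn (y - z) < e.
  have [||||y [yG yc]] := @riesz_graphC R H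
    [set p | exists s, p.1 = lc w s /\ p.2 = ⟪x, lc v s⟫] (n2 x * C ^+ 2).
  - by exists [::]; rewrite !lc_nil inner0r.
  - move=> a [p1 p2] [q1 q2] [s /= [-> ->]] [t /= [-> ->]].
    exists ([seq (a * p.1, p.2) | p <- s] ++ t).
    by rewrite !lc_cat !lc_scale innerDr innerZr.
  - by rewrite mulr_ge0 ?n2_ge0 ?sqr_ge0.
  - move=> [p1 p2] [s /= [-> ->]]; apply: le_trans (inner_CS _ _) _.
    rewrite -mulrA ler_wpM2l ?n2_ge0// -!hn2 -exprMn ler_pXn2r ?nnegrE ?hn_ge0 ?hC//.
    by rewrite mulr_ge0 ?hn_ge0.
  exists y; split.
    by move=> s; rewrite innerC (yG (lc w s, ⟪x, lc v s⟫)) -?innerC//; exists s.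
  by move=> e /yc[[p1 p2] [s /= [-> _]] h]; exists (lc w s) => //; exists s.
(* A vector of the closed span of [w] is determined by its pairings with [w]; this makes [S]
   linear. *)
have uniq x y : (forall e : R, 0 < e -> exists2 z, range (lc w) z & hn (x - z) < e) ->
    (forall e : R, 0 < e -> exists2 z, range (lc w) z & hn (y - z) < e) ->
    (forall s, ⟪lc w s, x⟫ = ⟪lc w s, y⟫) -> x = y.
  move=> hx hy h; apply/eqP; rewrite -subr_eq0; apply/eqP.
  apply: (@approx_ortho_eq0 _ _ (range (lc w))).
    move=> e e0; have e2 : 0 < e / 2 by rewrite divr_gt0.
    have [_ [s _ <-] hs] := hx _ e2; have [_ [t _ <-] ht] := hy _ e2.
    exists (lc w (s ++ [seq (-1 * p.1, p.2) | p <- t])); first by eexists.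
    rewrite lc_cat lc_scale scaleN1r.
    have -> : x - y - (lc w s - lc w t) = (x - lc w s) - (y - lc w t) by hvec.
    by apply: le_lt_trans (hnB _ _) _; lra.
  by move=> _ [s _ <-]; rewrite innerBr h subrr.
have one i : lc w [:: (1, i)] = w i /\ lc v [:: (1, i)] = v i.
  by rewrite !lc1 !scale1r.
exists S; split; last by move=> x; exact: (hS x).2.
  split.
    move=> a x y; apply: uniq; first exact: (hS _).2.
      move=> e e0; have e2 : 0 < e / (2 * (nc a + 1)).
        by rewrite divr_gt0// mulr_gt0// ltr_wpDl ?nc_ge0.
      have e3 : 0 < e / 2 by rewrite divr_gt0.
      have [_ [s _ <-] hs] := (hS x).2 _ e2; have [_ [t _ <-] ht] := (hS y).2 _ e3.
      exists (lc w ([seq (a * p.1, p.2) | p <- s] ++ t)); first by eexists.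
      rewrite lc_cat lc_scale.
      have -> : a *: S x + S y - (a *: lc w s + lc w t) =
        a *: (S x - lc w s) + (S y - lc w t) by hvec.
      apply: le_lt_trans (hnD _ _) _; rewrite hnZ.
      have na := nc_ge0 a.
      have h1 : nc a * hn (S x - lc w s) <= e / 2.
        apply: le_trans (_ : (nc a + 1) * (e / (2 * (nc a + 1))) <= _).
          by apply: ler_pM => //; [exact: hn_ge0|rewrite lerDl|exact: ltW].
        rewrite le_eqVlt; apply/orP; left; apply/eqP; field.
        by rewrite gt_eqF// ltr_wpDl.
      by lra.
    by move=> s; rewrite (hS _).1 !innerDr !innerZr !(hS _).1.
  exists C => // x.
  have [->|sx0] := eqVneq (hn (S x)) 0; first by rewrite mulr_ge0 ?hn_ge0.
  have sx1 : 0 < hn (S x) by rewrite lt_neqAle hn_ge0 eq_sym sx0.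
  rewrite -(ler_pM2r sx1) -expr2; apply/ler_addgt0Pr => e e0.
  have p0 : 0 < hn (S x) + C * hn x + 1 by rewrite ltr_wpDl ?addr_ge0 ?mulr_ge0 ?hn_ge0.
  have [_ [s _ <-] hs] := (hS x).2 _ (divr_gt0 e0 p0).
  rewrite ltr_pdivlMr// in hs.
  have h1 : hn (S x) ^+ 2 = rip (S x - lc w s) (S x) + rip (lc w s) (S x).
    by rewrite ripBl subrK hn2.
  have h2 : rip (lc w s) (S x) <= C * hn x * hn (lc w s).
    rewrite /rip (hS x).1; apply: le_trans (ler_norm _) (le_trans (rip_le _ _) _).
    by rewrite mulrAC ler_wpM2r ?hn_ge0.
  have h3 : rip (S x - lc w s) (S x) <= hn (S x - lc w s) * hn (S x).
    exact: le_trans (ler_norm _) (rip_le _ _).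
  have h4 : hn (lc w s) <= hn (S x) + hn (S x - lc w s).
    rewrite hnBC -[X in hn X <= _](_ : S x + (lc w s - S x) = _) ?hnD//.
    by rewrite addrC subrK.
  have h5 : hn (S x) ^+ 2 <= C * hn x * hn (S x) + e.
    have q0 : 0 <= C * hn x by rewrite mulr_ge0 ?hn_ge0.
    have := ler_wpM2l q0 h4; have := hn_ge0 (S x - lc w s); nra.
  exact: h5.
by move=> i x; have := (hS x).1 [:: (1, i)]; rewrite (one i).1 (one i).2.
Qed.

End One.
End Operators.

(** * Square roots *)

Section Bounded.
Variables (R : realType) (H : hilbertType R).
Implicit Types (S T A B : H -> H) (x y z : H).

Lemma adjC S T : adjoint_operators S T -> adjoint_operators T S.
Proof. by move=> h x y; rewrite innerC -h -innerC. Qed.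

Lemma adj_exists T : bdop T -> exists2 S, bdop S & adjoint_operators T S.
Proof.
move=> [lT [M M0 hM]].
have [s|S [bS hS _]] := @family_operator R H H idfun T M M0.
  rewrite (_ : lc T s = T (lc idfun s)); first exact: hM.
  by rewrite (lin_lc _ _ lT).
by exists S => // x y; rewrite hS.
Qed.

Lemma adj_comp S S' T T' : adjoint_operators S S' -> adjoint_operators T T' ->
  adjoint_operators (S \o T) (T' \o S').
Proof. by move=> h h' x y /=; rewrite h h'. Qed.

Lemma adjD S S' T T' : adjoint_operators S S' -> adjoint_operators T T' ->
  adjoint_operators (fun x => S x + T x) (fun x => S' x + T' x).
Proof. by move=> h h' x y /=; rewrite !innE h h'. Qed.

Definition pos T := [/\ bdop T, adjoint_operators T T & forall x, 0 <= rip x (T x)].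

Lemma posP T : pos T <-> bdop T /\ forall x, 0 <= ⟪x, T x⟫.
Proof.
split=> [[bT sT pT]|[bT pT]]; split=> //.
- move=> x; have -> : ⟪x, T x⟫ = (rip x (T x))%:C%C; last by rewrite ler0c.
  apply: complex_ext; rewrite !reim //.
  have /(congr1 (@complex.Im R)) := innerC x (T x); rewrite reim sT; lra.
- have l := bT.1.
  have im0 x : Im ⟪x, T x⟫ = 0 by apply: ger0_Im; exact: pT.
  move=> x y; apply: complex_ext.
    have h := im0 (x + imI *: y).
    rewrite (linD _ _ l) (linZ _ _ l) !innE !reim !im0 in h.
    by rewrite innerC reim; lra.
  have h := im0 (x + y).
  rewrite (linD _ _ l) !innE !reim !im0 in h.
  rewrite innerC reim; lra.
- by move=> x; have := pT x; rewrite lecE => /andP[_].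
Qed.

Lemma discr (a b c : R) : (forall t, 0 <= a + 2 * b * t + c * t ^+ 2) -> b ^+ 2 <= a * c.
Proof.
move=> h; have a0 : 0 <= a by have := h 0; rewrite mulr0 expr0n mulr0 !addr0.
have [c0|c0|c0] := ltgtP c 0.
- suff [t ht] : exists t, a + 2 * b * t + c * t ^+ 2 < 0 by have := h t; lra.
  pose t := (`|a| + 2 * `|b| + 1) / - c + 1.
  exists t; have d0 : 0 < - c by lra.
  have t1 : 1 <= t by rewrite lerDr divr_ge0 ?ltW// !addr_ge0 ?mulr_ge0.
  have ct : - c * t >= `|a| + 2 * `|b| + 1.
    rewrite /t mulrDr mulr1 mulrCA divff ?gt_eqF// mulr1; lra.
  have := ler_norm a; have := ler_norm b.
  have : (- c * t) * t >= (`|a| + 2 * `|b| + 1) * t by rewrite ler_wpM2r//; lra.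
  have := normr_ge0 a; have := normr_ge0 b; nra.
- have d0 := h (- b / c); have : 0 <= c * (a + 2 * b * (- b / c) + c * (- b / c) ^+ 2).
    by rewrite pmulr_rge0.
  have -> : c * (a + 2 * b * (- b / c) + c * (- b / c) ^+ 2) = a * c - b ^+ 2.
    by field; rewrite gt_eqF.
  by rewrite subr_ge0.
- subst c; rewrite mulr0 leNgt; apply/negP => b2.
  have b0 : b != 0 by apply: contraTneq b2 => ->; rewrite expr0n ltxx.
  have := h (- (a + 1) / (2 * b)).
  have -> : a + 2 * b * (- (a + 1) / (2 * b)) + 0 * (- (a + 1) / (2 * b)) ^+ 2 = -1.
    by field.
  lra.
Qed.

Lemma pos_CS T x y : pos T -> rip x (T y) ^+ 2 <= rip x (T x) * rip y (T y).
Proof.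
move=> [[l _] sT pT]; apply: discr => t.
have := pT (x + t%:C%C *: y); rewrite (linD _ _ l) (linZ _ _ l) !ripE.
have -> : rip y (T x) = rip x (T y) by rewrite ripC /rip sT.
lra.
Qed.

(** The operator inequality T^2 <= c T, by Cauchy-Schwarz for the form of T at [T x] and [x]. *)
Lemma pos_n2 T (c : R) x : pos T -> 0 <= c -> (forall y, rip y (T y) <= c * n2 y) ->
  n2 (T x) <= c * rip x (T x).
Proof.
move=> pT c0 hc; have := pos_CS (T x) x pT; rewrite rip_n2 => h.
have [->|n0] := eqVneq (n2 (T x)) 0; first by rewrite mulr_ge0//; case: pT.
have n1 : 0 < n2 (T x) by rewrite lt_neqAle n2_ge0 eq_sym n0.
rewrite -(ler_pM2l n1); apply: le_trans (_ : n2 (T x) ^+ 2 <= _); first by rewrite expr2.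
apply: le_trans h _.
by rewrite mulrA (mulrC (n2 _) c) ler_wpM2r ?hc//; case: pT.
Qed.

Lemma pos_eq0 T x : pos T -> rip x (T x) = 0 -> T x = 0.
Proof.
move=> pT h; apply/eqP; rewrite -n2_eq0 -sqrf_eq0 eq_le sqr_ge0 andbT.
by have := pos_CS (T x) x pT; rewrite h mulr0 rip_n2.
Qed.

Lemma pos_ub T : pos T -> exists2 c : R, 0 < c & forall x, rip x (T x) <= c * n2 x.
Proof.
move=> [[_ [M M0 hM]] _ _]; exists (M + 1); first by rewrite ltr_wpDl.
move=> x; apply: le_trans (ler_norm _) (le_trans (rip_le _ _) _).
have := hM x; have := hn_ge0 x; rewrite -hn2; nra.
Qed.

Lemma bdop0 : bdop (fun _ : H => 0 : H).
Proof. by split; [move=> a x y; rewrite scaler0 addr0|exists 0 => // x; rewrite hn0 mul0r]. Qed.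

(** Lax-Milgram: [B] is defined by <A' x, B y> = <x, y>, which is bounded because the adjoint [A']
    is bounded below by the same constant. *)
Lemma inverse_exists A (d : R) : bdop A -> 0 < d -> (forall x, d * n2 x <= rip x (A x)) ->
  exists B, [/\ bdop B, forall x, A (B x) = x & forall x, B (A x) = x].
Proof.
move=> bA d0 hA; have [lA _] := bA; have [A' [lA' _] aA] := adj_exists bA.
have hA' x : d * n2 x <= rip x (A' x) by rewrite /rip -aA -/(rip _ _) ripC.
have low T x : (forall x, d * n2 x <= rip x (T x)) -> hn x <= d^-1 * hn (T x).
  move=> hT; rewrite ler_pdivlMl//.
  have [->|x0] := eqVneq (hn x) 0; first by rewrite mulr0 hn_ge0.
  have x1 : 0 < hn x by rewrite lt_neqAle hn_ge0 eq_sym x0.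
  rewrite -(ler_pM2l x1) mulrCA -expr2 hn2; apply: le_trans (hT x) _.
  exact: le_trans (ler_norm _) (rip_le _ _).
have [|s|B [bB hB _]] := @family_operator R H H A' idfun d^-1; first by rewrite invr_ge0 ltW.
  by rewrite (_ : lc A' s = A' (lc idfun s)) ?low// (lin_lc _ _ lA').
have AB x : A (B x) = x by apply: inner_ext => w; rewrite -(adjC aA) hB.
exists B; split=> // x; apply/eqP; rewrite -subr_eq0 -n2_eq0 eq_le n2_ge0 andbT.
rewrite -(ler_pM2l d0) mulr0; apply: le_trans (hA _) _.
by rewrite (linB _ _ lA) AB subrr rip0r.
Qed.

(** The classical iteration for 1 - sqrt (1 - B): a fixed point T = (B + T^2) / 2 satisfies (1 -
    T)^2 = 1 - B. *)
Fixpoint sq_it B n : H -> H :=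
  if n is m.+1 then fun x => (2^-1)%:C%C *: (B x + sq_it B m (sq_it B m x)) else fun=> 0.

End Bounded.

Section Sqrt.
Variable R : realType.

(** The iteration [sq_it] for the number 1. It dominates [sq_it B] for every contraction B and so
    fixes a rate of convergence independent of the operator. *)
Fixpoint sq_tau n : R := if n is m.+1 then 2^-1 * (1 + sq_tau m ^+ 2) else 0.

Lemma sq_tau_bnd n : 0 <= sq_tau n <= 1.
Proof. by elim: n => [|n /andP[h1 h2]] /=; [rewrite lexx ler01|apply/andP; split; nra]. Qed.

Lemma sq_tauS n : sq_tau n <= sq_tau n.+1.
Proof. by rewrite /=; have := sqr_ge0 (sq_tau n - 1); lra. Qed.

Lemma sq_tau_le n m : (n <= m)%N -> sq_tau n <= sq_tau m.
Proof. by move=> /subnK <-; elim: (m - n)%N => // k ih; rewrite addSn (le_trans ih) ?sq_tauS. Qed.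

Lemma sq_tau_cauchy (e : R) : 0 < e ->
  exists N, forall n m, (N <= n)%N -> (N <= m)%N -> sq_tau m - sq_tau n < e.
Proof.
move=> e0; pose S : set R := range sq_tau.
have hS : has_sup S.
  split; first by exists (sq_tau 0); exists 0%N.
  by exists 1 => _ [n _ <-]; case/andP: (sq_tau_bnd n).
have [_ [N _ <-] hN] := sup_adherent e0 hS.
exists N => n m Nn Nm.
have : sq_tau m <= sup S by apply: ub_le_sup; [exact: hS.2|exists m].
have := sq_tau_le Nn; lra.
Qed.

Variable H : hilbertType R.
Implicit Types (S T A B : H -> H) (x y z : H).

Section Contraction.
Variable B : H -> H.
Hypotheses (lB : linear B) (hB : forall x, hn (B x) <= hn x).

Lemma sq_it_linear n : linear (sq_it B n).
Proof.
elim: n => [|n ih] a x y /=; first by rewrite scaler0 addr0.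
by rewrite ih ih lB; hvec.
Qed.

Lemma sq_it_bnd n x : hn (sq_it B n x) <= sq_tau n * hn x.
Proof.
elim: n x => [|n ih] x /=; first by rewrite hn0 mul0r.
rewrite hnZ ncC ger0_norm ?invr_ge0// -mulrA ler_wpM2l ?invr_ge0//.
apply: le_trans (hnD _ _) _; rewrite mulrDl mul1r lerD//.
apply: le_trans (ih _) _; rewrite expr2 -mulrA ler_wpM2l ?ih//.
by case/andP: (sq_tau_bnd n).
Qed.

(** Consecutive differences obey s1 s1 - s0 s0 = s1 (s1 - s0) + (s1 - s0) s0, for the operators and
    for [sq_tau] alike, so the induction carries the scalar bound along. *)
Lemma sq_it_step n x : hn (sq_it B n.+1 x - sq_it B n x) <= (sq_tau n.+1 - sq_tau n) * hn x.
Proof.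
elim: n x => [|n ih] x.
  rewrite /= !subr0 addr0 expr0n addr0 mulr1 hnZ ncC ger0_norm ?invr_ge0//.
  by rewrite ler_wpM2l ?invr_ge0.
set t1 := sq_tau n.+1 in ih *; set t0 := sq_tau n in ih *.
have -> : sq_tau n.+2 - t1 = 2^-1 * (t1 * (t1 - t0) + (t1 - t0) * t0).
  by rewrite /t1 /t0 /=; ring.
set s1 := sq_it B n.+1 in ih *; set s0 := sq_it B n in ih *.
have ls1 : linear s1 := sq_it_linear n.+1.
have -> : sq_it B n.+2 x - s1 x = (2^-1)%:C%C *: (s1 (s1 x - s0 x) + (s1 (s0 x) - s0 (s0 x))).
  rewrite (linB _ _ ls1) -[in LHS]/s1 {2}/s1 /= -/s0 -/s1; hvec.
rewrite hnZ ncC ger0_norm ?invr_ge0// -mulrA ler_wpM2l ?invr_ge0//.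
apply: le_trans (hnD _ _) _; rewrite mulrDl lerD//.
  apply: le_trans (sq_it_bnd _ _) _; rewrite -mulrA ler_wpM2l ?ih//.
  by case/andP: (sq_tau_bnd n.+1).
apply: le_trans (ih _) _; rewrite -mulrA ler_wpM2l ?sq_it_bnd//.
by rewrite subr_ge0 sq_tauS.
Qed.

Lemma sq_it_diff n m x : (n <= m)%N ->
  hn (sq_it B m x - sq_it B n x) <= (sq_tau m - sq_tau n) * hn x.
Proof.
move=> /subnK <-; elim: (m - n)%N => [|k ih]; first by rewrite !subrr hn0 mul0r.
apply: le_trans (hn_triangle _ (sq_it B (k + n) x) _) _.
apply: le_trans (lerD (sq_it_step _ _) ih) _.
by rewrite -mulrDl addrA subrK.
Qed.

Lemma sq_it_lim : exists T, [/\ bdop T, forall x, sq_it B ^~ x @ \oo --> T x,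
  forall x, hn (T x) <= hn x,
  forall x, T x = (2^-1)%:C%C *: (B x + T (T x)) &
  forall e : R, 0 < e -> exists N, forall n x, (N <= n)%N -> hn (T x - sq_it B n x) <= e * hn x].
Proof.
have /choice[T hT] x : exists y, sq_it B ^~ x @ \oo --> y.
  apply: hcomplete => e e0.
  have p0 : 0 < hn x + 1 by rewrite ltr_wpDl ?hn_ge0.
  have [N hN] := sq_tau_cauchy (divr_gt0 e0 p0).
  have main n m : (N <= n)%N -> (N <= m)%N -> (n <= m)%N -> hn (sq_it B m x - sq_it B n x) < e.
    move=> Nn Nm nm; apply: le_lt_trans (sq_it_diff _ nm) _.
    have := hN n m Nn Nm; rewrite ltr_pdivlMr//; apply: le_lt_trans.
    by rewrite ler_wpM2l ?subr_ge0 ?sq_tau_le// lerDl.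
  exists N => n m Nn Nm; have [nm|/ltnW mn] := leqP n m; last exact: main.
  by rewrite hnBC main.
have Tlin : linear T.
  move=> a x y; apply: (@hcvg_unique _ _ (sq_it B ^~ (a *: x + y))); first exact: hT.
  rewrite (_ : (fun n => _) = (fun n => a *: sq_it B n x + sq_it B n y)); last first.
    by apply/funext => n; rewrite sq_it_linear.
  by apply: cvgD (hT y); apply: cvgZr; exact: hT.
have lim_le (u : nat -> H) y (r : R) : u @ \oo --> y ->
    (exists N, forall n, (N <= n)%N -> hn (u n) <= r) -> hn y <= r.
  move=> uy [N hN]; apply/ler_addgt0Pr => e e0; have [N' hN'] := (hcvgP _ _).1 uy e e0.
  have := hN _ (leq_maxl N N'); have := hN' _ (leq_maxr N N').
  set k := maxn _ _ => h1 h2.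
  have -> : hn y = hn ((y - u k) + u k) by rewrite subrK.
  by apply: le_trans (hnD _ _) _; rewrite hnBC; lra.
have Tb x : hn (T x) <= hn x.
  apply: (lim_le _ _ _ (hT x)); exists 0%N => n _; apply: le_trans (sq_it_bnd _ _) _.
  by rewrite ler_piMl ?hn_ge0//; case/andP: (sq_tau_bnd n).
have Tapp (e : R) : 0 < e ->
    exists N, forall n x, (N <= n)%N -> hn (T x - sq_it B n x) <= e * hn x.
  move=> e0; have [N hN] := sq_tau_cauchy e0; exists N => k x Nk.
  have c : (fun n => sq_it B n x - sq_it B k x) @ \oo --> T x - sq_it B k x.
    by apply: cvgB (hT x) _; exact: cvg_cst.
  apply: (lim_le _ _ _ c); exists k => n kn; apply: le_trans (sq_it_diff _ kn) _.
  by rewrite ler_wpM2r ?hn_ge0// ltW// hN// (leq_trans Nk).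
have bT : bdop T by split => //; exists 1 => // x; rewrite mul1r.
exists T; split => // x.
apply: (@hcvg_unique _ _ (fun n => sq_it B n.+1 x)).
  by have := hT x; rewrite -(cvg_shiftS (sq_it B ^~ x)).
apply: cvgZr; apply: cvgD; first exact: cvg_cst.
apply/hcvgP => e e0.
have e2 : 0 < e / 2 by rewrite divr_gt0.
have [N1 hN1] := (hcvgP _ _).1 (hT (T x)) _ e2.
have [N3 hN3] := (hcvgP _ _).1 (hT x) _ e2.
exists (maxn N1 N3) => n; rewrite geq_max => /andP[n1 n3].
have h1 : hn (sq_it B n (sq_it B n x) - sq_it B n (T x)) < e / 2.
  rewrite -(linB _ _ (sq_it_linear n)); apply: le_lt_trans (sq_it_bnd _ _) _.
  by apply: le_lt_trans (hN3 n n3); rewrite ler_piMl ?hn_ge0//; case/andP: (sq_tau_bnd n).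
apply: le_lt_trans (hn_triangle _ (sq_it B n (T x)) _) _.
by have := hN1 n n1; move: h1; lra.
Qed.
End Contraction.

Lemma pos_complement_contraction A (c : R) x : pos A -> 0 < c -> (forall x, rip x (A x) <= c * n2 x) ->
  hn (x - (c^-1)%:C%C *: A x) <= hn x.
Proof.
move=> pA c0 hc; rewrite hn_le2 n2B n2Z sqcC ripZr.
have h := pos_n2 x pA (ltW c0) hc.
have : c^-1 ^+ 2 * n2 (A x) <= c^-1 * rip x (A x).
  by rewrite expr2 -mulrA ler_pM2l ?invr_gt0// ler_pdivrMl.
have : 0 <= c^-1 * rip x (A x) by case: pA => _ _ pA0; rewrite mulr_ge0 ?invr_ge0 ?(ltW c0).
lra.
Qed.

(** S = sqrt c (1 - T), with T the fixed point for B = 1 - A / c. The commutation clause stands in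
    for a functional calculus; the approximation clause carries square roots along real-linear maps
    and to compressions. *)
Lemma pos_sqrt A (c : R) : pos A -> 0 < c -> (forall x, rip x (A x) <= c * n2 x) ->
  exists S, [/\ pos S, forall x, S (S x) = A x,
    forall B, bdop B -> (forall x, B (A x) = A (B x)) -> forall x, B (S x) = S (B x) &
    forall e : R, 0 < e -> exists N, forall n x, (N <= n)%N ->
      hn (S x - (Num.sqrt c)%:C%C *: (x - sq_it (fun y => y - (c^-1)%:C%C *: A y) n x)) <= e * hn x].
Proof.
move=> pA c0 hc; have [bA sA pA0] := pA.
have [B BE] : exists B, B = fun y => y - (c^-1)%:C%C *: A y by eexists.
have bB : bdop B by rewrite BE; apply: bdopB; [exact: bdop_id|exact: bdopZ].
have lB := bB.1.
have hB x : hn (B x) <= hn x by rewrite BE; exact: pos_complement_contraction.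
have [T [bT Tl Tb Teq Tapp]] := sq_it_lim lB hB.
have lT := bT.1.
have sit n : adjoint_operators (sq_it B n) (sq_it B n).
  have sB : adjoint_operators B B by move=> x y; rewrite BE !innE !conjE sA.
  elim: n => [|n ih] x y /=; first by rewrite !innE.
  by rewrite !innE conjE sB !ih.
have sT : adjoint_operators T T.
  move=> x y.
  apply/eqP; rewrite -subr_eq0 -nc_eq0 eq_le nc_ge0 andbT; apply/ler_addgt0Pr => e e0.
  rewrite add0r.
  have p0 : 0 < 2 * (hn x * hn y + 1) by rewrite mulr_gt0// ltr_wpDl ?mulr_ge0 ?hn_ge0.
  have [N hN] := Tapp _ (divr_gt0 e0 p0).
  have -> : ⟪T x, y⟫ - ⟪x, T y⟫ = ⟪T x - sq_it B N x, y⟫ - ⟪x, T y - sq_it B N y⟫.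
    by rewrite !innE sit; ring.
  apply: le_trans (ncD _ _) _; rewrite ncN.
  have h1 := nc_inner (T x - sq_it B N x) y; have h2 := nc_inner x (T y - sq_it B N y).
  have h3 := ler_wpM2r (hn_ge0 y) (hN _ x (leqnn N)); have h4 := ler_wpM2l (hn_ge0 x) (hN _ y (leqnn N)).
  have : e / (2 * (hn x * hn y + 1)) * (2 * (hn x * hn y + 1)) = e by rewrite divfK// gt_eqF.
  have : 0 < e / (2 * (hn x * hn y + 1)) by rewrite divr_gt0.
  move: h1 h2 h3 h4; set q := e / _; lra.
pose s := Num.sqrt c; have s0 : 0 <= s := sqrtr_ge0 c.
have s2 : s * s = c by rewrite -expr2 sqr_sqrtr ?ltW.
exists (fun x => s%:C%C *: (x - T x)); split.
- split.
  + by apply: bdopZ; apply: bdopB => //; exact: bdop_id.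
  + by move=> x y; rewrite !innE conjE sT.
  + move=> x; rewrite ripZr mulr_ge0// ripBr rip_n2 subr_ge0.
    apply: le_trans (ler_norm _) (le_trans (rip_le _ _) _).
    by rewrite -hn2 expr2 ler_wpM2l ?hn_ge0.
- move=> x; rewrite (linZ _ _ lT) (linB _ _ lT).
  have h : T (T x) = 2%:R *: T x - B x.
    rewrite [in RHS]Teq scalerA.
    have -> : 2%:R * (2^-1)%:C%C = 1 :> R[i].
      by rewrite (_ : 2%:R = 2%:R%:C%C) -?rmorphM/= ?mulfV// ?rmorph_nat.
    by rewrite scale1r addrC addKr.
  rewrite h BE.
  have -> : s%:C%C *: (s%:C%C *: (x - T x) - s%:C%C *: (T x - (2%:R *: T x - (x - (c^-1)%:C%C *: A x))))
    = (s * s * c^-1)%:C%C *: A x by rewrite !realCM; hvec.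
  by rewrite s2 divff ?gt_eqF// scale1r.
- move=> C bC hC x; have lC := bC.1.
  rewrite (linZ _ _ lC) (linB _ _ lC); congr (_ *: (_ - _)).
  apply: (@hcvg_unique _ _ (C \o (sq_it B ^~ x))); first exact: bdop_cvg (Tl x).
  suff -> : C \o (sq_it B ^~ x) = sq_it B ^~ (C x) by [].
  apply/funext => n /=; have hCB y : C (B y) = B (C y) by rewrite BE (linB _ _ lC) (linZ _ _ lC) hC.
  elim: n x => [|n ih] x /=; first by rewrite (lin0 lC).
  by rewrite (linZ _ _ lC) (linD _ _ lC) hCB !ih.
- move=> e e0.
  have p0 : 0 < s + 1 by rewrite ltr_wpDl.
  have [N hN] := Tapp _ (divr_gt0 e0 p0); exists N => n x Nn.
  rewrite -/s -BE.
  have -> : s%:C%C *: (x - T x) - s%:C%C *: (x - sq_it B n x) = s%:C%C *: (sq_it B n x - T x) by hvec.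
  rewrite hnZ ncC ger0_norm// hnBC.
  have := ler_wpM2l s0 (hN n x Nn); move=> /le_trans; apply.
  rewrite mulrA ler_wpM2r ?hn_ge0// mulrA ler_pdivrMr// mulrC; nra.
Qed.

Lemma sqrt_exists A : pos A -> exists S, [/\ pos S, forall x, S (S x) = A x &
    forall B, bdop B -> (forall x, B (A x) = A (B x)) -> forall x, B (S x) = S (B x)].
Proof.
move=> pA; have [c c0 hc] := pos_ub pA.
by have [S [? ? ? _]] := pos_sqrt pA c0 hc; exists S.
Qed.

(** The constructed root S0 commutes with any other root U. For u = U x - S0 x this gives U u + S0 u
    = 0, so positivity forces U u = S0 u = 0, and then |u|^2 = <x, U u - S0 u> = 0. *)
Lemma sqrt_unique S T : pos S -> pos T -> (forall x, S (S x) = T (T x)) -> S =1 T.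
Proof.
move=> pS pT h.
have [[bS _ _] [bT _ _]] := (pS, pT).
have pA : pos (fun x => S (S x)).
  split; first exact: (bdop_comp bS bS).
    by case: pS => _ sS _ x y; rewrite !sS.
  by case: pS => _ sS _ x; rewrite /rip -sS -/(n2 _) n2_ge0.
have [S0 [pS0 S02 S0c]] := sqrt_exists pA.
have key U : pos U -> (forall x, U (U x) = S (S x)) -> U =1 S0.
  move=> pU hU x; have [bU sU _] := pU; have lU := bU.1; have [bS0 sS0 _] := pS0; have l0 := bS0.1.
  have com y : U (S0 y) = S0 (U y) by apply: S0c => // z; rewrite -!hU.
  apply/eqP; rewrite -subr_eq0 -n2_eq0; apply/eqP.
  set u := U x - S0 x.
  have hu : U u + S0 u = 0.
    by rewrite /u (linB _ _ lU) (linB _ _ l0) hU S02 com; hvec.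
  have h0 : rip u (U u) + rip u (S0 u) = 0 by rewrite -ripDr hu rip0r.
  have [_ _ p1] := pU; have [_ _ p2] := pS0.
  have hU0 : U u = 0 by apply: pos_eq0 => //; have := p1 u; have := p2 u; lra.
  have hS0 : S0 u = 0 by apply: pos_eq0 => //; have := p1 u; have := p2 u; lra.
  rewrite -rip_n2 {1}/u ripBl /rip sU sS0 hU0 hS0 inner0r; ring.
by move=> x; rewrite (key S)// (key T).
Qed.

Definition rlin B := (forall x y, B (x + y) = B x + B y) /\
  (forall (a : R) x, B (a%:C%C *: x) = a%:C%C *: B x).

Lemma rlinB B x y : rlin B -> B (x - y) = B x - B y.
Proof.
move=> [D Z]; rewrite D; congr (_ + _).
by rewrite -scaleN1r (_ : -1 = (-1)%:C%C) ?Z ?rmorphN ?rmorph1 ?scaleN1r.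
Qed.

Lemma rlin0 B : rlin B -> B 0 = 0.
Proof. by move=> rB; rewrite -(subrr 0) rlinB// !subrr. Qed.

(** The iteration has real coefficients, so a merely real-linear B carries the iterates for A to
    those for A' once both use the same scale [d]. It is applied to the antilinear difference of two
    real projections. *)
Lemma sqrt_intertwine A A' S S' B (M : R) : pos A -> pos A' -> pos S -> pos S' ->
  (forall x, S (S x) = A x) -> (forall x, S' (S' x) = A' x) ->
  rlin B -> 0 <= M -> (forall x, hn (B x) <= M * hn x) ->
  (forall x, B (A x) = A' (B x)) -> forall x, B (S x) = S' (B x).
Proof.
move=> pA pA' pS pS' SA SA' rB M0 hM com x.
have [c c0 hc] := pos_ub pA; have [c' c0' hc'] := pos_ub pA'.
pose d := Num.max c c'; have d0 : 0 < d by rewrite lt_max c0.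
have hd y : rip y (A y) <= d * n2 y.
  by apply: le_trans (hc y) _; rewrite ler_wpM2r ?n2_ge0// le_max lexx.
have hd' y : rip y (A' y) <= d * n2 y.
  by apply: le_trans (hc' y) _; rewrite ler_wpM2r ?n2_ge0// le_max lexx orbT.
have [T [pT TA _ Tapp]] := pos_sqrt pA d0 hd.
have [T' [pT' TA' _ Tapp']] := pos_sqrt pA' d0 hd'.
have ST y : S y = T y by apply: sqrt_unique => // z; rewrite SA TA.
have ST' y : S' y = T' y by apply: sqrt_unique => // z; rewrite SA' TA'.
rewrite ST ST'; apply/eqP; rewrite -subr_eq0 -hn_eq0 eq_le hn_ge0 andbT.
apply/ler_addgt0Pr => e e0; rewrite add0r.
have p0 : 0 < (2 * M + 1) * (hn x + 1) by rewrite mulr_gt0// ltr_wpDl ?mulr_ge0 ?hn_ge0.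
have q0 := divr_gt0 e0 p0; set q := e / _ in q0.
have [N hN] := Tapp _ q0; have [N' hN'] := Tapp' _ q0.
have := hN _ x (leq_maxl N N'); have := hN' _ (B x) (leq_maxr N N').
set k := maxn _ _; set p' := _ *: _; set p := _ *: _ => h1 h2.
have Bp : B p = p'.
  have [BD BZ] := rB; rewrite /p /p' BZ (rlinB _ _ rB); congr (_ *: (_ - _)).
  elim: k x {h1 h2 p p' p0 q q0 hN hN'} => [|k ih] x /=.
    exact: rlin0.
  by rewrite BZ BD (rlinB _ _ rB) BZ com !ih.
apply: le_trans (hn_triangle _ (B p) _) _.
rewrite -(rlinB _ _ rB) Bp (hnBC p').
have h3 := hM (T x - p); have h4 := ler_wpM2l M0 h2.
have h6 : q * hn (B x) <= q * (M * hn x) by rewrite ler_wpM2l// ltW.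
have eq : e = q * ((2 * M + 1) * (hn x + 1)) by rewrite /q divfK// gt_eqF.
have n0 := hn_ge0 x.
have : 0 <= q * (hn x + 2 * M + 1).
  by apply: mulr_ge0 (ltW q0) _; rewrite !addr_ge0 ?mulr_ge0.
move=> h7; apply: le_trans (_ : q * ((2 * M + 1) * (hn x + 1)) <= e); last by rewrite -eq.
by move: h1 h2 h3 h4 h6 h7; clear; move: (hn _) (hn _) (hn _) (hn _) q => *; lra.
Qed.

End Sqrt.

(** * Orthonormal families and Hilbert-Schmidt operators *)

Section Orthonormal.
Variables (R : realType) (H : hilbertType R).
Implicit Types (x y z : H).

Definition ons n (e : 'I_n -> H) := forall i j, ⟪e i, e j⟫ = (i == j)%:R.

Lemma ons_inner_sum n (e : 'I_n -> H) (a : 'I_n -> R[i]) i : ons e ->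
  ⟪e i, \sum_j a j *: e j⟫ = a i.
Proof.
move=> oe; rewrite inner_sumr (bigD1 i)//= big1 ?addr0.
  by rewrite innerZr oe eqxx mulr1.
by move=> j ji; rewrite innerZr oe eq_sym (negbTE ji) mulr0.
Qed.

Lemma ons_inner n (e : 'I_n -> H) (a b : 'I_n -> R[i]) : ons e ->
  ⟪\sum_j a j *: e j, \sum_j b j *: e j⟫ = \sum_j ((a j)^*)%C * b j.
Proof.
move=> oe; rewrite inner_suml; apply: eq_bigr => i _.
by rewrite innerZl ons_inner_sum.
Qed.

Lemma ons_n2 n (e : 'I_n -> H) (a : 'I_n -> R[i]) : ons e ->
  n2 (\sum_j a j *: e j) = \sum_j sqc (a j).
Proof.
move=> oe; rewrite /n2 ons_inner// Re_sum; apply: eq_bigr => i _.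
by rewrite -sqcEl.
Qed.

Definition oproj n (e : 'I_n -> H) x := \sum_i ⟪e i, x⟫ *: e i.

Lemma oprojE n (e : 'I_n -> H) i x : ons e -> ⟪e i, oproj e x⟫ = ⟪e i, x⟫.
Proof. exact: ons_inner_sum. Qed.

Lemma oproj_linear n (e : 'I_n -> H) : linear (oproj e).
Proof.
move=> a x y; rewrite /oproj scaler_sumr -big_split; apply: eq_bigr => i _ /=.
by rewrite innerDr innerZr scalerDl scalerA.
Qed.

Lemma oproj_sa n (e : 'I_n -> H) : adjoint_operators (oproj e) (oproj e).
Proof.
move=> x y; rewrite /oproj inner_suml inner_sumr; apply: eq_bigr => i _.
by rewrite innerZl innerZr -innerC mulrC.
Qed.

Lemma oproj_n2 n (e : 'I_n -> H) x : ons e -> n2 (oproj e x) = \sum_i sqc ⟪e i, x⟫.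
Proof. exact: ons_n2. Qed.

Lemma oproj_ortho n (e : 'I_n -> H) x : ons e -> ⟪oproj e x, x - oproj e x⟫ = 0.
Proof.
move=> oe; rewrite {1}/oproj inner_suml big1// => i _.
by rewrite innerZl innerBr oprojE// subrr mulr0.
Qed.

Lemma oproj_pyth n (e : 'I_n -> H) x : ons e ->
  n2 x = n2 (oproj e x) + n2 (x - oproj e x).
Proof.
move=> oe; rewrite -{1}(subrK (oproj e x) x) (n2D (x - oproj e x)) ripC.
by rewrite [rip _ _]/(Re _) oproj_ortho//= mulr0 addr0 addrC.
Qed.

Lemma bessel n (e : 'I_n -> H) x : ons e -> \sum_i sqc ⟪e i, x⟫ <= n2 x.
Proof. by move=> oe; rewrite -oproj_n2// (oproj_pyth x oe) lerDl n2_ge0. Qed.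

Lemma oproj_idem n (e : 'I_n -> H) x : ons e -> oproj e (oproj e x) = oproj e x.
Proof. by move=> oe; apply: eq_bigr => i _; rewrite oprojE. Qed.

Lemma oproj_hn n (e : 'I_n -> H) x : ons e -> hn (oproj e x) <= hn x.
Proof. by move=> oe; rewrite hn_le2 (oproj_pyth x oe) lerDl n2_ge0. Qed.

Lemma oproj_bdop n (e : 'I_n -> H) : ons e -> bdop (oproj e).
Proof.
by move=> oe; split; [exact: oproj_linear|exists 1 => // x; rewrite mul1r oproj_hn].
Qed.

Definition ocons n (e : 'I_n -> H) y : 'I_n.+1 -> H :=
  fun i => if unlift ord0 i is Some j then e j else y.

Lemma ocons0 n (e : 'I_n -> H) y : ocons e y ord0 = y.
Proof. by rewrite /ocons unlift_none. Qed.
Lemma oconsS n (e : 'I_n -> H) y i : ocons e y (lift ord0 i) = e i.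
Proof. by rewrite /ocons liftK. Qed.

Lemma ons_ocons n (e : 'I_n -> H) y : ons e -> n2 y = 1 -> (forall i, ⟪e i, y⟫ = 0) ->
  ons (ocons e y).
Proof.
move=> oe y1 ey i j.
case: (unliftP ord0 i) => [i' ->|->]; case: (unliftP ord0 j) => [j' ->|->];
  rewrite ?ocons0 ?oconsS.
- by rewrite oe (inj_eq lift_inj).
- by rewrite ey.
- by rewrite innerC ey conjE.
- by rewrite inner_n2 y1 eqxx.
Qed.

(** The predicate [P] lets one construction yield families of real vectors as well as families
    inside an orthogonal complement. *)
Lemma gram_schmidt (P : set H) :
  (forall n (e : 'I_n -> H) x, P x -> (forall i, P (e i)) -> P (x - oproj e x)) ->
  (forall x, P x -> P ((hn x)^-1%:C%C *: x)) ->
  forall s : seq H, (forall x, x \in s -> P x) ->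
  exists n (e : 'I_n -> H), [/\ ons e, forall i, P (e i) & forall x, x \in s -> oproj e x = x].
Proof.
move=> Pproj Pnorm; elim=> [|x s ih] Ps.
  by exists 0%N, (fun=> 0); split=> // -[].
have [|n [e [oe Pe es]]] := ih; first by move=> y ys; apply: Ps; rewrite inE ys orbT.
have [xe|xe] := eqVneq (oproj e x) x.
  by exists n, e; split=> // y; rewrite inE => /orP[/eqP ->|/es].
pose y := x - oproj e x.
have Py : P y by apply: Pproj => //; apply: Ps; rewrite inE eqxx.
have y0 : hn y != 0 by rewrite hn_eq0 subr_eq0 eq_sym.
pose u := (hn y)^-1%:C%C *: y.
have oeu : ons (ocons e u).
  apply: ons_ocons => //; first by rewrite n2Z sqcC -hn2 -exprMn mulVf// expr1n.
  by move=> i; rewrite innerZr innerBr oprojE// subrr mulr0.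
have key z : oproj (ocons e u) z = ⟪u, z⟫ *: u + oproj e z.
  rewrite /oproj big_ord_recl ocons0; congr (_ + _).
  by apply: eq_bigr => i _; rewrite oconsS.
exists n.+1, (ocons e u); split=> //.
  move=> i; case: (unliftP ord0 i) => [i' ->|->]; rewrite ?ocons0 ?oconsS//.
  exact: Pnorm.
move=> z; rewrite inE => /orP[/eqP ->|zs].
  have ux : ⟪u, x⟫ *: u = y.
    have -> : x = y + oproj e x by rewrite subrK.
    rewrite innerDr.
    have -> : ⟪u, oproj e x⟫ = 0.
      by rewrite innerZl innerC (_ : ⟪_, y⟫ = 0) ?oproj_ortho// J0 mulr0.
    rewrite addr0 innerZl JC inner_n2 scalerA -!rmorphM/= -hn2 expr2 mulKf//.
    by rewrite mulfV// scale1r.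
  by rewrite key ux subrK.
rewrite key es// (_ : ⟪u, z⟫ = 0) ?scale0r ?add0r//.
rewrite -(es z zs) innerZl -(oproj_sa e) (linB _ _ (oproj_linear e)) oproj_idem//.
by rewrite subrr inner0l mulr0.
Qed.

Lemma gram_schmidtT (s : seq H) :
  exists n (e : 'I_n -> H), ons e /\ forall x, x \in s -> oproj e x = x.
Proof. by have [//|//|//|n [e [? _ ?]]] := @gram_schmidt setT _ _ s; exists n, e. Qed.

Lemma inner_ons n (e : 'I_n -> H) x y : oproj e y = y ->
  ⟪x, y⟫ = \sum_i (⟪e i, x⟫^*)%C * ⟪e i, y⟫.
Proof.
move=> ey; rewrite -{1}ey /oproj inner_sumr; apply: eq_bigr => i _.
by rewrite innerZr mulrC innerC.
Qed.

Lemma n2_ons n (e : 'I_n -> H) x : ons e -> oproj e x = x -> n2 x = \sum_i sqc ⟪e i, x⟫.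
Proof. by move=> oe {1}<-; rewrite oproj_n2. Qed.

Lemma ons_fix n (f : 'I_n -> H) i : ons f -> oproj f (f i) = f i.
Proof.
move=> of_; rewrite /oproj (bigD1 i)//= of_ eqxx scale1r big1 ?addr0// => l li.
by rewrite of_ (negbTE li) scale0r.
Qed.

Lemma gram_schmidt_fun n (f : 'I_n -> H) :
  exists m (e : 'I_m -> H), ons e /\ forall i, oproj e (f i) = f i.
Proof.
have [m [e [oe ef]]] := gram_schmidtT [seq f i | i <- enum 'I_n].
by exists m, e; split => // i; apply: ef; apply: map_f; rewrite mem_enum.
Qed.

(* Hilbert-Schmidt norms are bounded through finite orthonormal families only,
   which makes the notion independent of a choice of basis. *)
Definition hsb (T : H -> H) (M : R) :=
  forall n (e : 'I_n -> H), ons e -> \sum_i n2 (T (e i)) <= M.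

Definition hs T := exists M, hsb T M.

Lemma hsb_ge0 T M : hsb T M -> 0 <= M.
Proof.
have o0 : ons (fun i : 'I_0 => 0 : H) by case.
by move=> /(_ 0%N _ o0); rewrite big_ord0.
Qed.

(** Expand all [S (f i)] in one orthonormal family [e]; exchanging the sums leaves T on [e], up to
    Bessel. *)
Lemma hsb_adj S T M : adjoint_operators S T -> hsb T M -> hsb S M.
Proof.
move=> a hT n f of_.
have [m [e [oe ef]]] := gram_schmidt_fun (fun i => S (f i)).
apply: le_trans (hT m e oe).
rewrite (eq_bigr (fun i => \sum_k sqc ⟪e k, S (f i)⟫)); last first.
  by move=> i _; exact: n2_ons.
rewrite exchange_big/=; apply: ler_sum => k _.
rewrite (eq_bigr (fun i => sqc ⟪f i, T (e k)⟫)); first exact: bessel.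
by move=> i _; rewrite innerC sqcJ a.
Qed.

Lemma hs_adj S T : adjoint_operators S T -> hs T -> hs S.
Proof. by move=> a [M h]; exists M; exact: hsb_adj h. Qed.

Lemma hs_left B T (c : R) : (forall x, hn (B x) <= c * hn x) -> hs T -> hs (B \o T).
Proof.
move=> hB [M hM]; exists (c ^+ 2 * M) => n e oe.
apply: le_trans (_ : \sum_i c ^+ 2 * n2 (T (e i)) <= _).
  apply: ler_sum => i _ /=; rewrite -!hn2 -exprMn ler_pXn2r ?nnegrE ?hn_ge0//.
  exact: le_trans (hn_ge0 _) (hB _).
by rewrite -mulr_sumr ler_wpM2l ?sqr_ge0// hM.
Qed.

Lemma hs_right B B' T T' (c : R) : adjoint_operators B B' -> adjoint_operators T T' ->
  (forall x, hn (B' x) <= c * hn x) -> hs T -> hs (T \o B).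
Proof.
move=> aB aT hB hT; apply: hs_adj (adj_comp aT aB) _.
by apply: (hs_left hB); exact: hs_adj (adjC aT) hT.
Qed.

Lemma hsD S T : hs S -> hs T -> hs (fun x => S x + T x).
Proof.
move=> [M hM] [N hN]; exists (2 * M + 2 * N) => n e oe.
apply: le_trans (_ : \sum_i (2 * n2 (S (e i)) + 2 * n2 (T (e i))) <= _).
  by apply: ler_sum => i _; exact: n2_le_2.
by rewrite big_split/= -!mulr_sumr lerD// ler_wpM2l// ?hM ?hN.
Qed.

Lemma hsZ T (a : R[i]) : hs T -> hs (fun x => a *: T x).
Proof.
by apply: (@hs_left (fun x => a *: x) T (nc a)) => x; rewrite hnZ.
Qed.

Lemma hs_hn T M x : (forall (a : R) x, T (a%:C%C *: x) = a%:C%C *: T x) -> hsb T M ->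
  n2 (T x) <= M * n2 x.
Proof.
move=> l hT; have [->|x0] := eqVneq x 0.
  by rewrite -(scale0r 0) (l 0) (_ : 0%:C%C = 0)// !scale0r n2_0 mulr0.
have n0 : hn x != 0 by rewrite hn_eq0.
pose e (i : 'I_1) := (hn x)^-1%:C%C *: x.
have oe : ons e.
  move=> i j; rewrite !ord1 /e eqxx inner_n2 n2Z sqcC -hn2 -exprMn mulVf// expr1n.
  by [].
have := hT _ _ oe; rewrite big_ord1 /e l n2Z sqcC exprVn hn2.
have nx : 0 < n2 x by rewrite lt_neqAle n2_ge0 eq_sym n2_eq0 x0.
by rewrite ler_pdivrMl// mulrC.
Qed.

End Orthonormal.

(** * Standard subspaces *)

Section StandardSubspace.
Variables (R : realType) (H : hilbertType R).
Implicit Types (x y z : H).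

(* With P the real orthogonal projection onto K, X^2 = P - i P i = 2 / (1 + delta),
   the operator j X j is delta^{1/2} X, and j is the modular conjugation. *)
Record std_data (K : set H) (X j : H -> H) : Prop := StdData {
  sdX : pos X;
  sdXi : forall x, X x = 0 -> x = 0;
  sdj : forall (a : R[i]) x y, j (a *: x + y) = (a^*)%C *: j x + j y;
  sdjK : forall x, j (j x) = x;
  sdjI : forall x y, ⟪j x, j y⟫ = ⟪y, x⟫;
  sdX2 : forall x, X (X x) + j (X (X (j x))) = 2%:R *: x;
  sdC : forall x, X (j (X (j x))) = j (X (j (X x)));
  sdK : forall h, K h <-> exists2 z, j z = z & X z = h
}.

Lemma two_half : (2^-1)%:C%C + (2^-1)%:C%C = 1 :> R[i].
Proof. by rewrite -rmorphD /= -(mulr1 2^-1) -mulrDr mulVf. Qed.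

(** The square root U of S commutes with T, so <x, S T x> = <U x, T U x>. *)
Lemma pos_comp S T : pos S -> pos T -> (forall x, S (T x) = T (S x)) -> pos (S \o T).
Proof.
move=> pS pT com; have [[bS sS _] [bT sT pT0]] := (pS, pT).
have [U [pU U2 Uc]] := sqrt_exists pS; have [bU sU _] := pU.
split; first exact: bdop_comp.
  by move=> x y /=; rewrite sS sT com.
move=> x /=; rewrite -U2 /rip -sU.
by rewrite -(Uc T)// -/(rip _ _).
Qed.

(** The projection of x to the closed range differs from x by a vector orthogonal to the range,
    hence in the kernel of M. *)
Lemma sa_injective_dense M : bdop M -> adjoint_operators M M ->
  (forall x, M x = 0 -> x = 0) ->
  forall x (e : R), 0 < e -> exists y, hn (x - M y) < e.
Proof.
move=> [lM _] sM Mi x e e0.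
have [||||v [vG vc]] := @riesz_graphC R H [set p | exists y, p.1 = M y /\ p.2 = ⟪x, M y⟫] (n2 x).
- by exists 0; rewrite (lin0 lM) inner0r.
- move=> a [p1 p2] [q1 q2] [y /= [-> ->]] [y' /= [-> ->]].
  by exists (a *: y + y'); rewrite lM !innE.
- exact: n2_ge0.
- by move=> [p1 p2] [y /= [-> ->]]; exact: inner_CS.
have vx : v = x.
  apply/eqP; rewrite -subr_eq0; apply/eqP/Mi/inner_extl => w; rewrite inner0l sM innerBl.
  by rewrite (vG (M w, ⟪x, M w⟫)) ?subrr//; exists w.
by have [[p1 p2] [y /= [-> _]]] := vc e e0; rewrite vx => hy; exists y.
Qed.

Lemma rlin_complex (A : H -> H) : rlin A -> (forall x, A (imI *: x) = imI *: A x) -> linear A.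
Proof.
move=> [AD AZ] Ai a x y; rewrite AD; congr (_ + _).
have aE : a = (Re a)%:C%C + (Im a)%:C%C * imI.
  by apply: complex_ext; rewrite !reim; ring.
by rewrite aE !scalerDl AD AZ -!scalerA AZ Ai.
Qed.

Lemma complex_sa (A B : H -> H) : linear A -> linear B ->
  (forall x y, rip (A x) y = rip x (B y)) -> adjoint_operators A B.
Proof.
move=> lA lB h x y; apply: complex_ext; first exact: h.
have := h x (imI *: y); rewrite (linZ _ _ lB) /rip !innerZr !reim; lra.
Qed.

(** The bounded operator approach of Rieffel and van Daele. P and Q are the real projections onto K
    and iK; A = P + Q is complex linear, T = P - Q is antilinear, and T^2 = A (2 - A). X is the root
    of A, X' that of 2 - A, and j is the isometric factor in T = j M with M = X X'. *)
Lemma standard_data (K : set H) : standard_subspace K -> exists X j, std_data K X j.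
Proof.
move=> [rK cK dK KiK]; have [K0 KD KZ] := rK.
have /choice[P PP] x : exists p, K p /\ forall k, K k -> rip (x - p) k = 0.
  by have [p ? ?] := real_projection rK cK x; exists p.
have Puniq x p : K p -> (forall k, K k -> rip (x - p) k = 0) -> P x = p.
  move=> Kp hp; apply/eqP; rewrite -subr_eq0 -n2_eq0; apply/eqP.
  have Kd : K (P x - p).
    have -> : P x - p = P x + (-1)%:C%C *: p by rewrite rmorphN rmorph1 scaleN1r.
    exact: KD (PP x).1 (KZ _ _ Kp).
  have := hp _ Kd; have := (PP x).2 _ Kd; rewrite -rip_n2 !ripBl; lra.
have PD x y : P (x + y) = P x + P y.
  apply: Puniq; first exact: KD (PP x).1 (PP y).1.
  move=> k Kk; have := (PP x).2 k Kk; have := (PP y).2 k Kk; rewrite !ripE; lra.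
have PZ (a : R) x : P (a%:C%C *: x) = a%:C%C *: P x.
  apply: Puniq; first exact: KZ (PP x).1.
  by move=> k Kk; rewrite -scalerBr ripZl (PP x).2// mulr0.
have rP : rlin P by split.
have PK k : K k -> P k = k.
  by move=> Kk; apply: Puniq => // k' _; rewrite subrr rip0l.
have Psa x y : rip (P x) y = rip x (P y).
  have := (PP x).2 _ (PP y).1; have := (PP y).2 _ (PP x).1.
  rewrite !ripE (ripC y) (ripC (P y) (P x)); lra.
have Pn x : rip x (P x) = n2 (P x).
  by have := (PP x).2 _ (PP x).1; rewrite !ripE rip_n2; lra.
have Pb x : n2 (P x) <= n2 x.
  by have := n2_ge0 (x - P x); rewrite n2B Pn; lra.
pose Q x := imI *: P (- imI *: x).
have Nim x : - imI *: x = - (imI *: x) by rewrite scaleNr.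
have PN x : P (- x) = - P x by rewrite -(sub0r x) (rlinB _ _ rP) (rlin0 rP) sub0r.
have ii x : imI *: (imI *: x) = - x by rewrite scalerA imI2 scaleN1r.
have QE x : Q x = - (imI *: P (imI *: x)) by rewrite /Q Nim PN scalerN.
have rQ : rlin Q.
  by split=> [x y|a x]; rewrite !QE ?scalerDr ?PD ?scalerDr ?opprD// scalerA mulrC -scalerA PZ
    scalerA mulrC -scalerA scalerN.
have Qi x : Q (imI *: x) = imI *: P x by rewrite QE ii PN scalerN opprK.
have Pi x : P (imI *: x) = imI *: Q x by rewrite QE scalerN ii opprK.
have Qsa x y : rip (Q x) y = rip x (Q y).
  rewrite !QE !ripE; congr (- _).
  by rewrite -(rip_iI _ y) -(rip_iI x) !ii ripNl ripNr Psa.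
have PPx x : P (P x) = P x by apply: PK; exact: (PP x).1.
have QQx x : Q (Q x) = Q x by rewrite QE (QE x) scalerN ii opprK PPx.
have [A AE] : exists A : H -> H, forall x, A x = P x + Q x by eexists.
have [A2 A2E] : exists A2 : H -> H, forall x, A2 x = 2%:R *: x - A x by eexists.
have [T TE] : exists T : H -> H, forall x, T x = P x - Q x by eexists.
have Qb x : n2 (Q x) <= n2 x.
  by rewrite QE n2N n2Z sqc_imI mul1r; apply: le_trans (Pb _) _; rewrite n2Z sqc_imI mul1r.
have ripi x y : rip x (imI *: y) = - rip (imI *: x) y.
  by rewrite -rip_iI ii ripNr.
have Qn x : rip x (Q x) = n2 (P (imI *: x)) by rewrite QE ripNr ripi opprK Pn.
have [PD' PZ'] := rP; have [QD QZ] := rQ.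
have QB x y : Q (x - y) = Q x - Q y := rlinB x y rQ.
have PB x y : P (x - y) = P x - P y := rlinB x y rP.
have P2 x : P (2%:R *: x) = 2%:R *: P x by rewrite -(rmorph_nat (@real_complex R)) PZ.
have Q2 x : Q (2%:R *: x) = 2%:R *: Q x by rewrite -(rmorph_nat (@real_complex R)) QZ.
have lA : linear A.
  apply: rlin_complex; last by move=> x; rewrite !AE Pi Qi scalerDr addrC.
  by split=> [x y|a x]; rewrite !AE ?PD ?QD ?PZ ?QZ; hvec.
have bA : bdop A.
  split => //; exists 2 => // x; rewrite AE; apply: le_trans (hnD _ _) _.
  have : hn (P x) <= hn x by rewrite hn_le2.
  have : hn (Q x) <= hn x by rewrite hn_le2.
  by lra.
have sA : adjoint_operators A A.
  by apply: complex_sa => // x y; rewrite !AE !ripE Psa Qsa.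
have An x : rip x (A x) = n2 (P x) + n2 (P (imI *: x)) by rewrite !AE ripDr Pn Qn.
have pA : pos A by split => // x; rewrite An addr_ge0 ?n2_ge0.
have bA2 : bdop A2.
  by apply: (bdop_eq (bdopB (bdopZ 2%:R (bdop_id H)) bA)) => x; rewrite A2E.
have A2n x : rip x (A2 x) = (n2 x - n2 (P x)) + (n2 (imI *: x) - n2 (P (imI *: x))).
  by rewrite !A2E ripBr An n2Z sqc_imI -(rmorph_nat (@real_complex R)) ripZr rip_n2; ring.
have pA2 : pos A2.
  split => //; first by move=> x y; rewrite !A2E !innE sA conjc_nat; ring.
  by move=> x; rewrite A2n addr_ge0 ?subr_ge0 ?Pb.
have AA2 x : A (A2 x) = A2 (A x).
  by rewrite !A2E (linB _ _ lA) (linZ _ _ lA).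
have [X [pX XX Xc]] := sqrt_exists pA; have [X' [pX' XX' Xc']] := sqrt_exists pA2.
have [[bX sX _] [bX' sX' _]] := (pX, pX'); have lX := bX.1; have lX' := bX'.1.
have comX x : X (X' x) = X' (X x).
  by apply: (Xc' X bX) => y; rewrite Xc.
(* The kernel of P + Q is orthogonal to K and to iK, hence to the dense space K + iK. *)
have Ai x : A x = 0 -> x = 0.
  move=> A0; have := An x; rewrite A0 rip0r => /esym/eqP.
  rewrite paddr_eq0 ?n2_ge0// !n2_eq0 => /andP[/eqP p1 /eqP p2].
  apply: (@approx_ortho_eq0 _ _ (complexify K)); first exact: (dense_hn _).1 dK x.
  move=> _ [h [k [Kh Kk ->]]].
  have z0 k' : K k' -> ⟪k', x⟫ = 0.
    move=> Kk'; have := (PP x).2 k' Kk'; have := (PP (imI *: x)).2 k' Kk'.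
    rewrite p1 p2 !subr0 /rip innerZl => h1 h2.
    apply: complex_ext; rewrite innerC !reim; first exact: h2.
    by move: h1; rewrite conjE !reim /=; lra.
  by rewrite innerDl innerZl !z0// mulr0 addr0.
(* If 2 - P - Q kills x, both projections fix x, so x is in K and in iK. *)
have A2i x : A2 x = 0 -> x = 0.
  move=> A0; have := A2n x; rewrite A0 rip0r => /esym/eqP.
  rewrite paddr_eq0 ?subr_ge0 ?Pb// !subr_eq0 => /andP[/eqP p1 /eqP p2].
  have fix1 y : n2 y = n2 (P y) -> K y.
    move=> h; suff -> : y = P y by exact: (PP y).1.
    by apply/eqP; rewrite -subr_eq0 -n2_eq0 n2B Pn h; apply/eqP; ring.
  by apply: KiK; exact: fix1.
have Xi x : X x = 0 -> x = 0 by move=> X0; apply: Ai; rewrite -XX X0 (lin0 lX).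
have Xi' x : X' x = 0 -> x = 0 by move=> X0; apply: A2i; rewrite -XX' X0 (lin0 lX').
have rT : rlin T by split=> [x y|a x]; rewrite !TE ?PD ?QD ?PZ ?QZ; hvec.
have Tb x : hn (T x) <= 2 * hn x.
  rewrite TE; apply: le_trans (hnB _ _) _.
  have : hn (P x) <= hn x by rewrite hn_le2.
  have : hn (Q x) <= hn x by rewrite hn_le2.
  by lra.
have Ti x : T (imI *: x) = - (imI *: T x) by rewrite !TE Pi Qi; hvec.
have TA x : T (A x) = A2 (T x) by rewrite !TE !A2E !AE !(PB, QB, PD, QD) PPx QQx; hvec.
have TA2 x : T (A2 x) = A (T x).
  by rewrite !TE !A2E !AE !(PB, QB, PD, QD, P2, Q2) PPx QQx; hvec.
have TT x : T (T x) = A (A2 x).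
  by rewrite !TE !A2E !AE !(PB, QB, PD, QD, P2, Q2) PPx QQx; hvec.
have TX x : T (X x) = X' (T x) by apply: (sqrt_intertwine pA pA2 pX pX') Tb _ x.
have TX' x : T (X' x) = X (T x) by apply: (sqrt_intertwine pA2 pA pX' pX) Tb _ x.
have Tsa x y : rip (T x) y = rip x (T y) by rewrite !TE !ripE Psa Qsa.
have Tsym x y : ⟪T x, y⟫ = ⟪T y, x⟫.
  apply: complex_ext; first by rewrite -!/(rip _ _) Tsa ripC.
  have := Tsa x (imI *: y); rewrite Ti ripNr /rip !innerZr [⟪x, T y⟫]innerC !reim /=; lra.
have [M ME] : exists M : H -> H, forall x, M x = X (X' x) by eexists.
have bM : bdop M by apply: bdop_eq (bdop_comp bX bX') _ => x; rewrite ME.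
have lM := bM.1.
have sM : adjoint_operators M M by move=> x y; rewrite !ME sX sX' comX.
have Mi x : M x = 0 -> x = 0 by rewrite ME => /Xi/Xi'.
have TM x : T (M x) = M (T x) by rewrite !ME TX TX' comX.
have MM x : M (M x) = T (T x) by rewrite TT !ME -(comX (X' x)) XX XX'.
have nM x : n2 (M x) = n2 (T x) by rewrite -!rip_n2 Tsa -MM /rip sM.
have Md := sa_injective_dense bM sM Mi.
have M0 x : (forall w, ⟪x, M w⟫ = 0) -> x = 0.
  by move=> h; apply/Mi/inner_extl => w; rewrite sM h inner0l.
(* j is defined by duality against the dense range of M; the bound needed for Riesz is |T w| = |M
   w|. *)
have /choice[j jM] x : exists y, forall w, ⟪y, M w⟫ = ⟪T w, x⟫.
  have [||||v [vG _]] := @riesz_graphC R H [set p | exists w, p.1 = M w /\ p.2 = ⟪T w, x⟫] (n2 x).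
  - by exists 0; rewrite (lin0 lM) (rlin0 rT) inner0l.
  - move=> a [p1 p2] [q1 q2] [y /= [-> ->]] [y' /= [-> ->]].
    exists (a *: y + y'); rewrite lM; split => //.
    by rewrite ![⟪T _, x⟫]Tsym [⟪_, a *: y + y'⟫]innerDr innerZr.
  - exact: n2_ge0.
  - by move=> [p1 p2] [y /= [-> ->]]; rewrite nM mulrC; exact: inner_CS.
  by exists v => w; apply: (vG (M w, ⟪T w, x⟫)); exists w.
have juniq x y : (forall w, ⟪y, M w⟫ = ⟪T w, x⟫) -> y = j x.
  move=> h; apply/eqP; rewrite -subr_eq0; apply/eqP/M0 => w.
  by rewrite innerBl h jM subrr.
have jl (a : R[i]) x y : j (a *: x + y) = (a^*)%C *: j x + j y.
  by apply/esym/juniq => w; rewrite !innE !jM conjE.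
have jMT w : j (M w) = T w.
  by apply/esym/juniq => v; rewrite -sM -TM Tsym.
have jTM w : j (T w) = M w.
  by apply/esym/juniq => v; rewrite -sM MM [RHS]Tsym.
have jb x : hn (j x) <= hn x.
  rewrite -[X in _ <= X]addr0; apply/ler_addgt0Pr => e e0; rewrite addr0.
  have e2 : 0 < e / 2 by rewrite divr_gt0.
  have [w hw] := Md (j x) _ e2.
  have h1 : hn (M w) ^+ 2 <= hn (M w) * (hn x + hn (j x - M w)).
    rewrite hn2 -rip_n2 -{1}(subrK (j x) (M w)) ripDl {2}/rip jM mulrDr addrC.
    apply: lerD; last by rewrite mulrC (hnBC (j x)); exact: le_trans (ler_norm _) (rip_le _ _).
    apply: le_trans (ler_norm _) (le_trans (rip_le _ _) _).
    by rewrite ler_wpM2r ?hn_ge0// hn_le2 nM.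
  have h2 : hn (M w) <= hn x + hn (j x - M w).
    have [->|n0] := eqVneq (hn (M w)) 0; first by rewrite addr_ge0 ?hn_ge0.
    have n1 : 0 < hn (M w) by rewrite lt_neqAle hn_ge0 eq_sym n0.
    by rewrite -(ler_pM2l n1) -expr2.
  have h3 : hn (j x) <= hn (M w) + hn (j x - M w).
    have -> : hn (j x) = hn (M w + (j x - M w)) by rewrite addrC subrK.
    exact: hnD.
  lra.
have jB x y : j (x - y) = j x - j y.
  by rewrite addrC -scaleN1r jl rmorphN rmorph1 scaleN1r addrC.
(* equalities between continuous real-linear maps are checked on the range of M *)
have ext (f g : H -> H) (c : R) : 0 <= c -> (forall x y, f (x - y) = f x - f y) ->
    (forall x y, g (x - y) = g x - g y) -> (forall x, hn (f x) <= c * hn x) ->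
    (forall x, hn (g x) <= c * hn x) -> (forall w, f (M w) = g (M w)) -> f =1 g.
  move=> c0 fB gB fb gb fg x; apply/eqP; rewrite -subr_eq0 -hn_eq0 eq_le hn_ge0 andbT.
  apply/ler_addgt0Pr => e e0; rewrite add0r.
  have c1 : 0 < 2 * c + 1 by rewrite ltr_wpDl ?mulr_ge0.
  have [w hw] := Md x _ (divr_gt0 e0 c1).
  have -> : f x - g x = f (x - M w) - g (x - M w) by rewrite fB gB fg; hvec.
  apply: le_trans (hnB _ _) _.
  have := fb (x - M w); have := gb (x - M w); move: hw; rewrite ltr_pdivlMr//.
  have := hn_ge0 (x - M w); lra.
have jj x : j (j x) = x.
  apply: (ext (fun x => j (j x)) id 1) => //; first by move=> ? ?; rewrite !jB.
  - by move=> y; rewrite mul1r; exact: le_trans (jb _) (jb _).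
  - by move=> y; rewrite mul1r.
  - by move=> w; rewrite jMT jTM.
have jsym x u : ⟪j x, u⟫ = ⟪j u, x⟫.
  have h w : ⟪j x, M w⟫ = ⟪j (M w), x⟫ by rewrite jM jMT.
  apply/eqP; rewrite -subr_eq0 -nc_eq0 eq_le nc_ge0 andbT.
  apply/ler_addgt0Pr => e e0; rewrite add0r.
  have p0 : 0 < 2 * hn x + 1 by rewrite ltr_wpDl ?mulr_ge0 ?hn_ge0.
  have [w] := Md u _ (divr_gt0 e0 p0); rewrite ltr_pdivlMr// => hw.
  have -> : ⟪j x, u⟫ - ⟪j u, x⟫ = ⟪j x, u - M w⟫ - ⟪j (u - M w), x⟫.
    by rewrite jB !innE h; ring.
  apply: le_trans (ncD _ _) _; rewrite ncN.
  have := nc_inner (j x) (u - M w); have := nc_inner (j (u - M w)) x.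
  have := ler_wpM2r (hn_ge0 x) (jb (u - M w)); have := ler_wpM2r (hn_ge0 (u - M w)) (jb x).
  have := hn_ge0 (u - M w); lra.
have jI x y : ⟪j x, j y⟫ = ⟪y, x⟫ by rewrite jsym jj.
have [_ [cX c0 hcX]] := bX; have [_ [cX' c0' hcX']] := bX'.
have jX x : j (X x) = X' (j x).
  apply: (ext (fun x => j (X x)) (fun x => X' (j x)) (cX + cX')).
  - exact: addr_ge0.
  - by move=> y z; rewrite (linB _ _ lX) jB.
  - by move=> y z; rewrite jB (linB _ _ lX').
  - move=> y; apply: le_trans (jb _) (le_trans (hcX _) _).
    by rewrite ler_wpM2r ?hn_ge0// lerDl.
  - move=> y; apply: le_trans (hcX' _) (le_trans (ler_wpM2l c0' (jb _)) _).
    by rewrite ler_wpM2r ?hn_ge0// lerDr.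
  - by move=> w; rewrite jMT -TX -jMT !ME !comX.
have jX' x : j (X' x) = X (j x) by rewrite -{1}(jj x) -jX jj.
have X'E x : X' x = j (X (j x)) by rewrite jX jj.
have jD x y : j (x + y) = j x + j y.
  by have := jl 1 x y; rewrite !scale1r rmorph1 scale1r.
have jZ (r : R) x : j (r%:C%C *: x) = r%:C%C *: j x.
  by have := jl r%:C%C x 0; rewrite !addr0 JC -(subrr 0) jB subrr addr0.
exists X, j; split => //.
- by move=> x; rewrite jX -X'E XX XX' A2E; hvec.
- by move=> x; rewrite -X'E -X'E comX.
- move=> h; split=> [Kh|[z jz <-]].
    have Ph : P h = h by exact: PK.
    have XjX' : X (j h) = X' h.
      apply/eqP; rewrite -subr_eq0; apply/eqP/Xi'.
      rewrite (linB _ _ lX') -comX -jX -jX' -comX -ME jMT XX' TE A2E AE Ph; hvec.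
    (* If X z = h with z real, then j h = X' z, so X h + X' (j h) = (X^2 + X'^2) z = 2 z. *)
    exists ((2^-1)%:C%C *: (X h + X' (j h))).
      by rewrite jZ jD jX jX' jj addrC.
    rewrite (linZ _ _ lX) (linD _ _ lX) comX XjX' XX XX' A2E.
    rewrite [A h + _](_ : _ = h + h); last by hvec.
    by rewrite scalerDr -scalerDl two_half scale1r.
  have TXz : T (X z) = A2 (X z).
    by rewrite -jMT ME jX jX' jX jz -XX' comX.
  have PXz : P (X z) = X z.
    have h1 : P (X z) + P (X z) = X z + X z.
      transitivity (T (X z) + A (X z)); first by rewrite TE AE; hvec.
      by rewrite TXz A2E; hvec.
    have := congr1 (fun v => (2^-1)%:C%C *: v) h1.
    by rewrite !scalerDr -!scalerDl two_half !scale1r.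
  by rewrite -PXz; exact: (PP _).1.
Qed.

End StandardSubspace.

(** * The Tomita and modular operators in terms of X and j *)

Section StandardData.
Variables (R : realType) (H : hilbertType R).
Implicit Types (x y z w : H).

Section Conjugation.
Variable j : H -> H.
Hypotheses (jl : forall (a : R[i]) x y, j (a *: x + y) = (a^*)%C *: j x + j y)
  (jK : forall x, j (j x) = x) (jI : forall x y, ⟪j x, j y⟫ = ⟪y, x⟫).

Lemma conj_D x y : j (x + y) = j x + j y.
Proof. by have := jl 1 x y; rewrite !scale1r rmorph1 scale1r. Qed.
Lemma conj_0 : j 0 = 0.
Proof. by apply: (addrI (j 0)); rewrite -conj_D !addr0. Qed.
Lemma conj_Z (a : R[i]) x : j (a *: x) = (a^*)%C *: j x.
Proof. by have := jl a x 0; rewrite !addr0 conj_0 addr0. Qed.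
Lemma conj_N x : j (- x) = - j x.
Proof. by rewrite -scaleN1r conj_Z rmorphN rmorph1 scaleN1r. Qed.
Lemma conj_B x y : j (x - y) = j x - j y.
Proof. by rewrite conj_D conj_N. Qed.
Lemma conj_Zr (a : R) x : j (a%:C%C *: x) = a%:C%C *: j x.
Proof. by rewrite conj_Z JC. Qed.
Lemma conj_sym x y : ⟪j x, y⟫ = ⟪j y, x⟫.
Proof. by rewrite -{1}(jK y) jI. Qed.
Lemma conj_hn x : hn (j x) = hn x.
Proof. by rewrite /hn /n2 jI. Qed.
Lemma conj_sum I (s : seq I) (P : pred I) (F : I -> H) :
  j (\sum_(i <- s | P i) F i) = \sum_(i <- s | P i) j (F i).
Proof. by elim/big_rec2: _ => [|i x y _ <-]; rewrite ?conj_0// conj_D. Qed.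

Definition rpart z := (2^-1)%:C%C *: (z + j z).
Definition ipart z := (2^-1)%:C%C *: (- imI *: (z - j z)).

Lemma rpart_j z : j (rpart z) = rpart z.
Proof. by rewrite /rpart conj_Zr conj_D jK addrC. Qed.
Lemma ipart_j z : j (ipart z) = ipart z.
Proof.
rewrite /ipart conj_Zr conj_Z conj_B jK; congr (_ *: _).
by rewrite !conjE; hvec.
Qed.
Lemma rpartE z : rpart z + imI *: ipart z = z.
Proof.
have h : (2^-1)%:C%C + (2^-1)%:C%C = 1 :> R[i] := two_half R.
have i2 : imI * imI = - 1 :> R[i] := @imI2 R.
apply: inner_ext => w; rewrite /rpart /ipart !innE.
set c := (2^-1)%:C%C in h *.
have -> : c * (⟪w, z⟫ + ⟪w, j z⟫) + imI * (c * (- imI * (⟪w, z⟫ - ⟪w, j z⟫))) =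
  c * (⟪w, z⟫ + ⟪w, j z⟫) - imI * imI * c * (⟪w, z⟫ - ⟪w, j z⟫) by ring.
by rewrite i2 -[RHS]mul1r -[in RHS]h; ring.
Qed.
Lemma rpart_rlin : rlin rpart.
Proof. by split=> [x y|a x]; rewrite /rpart ?conj_D ?conj_Zr; hvec. Qed.
Lemma ipart_rlin : rlin ipart.
Proof. by split=> [x y|a x]; rewrite /ipart ?conj_D ?conj_Zr; hvec. Qed.
Lemma rpart_real z : j z = z -> rpart z = z.
Proof. by move=> jz; rewrite /rpart jz -{1 2}[z]scale1r -scalerDl scalerA mulrDr !mulr1 two_half scale1r. Qed.
Lemma ipart_real z : j z = z -> ipart z = 0.
Proof. by move=> jz; rewrite /ipart jz subrr !scaler0. Qed.
Lemma rpart_i z : rpart (imI *: z) = - ipart z.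
Proof. by rewrite /rpart /ipart conj_Z conjE; hvec. Qed.
Lemma ipart_i z : ipart (imI *: z) = rpart z.
Proof.
rewrite /rpart /ipart conj_Z conjE; congr (_ *: _).
apply: inner_ext => w; rewrite !innE.
have i2 : imI * imI = - 1 :> R[i] := @imI2 R.
have -> : - imI * (imI * ⟪w, z⟫ - - imI * ⟪w, j z⟫) = - (imI * imI) * (⟪w, z⟫ + ⟪w, j z⟫) by ring.
by rewrite i2 opprK mul1r.
Qed.
Lemma rpart_hn z : hn (rpart z) <= hn z.
Proof.
rewrite /rpart hnZ ncC ger0_norm ?invr_ge0//.
have := hnD z (j z); rewrite conj_hn; lra.
Qed.
Lemma ipart_hn z : hn (ipart z) <= hn z.
Proof. by rewrite -[ipart z]opprK -rpart_i hnN; apply: le_trans (rpart_hn _) _; rewrite hnZ /nc sqc_imI sqrtr1 mul1r. Qed.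
Lemma real_inner x y : j x = x -> j y = y -> ⟪y, x⟫ = ⟪x, y⟫.
Proof. by move=> jx jy; rewrite -jI jx jy. Qed.
Lemma real_inner_rip x y : j x = x -> j y = y -> ⟪x, y⟫ = (rip x y)%:C%C.
Proof.
move=> jx jy; apply: complex_ext; rewrite ?reim//.
by have := real_inner jx jy; rewrite innerC => /(congr1 (@complex.Im R)); rewrite reim; lra.
Qed.
End Conjugation.

Variables (K : set H) (X j : H -> H).
Hypothesis sd : std_data K X j.

Let jl := sdj sd.
Let jK := sdjK sd.
Let jI := sdjI sd.
Let pX := sdX sd.

Lemma sd_bX : bdop X. Proof. by case: pX. Qed.
Lemma sd_sX : adjoint_operators X X. Proof. by case: pX. Qed.
Let lX : linear X := sd_bX.1.

Definition Xbar x := j (X (j x)).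

Lemma sd_lXb : linear Xbar.
Proof. by move=> a x y; rewrite /Xbar jl lX jl conjE. Qed.
Lemma sd_bXb : bdop Xbar.
Proof.
split; first exact: sd_lXb.
have [_ [M M0 hM]] := sd_bX; exists M => // x; rewrite /Xbar (conj_hn jI).
by rewrite -(conj_hn jI x).
Qed.
Lemma sd_sXb : adjoint_operators Xbar Xbar.
Proof. by move=> x y; rewrite /Xbar (conj_sym jK jI) -sd_sX -[in RHS](jK x) jI. Qed.
Lemma sd_pXb : pos Xbar.
Proof.
split; [exact: sd_bXb|exact: sd_sXb|move=> x].
rewrite /rip /Xbar -{1}(jK x) jI innerC reim.
by have [_ _ p] := pX; exact: (p (j x)).
Qed.
Lemma sd_com x : X (Xbar x) = Xbar (X x). Proof. exact: (sdC sd). Qed.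
Lemma sd_sq x : X (X x) + Xbar (Xbar x) = 2%:R *: x.
Proof. by rewrite -(sdX2 sd) /Xbar jK. Qed.
Lemma sd_jX x : j (X x) = Xbar (j x). Proof. by rewrite /Xbar jK. Qed.
Lemma sd_jXb x : j (Xbar x) = X (j x). Proof. by rewrite /Xbar jK. Qed.
Lemma sd_Xbi x : Xbar x = 0 -> x = 0.
Proof.
move=> h; have : X (j x) = 0 by rewrite -sd_jXb h (conj_0 jl).
by move/(sdXi sd) => h2; rewrite -(jK x) h2 (conj_0 jl).
Qed.
Lemma sd_Xinj x y : X x = X y -> x = y.
Proof. by move=> h; apply/eqP; rewrite -subr_eq0; apply/eqP/(sdXi sd); rewrite (linB _ _ lX) h subrr. Qed.

Lemma sd_XK z : j z = z -> K (X z).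
Proof. by move=> jz; apply/(sdK sd); exists z. Qed.

Lemma sd_complexify x : complexify K x <-> exists z, X z = x.
Proof.
split=> [[h [k [/(sdK sd)[a ja <-] /(sdK sd)[b jb <-] ->]]]|[z <-]].
  by exists (a + imI *: b); rewrite (linD _ _ lX) (linZ _ _ lX).
exists (X (rpart j z)), (X (ipart j z)); split.
- by apply: sd_XK; exact: rpart_j.
- by apply: sd_XK; exact: ipart_j.
- by rewrite -(linZ _ _ lX) -(linD _ _ lX) rpartE.
Qed.

(** X carries real vectors onto K, hence the conjugation j to s. *)
Lemma sd_tomita p : tomita K p <-> exists z, p = (X z, X (j z)).
Proof.
case: p => p1 p2; split.
  move=> [h [k [/(sdK sd)[a ja <-] /(sdK sd)[b jb <-] /= -> ->]]].
  exists (a + imI *: b); rewrite (conj_D jl) (conj_Z jl) ja jb conjE.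
  by rewrite (linD _ _ lX) (linZ _ _ lX) (linD _ _ lX) (linZ _ _ lX) scaleNr.
move=> [z [-> ->]]; exists (X (rpart j z)), (X (ipart j z)); split => /=.
- by apply: sd_XK; exact: rpart_j.
- by apply: sd_XK; exact: ipart_j.
- by rewrite -(linZ _ _ lX) -(linD _ _ lX) rpartE.
- rewrite -(linZ _ _ lX) -(linB _ _ lX); congr X.
  rewrite -{1}(rpartE j z) (conj_D jl) (conj_Z jl) rpart_j// ipart_j// conjE.
  by rewrite scaleNr.
Qed.

Lemma sd_tomita_fun z : tomita_fun K (X z) = X (j z).
Proof.
rewrite /tomita_fun; case: xgetP => [y _ /sd_tomita[w [hw ->]]|/(_ (X (j z)))[]].
  by rewrite (sd_Xinj hw).
by apply/sd_tomita; exists z.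
Qed.

(** Since s X z = j Xbar z, the two terms add up to <z, (X^2 + Xbar^2) w>. Up to the factor 2, X
    therefore identifies H with K + iK and its scalar product. *)
Lemma sd_inner_s z w : inner_s K (X z) (X w) = 2%:R * ⟪z, w⟫.
Proof.
rewrite /inner_s !sd_tomita_fun -!sd_jXb jI !sd_sX sd_sXb -innerDr sd_sq.
by rewrite innerZr.
Qed.

(** The graph of delta^(1/2), since Xbar = delta^(1/2) X. *)
Definition sd_half : H -> H -> Prop := fun p1 p2 => exists z, p1 = X z /\ p2 = Xbar z.

Lemma sd_polar : polar_decomposition (tomita K) j [set p | sd_half p.1 p.2].
Proof.
split.
- by split=> // y; exists (j y).
- split.
  + apply/dense_hn => x e e0; have [z hz] := sa_injective_dense sd_bX sd_sX (sdXi sd) x e0.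
    by exists (X z) => //; exists (Xbar z), z.
  + apply/seteqP; split=> [[p q]|[p q]] /=.
      (* A pair in the adjoint satisfies Xbar p = X q; with X^2 + Xbar^2 = 2 this vector is mapped
         to p by X and to q by Xbar. *)
      move=> h; exists ((2^-1)%:C%C *: (X p + Xbar q)).
      have e : Xbar p = X q.
        by apply: inner_ext => w; rewrite -sd_sXb -sd_sX; apply: (h (X w, Xbar w)); exists w.
      rewrite (linZ _ _ lX) (linZ _ _ sd_lXb) (linD _ _ lX) (linD _ _ sd_lXb).
      have -> : X (Xbar q) = Xbar (Xbar p) by rewrite sd_com -e.
      have -> : Xbar (X p) = X (X q) by rewrite -sd_com e.
      by rewrite !sd_sq !scalerA mulrDr !mulr1 two_half !scale1r.
    move=> [z [-> ->]] [u v] /= [w /= [-> ->]].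
    by rewrite sd_sXb sd_sX sd_com.
  + move=> x y /= [z [-> ->]].
    have pc := pos_comp sd_pXb pX (fun x => esym (sd_com x)).
    by rewrite sd_sX sd_com; have := ((posP _).1 pc).2 z.
- apply/seteqP; split=> [p /sd_tomita[z ->]|[p q]] /=.
    by exists (Xbar z); rewrite sd_jXb; split => //; exists z.
  by move=> [y [[z [-> ->]] ->]]; apply/sd_tomita; exists z; rewrite sd_jXb.
Qed.

(** The polar decomposition behind [modular_operator] is arbitrary here: self-adjointness of [d] and
    isometry of the antiunitary factor already force X v = Xbar^2 z for u = X z. *)
Lemma sd_modular_op u v : modular_operator K (u, v) -> u = (2^-1)%:C%C *: X (X (v + u)).
Proof.
move=> [j' [d [[[_ j'I _] [_ dsa _] GE] [y /= [duy dyv]]]]].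
have : tomita K (u, j' y) by rewrite GE; exists y.
move=> /sd_tomita[z [uz yz]].
have h w : ⟪w, X v⟫ = ⟪w, Xbar (Xbar z)⟫.
  have : tomita K (X w, X (j w)) by apply/sd_tomita; exists w.
  rewrite GE => -[y' /= [dw yw]].
  have : graph_adjoint d (y, v) by rewrite dsa.
  move=> /(_ _ dw) /= h; rewrite -sd_sX -h -j'I -yw yz.
  by rewrite -!sd_jXb jI sd_sXb.
have {h} : X v = Xbar (Xbar z) by exact: inner_ext.
move=> h; have : X (v + u) = 2%:R *: z by rewrite (linD _ _ lX) h uz addrC sd_sq.
move=> ->; rewrite (linZ _ _ lX) -uz scalerA mulrDr !mulr1 two_half scale1r.
by [].
Qed.

(** With X^2 = 2 / (1 + delta), the quotient (delta - 1) / (delta + 1) is 1 - X^2. *)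
Lemma sd_modular_R x : modular_R K x = imI *: (x - X (X x)).
Proof.
have half w : (2^-1)%:C%C *: w + (2^-1)%:C%C *: w = w by rewrite -scalerDl two_half scale1r.
have vu v u : v + u = x -> u = (2^-1)%:C%C *: X (X x) -> v - u = x - X (X x).
  by move=> <- hu; rewrite -(half (X (X _))) -hu; hvec.
rewrite /modular_R; case: xgetP => [z _ [u [v [/sd_modular_op h hx ->]]]|/(_ (imI *: (x - X (X x))))[]].
  by rewrite (vu v u)// hx.
pose u := (2^-1)%:C%C *: X (X x); exists u, (x - u); rewrite subrK; split => //; last first.
  by rewrite (vu (x - u) u)// subrK.
exists j, [set p | sd_half p.1 p.2]; split; first exact: sd_polar.
exists ((2^-1)%:C%C *: Xbar (X x)); split => /=.
  exists ((2^-1)%:C%C *: X x); by rewrite (linZ _ _ lX) (linZ _ _ sd_lXb).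
exists ((2^-1)%:C%C *: Xbar x); rewrite (linZ _ _ lX) (linZ _ _ sd_lXb) sd_com; split => //.
apply: (addrI u); rewrite addrC subrK /u -scalerDr sd_sq.
by rewrite scalerA mulrDr !mulr1 two_half scale1r.
Qed.

Lemma sd_iR z : X z + imI *: modular_R K (X z) = X (X (X z)).
Proof.
rewrite sd_modular_R scalerA imI2 scaleN1r; hvec.
Qed.

(** For real z the numbers |X z| and |Xbar z| agree, and their squares add up to 2 |z|^2. Thus X is
    a real isometry of the real vectors onto K. *)
Lemma sd_n2 z : j z = z -> n2 (X z) = n2 z.
Proof.
move=> jz; have h : n2 (Xbar z) = n2 (X z).
  by rewrite /n2 /Xbar jz jI.
have : rip z (X (X z)) + rip z (Xbar (Xbar z)) = 2 * n2 z.
  by rewrite -ripDr sd_sq -(rmorph_nat (@real_complex R)) ripZr.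
have -> : rip z (X (X z)) = n2 (X z) by rewrite /rip -sd_sX.
have -> : rip z (Xbar (Xbar z)) = n2 (Xbar z) by rewrite /rip -sd_sXb.
rewrite h; lra.
Qed.

Lemma sd_rip z w : j z = z -> j w = w -> rip (X z) (X w) = rip z w.
Proof.
move=> jz jw.
have := sd_n2 (_ : j (z + w) = z + w); rewrite (conj_D jl) jz jw => /(_ erefl).
rewrite (linD _ _ lX) !n2D !sd_n2//; lra.
Qed.

End StandardData.

(** * Coherent vectors and Weyl operators *)

Section ComplexSeries.
Variable R : realType.
Implicit Types (a b : nat -> R[i]).

Definition ccvg (u : nat -> R[i]) (l : R[i]) :=
  forall e : R, 0 < e -> exists N, forall n, (N <= n)%N -> nc (u n - l) < e.

Definition psum a (w : R[i]) N := \sum_(n < N) w ^+ n * a n.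

Lemma ccvgB u v l m : ccvg u l -> ccvg v m -> ccvg (fun n => u n - v n) (l - m).
Proof.
move=> hu hv e e0; have e2 : 0 < e / 2 by rewrite divr_gt0.
have [N hN] := hu _ e2; have [M hM] := hv _ e2.
exists (maxn N M) => n; rewrite geq_max => /andP[/hN h1 /hM h2].
have -> : u n - v n - (l - m) = (u n - l) - (v n - m) by ring.
by apply: le_lt_trans (ncD _ _) _; rewrite ncN; lra.
Qed.

Lemma ccvg_unique u l m : ccvg u l -> ccvg u m -> l = m.
Proof.
move=> hl hm; apply/eqP; rewrite -subr_eq0 -nc_eq0 eq_le nc_ge0 andbT.
apply/ler_addgt0Pr => e e0; rewrite add0r.
have e2 : 0 < e / 2 by rewrite divr_gt0.
have [N hN] := hl _ e2; have [M hM] := hm _ e2.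
have := hN _ (leq_maxl N M); have := hM _ (leq_maxr N M); set k := maxn _ _.
have -> : l - m = (u k - m) - (u k - l) by ring.
by move=> h1 h2; apply: le_trans (ncD _ _) _; rewrite ncN; lra.
Qed.

Lemma ccvg_eq u v l : u =1 v -> ccvg u l -> ccvg v l.
Proof. by move=> /funext ->. Qed.

Lemma geom_le (t : R) n m : 0 <= t -> t <= 2^-1 -> \sum_(n <= k < m) t ^+ k <= 2 * t ^+ n.
Proof.
move=> t0 t2; elim: m => [|m ih].
  by rewrite big_geq// mulr_ge0 ?exprn_ge0.
suff h : \sum_(n <= k < m.+1) t ^+ k <= 2 * t ^+ n - 2 * t ^+ m.+1 \/ (m.+1 <= n)%N.
  case: h => h; last by rewrite big_geq// mulr_ge0 ?exprn_ge0.
  by apply: le_trans h _; rewrite lerBlDr lerDl mulr_ge0 ?exprn_ge0.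
elim: m {ih} => [|m ih].
  case: n => [|n]; last by right.
  left; rewrite big_nat1 expr0 expr1; lra.
case: ih => [h|h].
  have [nm|nm] := leqP n m.+1; last by right.
  left; rewrite big_nat_recr//=; apply: le_trans (lerD h (lexx _)) _.
  rewrite (exprS t m.+1); have := exprn_ge0 m.+1 t0; nra.
have [nm|nm] := leqP n m.+1; last by right.
left; have -> : n = m.+1 by apply/eqP; rewrite eqn_leq nm.
rewrite big_nat1 (exprS t m.+1); have := exprn_ge0 m.+1 t0; nra.
Qed.

(** When the lower coefficients vanish, t^n a_n equals minus the tail, which is at most 2 B t^(n+1);
    divide by t^n and let t tend to 0. *)
Lemma power_series_zero a (B : R) : (forall n, nc (a n) <= B) ->
  (forall t : R, 0 < t -> t <= 1 -> ccvg (psum a t%:C%C) 0) -> forall n, a n = 0.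
Proof.
move=> aB h n; elim/ltn_ind: n => n ih.
have B0 : 0 <= B := le_trans (nc_ge0 _) (aB 0%N).
apply/eqP; rewrite -nc_eq0 eq_le nc_ge0 andbT; apply/ler_addgt0Pr => e e0; rewrite add0r.
(* The bound 1/2 sums the geometric tail; the other bound gives 2 B t <= e / 2. *)
pose t := Num.min 2^-1 (e / (4 * B + 4)).
have B4 : 0 < 4 * B + 4 by lra.
have t0 : 0 < t by rewrite lt_min invr_gt0 ltr0n/= divr_gt0.
have t2 : t <= 2^-1 by rewrite ge_min lexx.
have te : t * (4 * B + 4) <= e by rewrite -ler_pdivlMr// ge_min lexx orbT.
have tn : 0 < t ^+ n by rewrite exprn_gt0.
have t1 : t <= 1 by lra.
have [N hN] := h t t0 t1 (t ^+ n * (e / 4)) (mulr_gt0 tn (divr_gt0 e0 (ltr0n _ 4))).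
set M := maxn N n.+1; have := hN M (leq_maxl _ _); rewrite subr0.
have nM : (n < M)%N := leq_maxr _ _.
have -> : psum a t%:C%C M = (t ^+ n)%:C%C * a n + \sum_(n.+1 <= k < M) t%:C%C ^+ k * a k.
  rewrite /psum -(big_mkord xpredT (fun k => t%:C%C ^+ k * a k)) (big_cat_nat (n := n))//=; last exact: ltnW.
  rewrite big_nat_cond big1 ?add0r; last by move=> k /andP[/andP[_ kn] _]; rewrite ih// mulr0.
  by rewrite big_ltn// rmorphXn.
set S := \sum_(_ <= _ < _) _ => h1.
have hS : nc S <= B * (2 * t ^+ n.+1).
  apply: le_trans (nc_sum _ _ _) _; apply: le_trans (_ : \sum_(n.+1 <= k < M) B * t ^+ k <= _).
    apply: ler_sum => k _; rewrite ncM ncX ncC gtr0_norm// mulrC.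
    by rewrite ler_wpM2r// exprn_ge0// ltW.
  by rewrite -mulr_sumr ler_wpM2l// geom_le// ltW.
have h2 : t ^+ n * nc (a n) <= t ^+ n * (e / 4) + B * (2 * t ^+ n.+1).
  have -> : t ^+ n * nc (a n) = nc ((t ^+ n)%:C%C * a n + S - S).
    by rewrite addrK ncM ncC gtr0_norm.
  by apply: le_trans (ncD _ _) _; rewrite ncN; apply: lerD => //; exact: ltW.
have : t ^+ n * nc (a n) <= t ^+ n * (e / 4 + B * (2 * t)).
  by apply: le_trans h2 _; rewrite exprS; lra.
rewrite ler_pM2l// => h3; apply: le_trans h3 _; nra.
Qed.

Lemma expIRX (r : R) n : expIR r ^+ n = expIR (n%:R * r) :> R[i].
Proof.
elim: n => [|n ih]; first by rewrite expr0 mul0r expIR0.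
by rewrite exprS ih -expIRD -natr1; congr expIR; ring.
Qed.

(** A function that is holomorphic and antiholomorphic is constant. Comparing coefficients along the
    ray through z, |z| = 1, gives (- z)^k a_k = (conj z)^k b_k; the rays z = 1 and z = exp (i pi /
    (2 k)), where z^(2 k) = -1, give a_k = - a_k. *)
Lemma holomorphic_antiholomorphic a b (A B : R) (f : R[i] -> R[i]) :
  (forall n, nc (a n) <= A) -> (forall n, nc (b n) <= B) ->
  (forall u, nc u <= 1 -> ccvg (psum a (- u)) (f u)) ->
  (forall u, nc u <= 1 -> ccvg (psum b (u^*)%C) (f u)) ->
  forall n, a n.+1 = 0.
Proof.
move=> ha hb fa fb n.
have key (z : R[i]) k : nc z = 1 -> (- z) ^+ k * a k = ((z^*)%C) ^+ k * b k.
  move=> z1; apply/eqP; rewrite -subr_eq0; apply/eqP.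
  apply: (@power_series_zero (fun k => (- z) ^+ k * a k - ((z^*)%C) ^+ k * b k) (A + B)).
    move=> i; apply: le_trans (ncD _ _) _; rewrite ncN !ncM !ncX ncN ncJ z1 expr1n !mul1r.
    exact: lerD.
  move=> t t0 t1.
  have tz : nc (t%:C%C * z) <= 1 by rewrite ncM z1 mulr1 ncC gtr0_norm.
  rewrite -(subrr (f (t%:C%C * z))); apply: ccvg_eq (ccvgB (fa _ tz) (fb _ tz)) => N.
  rewrite /psum -sumrB; apply: eq_bigr => i _.
  rewrite JM JC -mulrN !exprMn; ring.
have h1 := key 1 n.+1 (nc1 R).
pose r : R := pi / (2 * n.+1%:R).
have h2 := key (expIR r) n.+1 (nc_expIR r).
have e1 : expIR r ^+ n.+1 * expIR r ^+ n.+1 = -1 :> R[i].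
  rewrite !expIRX -expIRD -mulrDl -natrD /r.
  have -> : (n.+1 + n.+1)%:R * (pi / (2 * n.+1%:R)) = pi :> R.
    by rewrite addnn -mul2n natrM mulrC divfK// mulf_neq0// pnatr_eq0.
  by apply: complex_ext; rewrite /expIR /= ?cospi ?sinpi ?oppr0.
have e2 : expIR r ^+ n.+1 * ((expIR r)^*%C) ^+ n.+1 = 1 :> R[i].
  by rewrite -exprMn -expIRN expIRK expr1n.
have : expIR r ^+ n.+1 * ((- expIR r) ^+ n.+1 * a n.+1) = (-1) ^+ n.+1 * a n.+1.
  by rewrite h2 mulrA e2 mul1r h1 rmorph1 expr1n mul1r.
rewrite -[- expIR r]mulN1r exprMn.
have -> : expIR r ^+ n.+1 * ((-1) ^+ n.+1 * expIR r ^+ n.+1 * a n.+1) =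
  (expIR r ^+ n.+1 * expIR r ^+ n.+1) * ((-1) ^+ n.+1 * a n.+1) by ring.
rewrite e1 mulN1r => /eqP; rewrite eq_sym -addr_eq0 -mulr2n -mulr_natl mulf_eq0 pnatr_eq0/=.
by rewrite mulf_eq0 signr_eq0/= => /eqP.
Qed.

Definition cexp (z : R[i]) : R[i] := (expR (Re z))%:C%C * expIR (Im z).

Lemma cexpD z w : cexp (z + w) = cexp z * cexp w.
Proof. by rewrite /cexp !reim expRD expIRD rmorphM/=; ring. Qed.
Lemma cexp0 : cexp 0 = 1.
Proof. by rewrite /cexp /= expR0 expIR0 mulr1. Qed.
Lemma cexpJ z : cexp (z^*)%C = ((cexp z)^*)%C.
Proof. by rewrite /cexp !reim expIRN JM JC. Qed.
Lemma cexpC (r : R) : cexp r%:C%C = (expR r)%:C%C.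
Proof. by rewrite /cexp /= expIR0 mulr1. Qed.
Lemma cexp_neq0 z : cexp z != 0.
Proof.
apply/eqP => h; have := cexpD z (- z); rewrite subrr cexp0 h mul0r => /eqP.
by rewrite oner_eq0.
Qed.
Lemma cexpK z : cexp z * cexp (- z) = 1.
Proof. by rewrite -cexpD subrr cexp0. Qed.
End ComplexSeries.

(** * Polarization of symmetric tensors *)

Section SymmetricTensors.
Variables (R : realType) (H : hilbertType R).

(** If S misses an index i, toggling i is a sign-reversing involution on the supersets of S, so the
    sum is its own negative. *)
Lemma sum_supersets (C : comUnitRingType) (I : finType) (S : {set I}) :
  (2%:R : C) \is a GRing.unit ->
  \sum_(e : {set I} | S \subset e) (-1) ^+ (#|I| + #|e|)%N = (S == (@finset.setTfor I))%:R :> C.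
Proof.
move=> u2; case: (eqVneq S (@finset.setTfor I)) => [->|ST].
  rewrite (big_pred1 (@finset.setTfor I)) => [|e]; last by rewrite finset.subTset.
  by rewrite cardsT addnn -mul2n exprM sqrrN expr1n expr1n.
have [i iS] : exists i, i \notin S.
  by apply/existsP; apply: contraNT ST; rewrite negb_exists => /forallP h;
    apply/eqP/finset.setP => i; have := h i; rewrite negbK inE.
pose f (e : {set I}) := if i \in e then e :\ i else i |: e.
have fK : involutive f.
  move=> e; rewrite /f; case: (boolP (i \in e)) => ie; first by rewrite !inE eqxx/= finset.setD1K.
  by rewrite !inE eqxx/= finset.setU1K.
set T := LHS; have h : T = - T.
  rewrite {1}/T (reindex_inj (inv_inj fK)) /= /T -sumrN.
  apply: eq_big => [e|e Se].
    rewrite /f; case: ifP => ie.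
      by rewrite finset.subsetD1 iS andbT.
    apply/idP/idP => [/fintype.subsetP h|h]; last exact: fintype.subset_trans h (finset.subsetUr _ _).
    apply/fintype.subsetP => k kS; have := h k kS; rewrite !inE => /orP[/eqP ki|//].
    by rewrite -ki kS in iS.
  rewrite /f; case: ifP => ie.
    rewrite [in RHS](cardsD1 i e) ie /= addnCA add1n exprS; ring.
  by rewrite cardsU1 ie /= addnCA add1n exprS; ring.
have : 2%:R * T = 0 by rewrite mulr_natl mulr2n {1}h addNr.
by move/(congr1 ( *%R 2%:R^-1)); rewrite mulKr// mulr0.
Qed.

(** The Ryser formula for permanents. Expanded over functions f, the coefficient of a product is the
    alternating sum over the sets that contain the range of f, which singles out the
    permutations. *)
Lemma ryser (C : comUnitRingType) n (a : 'I_n -> 'I_n -> C) : (2%:R : C) \is a GRing.unit ->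
  \sum_(s : 'S_n) \prod_k a k (s k) =
  \sum_(e : {set 'I_n}) (-1) ^+ (n + #|e|)%N * \prod_k \sum_(i in e) a k i.
Proof.
move=> u2.
under [RHS]eq_bigr => e _.
  rewrite (bigA_distr_big (fun i => i \in e)) big_distrr/= big_mkcond/=; over.
rewrite exchange_big/= -[LHS]addr0.
rewrite (bigID (fun f : {ffun 'I_n -> 'I_n} => injectiveb f)) /=; congr (_ + _).
  rewrite (reindex (fun s : 'S_n => pval s)) /=; last first.
    pose in_Sn := insubd (1%g : 'S_n).
    by exists in_Sn => /= f Uf; first apply: val_inj; apply: insubdK.
  apply: eq_big => /= [s|s _]; first by rewrite (valP s).
  rewrite (bigD1 (@finset.setTfor 'I_n))//= [X in _ = _ + X]big1 ?addr0.
    rewrite ifT; last by apply/ffun_onP => i; rewrite inE.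
    rewrite cardsT card_ord addnn -mul2n exprM sqrrN !expr1n mul1r.
    by apply: eq_bigr => i _; rewrite -pvalE.
  move=> e eT; rewrite ifF//; apply/negbTE; apply: contra eT => /ffun_onP h.
  apply/eqP/finset.setP => i; rewrite inE.
  by have := h ((s^-1)%g i); rewrite pvalE permKV.
symmetry; apply: big1 => f nf.
rewrite -big_mkcond/= -mulr_suml.
have -> : \sum_(e : {set 'I_n} | f \in ffun_on (fun i => i \in e)) (-1) ^+ (n + #|e|)%N = 0 :> C.
  rewrite -[RHS](_ : (((f @: 'I_n) == (@finset.setTfor 'I_n))%:R : C) = 0).
    rewrite -sum_supersets// card_ord; apply: eq_bigl => e.
    apply/ffun_onP/fintype.subsetP => [h _ /finset.imsetP[i _ ->]|h i]; first exact: h.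
    by apply: h; apply: imset_f.
  case: eqP => // h; case/negP: nf; apply/injectiveP => x y.
  have /finset.imset_injP inj : #|f @: 'I_n| == #|'I_n| by rewrite h cardsT.
  exact: inj.
by rewrite mul0r.
Qed.

Variables (n : nat) (T : tensor_power H n).

Lemma unit2 : (2%:R : R[i]) \is a GRing.unit.
Proof. by rewrite unitfE pnatr_eq0. Qed.

Lemma tensor_ext (s t : T) : (forall x, inner (tensor T x) s = inner (tensor T x) t) -> s = t.
Proof.
move=> h; apply/eqP; rewrite -subr_eq0; apply/eqP.
apply: (@approx_ortho_eq0 _ _ (Cspan (range (tensor T)))).
  exact: (dense_hn _).1 (@tensor_total _ _ _ T) _.
move=> _ [m [a [u [hu ->]]]]; rewrite inner_suml big1// => i _.
have [x _ <-] := hu i; by rewrite innerZl innerBr h subrr mulr0.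
Qed.

(** Paired with an elementary tensor z, this is the permanent of the matrix <z_k, x_i>, to which
    [ryser] applies. *)
Lemma tensor_polarization (x : 'I_n -> H) :
  \sum_(s : 'S_n) tensor T (x \o s) =
  \sum_(e : {set 'I_n}) (-1) ^+ (n + #|e|)%N *: tensor T (fun=> \sum_(i in e) x i).
Proof.
apply: tensor_ext => z; rewrite !inner_sumr.
have := @ryser _ n (fun k i => ⟪z k, x i⟫) unit2.
set L := LHS => hL; transitivity L.
  by apply: eq_bigr => s _; rewrite tensor_inner.
rewrite hL; apply: eq_bigr => e _; rewrite innerZr tensor_inner; congr (_ * _).
by apply: eq_bigr => k _; rewrite inner_sumr.
Qed.

Lemma symmetric_const x : symmetric_tensor (tensor T (fun=> x)).
Proof.
move=> s y; rewrite !tensor_inner.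
by rewrite [RHS](reindex_inj (@perm_inj _ s)).
Qed.

Lemma symmetricZD (a : R[i]) (s t : T) : symmetric_tensor s -> symmetric_tensor t ->
  symmetric_tensor (a *: s + t).
Proof. by move=> hs_ ht p x; rewrite !innE hs_ ht. Qed.

Lemma symmetric0 : symmetric_tensor (0 : T).
Proof. by move=> p x; rewrite !inner0r. Qed.

(** By polarization s is orthogonal to every symmetrized elementary tensor; by symmetry of s these
    pairings are n! times the plain ones. *)
Lemma symmetric_eq0 (s : T) : symmetric_tensor s ->
  (forall x, ⟪s, tensor T (fun=> x)⟫ = 0) -> s = 0.
Proof.
move=> sy h; apply: tensor_ext => x; rewrite inner0r.
have : ⟪s, \sum_(p : 'S_n) tensor T (x \o p)⟫ = 0.
  by rewrite tensor_polarization inner_sumr big1// => e _; rewrite innerZr h mulr0.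
rewrite inner_sumr (eq_bigr (fun=> ⟪s, tensor T x⟫)); last first.
  by move=> p _; rewrite innerC sy -innerC.
rewrite sumr_const -mulr_natl => /eqP; rewrite mulf_eq0 pnatr_eq0 => /orP[/eqP/card0_eq/(_ 1%g)//|/eqP h0].
by rewrite innerC h0 J0.
Qed.

End SymmetricTensors.

(** * Coherent vectors and their totality *)

Section Coherent.
Variables (R : realType) (H : hilbertType R) (F : fock_space H).
Implicit Types (x y z : H) (u v w : F).

Definition cn n x : F := (Num.sqrt (n`!%:R : R))^-1%:C%C *:
  fock_in (tensor (fock_tensor F n) (fun=> x)).

Lemma fact_gt0R n : 0 < n`!%:R :> R. Proof. by rewrite ltr0n fact_gt0. Qed.

Lemma inner_cn n x y : ⟪cn n x, cn n y⟫ = (n`!%:R^-1)%:C%C * ⟪x, y⟫ ^+ n.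
Proof.
rewrite /cn innerZl innerZr JC fock_in_inner; try exact: symmetric_const.
rewrite tensor_inner prodr_const card_ord mulrA -rmorphM/= -invfM -expr2 sqr_sqrtr//.
Qed.

Lemma inner_cn_neq n m x y : n != m -> ⟪cn n x, cn m y⟫ = 0.
Proof.
move=> nm; rewrite /cn innerZl innerZr fock_in_orthogonal ?mulr0//; exact: symmetric_const.
Qed.

Lemma n2_cn n x : n2 (cn n x) = n2 x ^+ n / n`!%:R.
Proof. by rewrite /n2 inner_cn inner_n2 -rmorphXn -rmorphM/= mulrC. Qed.

Lemma cn_scale n (a : R[i]) x : cn n (a *: x) = a ^+ n *: cn n x.
Proof.
apply/eqP; rewrite -subr_eq0 -n2_eq0; apply/eqP.
suff : ⟪cn n (a *: x) - a ^+ n *: cn n x, cn n (a *: x) - a ^+ n *: cn n x⟫ = 0.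
  by rewrite /n2 => ->.
have := (inner_cn n (a *: x) (a *: x), inner_cn n (a *: x) x, inner_cn n x (a *: x), inner_cn n x x).
move: (cn n (a *: x)) (cn n x) => u v [[[h1 h2] h3] h4].
rewrite !innE h1 h2 h3 h4 !innE !exprMn rmorphXn; ring.
Qed.

Lemma cn0 n : cn n.+1 0 = 0.
Proof. by rewrite -(scale0r 0) cn_scale expr0n scale0r. Qed.

Lemma cn_0 x y : cn 0 x = cn 0 y.
Proof.
have h z : cn 0 z = cn 0 0 by have := cn_scale 0 0 z; rewrite expr0 scale1r scale0r.
by rewrite h (h y).
Qed.

Lemma exp_cauchy (r e : R) : 0 <= r -> 0 < e -> exists N, forall n m, (N <= n)%N -> (n <= m)%N ->
  \sum_(n <= k < m) r ^+ k / k`!%:R < e.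
Proof.
move=> r0 e0; have /cvg_ex[l hl] := is_cvg_series_exp_coeff r.
have [N hN] := (rcvgP _ _).1 hl (e / 2) (divr_gt0 e0 (ltr0n _ 2)).
exists N => n m Nn nm.
have -> : \sum_(n <= k < m) r ^+ k / k`!%:R = series (exp_coeff r) m - series (exp_coeff r) n.
  by rewrite sub_series_geq.
have h1 := hN n Nn; have h2 := hN m (leq_trans Nn nm).
have -> : series (exp_coeff r) m - series (exp_coeff r) n =
  (series (exp_coeff r) m - l) - (series (exp_coeff r) n - l) by ring.
apply: le_lt_trans (ler_norm _) _; apply: le_lt_trans (ler_normB _ _) _.
by lra.
Qed.

Lemma n2_sum_cn x n m : n2 (\sum_(n <= k < m) cn k x) = \sum_(n <= k < m) n2 x ^+ k / k`!%:R.
Proof.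
elim: m => [|m ih]; first by rewrite !big_geq// n2_0.
have [nm|mn] := leqP n m; last by rewrite !big_geq// n2_0.
rewrite !big_nat_recr//= n2D ih n2_cn.
rewrite (_ : rip _ _ = 0) ?mulr0 ?addr0// ripC rip_sumr big_nat_cond big1// => k /andP[/andP[_ km] _].
by rewrite /rip inner_cn_neq// neq_ltn km orbT.
Qed.

Lemma coherent_cvg x : (fun n => \sum_(k < n) cn k x) @ \oo --> coherent F x.
Proof.
have [|l hl] := @hcomplete R F (series (fun n => cn n x)).
  move=> e e0; have [N hN] := exp_cauchy (n2_ge0 x) (exprn_gt0 2 e0).
  have main n m : (N <= n)%N -> (n <= m)%N -> hn (series (cn^~ x) m - series (cn^~ x) n) < e.
    move=> Nn nm; rewrite sub_series_geq//.
    rewrite -(@ltr_pXn2r _ 2)// ?nnegrE ?hn_ge0 ?ltW// hn2 n2_sum_cn; exact: hN.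
  exists N => n m Nn Nm; have [nm|/ltnW mn] := leqP n m; last exact: main.
  by rewrite hnBC main.
have -> : coherent F x = l by apply: (cvg_lim _ hl); exact: norm_hausdorff.
rewrite (_ : (fun n => _) = series (cn^~ x)) //.
by apply/funext => n; rewrite /series/= big_mkord.
Qed.

Lemma inner_cn_coherent n x y : ⟪cn n x, coherent F y⟫ = ⟪cn n x, cn n y⟫.
Proof.
have h := @coherent_cvg y; have {}h : (fun k => \sum_(i < k + n.+1) cn i y) @ \oo --> coherent F y.
  by move: h; rewrite -(cvg_shiftn n.+1).
apply: (hcvg_inner_eq h) => k; rewrite inner_sumr.
have nk : (n < k + n.+1)%N by rewrite addnS ltnS leq_addl.
rewrite (bigD1 (Ordinal nk))//= big1 ?addr0// => i ni.
by apply: inner_cn_neq; apply: contra ni => /eqP e; apply/eqP/val_inj.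
Qed.

Lemma hn_cn n x : hn (cn n x) <= hn (coherent F x).
Proof.
have [->|c0] := eqVneq (hn (cn n x)) 0; first exact: hn_ge0.
have c1 : 0 < hn (cn n x) by rewrite lt_neqAle hn_ge0 eq_sym c0.
rewrite -(ler_pM2l c1) -expr2 hn2; apply: le_trans (rip_le _ _).
by rewrite /rip inner_cn_coherent ler_norm.
Qed.

Definition vac : F := coherent F 0.

Lemma vacE x : cn 0 x = vac.
Proof.
apply/esym; apply: (@hcvg_unique _ _ (fun n => \sum_(k < n.+1) cn k 0)).
  by have := @coherent_cvg 0; rewrite -(cvg_shiftS (fun n => \sum_(k < n) cn k 0)).
rewrite (_ : (fun n => _) = cst (cn 0 x)); first exact: cvg_cst.
apply/funext => n; rewrite big_ord_recl/= big1 ?addr0; first exact: cn_0.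
by move=> i _; rewrite /bump /= add1n cn0.
Qed.

Lemma n2_vac : n2 vac = 1.
Proof. by rewrite -(vacE 0) n2_cn expr0 fact0 divr1. Qed.

Lemma hn_vac : hn vac = 1. Proof. by rewrite /hn n2_vac sqrtr1. Qed.

Lemma inner_coherent_ccvg v x (w : R[i]) :
  ccvg (psum (fun n => ⟪v, cn n x⟫) w) ⟪v, coherent F (w *: x)⟫.
Proof.
move=> e e0; have p0 : 0 < hn v + 1 by rewrite ltr_wpDl ?hn_ge0.
have [N hN] := (hcvgP _ _).1 (@coherent_cvg (w *: x)) _ (divr_gt0 e0 p0).
exists N => n /hN; rewrite ltr_pdivlMr// => h.
have -> : psum (fun n => ⟪v, cn n x⟫) w n = ⟪v, \sum_(k < n) cn k (w *: x)⟫.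
  by rewrite inner_sumr; apply: eq_bigr => k _; rewrite cn_scale innerZr.
rewrite -innerBr; apply: le_lt_trans (nc_inner _ _) (le_lt_trans _ h).
by rewrite mulrC ler_wpM2l ?hn_ge0// lerDl.
Qed.

Lemma coherent_ortho_cn v x : (forall t : R, ⟪v, coherent F (t%:C%C *: x)⟫ = 0) ->
  forall n, ⟪v, cn n x⟫ = 0.
Proof.
move=> h; apply: (@power_series_zero _ _ (hn v * hn (coherent F x))).
  by move=> n; apply: le_trans (nc_inner _ _) _; rewrite ler_wpM2l ?hn_ge0 ?hn_cn.
by move=> t _ _; rewrite -(h t); exact: inner_coherent_ccvg.
Qed.

(** Scaling x separates the n-particle components by [power_series_zero]. On each n-particle space v
    acts as a functional on symmetric tensors; its representing vector is orthogonal to all powers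
    of vectors, hence 0. *)
Lemma coherent_total v : (forall x, ⟪v, coherent F x⟫ = 0) -> v = 0.
Proof.
move=> h.
have hc n x : ⟪v, fock_in (tensor (fock_tensor F n) (fun=> x))⟫ = 0.
  have := coherent_ortho_cn (fun t => h (t%:C%C *: x)) n.
  rewrite /cn innerZr => /eqP; rewrite mulf_eq0 => /orP[|/eqP//].
  rewrite -(rmorph0 (@real_complex R)) (inj_eq (@complexI _)) invr_eq0 sqrtr_eq0.
  by rewrite leNgt fact_gt0R.
apply: (@approx_ortho_eq0 _ _ (Cspan [set u | exists n (t : fock_tensor F n),
    symmetric_tensor t /\ u = fock_in t])); first exact: (dense_hn _).1 (@fock_total _ _ F) _.
move=> _ [m [a [u [hu ->]]]]; rewrite inner_suml big1// => i _.
have [n [t [st ->]]] := hu i; rewrite innerZl (_ : ⟪_, _⟫ = 0) ?mulr0// innerC.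
have lin0' : fock_in (0 : fock_tensor F n) = 0.
  have := @fock_in_linear _ _ F n 1 0 0 (@symmetric0 _ _ _ _) (@symmetric0 _ _ _ _).
  rewrite !scale1r addr0 => /eqP; rewrite -subr_eq0 opprD addrA subrr sub0r oppr_eq0.
  by move/eqP.
have [||||s [sG sc]] := @riesz_graphC R (fock_tensor F n)
  [set p | symmetric_tensor p.1 /\ p.2 = ⟪v, fock_in p.1⟫] (n2 v).
- by split; [exact: symmetric0|rewrite /= lin0' inner0r].
- move=> b [p1 p2] [q1 q2] /= [sp ->] [sq ->]; split; first exact: symmetricZD.
  by rewrite fock_in_linear// innerDr innerZr.
- exact: n2_ge0.
- move=> [p1 p2] /= [sp ->]; apply: le_trans (inner_CS _ _) _.
  by rewrite [X in _ * X <= _](_ : _ = n2 p1)// /n2 (fock_in_inner sp sp).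
(* Riesz yields a vector of the closure of the symmetric tensors; symmetry passes to the limit. *)
have ss : symmetric_tensor s.
  move=> p x; apply/eqP; rewrite -subr_eq0 -innerBl -nc_eq0 eq_le nc_ge0 andbT.
  apply/ler_addgt0Pr => e e0; rewrite add0r.
  set d := _ - _; have p0 : 0 < hn d + 1 by rewrite ltr_wpDl ?hn_ge0.
  have [[q1 q2] /= [sq _]] := sc _ (divr_gt0 e0 p0); rewrite ltr_pdivlMr// => hq.
  have -> : ⟪d, s⟫ = ⟪d, s - q1⟫.
    by rewrite innerBr (_ : ⟪d, q1⟫ = 0) ?subr0// /d innerBl sq subrr.
  apply: le_trans (nc_inner _ _) _; apply: le_trans (ltW hq); rewrite mulrC.
  by rewrite ler_wpM2l ?hn_ge0// lerDl.
have s0 : s = 0.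
  apply: symmetric_eq0 => // x; rewrite (sG (_, ⟪v, fock_in (tensor (fock_tensor F n) (fun=> x))⟫)) ?hc//.
  by split => /=; first exact: symmetric_const.
by have := sG (t, ⟪v, fock_in t⟫) (conj st erefl); rewrite /= s0 inner0l => <-; rewrite J0.
Qed.

End Coherent.

(** * Weyl operators on coherent vectors *)

Section Weyl.
Variables (R : realType) (H : hilbertType R) (F : fock_space H) (W : H -> F -> F).
Hypothesis hW : weyl_operators W.
Implicit Types (x y z : H) (u v w : F).

Local Notation coh := (coherent F).
Local Notation vac := (vac F).

Lemma weyl_lin x : linear (W x).
Proof. by have [h _ _] := hW; have [] := h x. Qed.
Lemma weyl_iso x u v : ⟪W x u, W x v⟫ = ⟪u, v⟫.
Proof. by have [h _ _] := hW; have [] := h x. Qed.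
Lemma weyl_hn x u : hn (W x u) = hn u.
Proof. by rewrite /hn /n2 weyl_iso. Qed.
Lemma weyl_mul x y v : W x (W y v) = expIR (- (Im ⟪x, y⟫ / 2)) *: W (x + y) v.
Proof. by have [_ _ h] := hW; exact: h. Qed.
Lemma weyl_bdop x : bdop (W x).
Proof. by split; [exact: weyl_lin|exists 1 => // v; rewrite mul1r weyl_hn]. Qed.
Lemma weyl0 v : W 0 v = v.
Proof.
have h := weyl_mul 0 0 v; rewrite inner0r mul0r oppr0 expIR0 scale1r addr0 in h.
apply/eqP; rewrite -subr_eq0 -hn_eq0 -(weyl_hn 0) (linB _ _ (weyl_lin 0)) h subrr.
by rewrite hn0.
Qed.
Lemma weylN x v : W (- x) (W x v) = v.
Proof.
by rewrite weyl_mul innerNl inner_n2 !reim oppr0 mul0r oppr0 expIR0 scale1r addNr weyl0.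
Qed.
Lemma weylK x v : W x (W (- x) v) = v.
Proof. by rewrite -{1}(opprK x) weylN. Qed.
Lemma weyl_adj x u v : ⟪W x u, v⟫ = ⟪u, W (- x) v⟫.
Proof. by rewrite -{1}(weylK x v) weyl_iso. Qed.
Lemma weyl_vac x : W x vac = (expR (- (n2 x / 4)))%:C%C *: coh ((imI * (Num.sqrt 2)^-1%:C%C) *: x).
Proof.
by have [_ h _] := hW; rewrite /vac h hn_normE ReC hn2.
Qed.

(** The inverse of z |-> i z / sqrt 2: up to a scalar, W (kap x) sends the vacuum to the coherent
    vector of x. *)
Definition kap x : H := (- imI * (Num.sqrt 2)%:C%C) *: x.
Definition iskap x : H := (imI * (Num.sqrt 2)^-1%:C%C) *: x.

Lemma sqrt2_neq0 : Num.sqrt 2 != 0 :> R.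
Proof. by rewrite gt_eqF// sqrtr_gt0. Qed.
Lemma sqrt2_sq : Num.sqrt 2 * Num.sqrt 2 = 2 :> R.
Proof. by rewrite -expr2 sqr_sqrtr. Qed.
Lemma kapK x : iskap (kap x) = x.
Proof.
rewrite /iskap /kap scalerA (_ : _ * _ = 1) ?scale1r//.
have -> : imI * (Num.sqrt 2)^-1%:C%C * (- imI * (Num.sqrt 2)%:C%C) =
  - (imI * imI) * ((Num.sqrt 2)^-1%:C%C * (Num.sqrt 2)%:C%C) :> R[i] by ring.
by rewrite imI2 opprK mul1r -rmorphM/= mulVf ?sqrt2_neq0.
Qed.
Lemma n2_kap x : n2 (kap x) = 2 * n2 x.
Proof. by rewrite n2Z sqcM sqcN sqc_imI mul1r sqcC expr2 sqrt2_sq. Qed.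

Lemma kapB x y : kap (x - y) = kap x - kap y.
Proof. exact: scalerBr. Qed.
Lemma inner_kap x y : ⟪kap x, kap y⟫ = 2%:C%C * ⟪x, y⟫.
Proof.
rewrite innerZl innerZr mulrA; congr (_ * _).
by rewrite -sqcEl sqcM sqcN sqc_imI mul1r sqcC expr2 sqrt2_sq.
Qed.

Lemma coherentE x : coh x = (expR (n2 x / 2))%:C%C *: W (kap x) vac.
Proof.
rewrite weyl_vac scalerA -rmorphM/= -expRD n2_kap.
rewrite (_ : _ + _ = 0); last by field.
by rewrite expR0 scale1r -/(iskap _) kapK.
Qed.

Lemma inner_weyl x y u v :
  ⟪W x u, W y v⟫ = expIR (Im ⟪x, y⟫ / 2) * ⟪u, W (y - x) v⟫.
Proof.
rewrite weyl_adj weyl_mul innerZr innerNl reim mulNr opprK addrC.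
by [].
Qed.

Lemma vac_coherent x : ⟪vac, coh x⟫ = 1.
Proof. by rewrite -(vacE F 0) inner_cn_coherent inner_cn fact0 invr1 mul1r expr0. Qed.

Lemma vac_weyl x : ⟪vac, W x vac⟫ = (expR (- (n2 x / 4)))%:C%C.
Proof. by rewrite weyl_vac innerZr vac_coherent mulr1. Qed.

Lemma ImZ (r : R) (a : R[i]) : Im (r%:C%C * a) = r * Im a.
Proof. by rewrite !reim mul0r addr0. Qed.

(** Both vectors are multiples of Weyl operators on the vacuum, so the Weyl relation and [vac_weyl]
    give the value without summing a series. *)
Lemma inner_coherent x y : ⟪coh x, coh y⟫ = cexp ⟪x, y⟫.
Proof.
rewrite !coherentE innerZl innerZr JC inner_weyl vac_weyl -kapB n2_kap inner_kap ImZ /cexp.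
have -> : 2 * Im ⟪x, y⟫ / 2 = Im ⟪x, y⟫ by field.
transitivity ((expR (n2 x / 2) * expR (n2 y / 2) * expR (- (2 * n2 (y - x) / 4)))%:C%C *
  expIR (Im ⟪x, y⟫)); first by rewrite !realCM; ring.
by rewrite -!expRD n2BC n2B (_ : _ + _ = rip x y)//; field.
Qed.

Lemma weyl_coherent z x :
  W z (coh x) = cexp ((- (n2 z / 4))%:C%C + (imI * (Num.sqrt 2)^-1%:C%C) * ⟪z, x⟫) *: coh (x + iskap z).
Proof.
have hk : z + kap x = kap (x + iskap z).
  rewrite /kap scalerDr addrC; congr (_ + _).
  have := kapK z; rewrite /iskap /kap !scalerA => h.
  rewrite -{1}h; congr (_ *: _); ring.
rewrite coherentE (linZ _ _ (weyl_lin z)) weyl_mul hk [in RHS]coherentE !scalerA.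
congr (_ *: _); rewrite n2D /cexp.
have s2 := sqrt2_sq; have s0 := sqrt2_neq0; set s := Num.sqrt 2 in s2 s0 *.
have si : s^-1 * s^-1 = 2^-1 by rewrite -invfM s2.
rewrite n2Z sqcM sqc_imI mul1r sqcC expr2 si.
have -> : rip x (iskap z) = s^-1 * Im ⟪z, x⟫.
  by rewrite /rip innerZr innerC !reim; ring.
have -> : Im ⟪z, kap x⟫ = - (s * Re ⟪z, x⟫).
  by rewrite innerZr !reim -/s; ring.
rewrite mulrAC -rmorphM/= -expRD.
have -> : Re ((- (n2 z / 4))%:C%C + imI * s^-1%:C%C * ⟪z, x⟫) = - (n2 z / 4) - s^-1 * Im ⟪z, x⟫.
  by rewrite !reim; ring.
have -> : Im ((- (n2 z / 4))%:C%C + imI * s^-1%:C%C * ⟪z, x⟫) = s^-1 * Re ⟪z, x⟫.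
  by rewrite !reim; ring.
have ss : s^-1 = s / 2 by apply: (mulfI s0); rewrite mulfV// mulrA s2 mulfV.
have -> : - (n2 z / 4) - s^-1 * Im ⟪z, x⟫ +
  (n2 x + 2^-1 * n2 z + 2 * (s^-1 * Im ⟪z, x⟫)) / 2 = n2 x / 2 by field.
have -> : s^-1 * Re ⟪z, x⟫ = - (- (s * Re ⟪z, x⟫) / 2) by rewrite ss; field.
by [].
Qed.

End Weyl.

Section Limits.
Variables (R : realType).

Lemma ccvg_cst (l : R[i]) : ccvg (fun=> l) l.
Proof. by move=> e e0; exists 0%N => n _; rewrite subrr nc0. Qed.

Lemma ccvgM (u v : nat -> R[i]) l m : ccvg u l -> ccvg v m -> ccvg (fun n => u n * v n) (l * m).
Proof.
move=> hu hv e e0.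
pose c := nc l + nc m + 1; have c0 : 0 < c by rewrite ltr_wpDl ?addr_ge0 ?nc_ge0.
pose d := Num.min 1 (e / (2 * c)).
have d0 : 0 < d by rewrite lt_min ltr01 divr_gt0// mulr_gt0.
have d1 : d <= 1 by rewrite ge_min lexx.
have dc : d * (2 * c) <= e by rewrite -ler_pdivlMr ?mulr_gt0// ge_min lexx orbT.
have [N hN] := hu _ d0; have [M hM] := hv _ d0.
exists (maxn N M) => n; rewrite geq_max => /andP[/hN h1 /hM h2].
have -> : u n * v n - l * m = (u n - l) * (v n - m) + l * (v n - m) + (u n - l) * m by ring.
apply: le_lt_trans (ncD _ _) _; apply: le_lt_trans (lerD (ncD _ _) (lexx _)) _; rewrite !ncM.
have := nc_ge0 l; have := nc_ge0 m; have := nc_ge0 (u n - l); have := nc_ge0 (v n - m).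
rewrite /c in dc; move: (nc l) (nc m) (nc (u n - l)) (nc (v n - m)) h1 h2 dc => *; nra.
Qed.

Lemma ccvg_inner (H : hilbertType R) (u v : nat -> H) x y :
  u @ \oo --> x -> v @ \oo --> y -> ccvg (fun n => ⟪u n, v n⟫) ⟪x, y⟫.
Proof.
move=> hu hv e e0.
pose c := hn x + hn y + 1; have c0 : 0 < c by rewrite ltr_wpDl ?addr_ge0 ?hn_ge0.
pose d := Num.min 1 (e / (2 * c)).
have d0 : 0 < d by rewrite lt_min ltr01 divr_gt0// mulr_gt0.
have d1 : d <= 1 by rewrite ge_min lexx.
have dc : d * (2 * c) <= e by rewrite -ler_pdivlMr ?mulr_gt0// ge_min lexx orbT.
have [N hN] := (hcvgP _ _).1 hu _ d0; have [M hM] := (hcvgP _ _).1 hv _ d0.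
exists (maxn N M) => n; rewrite geq_max => /andP[/hN h1 /hM h2].
have -> : ⟪u n, v n⟫ - ⟪x, y⟫ = ⟪u n - x, v n - y⟫ + ⟪x, v n - y⟫ + ⟪u n - x, y⟫.
  by rewrite !innE; ring.
apply: le_lt_trans (ncD _ _) _; apply: le_lt_trans (lerD (ncD _ _) (lexx _)) _.
apply: le_lt_trans (lerD (lerD (nc_inner _ _) (nc_inner _ _)) (nc_inner _ _)) _.
have := hn_ge0 x; have := hn_ge0 y; have := hn_ge0 (u n - x); have := hn_ge0 (v n - y).
rewrite /c in dc; move: (hn x) (hn y) (hn (u n - x)) (hn (v n - y)) h1 h2 dc => *; nra.
Qed.

Lemma dense_seq (H : hilbertType R) (S : set H) (x : H) : dense S ->
  exists2 u : nat -> H, forall n, S (u n) & u @ \oo --> x.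
Proof.
move=> /dense_hn h.
have /choice[u hu] n : exists y, S y /\ hn (x - y) < n.+1%:R^-1.
  by have [|y Sy hy] := h x n.+1%:R^-1; [rewrite invr_gt0|exists y].
exists u; first by move=> n; exact: (hu n).1.
apply/hcvgP => e /inv_nat_small[N hN]; exists N => n /hN; apply: lt_trans.
by rewrite hnBC; exact: (hu n).2.
Qed.

End Limits.

(** * Cyclicity of the vacuum and irreducibility of the Weyl operators *)

Section WeylTotal.
Variables (R : realType) (H : hilbertType R) (F : fock_space H) (W : H -> F -> F).
Hypothesis hW : weyl_operators W.
Implicit Types (x y z : H) (u v w : F).

Local Notation coh := (coherent F).
Local Notation vac := (vac F).

Lemma coh_cvg (s : nat -> H) x : s @ \oo --> x -> (coh \o s) @ \oo --> coh x.
Proof.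
move=> sx.
have h : (fun n => n2 (coh (s n) - coh x)) @ \oo --> (0 : R).
  have nE n : n2 (coh (s n) - coh x) =
      expR (n2 (s n)) + expR (n2 x) - 2 * (expR (rip x (s n)) * cos (rip (imI *: x) (s n))).
    rewrite n2B /n2 !(inner_coherent hW) !inner_n2 !cexpC !ReC; congr (_ - 2 * _).
    rewrite /rip (inner_coherent hW) innerC cexpJ reim /cexp ReZ /= innerZl.
    by congr (_ * cos _); rewrite !reim; ring.
  have -> : (0 : R) = expR (n2 x) + expR (n2 x) - 2 * (expR (rip x x) * cos (rip (imI *: x) x)).
    have -> : rip (imI *: x) x = 0 by rewrite /rip innerZl inner_n2 !reim; ring.
    by rewrite cos0 rip_n2; ring.
  under eq_fun do rewrite nE.
  apply: cvgB; first apply: cvgD; first exact: (continuous_cvg _ (@continuous_expR R _) (n2_cvg sx)).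
    exact: cvg_cst.
  apply: cvgM; first exact: cvg_cst.
  apply: cvgM; first exact: (continuous_cvg _ (@continuous_expR R _) (hcvg_rip (y := x) sx)).
  exact: (continuous_cvg _ (@continuous_cos R _) (hcvg_rip (y := imI *: x) sx)).
apply/hcvgP => e e0; have [N hN] := (rcvgP _ _).1 h _ (exprn_gt0 2 e0).
exists N => n /hN; rewrite subr0 ger0_norm ?n2_ge0//= -hn2.
by rewrite ltr_pXn2r// nnegrE ?hn_ge0 ?ltW.
Qed.

(** v is orthogonal to the coherent vectors of i h + t i k for real t and h, k in L. The pairing is
    a scalar times a power series in t, so it also vanishes at t = i; this covers i (L + iL), which
    is dense. *)
Lemma weyl_total (L : set H) : real_subspace L -> dense (complexify L) ->
  forall v, (forall z, L z -> ⟪v, W z vac⟫ = 0) -> v = 0.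
Proof.
move=> [L0 LD LZ] dL v hv; apply: (@coherent_total _ _ F) => x.
have hcoh h : L h -> ⟪v, coh (imI *: h)⟫ = 0.
  move=> Lh; have h1 : imI *: h = iskap ((Num.sqrt 2)%:C%C *: h).
    rewrite /iskap scalerA -mulrA -rmorphM/= mulVf ?sqrt2_neq0// mulr1.
    by [].
  have := hv _ (LZ (Num.sqrt 2) _ Lh); rewrite (weyl_vac hW) innerZr -/(iskap _) -h1.
  move=> /eqP; rewrite mulf_eq0 => /orP[|/eqP//].
  by rewrite -(rmorph0 (@real_complex R)) (inj_eq (@complexI _)) gt_eqF// expR_gt0.
have step (h k : H) : L h -> L k -> ⟪v, coh (imI *: h + imI *: (imI *: k))⟫ = 0.
  move=> Lh Lk.
  pose y := imI *: h; pose z1 := kap y.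
  (* The translation by y is moved into a Weyl operator, and from there to v, so that the remaining
     vector is a power series in [a]. *)
  have cohE (a : R[i]) : exists2 c : R[i], c != 0 &
      coh (y + a *: (imI *: k)) = c *: W z1 (coh (a *: (imI *: k))).
    exists (cexp (- ((- (n2 z1 / 4))%:C%C + (imI * (Num.sqrt 2)^-1%:C%C) * ⟪z1, a *: (imI *: k)⟫))).
      exact: cexp_neq0.
    by rewrite (weyl_coherent hW) [_ *: (_ *: coh _)]scalerA [cexp (- _) * _]mulrC cexpK scale1r /z1 kapK addrC.
  have h0 n : ⟪W (- z1) v, cn F n (imI *: k)⟫ = 0.
    apply: coherent_ortho_cn => t.
    have [c c0 hc] := cohE t%:C%C.
    have : ⟪v, coh (imI *: (h + t%:C%C *: k))⟫ = 0 by apply: hcoh; exact: LD (LZ _ _ Lk).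
    rewrite scalerDr (_ : imI *: (t%:C%C *: k) = t%:C%C *: (imI *: k)); last first.
      by rewrite !scalerA mulrC.
    rewrite -/y hc innerZr => /eqP; rewrite mulf_eq0 (negbTE c0)/= => /eqP.
    by rewrite (weyl_adj hW) opprK.
  have [c c0] := cohE imI; rewrite -/y => ->; rewrite innerZr.
  rewrite -(opprK z1) -(weyl_adj hW) (_ : ⟪_, coh _⟫ = 0) ?mulr0//.
  apply: ccvg_unique (inner_coherent_ccvg _ _ _) _.
  apply: ccvg_eq (ccvg_cst 0) => n; rewrite /psum big1// => i _.
  by rewrite h0 mulr0.
have [s sL sx] := dense_seq (- imI *: x) dL.
have sx' : (fun n => imI *: s n) @ \oo --> x.
  have -> : x = imI *: (- imI *: x) by rewrite scalerA mulrN imI2 opprK scale1r.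
  by apply: cvgZr.
apply: (hcvg_inner_eq (coh_cvg sx')) => n /=.
by have [h [k [Lh Lk ->]]] := sL n; rewrite scalerDr step.
Qed.

(** S, the projection onto the closed span of the W z v, commutes with W z for z in L. Then <coh x,
    S coh y> / <coh x, coh y> depends only on y - x, holomorphically; at y = 0 it is antiholomorphic
    in y - x as well, hence constant. So S is a scalar, while S v = v and S u = 0. *)
Lemma weyl_irreducible (L : set H) : real_subspace L -> dense L ->
  forall u v, (forall z, L z -> ⟪u, W z v⟫ = 0) -> u = 0 \/ v = 0.
Proof.
move=> [L0 LD LZ] dL u v huv.
have LN z : L z -> L (- z).
  by move=> Lz; have := LZ (-1) _ Lz; rewrite rmorphN rmorph1 scaleN1r.
pose w (z : {z | L z}) := W (sval z) v.
have [//|s|S [bS hS cS]] := @family_operator R F _ w w 1; first by rewrite mul1r.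
have lS := bS.1.
have Suniq a b : (forall e : R, 0 < e -> exists2 y, range (lc w) y & hn (a - y) < e) ->
    (forall i, ⟪w i, a⟫ = ⟪w i, b⟫) -> S b = a.
  move=> ca hab; apply/eqP; rewrite -subr_eq0; apply/eqP.
  apply: (@approx_ortho_eq0 _ _ (range (lc w))).
    move=> e e0; have e2 : 0 < e / 2 by rewrite divr_gt0.
    have [_ [s _ <-] h1] := cS b _ e2; have [_ [t _ <-] h2] := ca _ e2.
    exists (lc w (s ++ [seq (-1 * p.1, p.2) | p <- t])); first by eexists.
    rewrite lc_cat lc_scale scaleN1r.
    have -> : S b - a - (lc w s - lc w t) = (S b - lc w s) - (a - lc w t) by hvec.
    by apply: le_lt_trans (hnB _ _) _; lra.
  move=> _ [s _ <-]; rewrite /lc inner_suml big1// => p _.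
  by rewrite innerZl innerBr hS hab subrr mulr0.
have com z (y : F) : L z -> S (W z y) = W z (S y).
  move=> Lz; have wz (i : {z | L z}) : exists (a : R[i]) i', W (- z) (w i) = a *: w i'.
    have Li : L (- z + sval i) by apply: LD (LN _ Lz) (svalP i).
    by rewrite /w (weyl_mul hW); eexists; exists (exist _ _ Li).
  apply: Suniq => [e e0|i].
    have [_ [s _ <-] h1] := cS y _ e0.
    have wz' (i : {z | L z}) : exists (a : R[i]) i', W z (w i) = a *: w i'.
      have Li : L (z + sval i) by apply: LD Lz (svalP i).
      by rewrite /w (weyl_mul hW); eexists; exists (exist _ _ Li).
    exists (W z (lc w s)); last by rewrite -(linB _ _ (weyl_lin hW z)) (weyl_hn hW).
    elim: s {h1} => [|[a i] s [t _ ht]].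
      by exists [::] => //; rewrite !lc_nil (lin0 (weyl_lin hW z)).
    have [b [i' hb]] := wz' i; exists ((a * b, i') :: t) => //.
    rewrite /lc !big_cons/= -!/(lc _ _) (linD _ _ (weyl_lin hW z)) (linZ _ _ (weyl_lin hW z)).
    by rewrite hb ht scalerA.
  have [a [i' ha]] := wz i.
  have adj t : ⟪w i, W z t⟫ = ⟪W (- z) (w i), t⟫ by rewrite (weyl_adj hW) opprK.
  by rewrite !adj ha !innerZl hS.
have Sv : S v = v.
  apply: Suniq => // e e0; exists (lc w [:: (1, exist _ 0 L0)]); first by eexists.
  by rewrite lc1 scale1r /w /= (weyl0 hW) subrr hn0.
have Su : S u = 0.
  apply: Suniq => [e e0|i]; first by exists (lc w [::]); [eexists|rewrite lc_nil subrr hn0].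
  by rewrite inner0r innerC huv ?J0//; exact: svalP.
(* When kap x is in L, S commutes with the Weyl operator that moves coh x to the vacuum; density of
   L and continuity give the other x. *)
have key x y : ⟪coh x, S (coh y)⟫ = ⟪coh x, coh y⟫ * ⟪vac, S (coh (y - x))⟫.
  have keyL x' : L (kap x') -> ⟪coh x', S (coh y)⟫ = ⟪coh x', coh y⟫ * ⟪vac, S (coh (y - x'))⟫.
    move=> Lx; rewrite {1}(coherentE hW x') innerZl (weyl_adj hW) -com; last exact: LN.
    rewrite (weyl_coherent hW) (linZ _ _ lS) innerZr mulrA.
    have -> : iskap (- kap x') = - x' by rewrite /iskap scalerN -/(iskap _) kapK.
    congr (_ * _); rewrite (inner_coherent hW) JC -cexpC -cexpD; congr cexp.
    rewrite n2N n2_kap innerNl innerZl conjE conjE.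
    have s0 := sqrt2_neq0 R.
    have e1 : (Num.sqrt 2)^-1%:C%C * (Num.sqrt 2)%:C%C = 1 :> R[i].
      by rewrite -rmorphM/= mulVf.
    rewrite !conjE.
    have -> : imI * (Num.sqrt 2)^-1%:C%C * - (- - imI * (Num.sqrt 2)%:C%C * ⟪x', y⟫) =
      - (imI * imI) * ((Num.sqrt 2)^-1%:C%C * (Num.sqrt 2)%:C%C) * ⟪x', y⟫ by ring.
    rewrite e1 imI2 opprK !mul1r addrA -rmorphD/=.
    by rewrite (_ : _ + _ = 0) ?add0r//; field.
  have [s sL sx] := dense_seq (kap x) dL.
  have sx' : (fun n => iskap (s n)) @ \oo --> x by rewrite -(kapK x); apply: cvgZr.
  have kiK z : kap (iskap z) = z.
    by rewrite -[RHS](kapK z) /kap /iskap !scalerA mulrC.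
  have c1 := ccvg_inner (coh_cvg sx') (@hcvg_const _ _ (S (coh y))).
  have c2 := ccvgM (ccvg_inner (coh_cvg sx') (@hcvg_const _ _ (coh y)))
    (ccvg_inner (@hcvg_const _ _ vac) (bdop_cvg bS (coh_cvg (cvgB (@hcvg_const _ _ y) sx')))).
  apply: ccvg_unique c1 _; apply: ccvg_eq (c2 _) => n /=.
  by rewrite keyL ?kiK.
have [_ [M M0 hM]] := bS.
have const z : ⟪vac, S (coh z)⟫ = ⟪vac, S vac⟫.
  have a0 : forall n, ⟪vac, S (cn F n.+1 z)⟫ = 0.
    apply: (@holomorphic_antiholomorphic R (fun n => ⟪vac, S (cn F n z)⟫)
      (fun n => ⟪cn F n z, S vac⟫) (M * hn (coh z)) (hn (coh z) * hn (S vac))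
      (fun c => ⟪vac, S (coh (- c *: z))⟫)).
    - move=> n; apply: le_trans (nc_inner _ _) _; rewrite hn_vac mul1r.
      by apply: le_trans (hM _) _; rewrite ler_wpM2l ?hn_cn.
    - by move=> n; apply: le_trans (nc_inner _ _) _; rewrite ler_wpM2r ?hn_ge0 ?hn_cn.
    - move=> c _; have [T bT aT] := adj_exists bS.
      have h := inner_coherent_ccvg (T vac) z (- c).
      rewrite (adjC aT) in h; apply: ccvg_eq h => n; apply: eq_bigr => i _.
      by rewrite (adjC aT).
    - move=> c _.
      have -> : ⟪vac, S (coh (- c *: z))⟫ = ((⟪S vac, coh (c *: z)⟫)^*)%C.
        have := key (c *: z) 0; rewrite sub0r -scaleNr.
        have -> : ⟪coh (c *: z), coh 0⟫ = 1.
          by rewrite innerC (vac_coherent F) J1.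
        by rewrite mul1r => <-; rewrite innerC.
      move=> e e0; have [N hN] := inner_coherent_ccvg (S vac) z c e0.
      exists N => n /hN; rewrite -ncJ rmorphB; congr (nc (_ - _) < e).
      rewrite /psum rmorph_sum; apply: eq_bigr => i _; rewrite rmorphM rmorphXn; congr (_ * _).
      by rewrite [RHS]innerC.
  have h : (fun n => S (\sum_(k < n.+1) cn F k z)) @ \oo --> S (coh z).
    apply: (bdop_cvg bS (u := fun n => \sum_(k < n.+1) cn F k z)).
    by have := @coherent_cvg _ _ F z; rewrite -(cvg_shiftS (fun n => \sum_(k < n) cn F k z)).
  apply: (hcvg_inner_eq h) => n; rewrite (lin_sum _ _ _ lS) inner_sumr big_ord_recl/= vacE.
  by rewrite big1 ?addr0// => i _; rewrite /bump /= add1n a0.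
have Sid (y : F) : S y = ⟪vac, S vac⟫ *: y.
  have [T bT aT] := adj_exists bS.
  apply/eqP; rewrite -subr_eq0; apply/eqP; apply: (@coherent_total _ _ F) => x.
  rewrite innerBl innerZl aT.
  have -> : T (coh x) = (⟪vac, S vac⟫^*)%C *: coh x.
    apply/eqP; rewrite -subr_eq0; apply/eqP; apply: (@coherent_total _ _ F) => x'.
    by rewrite innerBl innerZl conjcK (adjC aT) key const mulrC subrr.
  by rewrite innerZr subrr.
have [v0|v0] := eqVneq v 0; [by right|left].
have : (1 - ⟪vac, S vac⟫) *: v = 0 by rewrite scalerBl scale1r -Sid Sv subrr.
move=> /eqP; rewrite scaler_eq0 (negbTE v0) orbF subr_eq0 => /eqP a1.
by rewrite -(scale1r u) a1 -Sid.
Qed.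

End WeylTotal.

(** * Squeezed vacua *)

Section FiniteSums.
Variable R : realType.

Lemma real_sum_CS (I : finType) (x y : I -> R) :
  (\sum_i x i * y i) ^+ 2 <= (\sum_i x i ^+ 2) * (\sum_i y i ^+ 2).
Proof.
apply: discr => t.
have -> : \sum_i x i ^+ 2 + 2 * (\sum_i x i * y i) * t + (\sum_i y i ^+ 2) * t ^+ 2 =
    \sum_i (x i + t * y i) ^+ 2.
  rewrite mulr_sumr !mulr_suml -!big_split/=; apply: eq_bigr => i _; ring.
by apply: sumr_ge0 => i _; exact: sqr_ge0.
Qed.

Lemma complex_sum_CS (I : finType) (x y : I -> R[i]) :
  sqc (\sum_i x i * y i) <= (\sum_i sqc (x i)) * (\sum_i sqc (y i)).
Proof.
rewrite -nc2; apply: le_trans (_ : (\sum_i nc (x i) * nc (y i)) ^+ 2 <= _).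
  have h : nc (\sum_i x i * y i) <= \sum_i nc (x i) * nc (y i).
    by apply: le_trans (nc_sum _ _ _) _; apply: ler_sum => i _; rewrite ncM.
  by rewrite ler_pXn2r// nnegrE ?nc_ge0 ?(le_trans (nc_ge0 _) h).
apply: le_trans (real_sum_CS _ _) _.
by under eq_bigr do rewrite nc2; under [X in _ * X]eq_bigr do rewrite nc2.
Qed.

Lemma dbl_sum_CS n m m' (a : 'I_n -> R[i]) (U : 'I_m -> 'I_n -> R[i]) (V : 'I_m' -> 'I_n -> R[i])
    (z : 'I_m -> 'I_m' -> R[i]) :
  sqc (\sum_i (a i)^*%C * (\sum_k \sum_l (U k i)^*%C * (V l i)^*%C * z k l)) <=
  (\sum_k \sum_l sqc (z k l)) *
  Re (\sum_i \sum_j (a i)^*%C * a j * ((\sum_k (U k i)^*%C * U k j) * (\sum_l (V l i)^*%C * V l j))).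
Proof.
pose b (p : 'I_m * 'I_m') := \sum_i a i * U p.1 i * V p.2 i.
have -> : \sum_i (a i)^*%C * (\sum_k \sum_l (U k i)^*%C * (V l i)^*%C * z k l) =
    \sum_(p : 'I_m * 'I_m') z p.1 p.2 * (b p)^*%C.
  under eq_bigr do rewrite pair_bigA mulr_sumr/=.
  rewrite exchange_big; apply: eq_bigr => p _; rewrite /b rmorph_sum mulr_sumr.
  by apply: eq_bigr => i _; rewrite !rmorphM; ring.
apply: le_trans (complex_sum_CS _ _) _.
rewrite pair_bigA/= le_eqVlt; apply/orP; left; apply/eqP; congr (_ * _).
rewrite -[LHS]ReC; congr (Re _); rewrite rmorph_sum/=.
under eq_bigr do rewrite sqcJ sqcEl.
transitivity (\sum_(p : 'I_m * 'I_m') \sum_i \sum_j (a i)^*%C * a j *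
    (((U p.1 i)^*%C * U p.1 j) * ((V p.2 i)^*%C * V p.2 j))).
  apply: eq_bigr => p _; rewrite /b rmorph_sum mulr_suml; apply: eq_bigr => i _.
  by rewrite mulr_sumr; apply: eq_bigr => j _; rewrite !rmorphM; ring.
rewrite exchange_big; apply: eq_bigr => i _; rewrite exchange_big; apply: eq_bigr => j _.
rewrite -mulr_sumr; congr (_ * _); rewrite mulr_suml.
under [RHS]eq_bigr do rewrite mulr_sumr.
by rewrite pair_bigA.
Qed.

End FiniteSums.

Section Schur.
Variables (R : realType) (H1 H2 : hilbertType R).

(** Cauchy-Schwarz in the tensor product of H1 and H2 for p (x) p' and the sum of a_i u_i (x) v_i,
    written in coordinates. *)
Lemma schur_CS n (a : 'I_n -> R[i]) (u : 'I_n -> H1) (v : 'I_n -> H2) p p' :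
  sqc (\sum_i (a i)^*%C * (⟪u i, p⟫ * ⟪v i, p'⟫)) <=
  n2 p * n2 p' * Re (\sum_i \sum_j (a i)^*%C * a j * (⟪u i, u j⟫ * ⟪v i, v j⟫)).
Proof.
have [m [e [oe eu]]] := gram_schmidt_fun u; have [m' [f [of_ fv]]] := gram_schmidt_fun v.
have h := dbl_sum_CS a (fun k i => ⟪e k, u i⟫) (fun l i => ⟪f l, v i⟫)
  (fun k l => ⟪e k, p⟫ * ⟪f l, p'⟫).
have uE i : ⟪u i, p⟫ = \sum_k (⟪e k, u i⟫^*)%C * ⟪e k, p⟫.
  rewrite innerC (inner_ons p (eu i)) rmorph_sum; apply: eq_bigr => k _.
  by rewrite rmorphM/= JK mulrC.
have vE i : ⟪v i, p'⟫ = \sum_k (⟪f k, v i⟫^*)%C * ⟪f k, p'⟫.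
  rewrite innerC (inner_ons p' (fv i)) rmorph_sum; apply: eq_bigr => k _.
  by rewrite rmorphM/= JK mulrC.
have -> : \sum_i (a i)^*%C * (⟪u i, p⟫ * ⟪v i, p'⟫) = \sum_i (a i)^*%C *
    (\sum_k \sum_l (⟪e k, u i⟫)^*%C * (⟪f l, v i⟫)^*%C * (⟪e k, p⟫ * ⟪f l, p'⟫)).
  apply: eq_bigr => i _; rewrite uE vE mulr_suml; congr (_ * _); apply: eq_bigr => k _.
  by rewrite mulr_sumr; apply: eq_bigr => l _; ring.
have e1 : \sum_i \sum_j (a i)^*%C * a j * (⟪u i, u j⟫ * ⟪v i, v j⟫) =
    \sum_i \sum_j (a i)^*%C * a j * ((\sum_k (⟪e k, u i⟫)^*%C * ⟪e k, u j⟫) *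
      (\sum_l (⟪f l, v i⟫)^*%C * ⟪f l, v j⟫)).
  apply: eq_bigr => i _; apply: eq_bigr => j _.
  by rewrite (inner_ons _ (eu j)) (inner_ons _ (fv j)).
rewrite e1; apply: le_trans h _; rewrite -e1 ler_wpM2r//.
  rewrite -(ReC 0) e1; set X := (\sum_i _).
  have -> : Re X = \sum_(p : 'I_m * 'I_m') sqc (\sum_i a i * ⟪e p.1, u i⟫ * ⟪f p.2, v i⟫).
    rewrite -[RHS]ReC rmorph_sum/=; congr (Re _).
    under [RHS]eq_bigr do rewrite sqcEl rmorph_sum mulr_suml.
    rewrite [RHS]exchange_big; apply: eq_bigr => i _.
    under [RHS]eq_bigr do rewrite mulr_sumr.
    rewrite [RHS]exchange_big; apply: eq_bigr => j _.
    rewrite mulr_suml -(pair_bigA _ (fun k l => ((a i * ⟪e k, u i⟫ * ⟪f l, v i⟫)^*)%C *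
      (a j * ⟪e k, u j⟫ * ⟪f l, v j⟫)))/= mulr_sumr; apply: eq_bigr => k _.
    by rewrite !mulr_sumr; apply: eq_bigr => l _; rewrite !JM; ring.
  by apply: sumr_ge0 => ? _; exact: sqc_ge0.
under eq_bigr => k _ do (under eq_bigr do rewrite sqcM); rewrite -big_distrlr/=.
by apply: ler_pM; rewrite ?bessel//; apply: sumr_ge0 => ? _; exact: sqc_ge0.
Qed.

End Schur.

Section Series.
Variables (R : realType).

Lemma geom_half_sum n m : \sum_(n <= k < m) (2^-1 : R) ^+ k <= 2 * 2^-1 ^+ n.
Proof. by apply: geom_le => //; rewrite invr_ge0. Qed.

Lemma half_small (A e : R) : 0 <= A -> 0 < e -> exists N, forall n, (N <= n)%N -> A * 2^-1 ^+ n < e.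
Proof.
move=> A0 e0.
have p0 : 0 < A + 1 by rewrite ltr_wpDl.
have [N hN] := inv_nat_small (divr_gt0 e0 p0).
exists N => n Nn; have h := hN _ Nn; rewrite ltr_pdivlMr// in h.
apply: le_lt_trans h; rewrite mulrC; apply: ler_pM => //; last by rewrite lerDl.
rewrite exprVn lef_pV2 ?posrE ?exprn_gt0 ?ltr0n//.
by rewrite -natrX ler_nat; exact: ltn_expl.
Qed.

Lemma rcvg_le (u : nat -> R) (l b : R) : u @ \oo --> l -> (forall n, u n <= b) -> l <= b.
Proof.
move=> /rcvgP h ub; apply/ler_addgt0Pr => e /h[N /(_ N (leqnn N))].
by have := ub N; rewrite ltr_distl => h1 /andP[h2 h3]; lra.
Qed.

Lemma vector_series (H : hilbertType R) (u : nat -> H) (A : R) : 0 <= A ->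
  (forall n, hn (u n) <= A * 2^-1 ^+ n) ->
  exists v, hn v <= 2 * A /\ forall y, ccvg (fun N => \sum_(k < N) ⟪y, u k⟫) ⟪y, v⟫.
Proof.
move=> A0 hu.
have bd n m : hn (\sum_(n <= k < m) u k) <= 2 * A * 2^-1 ^+ n.
  apply: le_trans (hn_sum _ _ _) _.
  apply: le_trans (_ : \sum_(n <= k < m) A * 2^-1 ^+ k <= _); first exact: ler_sum.
  by rewrite -mulr_sumr [2 * A]mulrC -mulrA ler_wpM2l ?geom_half_sum.
pose s N := \sum_(0 <= k < N) u k.
have sB n m : (n <= m)%N -> hn (s m - s n) <= 2 * A * 2^-1 ^+ n.
  by move=> nm; rewrite /s (big_cat_nat (leq0n n) nm)/= [X in X - _]addrC addrK.
have A2 : 0 <= 2 * A by rewrite mulr_ge0.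
have [|v hv] := @hcomplete _ _ s.
  move=> e e0; have [N hN] := half_small A2 e0; exists N => n m Nn Nm.
  have [nm|/ltW nm] := leP n m; last by apply: le_lt_trans (sB _ _ nm) _; exact: hN.
  by rewrite hnBC; apply: le_lt_trans (sB _ _ nm) _; exact: hN.
exists v; split.
  apply: (rcvg_le (hn_cvg hv)) => n.
  by have := bd 0%N n; rewrite expr0 mulr1.
move=> y e e0; have p0 : 0 < hn y + 1 by rewrite ltr_wpDl ?hn_ge0.
have [N hN] := (hcvgP _ _).1 hv _ (divr_gt0 e0 p0).
exists N => n /hN; rewrite ltr_pdivlMr// => h.
rewrite -inner_sumr -innerBr -(big_mkord xpredT u).
by apply: le_lt_trans (nc_inner _ _) (le_lt_trans _ h); rewrite mulrC ler_wpM2l ?hn_ge0// lerDl.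
Qed.

(** The product of the partial sums exceeds the partial sum of the Cauchy product by terms x_i y_j
    with i + j >= N. One factor 2^-i of 4^-i completes 2^-(N - i) to 2^-N, the other one sums over
    i. *)
Lemma ccvg_psum_cauchy (a b : nat -> R[i]) (A B : R) u l m :
  (forall n, nc (a n) <= A * 4^-1 ^+ n) -> (forall n, nc (b n) <= B * 4^-1 ^+ n) -> nc u <= 1 ->
  ccvg (psum a u) l -> ccvg (psum b u) m ->
  ccvg (psum (fun n => \sum_(i < n.+1) a i * b (n - i)%N) u) (l * m).
Proof.
move=> ha hb u1 hl hm.
have A0 : 0 <= A by have := le_trans (nc_ge0 _) (ha 0%N); rewrite expr0 mulr1.
have B0 : 0 <= B by have := le_trans (nc_ge0 _) (hb 0%N); rewrite expr0 mulr1.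
pose x i := u ^+ i * a i; pose y i := u ^+ i * b i.
have ux n : nc (u ^+ n) <= 1 by rewrite ncX exprn_ile1 ?nc_ge0.
have hx n : nc (x n) <= A * 4^-1 ^+ n.
  by rewrite ncM -[leRHS]mul1r; apply: ler_pM; rewrite ?nc_ge0.
have hy n : nc (y n) <= B * 4^-1 ^+ n.
  by rewrite ncM -[leRHS]mul1r; apply: ler_pM; rewrite ?nc_ge0.
pose S k := \sum_(0 <= j < k) y j.
have e1 N : psum (fun n => \sum_(i < n.+1) a i * b (n - i)%N) u N =
    \sum_(0 <= i < N) x i * S (N - i)%N.
  rewrite /psum -(big_mkord xpredT (fun n => u ^+ n * \sum_(i < n.+1) a i * b (n - i)%N)).
  transitivity (\sum_(0 <= n < N) \sum_(0 <= i < N | (i < n.+1)%N) x i * y (n - i)%N).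
    rewrite !big_nat; apply: eq_bigr => n /andP[_ nN].
    rewrite -(big_mkord xpredT (fun i => a i * b (n - i)%N)) mulr_sumr (big_nat_widen _ _ _ _ _ nN).
    apply: eq_bigr => i; rewrite /= ltnS => le.
    by rewrite /x /y -{1}(subnKC le) exprD; ring.
  rewrite (exchange_big_dep_nat xpredT)//=; apply: eq_bigr => i _.
  rewrite /S mulr_sumr -(@big_nat_widenl _ _ _ i 0 N xpredT)// -{1}(add0n i) big_addn.
  by apply: eq_bigr => j _; rewrite addnK.
have e2 N : psum a u N * psum b u N - psum (fun n => \sum_(i < n.+1) a i * b (n - i)%N) u N =
    \sum_(0 <= i < N) x i * \sum_(N - i <= j < N) y j.
  have p0 c : psum c u N = \sum_(0 <= i < N) u ^+ i * c i by rewrite /psum big_mkord.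
  rewrite e1 !p0 mulr_suml -sumrB; apply: eq_big_nat => i /andP[_ iN].
  by rewrite /S -/(x i) -mulrBr (big_cat_nat (leq0n _) (leq_subr i N))/= [X in X - _]addrC addrK.
have q (n : nat) : 0 <= (2^-1 : R) ^+ n by rewrite exprn_ge0// invr_ge0.
have q4 (n : nat) : (4^-1 : R) ^+ n = 2^-1 ^+ n * 2^-1 ^+ n.
  by rewrite -exprMn; congr (_ ^+ n); field.
have q1 (n : nat) : (2^-1 : R) ^+ n <= 1 by rewrite exprn_ile1 ?invr_ge0// invf_le1 ?ler1n.
have bnd N : nc (psum a u N * psum b u N - psum (fun n => \sum_(i < n.+1) a i * b (n - i)%N) u N) <=
    4 * A * B * 2^-1 ^+ N.
  rewrite e2; apply: le_trans (nc_sum _ _ _) _.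
  apply: le_trans (_ : \sum_(0 <= i < N) 2 * A * B * 2^-1 ^+ N * 2^-1 ^+ i <= _).
    rewrite big_nat [leRHS]big_nat; apply: ler_sum => i /andP[_ iN]; rewrite ncM.
    have h1 : nc (\sum_(N - i <= j < N) y j) <= B * (2 * 2^-1 ^+ (N - i)).
      apply: le_trans (nc_sum _ _ _) _.
      apply: le_trans (_ : \sum_(N - i <= j < N) B * 2^-1 ^+ j <= _).
        apply: ler_sum => j _; apply: le_trans (hy j) _; rewrite ler_wpM2l// q4.
        by rewrite -[leRHS]mulr1 ler_wpM2l.
      by rewrite -mulr_sumr ler_wpM2l ?geom_half_sum.
    apply: le_trans (ler_pM (nc_ge0 _) (nc_ge0 _) (hx i) h1) _.
    by rewrite q4 -{2}(subnK (ltnW iN)) exprD le_eqVlt; apply/orP; left; apply/eqP; ring.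
  rewrite -mulr_sumr; apply: le_trans (ler_wpM2l _ (geom_half_sum 0 N)) _; last first.
    by rewrite expr0 le_eqVlt; apply/orP; left; apply/eqP; ring.
  by rewrite !mulr_ge0.
have AB : 0 <= 4 * A * B by rewrite !mulr_ge0.
apply: ccvg_eq (_ : ccvg (fun N => psum a u N * psum b u N - (psum a u N * psum b u N -
    psum (fun n => \sum_(i < n.+1) a i * b (n - i)%N) u N)) _); first by move=> N; rewrite subKr.
rewrite -[l * m]subr0; apply: ccvgB; first exact: ccvgM.
move=> e e0; have [N hN] := half_small AB e0; exists N => n /hN; rewrite subr0.
exact: le_lt_trans.
Qed.

End Series.

(** * Fock vectors prescribed by their pairing with coherent vectors *)

Section FockVectors.
Variables (R : realType) (H : hilbertType R) (F : fock_space H).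
Implicit Types (x y : H) (p : F).
Local Notation coh := (coherent F).
Local Notation vac := (vac F).
Local Notation cn := (cn F).

(* p lies in the m-particle space and pairs with x^{(x) m} as phi prescribes. *)
Definition fvec (phi : H -> R[i]) m (C : R) p :=
  [/\ n2 p <= C * m`!%:R, forall x, ⟪cn m x, p⟫ = phi x & forall x, ⟪coh x, p⟫ = phi x].

Lemma gram_cn n m (a : 'I_n -> R[i]) (x : 'I_n -> H) :
  Re (\sum_i \sum_j (a i)^*%C * a j * ⟪x i, x j⟫ ^+ m) = m`!%:R * n2 (\sum_i a i *: cn m (x i)).
Proof.
rewrite /n2 -ReZ; congr (Re _); rewrite inner_suml mulr_sumr; apply: eq_bigr => i _.
rewrite inner_sumr mulr_sumr; apply: eq_bigr => j _; rewrite innerZl innerZr inner_cn.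
have -> : (m`!%:R)%:C%C * ((a i)^*%C * (a j * ((m`!%:R^-1)%:C%C * ⟪x i, x j⟫ ^+ m))) =
  ((m`!%:R) * (m`!%:R^-1))%:C%C * ((a i)^*%C * a j * ⟪x i, x j⟫ ^+ m) by rewrite realCM; ring.
by rewrite divff ?mul1r// gt_eqF// fact_gt0R.
Qed.

Lemma gram_cn_ge0 n m (a : 'I_n -> R[i]) (x : 'I_n -> H) :
  0 <= Re (\sum_i \sum_j (a i)^*%C * a j * ⟪x i, x j⟫ ^+ m).
Proof. by rewrite gram_cn mulr_ge0 ?n2_ge0. Qed.

(** The hypothesis bounds phi by the Gram matrix of m-th tensor powers, so Riesz applies. The vector
    lies in the closed span of the [cn m x] and thus sees only the m-th component of a coherent
    vector. *)
Lemma fvec_exists (phi : H -> R[i]) m (C : R) : 0 <= C ->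
  (forall n (a : 'I_n -> R[i]) (x : 'I_n -> H), sqc (\sum_i (a i)^*%C * phi (x i)) <=
     C * Re (\sum_i \sum_j (a i)^*%C * a j * ⟪x i, x j⟫ ^+ m)) ->
  exists p, fvec phi m C p.
Proof.
move=> C0 hC.
have C1 : 0 <= C * m`!%:R by rewrite mulr_ge0.
have bd (s : seq (R[i] * H)) :
    sqc (\sum_(t <- s) t.1 * (phi t.2)^*%C) <= C * m`!%:R * n2 (lc (cn m) s).
  have := hC (size s) (fun i => (tnth (in_tuple s) i).1) (fun i => (tnth (in_tuple s) i).2).
  rewrite gram_cn mulrA => h; rewrite /lc (big_tnth _ _ s) [in X in _ <= X](big_tnth _ _ s).
  apply: le_trans h; rewrite -sqcJ rmorph_sum le_eqVlt; apply/orP; left; apply/eqP; congr sqc.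
  by apply: eq_bigr => i _; rewrite rmorphM/= JK.
have [||||p [pG pc]] := @riesz_graphC R F
    [set q | exists s, q.1 = lc (cn m) s /\ q.2 = \sum_(t <- s) t.1 * (phi t.2)^*%C] (C * m`!%:R).
- by exists [::]; rewrite lc_nil big_nil.
- move=> a [p1 p2] [q1 q2] [s /= [-> ->]] [t /= [-> ->]].
  exists ([seq (a * r.1, r.2) | r <- s] ++ t).
  rewrite lc_cat lc_scale big_cat big_map/= mulr_sumr; split=> //; congr (_ + _).
  by apply: eq_bigr => q _; rewrite mulrA.
- exact: C1.
- by move=> [p1 p2] [s /= [-> ->]].
have pcn x : ⟪cn m x, p⟫ = phi x.
  rewrite innerC (pG (cn m x, (phi x)^*%C)) ?JK//=.
  by exists [:: (1, x)]; rewrite lc1 scale1r big_seq1 mul1r.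
exists p; split=> //; last first.
  move=> x; rewrite -pcn; apply/eqP; rewrite -subr_eq0 -innerBl -nc_eq0 eq_le nc_ge0 andbT.
  apply/ler_addgt0Pr => e e0; rewrite add0r.
  have p0 : 0 < hn (coh x - cn m x) + 1 by rewrite ltr_wpDl ?hn_ge0.
  have [[q1 q2] [s /= [-> _]]] := pc _ (divr_gt0 e0 p0); rewrite ltr_pdivlMr// => h.
  have -> : ⟪coh x - cn m x, p⟫ = ⟪coh x - cn m x, p - lc (cn m) s⟫.
    rewrite [RHS]innerBr (_ : ⟪_, lc (cn m) s⟫ = 0) ?subr0//.
    rewrite /lc inner_sumr big1// => t _; rewrite innerZr innerBl innerC inner_cn_coherent.
    by rewrite -innerC subrr mulr0.
  apply: le_trans (nc_inner _ _) (le_trans _ (ltW h)).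
  by rewrite mulrC ler_wpM2l ?hn_ge0// lerDl.
pose c := Num.sqrt (C * m`!%:R).
have c2 : c ^+ 2 = C * m`!%:R by rewrite sqr_sqrtr.
rewrite -c2 -hn_le ?sqrtr_ge0//.
have [->|p0] := eqVneq (hn p) 0; first exact: sqrtr_ge0.
have p1 : 0 < hn p by rewrite lt_neqAle hn_ge0 eq_sym p0.
rewrite -(ler_pM2r p1) -expr2; apply/ler_addgt0Pr => e e0.
have q0 : 0 < hn p + c + 1 by rewrite ltr_wpDl// addr_ge0 ?hn_ge0 ?sqrtr_ge0.
have [[q1 q2] [s /= [-> _]]] := pc _ (divr_gt0 e0 q0); rewrite ltr_pdivlMr// => h.
have h1 : rip p (lc (cn m) s) <= c * hn (lc (cn m) s).
  rewrite /rip (pG (lc (cn m) s, \sum_(t <- s) t.1 * (phi t.2)^*%C)); last by exists s.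
  apply: le_trans (ler_norm _) (le_trans (Re_le_nc _) _) => /=.
  rewrite -(@ler_pXn2r _ 2)// ?nnegrE ?nc_ge0 ?mulr_ge0 ?sqrtr_ge0 ?hn_ge0//.
  by rewrite nc2 exprMn hn2 c2.
have h2 : hn (lc (cn m) s) <= hn p + hn (p - lc (cn m) s).
  rewrite -{1}(subKr p (lc (cn m) s)); exact: hnB.
have h3 : hn p ^+ 2 = rip p (p - lc (cn m) s) + rip p (lc (cn m) s).
  by rewrite ripBr subrK hn2.
have h4 : rip p (p - lc (cn m) s) <= hn p * hn (p - lc (cn m) s).
  exact: le_trans (ler_norm _) (rip_le _ _).
have c0 : 0 <= c by exact: sqrtr_ge0.
have := ler_wpM2l c0 h2; have := hn_ge0 (p - lc (cn m) s); nra.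
Qed.

(** Products of functions correspond to symmetrized tensor products; [schur_CS] supplies the bound
    that [fvec_exists] asks for. *)
Lemma fvecM phi psi m m' (C C' : R) p p' : 0 <= C -> 0 <= C' ->
  fvec phi m C p -> fvec psi m' C' p' ->
  exists q, fvec (fun x => phi x * psi x) (m + m') (C * C') q.
Proof.
move=> C0 C0' [np pc _] [np' pc' _]; apply: fvec_exists; first exact: mulr_ge0.
move=> n a x.
have -> : \sum_i (a i)^*%C * (phi (x i) * psi (x i)) =
    \sum_i (a i)^*%C * (⟪cn m (x i), p⟫ * ⟪cn m' (x i), p'⟫).
  by apply: eq_bigr => i _; rewrite pc pc'.
apply: le_trans (schur_CS _ _ _ _ _) _.
have -> : Re (\sum_i \sum_j (a i)^*%C * a j * (⟪cn m (x i), cn m (x j)⟫ * ⟪cn m' (x i), cn m' (x j)⟫)) =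
    m`!%:R^-1 * m'`!%:R^-1 * Re (\sum_i \sum_j (a i)^*%C * a j * ⟪x i, x j⟫ ^+ (m + m')).
  rewrite -ReZ; congr (Re _); rewrite mulr_sumr; apply: eq_bigr => i _.
  rewrite mulr_sumr; apply: eq_bigr => j _; rewrite !inner_cn realCM exprD; ring.
rewrite mulrA ler_wpM2r ?gram_cn_ge0//.
have f0 := @fact_gt0R R m; have f0' := @fact_gt0R R m'.
rewrite mulrACA; apply: ler_pM; rewrite ?divr_ge0 ?n2_ge0// ler_pdivrMr//.
Qed.

Lemma fvec1 : fvec (fun=> 1) 0 1 vac.
Proof.
split=> [|x|x]; first by rewrite n2_vac fact0 mulr1.
  by rewrite vacE inner_n2 n2_vac.
by rewrite innerC vac_coherent J1.
Qed.

Lemma fvec_linear y : fvec (fun x => ⟪x, y⟫) 1 (n2 y) (cn 1 y).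
Proof.
have f1 : 1`!%:R = 1 :> R by [].
have e x : ⟪cn 1 x, cn 1 y⟫ = ⟪x, y⟫ by rewrite inner_cn f1 invr1 mul1r expr1.
split=> // [|x]; first by rewrite n2_cn expr1 f1 mulr1 divr1.
by rewrite innerC inner_cn_coherent -innerC e.
Qed.

Lemma fvecX phi m (C : R) p n : 0 <= C -> fvec phi m C p ->
  exists q, fvec (fun x => phi x ^+ n) (n * m) (C ^+ n) q.
Proof.
move=> C0 hp; elim: n => [|n [q hq]].
  by exists vac; rewrite mul0n expr0; exact: fvec1.
have [q' [h1 h2 h3]] := fvecM C0 (exprn_ge0 n C0) hp hq.
by exists q'; split; rewrite ?exprS ?mulSn// => x; rewrite ?h2 ?h3 exprS.
Qed.

Section Quadratic.
Variables (Z : H -> H) (e2 : R).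
Hypothesis hZ : hsb Z e2.
Hypothesis Zl : forall (a : R[i]) x y, Z (a *: x + y) = (a^*)%C *: Z x + Z y.

Definition qf x := ⟪x, Z x⟫.

Lemma anti0 : Z 0 = 0.
Proof. by have := Zl (-1) 0 0; rewrite scaler0 addr0 JN J1 scaleN1r addNr. Qed.

Lemma antiZ (a : R[i]) x : Z (a *: x) = (a^*)%C *: Z x.
Proof. by have := Zl a x 0; rewrite anti0 !addr0. Qed.

Lemma antiD x y : Z (x + y) = Z x + Z y.
Proof. by have := Zl 1 x y; rewrite J1 !scale1r. Qed.

Lemma anti_sum I (s : seq I) (P : pred I) (f : I -> H) :
  Z (\sum_(i <- s | P i) f i) = \sum_(i <- s | P i) Z (f i).
Proof. by apply: (big_morph Z antiD anti0). Qed.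

(** As Z is antilinear, <x, Z x> is conjugate-quadratic in x: in coordinates it is the pairing of x
    (x) x with the matrix <e_k, Z e_l>, whose norm is the Hilbert-Schmidt norm of Z. *)
Lemma fvec_quadratic : exists p, fvec qf 2 e2 p.
Proof.
apply: fvec_exists; first exact: hsb_ge0 hZ.
move=> n a x; have [m [e [oe ex]]] := gram_schmidt_fun x.
have h := dbl_sum_CS a (fun k i => ⟪e k, x i⟫) (fun k i => ⟪e k, x i⟫) (fun k l => ⟪e k, Z (e l)⟫).
have -> : \sum_i (a i)^*%C * qf (x i) = \sum_i (a i)^*%C * (\sum_k \sum_l
    (⟪e k, x i⟫)^*%C * (⟪e l, x i⟫)^*%C * ⟪e k, Z (e l)⟫).
  apply: eq_bigr => i _; congr (_ * _); rewrite /qf -{1 2}(ex i) /oproj inner_suml.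
  apply: eq_bigr => k _; rewrite innerZl anti_sum inner_sumr mulr_sumr; apply: eq_bigr => l _.
  by rewrite antiZ innerZr; ring.
have -> : \sum_i \sum_j (a i)^*%C * a j * ⟪x i, x j⟫ ^+ 2 =
    \sum_i \sum_j (a i)^*%C * a j * ((\sum_k (⟪e k, x i⟫)^*%C * ⟪e k, x j⟫) *
      (\sum_l (⟪e l, x i⟫)^*%C * ⟪e l, x j⟫)).
  apply: eq_bigr => i _; apply: eq_bigr => j _.
  by rewrite (inner_ons (x i) (ex j)) expr2.
apply: le_trans h _; apply: ler_wpM2r.
  have := gram_cn_ge0 2 a x; congr (0 <= Re _).
  apply: eq_bigr => i _; apply: eq_bigr => j _.
  by rewrite (inner_ons (x i) (ex j)) expr2.
apply: le_trans (hZ oe); rewrite exchange_big; apply: ler_sum => l _; exact: bessel.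
Qed.

End Quadratic.
End FockVectors.

(** * The squeezed vacuum and its Gaussian expectations *)

Section Squeezed.
Variables (R : realType) (H : hilbertType R) (F : fock_space H) (W : H -> F -> F).
Hypothesis hW : weyl_operators W.
Implicit Types (x y z : H) (u v w : F).

Local Notation coh := (coherent F).
Local Notation vac := (vac F).

Lemma pow_fact_le (t : R) n : 0 <= t -> t ^+ n / n`!%:R <= expR t.
Proof.
move=> t0; case: n => [|n]; first by rewrite expr0 fact0 divr1 -expR0 ler_expR.
by apply: le_trans (expR_ge1Dxn n t0); rewrite lerDr.
Qed.

Lemma cexp_series0 (a : nat -> R[i]) : ccvg (psum a 0) (a 0%N).
Proof.
move=> e e0; exists 1%N => -[//|n] _.
rewrite /psum big_ord_recl expr0 mul1r big1 ?addr0 ?subrr ?nc0// => i _.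
by rewrite expr0n mul0r.
Qed.

Lemma cexp_series x (z : R[i]) : (x = 0 -> z = 0) ->
  ccvg (psum (fun k => (k`!%:R^-1)%:C%C) z) (cexp z).
Proof.
have [x0 h|x0 _] := eqVneq x 0.
  rewrite (h x0) cexp0; have := cexp_series0 (fun k => (k`!%:R^-1)%:C%C).
  by rewrite fact0 invr1.
pose e := (hn x)^-1%:C%C *: x.
have e1 : n2 e = 1 by rewrite n2Z sqcC -hn2 -exprMn mulVf ?hn_eq0// expr1n.
have := inner_coherent_ccvg (coh e) e z.
rewrite (inner_coherent hW) innerZr inner_n2 e1 mulr1.
apply: ccvg_eq => n; apply: eq_bigr => k _; congr (_ * _).
by rewrite innerC inner_cn_coherent inner_n2 n2_cn e1 expr1n JC mul1r.
Qed.

Lemma bin_le_exp2 n k : ('C(n, k) <= 2 ^ n)%N.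
Proof.
elim: n k => [|n ih] [|k]; rewrite ?bin0 ?expn_gt0//.
by rewrite binS expnS mul2n -addnn leq_add.
Qed.

Lemma fact_add_le a b : ((a + b)`! <= 2 ^ (a + b) * (a`! * b`!))%N.
Proof.
have h : (a <= a + b)%N by exact: leq_addr.
by rewrite -(bin_fact h) addKn leq_mul2r bin_le_exp2 orbT.
Qed.

Lemma ccvgJ (a : nat -> R[i]) l : ccvg a l -> ccvg (fun n => (a n)^*%C) (l^*)%C.
Proof. by move=> h e /h[N hN]; exists N => n /hN; rewrite -rmorphB ncJ. Qed.

Variables (Z : H -> H) (M : R).
Hypotheses (Zs : forall x y, ⟪x, Z y⟫ = ⟪y, Z x⟫) (hZ : hsb Z M) (M1 : 16 * M <= 1).
Hypothesis Zl : forall (a : R[i]) x y, Z (a *: x + y) = (a^*)%C *: Z x + Z y.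

Local Notation q := (qf Z).

(** The factorial of the particle number is split by (a + b)! <= 2^(a + b) a! b!, first into n! and
    (2 N)!, then (2 N)! into N! N!. The squared norm becomes (2 |y|^2)^n / n! times 4^-N times (16
    M)^N, which is where 16 M <= 1 comes from. *)
Lemma squeezed_term y n N : exists p : F,
  hn p <= Num.sqrt ((2 * n2 y) ^+ n / n`!%:R) * 2^-1 ^+ N /\
  forall x, ⟪coh x, p⟫ = (⟪x, y⟫ ^+ n * (n`!%:R^-1)%:C%C) * ((q x / 2) ^+ N * (N`!%:R^-1)%:C%C).
Proof.
have M0 := hsb_ge0 hZ.
have [p1 h1] := fvecX n (n2_ge0 y) (fvec_linear F y).
have [p0 hp0] := fvec_quadratic F hZ Zl.
have [p2 h2] := fvecX N M0 hp0.
have [p [np _ cp]] := fvecM (exprn_ge0 _ (n2_ge0 y)) (exprn_ge0 _ M0) h1 h2.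
pose c : R := n`!%:R^-1 * (N`!%:R^-1 * 2^-1 ^+ N).
have c0 : 0 <= c by rewrite !mulr_ge0 ?exprn_ge0 ?invr_ge0.
have t0 : 0 <= (2 * n2 y) ^+ n / n`!%:R by rewrite divr_ge0 ?exprn_ge0 ?mulr_ge0 ?n2_ge0.
exists (c%:C%C *: p); split; last first.
  move=> x; rewrite innerZr cp /c !realCM rmorphXn/= exprMn.
  have -> : (2^-1)%:C%C = 2^-1 :> R[i] by rewrite fmorphV/= rmorph_nat.
  by ring.
have h0 : 0 <= Num.sqrt ((2 * n2 y) ^+ n / n`!%:R) * 2^-1 ^+ N.
  by rewrite mulr_ge0 ?sqrtr_ge0 ?exprn_ge0 ?invr_ge0.
rewrite hn_le// n2Z sqcC [leRHS]exprMn sqr_sqrtr//.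
rewrite muln1 in np.
have f1 : (n + N * 2)`!%:R <= 2 ^+ n * 2 ^+ (2 * N) * (n`!%:R * (2 ^+ (2 * N) * (N`!%:R * N`!%:R))) :> R.
  rewrite -exprD -!natrX -!natrM ler_nat; apply: leq_trans (fact_add_le _ _) _.
  rewrite [(N * 2)%N]mulnC leq_mul2l leq_mul2l; apply/orP; right; apply/orP; right.
  by rewrite mul2n -addnn; exact: fact_add_le.
apply: le_trans (ler_wpM2l (sqr_ge0 _) np) _.
have P0 : 0 <= n2 y ^+ n * M ^+ N by rewrite mulr_ge0 ?exprn_ge0 ?n2_ge0.
apply: le_trans (ler_wpM2l (sqr_ge0 _) (ler_wpM2l P0 f1)) _.
have fn := @fact_gt0R R n; have fN := @fact_gt0R R N.
have -> : c ^+ 2 * (n2 y ^+ n * M ^+ N * (2 ^+ n * 2 ^+ (2 * N) * (n`!%:R * (2 ^+ (2 * N) * (N`!%:R * N`!%:R))))) =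
   (2 * n2 y) ^+ n / n`!%:R * ((2^-1 ^+ N) ^+ 2 * (2 ^+ N * 2 ^+ N * (2 ^+ N * 2 ^+ N) * M ^+ N)).
  rewrite /c mul2n -addnn !exprD [(2 * _) ^+ n]exprMn.
  move: (n`!%:R) fn (N`!%:R) fN (n2 y ^+ n) (M ^+ N) (2 ^+ n : R) (2 ^+ N : R) (2^-1 ^+ N : R).
  move=> f f0 g g0 a b d e h; field.
  by rewrite !gt_eqF.
apply: ler_wpM2l => //; rewrite -[leRHS]mulr1 ler_wpM2l ?sqr_ge0// -!exprMn.
apply: exprn_ile1; first by rewrite !mulr_ge0.
by apply: le_trans M1; rewrite le_eqVlt; apply/orP; left; apply/eqP; ring.
Qed.

(** Summing over N exponentiates q / 2. The decay 4^-n is bought by (2 s)^n / n! = 16^-n (32 s)^n /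
    n! <= 16^-n exp (32 s), with s = |y|^2; the Cauchy product needs it. *)
Lemma squeezed_coeff y n : exists p : F,
  hn p <= 2 * Num.sqrt (expR (32 * n2 y)) * 4^-1 ^+ n /\
  forall x, ⟪coh x, p⟫ = (⟪x, y⟫ ^+ n * (n`!%:R^-1)%:C%C) * cexp (q x / 2).
Proof.
have /choice[u hu] N := squeezed_term y n N.
have [p [np hp]] := vector_series (sqrtr_ge0 _) (fun N => (hu N).1).
exists p; split.
  apply: le_trans np _; rewrite -mulrA ler_wpM2l//.
  have q4 : (4^-1 : R) ^+ n = Num.sqrt (4^-1 ^+ n * 4^-1 ^+ n).
    by rewrite -expr2 sqrtr_sqr ger0_norm// exprn_ge0 ?invr_ge0.
  rewrite q4 -sqrtrM ?expR_ge0// ler_wsqrtr//.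
  have t0 : 0 <= 32 * n2 y by rewrite mulr_ge0 ?n2_ge0.
  apply: le_trans (ler_wpM2r _ (pow_fact_le n t0)); last first.
    by rewrite mulr_ge0 ?exprn_ge0 ?invr_ge0.
  rewrite mulrAC ler_wpM2r ?invr_ge0// -!exprMn le_eqVlt; apply/orP; left; apply/eqP.
  by congr (_ ^+ _); field.
move=> x; apply: ccvg_unique (hp (coh x)) _.
have x0 : x = 0 -> q x / 2 = 0 by move=> ->; rewrite /qf inner0l mul0r.
apply: ccvg_eq (ccvgM (ccvg_cst (⟪x, y⟫ ^+ n * (n`!%:R^-1)%:C%C)) (cexp_series x0)) => N.
by rewrite /psum mulr_sumr; apply: eq_bigr => k _; rewrite (hu k).2.
Qed.

Lemma weyl_squeezed (E : F) : (forall x, ⟪coh x, E⟫ = cexp (q x / 2)) -> forall z x,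
  ⟪coh x, W z E⟫ = cexp (⟪x, (imI * (Num.sqrt 2)^-1%:C%C) *: (z + Z z)⟫ + q x / 2 - ⟪z, z + Z z⟫ / 4).
Proof.
move=> hE z x; rewrite -{1}(opprK z) -(weyl_adj hW) (weyl_coherent hW) innerZl hE -cexpJ -cexpD.
congr cexp; rewrite /iskap scalerN; set s := (imI * _).
have s2 : s * s = - (2^-1).
  rewrite /s mulrACA imI2 -rmorphM/= -invfM sqrt2_sq fmorphV/= rmorph_nat; ring.
have sJ : (s^*)%C = - s by rewrite /s JM J_imI JC mulNr.
have Zss : Z (s *: z) = (- s) *: Z z by rewrite (antiZ Zl) sJ.
have ZB a b : Z (a - b) = Z a - Z b.
  by rewrite (antiD Zl) -scaleN1r (antiZ Zl) JN J1 scaleN1r.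
have e1 : ⟪s *: z, Z x⟫ = - s * ⟪x, Z z⟫ by rewrite -Zs Zss innerZr.
have e2 : ⟪s *: z, Z (s *: z)⟫ = s * s * ⟪z, Z z⟫ by rewrite Zss innerZl innerZr sJ; ring.
rewrite JD JC JM sJ n2N -innerC innerNr /qf ZB !(innerDl, innerNl, innerDr, innerNr, innerZr) e1 e2 s2.
rewrite Zss innerZr inner_n2.
have -> : (- (n2 z / 4))%:C%C = - ((n2 z)%:C%C / 4) :> R[i].
  by rewrite rmorphN rmorphM/= fmorphV/= rmorph_nat.
by field.
Qed.

(** E is exp (q / 2) applied to the vacuum. Replace r by t r with complex t: after removal of the
    Gaussian factor in |t|^2 the expectation m (t) is a power series in t, while W (- z) = W (z)^*
    gives m (- t) = conj (m t). So m is constant, and m 1 = m 0 = |E|^2; no determinant is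
    computed. *)
Lemma squeezed_vacuum : exists E : F, E <> 0 /\ forall r,
  ⟪E, W (r - Z r) E⟫ = (n2 E * expR (- ((n2 r - n2 (Z r)) / 4)))%:C%C.
Proof.
have [E [_ hE0]] := squeezed_coeff 0 0.
have hE x : ⟪coh x, E⟫ = cexp (q x / 2).
  by rewrite hE0 expr0 fact0 invr1 !mul1r.
exists E; split.
  move=> E0; have := hE 0; rewrite E0 inner0r => /eqP.
  by rewrite eq_sym (negbTE (cexp_neq0 _)).
move=> r; have [->|r0] := eqVneq r 0.
  by rewrite (anti0 Zl) subrr n2_0 subrr mul0r oppr0 expR0 mulr1 (weyl0 hW) inner_n2.
(* For z = t r - Z (t r) the antilinear parts of z + Z z cancel: z + Z z = t (r - Z (Z r)), so
   [weyl_squeezed] depends on t through t [y]. *)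
pose y := (imI * (Num.sqrt 2)^-1%:C%C) *: (r - Z (Z r)).
have /choice[B hB] n := squeezed_coeff y n.
pose A := 2 * Num.sqrt (expR (32 * n2 y)).
have A0 : 0 <= A by rewrite mulr_ge0 ?sqrtr_ge0.
pose zz (t : R[i]) := t *: r - Z (t *: r).
pose ka := n2 r - n2 (Z r); pose la := ⟪Z r, r - Z (Z r)⟫.
have Zz t : zz t + Z (zz t) = t *: (r - Z (Z r)).
  have ZB a b : Z (a - b) = Z a - Z b.
    by rewrite (antiD Zl) -scaleN1r (antiZ Zl) JN J1 scaleN1r.
  by rewrite /zz ZB !(antiZ Zl) conjcK scalerBr addrA subrK.
have zzE t : ⟪zz t, zz t + Z (zz t)⟫ = (sqc t * ka)%:C%C - t * t * la.
  rewrite Zz innerZr /zz (antiZ Zl) innerBl !innerZl JK -/la innerBr inner_n2 Zs inner_n2.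
  rewrite realCM sqcE /ka rmorphB/=; ring.
have wE t x : ⟪coh x, W (zz t) E⟫ =
    cexp (t * ⟪x, y⟫) * cexp (q x / 2) * (cexp (- (sqc t * ka / 4))%:C%C * cexp (t * t * la / 4)).
  rewrite (weyl_squeezed hE) zzE Zz -!cexpD; congr cexp.
  rewrite scalerA mulrC -scalerA innerZr -/y.
  have -> : (- (sqc t * ka / 4))%:C%C = - ((sqc t * ka)%:C%C / 4) :> R[i].
    by rewrite rmorphN rmorphM/= fmorphV/= rmorph_nat.
  by ring.
pose a n := ⟪E, B n⟫.
have ha n : nc (a n) <= hn E * A * 4^-1 ^+ n.
  by apply: le_trans (nc_inner _ _) _; rewrite -mulrA ler_wpM2l ?hn_ge0 ?(hB n).1.
(* The coefficients of [cexp (t * t * la / 4)], which has even powers only. *)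
pose b n : R[i] := if odd n then 0 else (la / 4) ^+ n./2 * (n./2`!%:R^-1)%:C%C.
have hb n : nc (b n) <= expR (4 * nc la) * 4^-1 ^+ n.
  rewrite /b; case: ifP => on; first by rewrite nc0 mulr_ge0 ?expR_ge0 ?exprn_ge0 ?invr_ge0.
  have nE : n = (n./2 + n./2)%N by rewrite -{1}(odd_double_half n) on add0n addnn.
  have -> : (4^-1 : R) ^+ n = 4^-1 ^+ n./2 * 4^-1 ^+ n./2 by rewrite -exprD -nE.
  have t0 : 0 <= 4 * nc la by rewrite mulr_ge0 ?nc_ge0.
  apply: le_trans (ler_wpM2r _ (pow_fact_le n./2 t0)); last by rewrite mulr_ge0 ?exprn_ge0 ?invr_ge0.
  have n4 : nc (4^-1) = 4^-1 :> R.
    have -> : 4^-1 = (4^-1)%:C%C :> R[i] by rewrite fmorphV/= rmorph_nat.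
    by rewrite ncC ger0_norm// invr_ge0.
  rewrite ncM ncX ncM ncC (ger0_norm (_ : 0 <= n./2`!%:R^-1)) ?invr_ge0// n4.
  rewrite mulrAC ler_wpM2r ?invr_ge0// -!exprMn le_eqVlt; apply/orP; left; apply/eqP.
  by congr (_ ^+ _); field.
have cb t : ccvg (psum b t) (cexp (t * t * la / 4)).
  have := @cexp_series r (t * t * la / 4) (fun h => False_ind _ (elimN eqP r0 h)).
  set f := (fun k : nat => _); set w := _ / 4 => hf.
  have bE N : psum b t N = psum f w (uphalf N).
    elim: N => [|N ih]; first by rewrite /psum !big_ord0.
    rewrite {1}/psum big_ord_recr/= -/(psum b t N) ih /b uphalf_half.
    case: ifP => oN; first by rewrite mulr0 addr0.
    rewrite add0n /psum big_ord_recr/=; congr (_ + _); rewrite /f mulrA; congr (_ * _).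
    by rewrite -{1}(odd_double_half N) oN add0n -mul2n exprM -exprMn /w; congr (_ ^+ _); ring.
  move=> e /hf[N hN]; exists (N + N)%N => n Nn; rewrite bE; apply: hN.
  by rewrite uphalf_half; apply: leq_trans (leq_addl _ _); rewrite -(doubleK N) -addnn half_leq.
pose c n := \sum_(i < n.+1) a i * b (n - i)%N.
pose m t := cexp (sqc t * ka / 4)%:C%C * ⟪E, W (zz t) E⟫.
have cm t : nc t <= 1 -> ccvg (psum c t) (m t).
  move=> t1.
  have [|v [_ hv]] := @vector_series R F (fun n => t ^+ n *: B n) A A0.
    move=> n; rewrite hnZ ncX; apply: le_trans (_ : 1 * (A * 4^-1 ^+ n) <= _).
      by apply: ler_pM; rewrite ?exprn_ge0 ?hn_ge0 ?nc_ge0 ?exprn_ile1 ?nc_ge0// (hB n).1.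
    by rewrite mul1r ler_wpM2l// lerXn2r// ?nnegrE ?invr_ge0// lef_pV2 ?posrE// ler_nat.
  have vE x : ⟪coh x, v⟫ = cexp (t * ⟪x, y⟫) * cexp (q x / 2).
    apply: ccvg_unique (hv _) _.
    have x0 : x = 0 -> t * ⟪x, y⟫ = 0 by move=> ->; rewrite inner0l mulr0.
    apply: ccvg_eq (ccvgM (cexp_series x0) (ccvg_cst (cexp (q x / 2)))) => N.
    rewrite /psum mulr_suml; apply: eq_bigr => k _; rewrite innerZr (hB k).2 exprMn; ring.
  have wv : W (zz t) E = (cexp (- (sqc t * ka / 4))%:C%C * cexp (t * t * la / 4)) *: v.
    apply/eqP; rewrite -subr_eq0; apply/eqP; apply: (@coherent_total _ _ F) => x.
    by rewrite innerC innerBr innerZr wE vE mulrC subrr J0.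
  have -> : m t = ⟪E, v⟫ * cexp (t * t * la / 4).
    rewrite /m wv innerZr rmorphN.
    have := cexpK (sqc t * ka / 4)%:C%C; set e1 := cexp _; set e2 := cexp (- _) => e12.
    by rewrite -mulrA mulrA e12 mul1r mulrC.
  apply: ccvg_psum_cauchy ha hb t1 _ (cb t).
  by apply: ccvg_eq (hv E) => N; apply: eq_bigr => k _; rewrite innerZr.
have mJ t : m (- t) = (m t)^*%C.
  have zN : zz (- t) = - zz t by rewrite /zz !(antiZ Zl) rmorphN !scaleNr opprD.
  by rewrite /m sqcN zN -(weyl_adj hW) JM cexpC JC -innerC.
have c0 : forall n, c n.+1 = 0.
  pose C1 := hn E * A; pose C2 := expR (4 * nc la).
  have C10 : 0 <= C1 by rewrite mulr_ge0 ?hn_ge0.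
  have C20 : 0 <= C2 by exact: expR_ge0.
  have q0 (k : nat) : 0 <= (4^-1 : R) ^+ k by rewrite exprn_ge0 ?invr_ge0.
  have cbd n : nc (c n) <= C1 * C2.
    apply: le_trans (nc_sum _ _ _) _.
    apply: le_trans (_ : \sum_(i < n.+1) C1 * C2 * 4^-1 ^+ n <= _).
      apply: ler_sum => i _; rewrite ncM; apply: le_trans (ler_pM (nc_ge0 _) (nc_ge0 _) (ha _) (hb _)) _.
      have in_ : (i <= n)%N by rewrite -ltnS.
      have -> : (4^-1 : R) ^+ n = 4^-1 ^+ i * 4^-1 ^+ (n - i) by rewrite -exprD subnKC.
      rewrite -/C1 -/C2 le_eqVlt; apply/orP; left; apply/eqP; ring.
    rewrite sumr_const card_ord.
    apply: le_trans (_ : C1 * C2 * (4^-1 ^+ n * n.+1%:R) <= _); first by rewrite mulrA mulr_natr.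
    rewrite -[leRHS]mulr1; apply: ler_wpM2l; first exact: mulr_ge0.
    rewrite exprVn mulrC ler_pdivrMr ?exprn_gt0// mul1r -natrX ler_nat.
    by apply: ltn_expl.
  apply: (@holomorphic_antiholomorphic R c (fun n => (c n)^*%C) (C1 * C2) (C1 * C2) (fun t => m (- t))).
  - exact: cbd.
  - by move=> n; rewrite ncJ.
  - by move=> t t1; apply: cm; rewrite ncN.
  - move=> t t1; rewrite mJ; apply: ccvg_eq (ccvgJ (cm t t1)) => N.
    by rewrite /psum rmorph_sum; apply: eq_bigr => k _; rewrite rmorphM rmorphXn.
have mc t : nc t <= 1 -> m t = c 0%N.
  move=> /cm ct; apply: ccvg_unique ct _ => e e0; exists 1%N => -[//|n] _.
  by rewrite /psum big_ord_recl expr0 mul1r big1 ?addr0 ?subrr ?nc0// => i _; rewrite c0 mulr0.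
have m1 : m 1 = m 0 by rewrite !mc ?nc0 ?nc1 ?ler01.
move: m1; rewrite /m /zz scale0r scale1r (anti0 Zl) subrr (weyl0 hW) inner_n2.
have -> : sqc 1 = 1 :> R by rewrite (sqcC 1) expr1n.
have -> : sqc 0 = 0 :> R by rewrite (sqcC 0) expr0n.
rewrite !mul0r mul1r cexp0 mul1r cexpC -/ka => h.
by rewrite realCM -h [RHS]mulrC mulrA -rmorphM/= -expRD addNr expR0 mul1r.
Qed.

End Squeezed.

(** * Intertwiners from Gaussian noise *)

Section RealLimits.
Variable R : realType.

Lemma deriv_ge0_le (f df : R -> R) : (forall x : R, is_derive x 1 f (df x)) ->
  (forall x, 0 <= x -> 0 <= df x) -> forall x, 0 <= x -> f 0 <= f x.
Proof.
move=> hd h x x0; have [|c] := @MVT_segment R f df 0 x x0 (fun y _ => hd y).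
  apply: derivable_within_continuous => y _; exact: (@ex_derive _ _ _ _ _ _ _ (hd y)).
rewrite in_itv/= subr0 => /andP[c0 _] e.
by rewrite -subr_ge0 e mulr_ge0 ?h.
Qed.

Lemma sin_le_id (x : R) : 0 <= x -> sin x <= x.
Proof.
move=> x0; have := @deriv_ge0_le (fun y => y - sin y) (fun y => 1 - cos y) _ _ x x0.
rewrite sin0 subrr subr_ge0; apply.
by move=> y _; rewrite subr_ge0 cos_le1.
Qed.

Lemma cos_ge_quad (x : R) : 0 <= x -> 1 - x ^+ 2 / 2 <= cos x.
Proof.
move=> x0; have := @deriv_ge0_le (fun y => cos y + 2^-1 *: y ^+ 2) (fun y => y - sin y) _ _ x x0.
rewrite cos0 expr0n/= scaler0 addr0 /GRing.scale/= => h.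
suff : 1 <= cos x + 2^-1 * x ^+ 2 by lra.
apply: h; first move=> y.
  by apply: is_derive_eq; rewrite /GRing.scale/=; field.
by move=> y y0; rewrite subr_ge0 sin_le_id.
Qed.

Lemma sin_ge_cubic (x : R) : 0 <= x -> x - x ^+ 3 / 6 <= sin x.
Proof.
move=> x0; have := @deriv_ge0_le (fun y => sin y - y + 6^-1 *: y ^+ 3)
  (fun y => cos y - 1 + y ^+ 2 / 2) _ _ x x0.
rewrite sin0 expr0n/= scaler0 !addr0 /GRing.scale/= subrr => h.
suff : 0 <= sin x - x + 6^-1 * x ^+ 3 by lra.
apply: h; first move=> y.
  by apply: is_derive_eq; rewrite /GRing.scale/=; field.
by move=> y y0; have := cos_ge_quad y0; lra.
Qed.

Lemma cos_le_quart (x : R) : 0 <= x -> cos x <= 1 - x ^+ 2 / 2 + x ^+ 4 / 24.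
Proof.
move=> x0; have := @deriv_ge0_le (fun y => 24^-1 *: y ^+ 4 - 2^-1 *: y ^+ 2 - cos y)
  (fun y => y ^+ 3 / 6 - y + sin y) _ _ x x0.
rewrite cos0 !expr0n/= !scaler0 subr0 /GRing.scale/= => h.
suff : 0 - 1 <= 24^-1 * x ^+ 4 - 2^-1 * x ^+ 2 - cos x by lra.
apply: h; first move=> y.
  by apply: is_derive_eq; rewrite /GRing.scale/=; field.
by move=> y y0; have := sin_ge_cubic y0; lra.
Qed.

Lemma cos_gauss (x : R) : `|cos x - expR (- (x ^+ 2 / 2))| <= (x ^+ 2 / 2) ^+ 2.
Proof.
wlog x0 : x / 0 <= x => [h|].
  have [/h//|/ltW x0] := leP 0 x.
  by have := h (- x); rewrite cosN sqrrN; apply; rewrite oppr_ge0.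
have h1 := cos_ge_quad x0; have h2 := cos_le_quart x0.
have h3 := @expR_ge1Dx R (- (x ^+ 2 / 2)).
have h4 : expR (- (x ^+ 2 / 2)) <= 1 - x ^+ 2 / 2 + (x ^+ 2 / 2) ^+ 2.
  have u0 : 0 <= x ^+ 2 / 2 by rewrite divr_ge0 ?sqr_ge0.
  move: (x ^+ 2 / 2) u0 => u u0; rewrite expRN.
  have e1 := @expR_ge1Dx R u; have e0 : 0 < expR u by exact: expR_gt0.
  rewrite -(ler_pM2r e0) mulVf ?gt_eqF//.
  have q0 : 0 <= 1 - u + u ^+ 2 by nra.
  have := ler_wpM2l q0 e1; nra.
have e4 : x ^+ 4 = (x ^+ 2) ^+ 2 by rewrite -exprM.
rewrite e4 in h2; move: (x ^+ 2) h1 h2 h3 h4 => y *.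
by rewrite ler_norml; apply/andP; split; nra.
Qed.

Lemma pow_dist (a b : R) n : `|a| <= 1 -> `|b| <= 1 -> `|a ^+ n - b ^+ n| <= n%:R * `|a - b|.
Proof.
move=> a1 b1; elim: n => [|n ih]; first by rewrite !expr0 subrr normr0 mul0r.
have -> : a ^+ n.+1 - b ^+ n.+1 = (a - b) * a ^+ n + b * (a ^+ n - b ^+ n).
  by rewrite !exprS; ring.
apply: le_trans (ler_normD _ _) _; rewrite !normrM -natr1 mulrDl mul1r addrC lerD//.
  by rewrite -[leRHS]mul1r; apply: ler_pM.
by rewrite -[leRHS]mulr1 ler_wpM2l// normrX exprn_ile1.
Qed.

(** Central limit theorem for random signs: each of the m + 1 factors is off by a multiple of (m +
    1)^-2. *)
Lemma cos_gauss_limit (t : R) :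
  (fun m => cos ((Num.sqrt m.+1%:R)^-1 * t) ^+ m.+1) @ \oo --> expR (- (t ^+ 2 / 2)).
Proof.
apply/rcvgP => e e0.
have p0 : 0 < t ^+ 2 * t ^+ 2 + 1 by apply: ltr_wpDl => //; apply: mulr_ge0; exact: sqr_ge0.
have [N hN] := inv_nat_small (divr_gt0 e0 p0); exists N => m /hN hm.
have m0 : 0 < m.+1%:R :> R by [].
set x := _ * t; have x2 : x ^+ 2 / 2 = m.+1%:R^-1 * (t ^+ 2 / 2).
  by rewrite /x exprMn exprVn sqr_sqrtr ?ler0n// -mulrA.
have -> : expR (- (t ^+ 2 / 2)) = expR (- (x ^+ 2 / 2)) ^+ m.+1.
  by rewrite -expRM_natl x2 mulrN mulrA mulfV ?mul1r// gt_eqF.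
have a1 : `|cos x| <= 1 by exact: cos_max.
have b1 : `|expR (- (x ^+ 2 / 2))| <= 1.
  by rewrite ger0_norm ?expR_ge0// -expR0 ler_expR oppr_le0 divr_ge0 ?sqr_ge0.
apply: le_lt_trans (pow_dist _ a1 b1) _.
apply: le_lt_trans (ler_wpM2l (ltW m0) (cos_gauss x)) _.
rewrite x2 ltr_pdivlMr// in hm *.
have -> : m.+1%:R * (m.+1%:R^-1 * (t ^+ 2 / 2)) ^+ 2 = m.+1%:R^-1 * (t ^+ 2 * t ^+ 2 / 4).
  by field; rewrite gt_eqF.
apply: le_lt_trans hm; apply: ler_wpM2l; first by rewrite invr_ge0 ltW.
have := sqr_ge0 (t ^+ 2); rewrite expr2; move: (t ^+ 2 * t ^+ 2) => y; lra.
Qed.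

Lemma rcvg_sum I (s : seq I) (f : I -> nat -> R) (l : I -> R) : (forall i, f i @ \oo --> l i) ->
  (fun n => \sum_(i <- s) f i n) @ \oo --> \sum_(i <- s) l i.
Proof.
move=> h; elim: s => [|i s ih].
  by under eq_fun do rewrite big_nil; rewrite big_nil; exact: cvg_cst.
by under eq_fun do rewrite big_cons; rewrite big_cons; exact: cvgD.
Qed.

Lemma rcvg_prod I (s : seq I) (f : I -> nat -> R) (l : I -> R) : (forall i, f i @ \oo --> l i) ->
  (fun n => \prod_(i <- s) f i n) @ \oo --> \prod_(i <- s) l i.
Proof.
move=> h; elim: s => [|i s ih].
  by under eq_fun do rewrite big_nil; rewrite big_nil; exact: cvg_cst.
by under eq_fun do rewrite big_cons; rewrite big_cons; exact: cvgM.
Qed.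

Lemma rcvg_near_le (u : nat -> R) (l e : R) : u @ \oo --> l -> 0 < e ->
  exists N, forall n, (N <= n)%N -> u n <= l + e.
Proof.
move=> /rcvgP h /h[N hN]; exists N => n /hN; rewrite ltr_distl => /andP[_ /ltW//].
Qed.

End RealLimits.

(** * Sums with random signs *)

Section Signs.
Variables (R : realType) (H : hilbertType R).
Implicit Types (x y b : H) (bs : seq H).

(** All values of the sum of the [b] with independent signs, listed with multiplicity, so that
    averages over the list are expectations. *)
Fixpoint signs bs : seq H :=
  if bs is b :: bs' then [seq b + x | x <- signs bs'] ++ [seq x - b | x <- signs bs'] else [:: 0].

Lemma size_signs bs : size (signs bs) = (2 ^ size bs)%N.
Proof. by elim: bs => //= b bs ih; rewrite size_cat !size_map ih addnn -mul2n -expnS. Qed.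

Lemma signs_char bs h :
  \sum_(x <- signs bs) expIR (rip h x) = ((2 ^+ size bs) * \prod_(b <- bs) cos (rip h b))%:C%C.
Proof.
elim: bs => [|b bs ih] /=.
  by rewrite big_seq1 rip0r expIR0 big_nil mulr1.
rewrite big_cat !big_map/= big_cons.
transitivity ((2 * cos (rip h b))%:C%C * \sum_(x <- signs bs) expIR (rip h x)).
  rewrite mulr_sumr -big_split/=; apply: eq_bigr => x _.
  rewrite ripDr ripBr !expIRD mulrC -mulrDr mulrC; congr (_ * _).
  by rewrite expIRN; apply: complex_ext; rewrite !reim /=; ring.
by rewrite ih -realCM exprS; congr (_%:C)%C; ring.
Qed.

Lemma signs_n2 bs : \sum_(x <- signs bs) n2 x = 2 ^+ size bs * \sum_(b <- bs) n2 b.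
Proof.
elim: bs => [|b bs ih] /=; first by rewrite big_seq1 n2_0 big_nil mulr0.
rewrite big_cat !big_map/= big_cons -big_split/=.
transitivity (\sum_(x <- signs bs) (2 * n2 b + 2 * n2 x)).
  apply: eq_bigr => x _; rewrite addrC -parallelogram addrC; congr (_ + _).
  exact: n2BC.
rewrite big_split/= -[X in _ + X]mulr_sumr ih big_const_seq count_predT iter_addr addr0 size_signs.
by rewrite -[_ *+ (2 ^ _)%N]mulr_natr natrX exprS; ring.
Qed.

(** Jensen for s |-> exp (- C s), by its tangent at the mean of [n2], which is the sum of the
    [n2 b]. *)
Lemma signs_jensen (C : R) bs :
  2 ^+ size bs * expR (- (C * \sum_(b <- bs) n2 b)) <= \sum_(x <- signs bs) expR (- (C * n2 x)).
Proof.
set c := - (C * _).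
apply: le_trans (_ : \sum_(x <- signs bs) expR c * (1 + (- (C * n2 x) - c)) <= _); last first.
  apply: ler_sum => x _; apply: le_trans (_ : expR c * expR (- (C * n2 x) - c) <= _); last by rewrite -expRD addrC subrK.
  by rewrite ler_wpM2l ?expR_ge0// expR_ge1Dx.
rewrite -mulr_sumr big_split/= sumrB sumrN -mulr_sumr signs_n2.
rewrite !big_const_seq !count_predT !iter_addr !addr0 size_signs mulrC ler_wpM2l ?expR_ge0//.
rewrite -[c *+ _]mulr_natr natrX /c le_eqVlt; apply/orP; left; apply/eqP; ring.
Qed.

Lemma n2_average I (s : seq I) (f : I -> H) : (0 < size s)%N ->
  n2 ((size s)%:R^-1%:C%C *: \sum_(x <- s) f x) <= (size s)%:R^-1 * \sum_(x <- s) n2 (f x).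
Proof.
move=> s0; have p0 : 0 < (size s)%:R :> R by rewrite ltr0n.
set mu := _ *: _.
have e : rip mu (\sum_(x <- s) f x) = (size s)%:R * n2 mu.
  rewrite -[X in rip mu X](_ : (size s)%:R%:C%C *: mu = _); last first.
    by rewrite /mu scalerA -rmorphM/= mulfV ?gt_eqF// rmorph1 scale1r.
  by rewrite ripZr rip_n2.
have : 0 <= \sum_(x <- s) n2 (f x - mu) by apply: sumr_ge0 => x _; exact: n2_ge0.
have -> : \sum_(x <- s) n2 (f x - mu) = \sum_(x <- s) n2 (f x) - (size s)%:R * n2 mu.
  transitivity (\sum_(x <- s) (n2 (f x) + n2 mu - 2 * rip mu (f x))).
    by apply: eq_bigr => x _; rewrite n2B (ripC (f x)).
  rewrite sumrB big_split/= -mulr_sumr (_ : \sum_(i <- s) rip mu (f i) = (size s)%:R * n2 mu) ?big_const_seq; last by rewrite -e rip_sumr.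
  rewrite count_predT iter_addr addr0.
  by rewrite -mulr_natr; ring.
by rewrite subr_ge0 mulrC ler_pdivlMl// mulrC.
Qed.

End Signs.

(** * A compactness principle for closed convex sets *)

Section FiniteIntersection.
Variables (R : realType) (H : hilbertType R) (T : Type) (K : T -> set H) (r : R).
Hypotheses (Kmid : forall t x y, K t x -> K t y -> K t ((2^-1)%:C%C *: (x + y)))
  (Kcl : forall t (u : nat -> H) x, (forall n, K t (u n)) -> u @ \oo --> x -> K t x).

Fixpoint allK (s : seq T) (x : H) : Prop := if s is t :: s' then K t x /\ allK s' x else True.

Hypothesis Kfin : forall s, exists x, n2 x <= r /\ allK s x.

Lemma allK_cat s t x : allK (s ++ t) x <-> allK s x /\ allK t x.
Proof. by elim: s => [|a s ih] /=; [tauto|rewrite ih; tauto]. Qed.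

Lemma allK_mid s x y : allK s x -> allK s y -> allK s ((2^-1)%:C%C *: (x + y)).
Proof. by elim: s => //= t s ih [a b] [c d]; split; [exact: Kmid|exact: ih]. Qed.

Let m s := inf [set n2 x | x in allK s].

Let m_has s : has_inf [set n2 x | x in allK s].
Proof.
split; first by have [x [_ h]] := Kfin s; exists (n2 x), x.
by exists 0 => _ [x _ <-]; exact: n2_ge0.
Qed.

Let m_le s x : allK s x -> m s <= n2 x.
Proof. by move=> h; apply: ge_inf; [exact: (m_has s).2|exists x]. Qed.

Let m_near s (e : R) : 0 < e -> exists x, allK s x /\ n2 x < m s + e.
Proof. by move=> e0; have [_ [x h <-] hx] := inf_adherent e0 (m_has s); exists x. Qed.

Let m_r s : m s <= r.
Proof. by have [x [h1 h2]] := Kfin s; apply: le_trans (m_le h2) h1. Qed.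

Let close s x y : allK s x -> allK s y -> n2 (x - y) <= 2 * n2 x + 2 * n2 y - 4 * m s.
Proof.
move=> hx hy; have := m_le (allK_mid hx hy); rewrite n2Z sqcC => h.
have := parallelogram x y; lra.
Qed.

(** Takes the place of weak compactness. Choose finite subfamilies whose minimal square norms
    increase to the supremum M over all of them; by the parallelogram law, almost minimal vectors
    form a Cauchy sequence. *)
Lemma finite_intersection : exists x, forall t, K t x.
Proof.
pose M := sup (range m).
have hM : has_sup (range m).
  by split; [exists (m [::]), [::]|exists r => _ [s _ <-]; exact: m_r].
have mM s : m s <= M by apply: ub_le_sup; [exact: hM.2|exists s].
have d0 n : 0 < n.+1%:R^-1 :> R by rewrite invr_gt0.
have /choice[s' hs'] n : exists s, M - n.+1%:R^-1 < m s.
  by have [_ [s _ <-] h] := sup_adherent (d0 n) hM; exists s.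
pose S := fix S n := if n is n'.+1 then S n' ++ s' n'.+1 else s' 0%N.
have hS n : M - n.+1%:R^-1 < m (S n).
  case: n => [|n]; first exact: hs'.
  apply: lt_le_trans (hs' _) _; apply/ler_addgt0Pr => e e0.
  by have [x [/= /allK_cat[_ h] hx]] := m_near (S n.+1) e0; apply: le_trans (m_le h) (ltW hx).
have anti n k x : (n <= k)%N -> allK (S k) x -> allK (S n) x.
  by move=> /subnK <-; elim: (k - n)%N => // i ih; rewrite addSn /= => /allK_cat[/ih].
have /choice[x hx] n : exists x, allK (S n) x /\ n2 x < m (S n) + n.+1%:R^-1.
  exact: m_near.
have cl n y z : allK (S n) y -> n2 y < M + n.+1%:R^-1 -> allK (S n) z -> n2 z < M + n.+1%:R^-1 ->
    n2 (y - z) < 8 * n.+1%:R^-1.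
  by move=> ay ny az nz; have := close ay az; have := hS n; move: (n.+1%:R^-1) ny nz => d; lra.
have xM n : n2 (x n) < M + n.+1%:R^-1.
  by apply: lt_le_trans (hx n).2 _; rewrite lerD2r.
have dmono n k : (n <= k)%N -> k.+1%:R^-1 <= n.+1%:R^-1 :> R.
  by move=> nk; rewrite lef_pV2 ?posrE// ler_nat ltnS.
have c1 n k : (n <= k)%N -> n2 (x n - x k) < 8 * n.+1%:R^-1.
  move=> nk; apply: (cl n _ _ (hx n).1) => //; first exact: anti nk (hx k).1.
  by apply: lt_le_trans (xM k) _; rewrite lerD2l dmono.
have small (e : R) : 0 < e -> exists N, forall n, (N <= n)%N -> 8 * n.+1%:R^-1 < e ^+ 2.
  move=> e0; have q0 : 0 < e ^+ 2 / 8 by rewrite divr_gt0 ?exprn_gt0.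
  have [N hN] := inv_nat_small q0; exists N => n /hN; rewrite ltr_pdivlMr//; by rewrite mulrC.
have hnlt (e : R) y : 0 < e -> n2 y < e ^+ 2 -> hn y < e.
  by move=> e0 h; rewrite -(@ltr_pXn2r _ 2)// ?nnegrE ?hn_ge0 ?ltW// hn2.
have [|l hl] := @hcomplete _ _ x.
  move=> e e0; have [N hN] := small _ e0; exists N => n k Nn Nk; apply: hnlt => //.
  have [nk|/ltW kn] := leP n k; first exact: lt_trans (c1 _ _ nk) (hN _ Nn).
  by rewrite n2BC; exact: lt_trans (c1 _ _ kn) (hN _ Nk).
exists l => t.
(* Adding one more index t cannot raise the minimum above M, so almost minimal vectors that also
   satisfy t stay close to [x n], and the limit satisfies t. *)
have /choice[y hy] n : exists y, allK (S n ++ [:: t]) y /\ n2 y < m (S n ++ [:: t]) + n.+1%:R^-1.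
  exact: m_near.
apply: (Kcl (u := y)); first by move=> n; have /allK_cat[_ []] := (hy n).1.
apply/hcvgP => e e0; have e2 : 0 < e / 2 by rewrite divr_gt0.
have [N hN] := small _ e2; have [N' hN'] := (hcvgP _ _).1 hl _ e2.
exists (maxn N N') => n; rewrite geq_max => /andP[/hN h1 /hN' h2].
have h3 : hn (y n - x n) < e / 2.
  apply: hnlt => //; apply: lt_trans h1; apply: cl.
  - by have /allK_cat[] := (hy n).1.
  - by apply: lt_le_trans (hy n).2 _; rewrite lerD2r.
  - exact: (hx n).1.
  - exact: xM.
by apply: le_lt_trans (hn_triangle _ (x n) _) _; lra.
Qed.

End FiniteIntersection.

(** * Intertwiners between Gaussian states that differ by noise *)

Section Noise.
Variables (R : realType) (H : hilbertType R) (F : fock_space H) (W : H -> F -> F).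
Hypothesis hW : weyl_operators W.
Variables (P : set H) (i1 i0 : H -> H) (xi xi0 : F) (S M : H -> R) (C0 C1 : R).
Hypotheses (hP : real_subspace P) (r1 : rlin i1) (r0 : rlin i0).
Hypothesis hsym : forall h k, P h -> P k -> Im ⟪i1 h, i1 k⟫ = Im ⟪i0 h, i0 k⟫.
Hypothesis hxi : forall h, P h -> ⟪xi, W (i1 h) xi⟫ = (expR (- (S h / 4)))%:C%C.
Hypothesis hxi0 : forall h, P h -> ⟪xi0, W (i0 h) xi0⟫ = (expR (- ((S h + M h) / 4)))%:C%C.
Hypothesis noise : forall s : seq H, exists a : seq H,
  (forall h, h \in s -> M h = 2 * \sum_(b <- a) rip h b ^+ 2) /\ \sum_(b <- a) n2 b <= C0.
Hypothesis displace : forall a, exists d, (forall h, P h -> Im ⟪i1 h, d⟫ = rip h a) /\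
  expR (- (C1 * n2 a)) <= Re ⟪xi, W d xi⟫.
Hypothesis C10 : 0 <= C1.

Local Notation T := {h | P h}.
Let w1 eta (h : T) := W (i1 (sval h)) eta.
Let w0 (h : T) := W (i0 (sval h)) xi0.

Let PB h k : P h -> P k -> P (k - h).
Proof.
case: hP => _ PD PZ Ph Pk; apply: PD => //.
by have := PZ (-1) _ Ph; rewrite rmorphN rmorph1 scaleN1r.
Qed.

Lemma weyl_commute x y u : W x (W y u) = expIR (- Im ⟪x, y⟫) *: W y (W x u).
Proof.
rewrite !(weyl_mul hW) scalerA -expIRD addrC (innerC x y) reim [y + x]addrC.
by congr (expIR _ *: _); field.
Qed.

Let gram0 h k : P h -> P k -> ⟪W (i0 h) xi0, W (i0 k) xi0⟫ =
  expIR (Im ⟪i1 h, i1 k⟫ / 2) * (expR (- ((S (k - h) + M (k - h)) / 4)))%:C%C.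
Proof. by move=> Ph Pk; rewrite (inner_weyl hW) -rlinB// hxi0 ?hsym//; exact: PB. Qed.

(** A displacement multiplies the correlations of [xi] by a character of h - k; averaging these
    characters adds the noise. *)
Let gram1 h k d a : P h -> P k -> (forall h, P h -> Im ⟪i1 h, d⟫ = rip h a) ->
  ⟪W (i1 h) (W d xi), W (i1 k) (W d xi)⟫ =
  expIR (Im ⟪i1 h, i1 k⟫ / 2) * (expR (- (S (k - h) / 4)))%:C%C * expIR (rip (h - k) a).
Proof.
move=> Ph Pk hd; rewrite !(weyl_commute _ d) innerZl innerZr (weyl_iso hW) (inner_weyl hW).
rewrite -rlinB// hxi; last exact: PB.
rewrite !hd// ripBl expIRD !expIRN JK; ring.
Qed.

(** m + 1 scaled copies keep the total of [n2] and make the product of cosines Gaussian in the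
    limit. *)
Let steps (a : seq H) m := flatten (nseq m.+1 [seq ((Num.sqrt m.+1%:R)^-1 : R)%:C%C *: b | b <- a]).

Let steps_n2 a m : \sum_(b <- steps a m) n2 b = \sum_(b <- a) n2 b.
Proof.
have m0 : m.+1%:R != 0 :> R by rewrite pnatr_eq0.
have -> : \sum_(b <- steps a m) n2 b =
    m.+1%:R * \sum_(b <- [seq ((Num.sqrt m.+1%:R)^-1 : R)%:C%C *: b | b <- a]) n2 b.
  rewrite /steps; move: [seq _ | b <- a] => L.
  elim: {m0} m.+1 => [|k ih]; first by rewrite big_nil mul0r.
  by rewrite /= big_cat/= ih -natr1 mulrDl mul1r addrC.
rewrite big_map mulr_sumr; apply: eq_bigr => b _.
by rewrite n2Z sqcC exprVn sqr_sqrtr ?ler0n// mulrA mulfV ?mul1r.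
Qed.

Let steps_cos a h : (fun m => \prod_(b <- steps a m) cos (rip h b)) @ \oo -->
  expR (- (\sum_(b <- a) rip h b ^+ 2 / 2)).
Proof.
have e m : \prod_(b <- steps a m) cos (rip h b) =
    \prod_(b <- a) cos ((Num.sqrt m.+1%:R)^-1 * rip h b) ^+ m.+1.
  transitivity ((\prod_(b <- a) cos ((Num.sqrt m.+1%:R)^-1 * rip h b)) ^+ m.+1).
    rewrite /steps; elim: {1 4}m.+1 => [|k ih]; first by rewrite big_nil expr0.
    rewrite /= big_cat/= ih exprS big_map; congr (_ * _).
    by apply: eq_bigr => b _; rewrite ripZr.
  by rewrite prodrXl.
under eq_fun do rewrite e.
rewrite -sumrN expR_sum; apply: (rcvg_prod (f := fun b m => _) (l := fun b => _)) => b.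
exact: cos_gauss_limit.
Qed.

(** The closed convex conditions on the vector [eta] sought. [None] bounds its overlap with [xi]
    from below and so keeps it away from 0. *)
Let K (t : option (seq (R[i] * T) * {e : R | 0 < e})) : set F :=
  if t is Some (l, e) then [set eta | n2 (lc (w1 eta) l) <= n2 (lc w0 l) + sval e]
  else [set eta | expR (- (C1 * C0)) <= Re ⟪xi, eta⟫].

Let w1_lin l : bdop (fun eta => lc (w1 eta) l).
Proof.
rewrite /lc; elim: l => [|p l ih].
  by apply: (@bdop_eq _ _ (fun=> 0)) => [|x]; [exact: bdop0|rewrite big_nil].
apply: (@bdop_eq _ _ (fun eta => p.1 *: w1 eta p.2 + \sum_(p <- l) p.1 *: w1 eta p.2)).
  by apply: bdopD => //; apply: bdopZ; exact: weyl_bdop.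
by move=> x; rewrite big_cons.
Qed.

(** [eta] is the average of W (d x) xi over the sign sums x. By convexity of [n2] it suffices to
    average the square norms, where products of cosines tend to exp (- M / 4); Jensen preserves the
    overlap with [xi]. *)
Let approx cs : exists eta, n2 eta <= n2 xi /\ allK K cs eta.
Proof.
pose diffs (l : seq (R[i] * T)) : seq H :=
  [seq sval (tnth (in_tuple l) i).2 - sval (tnth (in_tuple l) k).2 |
    i <- enum 'I_(size l), k <- enum 'I_(size l)].
pose s : seq H := flatten [seq (if t is Some (l, _) then diffs l else [::]) | t <- cs].
have [a [ha an]] := noise s.
have /choice[d hd] b := displace b.
pose N m : nat := size (signs (steps a m)).
have N0 m : (0 < N m)%N by rewrite /N size_signs expn_gt0.
have NR m : 0 < (N m)%:R :> R by rewrite ltr0n.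
have NE m : (N m)%:R = 2 ^+ size (steps a m) :> R by rewrite /N size_signs natrX.
pose eta m := (N m)%:R^-1%:C%C *: \sum_(x <- signs (steps a m)) W (d x) xi.
have eta_n m : n2 (eta m) <= n2 xi.
  apply: le_trans (n2_average _ (N0 m)) _; rewrite (ler_pdivrMl _ _ (NR m)).
  under eq_bigr do rewrite /n2 (weyl_iso hW).
  by rewrite big_const_seq count_predT iter_addr addr0 mulr_natl.
have eta_xi m : expR (- (C1 * C0)) <= Re ⟪xi, eta m⟫.
  rewrite /eta innerZr ReZ inner_sumr Re_sum (ler_pdivlMl _ _ (NR m)).
  apply: le_trans (_ : \sum_(x <- signs (steps a m)) expR (- (C1 * n2 x)) <= _); last first.
    by apply: ler_sum => x _; exact: (hd x).2.
  apply: le_trans (signs_jensen _ _); rewrite NE ler_wpM2l ?exprn_ge0//.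
  by rewrite ler_expR lerN2 ler_wpM2l// steps_n2.
have conv (l : seq (R[i] * T)) (e : {e : R | 0 < e}) : (forall h, h \in diffs l -> h \in s) ->
    exists m0, forall m, (m0 <= m)%N -> K (Some (l, e)) (eta m).
  move=> ls; pose g (p q : R[i] * T) m := Re ((p.1^*)%C * q.1 *
    (expIR (Im ⟪i1 (sval p.2), i1 (sval q.2)⟫ / 2) *
     (expR (- (S (sval q.2 - sval p.2) / 4)))%:C%C)) *
    \prod_(b <- steps a m) cos (rip (sval p.2 - sval q.2) b).
  have up m : n2 (lc (w1 (eta m)) l) <= \sum_(p <- l) \sum_(q <- l) g p q m.
    have -> : lc (w1 (eta m)) l = (N m)%:R^-1%:C%C *:
        \sum_(x <- signs (steps a m)) lc (w1 (W (d x) xi)) l.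
      by rewrite /eta (linZ _ _ (w1_lin l).1) (lin_sum _ _ _ (w1_lin l).1).
    apply: le_trans (n2_average _ (N0 m)) _; rewrite (ler_pdivrMl _ _ (NR m)).
    rewrite le_eqVlt; apply/orP; left; apply/eqP.
    transitivity (\sum_(x <- signs (steps a m)) \sum_(p <- l) \sum_(q <- l)
      Re ((p.1^*)%C * q.1 * (expIR (Im ⟪i1 (sval p.2), i1 (sval q.2)⟫ / 2) *
       (expR (- (S (sval q.2 - sval p.2) / 4)))%:C%C) * expIR (rip (sval p.2 - sval q.2) x))).
      apply: eq_bigr => x _; rewrite n2_lc; apply: eq_bigr => p _; apply: eq_bigr => q _.
      rewrite /w1 (gram1 (svalP p.2) (svalP q.2) (hd x).1); congr (Re _); ring.
    rewrite exchange_big mulr_sumr; apply: eq_bigr => p _.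
    rewrite exchange_big mulr_sumr; apply: eq_bigr => q _.
    rewrite -Re_sum -mulr_sumr signs_char -NE mulrC ReZ /g; ring.
  have lim : (fun m => \sum_(p <- l) \sum_(q <- l) g p q m) @ \oo --> n2 (lc w0 l).
    rewrite n2_lc.
    pose L (p q : R[i] * T) := Re ((p.1^*)%C * q.1 *
      (expIR (Im ⟪i1 (sval p.2), i1 (sval q.2)⟫ / 2) *
      (expR (- (S (sval q.2 - sval p.2) / 4)))%:C%C)) *
      expR (- (\sum_(b <- a) rip (sval p.2 - sval q.2) b ^+ 2 / 2)).
    have -> : \sum_(p <- l) \sum_(q <- l) Re ((p.1^*)%C * q.1 * ⟪w0 p.2, w0 q.2⟫) =
        \sum_(p <- l) \sum_(q <- l) L p q; last first.
      apply: (rcvg_sum (f := fun p m => \sum_(q <- l) g p q m) (l := fun p => \sum_(q <- l) L p q)) => p.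
      apply: (rcvg_sum (f := g p) (l := L p)) => q.
      by apply: cvgM; [exact: cvg_cst|exact: steps_cos].
    rewrite big_tnth [RHS]big_tnth; apply: eq_bigr => i _.
    rewrite big_tnth [RHS]big_tnth; apply: eq_bigr => k _.
    set p := tnth _ i; set q := tnth _ k.
    rewrite /w0 (gram0 (svalP p.2) (svalP q.2)) /L [RHS]mulrC -ReZ; congr (Re _).
    have hM : M (sval q.2 - sval p.2) = 2 * \sum_(b <- a) rip (sval p.2 - sval q.2) b ^+ 2.
      rewrite ha; last by apply: ls; apply: (allpairs_f (fun i k => sval (tnth (in_tuple l) i).2 - sval (tnth (in_tuple l) k).2)); rewrite mem_enum.
      by congr (_ * _); apply: eq_bigr => b _; rewrite -opprB ripNl sqrrN.
    rewrite -mulr_suml.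
    have -> : expR (- ((S (sval q.2 - sval p.2) + M (sval q.2 - sval p.2)) / 4)) =
      expR (- (S (sval q.2 - sval p.2) / 4)) *
      expR (- ((\sum_(b <- a) rip (sval p.2 - sval q.2) b ^+ 2) / 2)).
      by rewrite -expRD hM; congr expR; field.
    rewrite realCM; ring.
  have [m0 hm0] := rcvg_near_le lim (svalP e); exists m0 => m /hm0 h.
  exact: le_trans (up m) h.
have sub cs1 cs2 : cs = cs1 ++ cs2 -> exists m0, forall m, (m0 <= m)%N -> allK K cs2 (eta m).
  elim: cs2 cs1 => [|t cs2 ih] cs1 e; first by exists 0%N.
  have [|m1 h1] := ih (rcons cs1 t); first by rewrite cat_rcons.
  case: t e {ih} => [[l d0]|] e; last by exists m1 => m /h1 h; split=> //; exact: eta_xi.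
  have [|m2 h2] := conv l d0.
    by move=> h hl; rewrite /s e map_cat flatten_cat mem_cat/= mem_cat hl orbT.
  by exists (maxn m1 m2) => m; rewrite geq_max => /andP[/h1 ? /h2 ?].
have [m hm] := sub [::] cs (erefl _).
by exists (eta m); split; [exact: eta_n|exact: hm].
Qed.

(** For a common [eta], W (i0 h) xi0 |-> W (i1 h) eta extends to a contraction, and U is its
    adjoint. It is nonzero because <xi0, U eta> = |eta|^2. *)
Lemma noise_intertwiner : exists U, [/\ bdop U, exists x, U x <> 0 &
  forall h x, P h -> U (W (i1 h) x) = W (i0 h) (U x)].
Proof.
have [t x y|t u x|eta heta] := @finite_intersection R F _ K (n2 xi) _ _ approx.
- case: t => [[l e]|] /=; last first.
    by move=> h1 h2; rewrite innerZr ReZ innerDr reim; lra.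
  have [lL _] := w1_lin l; move=> h1 h2.
  rewrite (linZ _ _ lL) (linD _ _ lL) n2Z sqcC.
  by have := n2_le_2 (lc (w1 x) l) (lc (w1 y) l); lra.
- case: t => [[l e]|] /= hu ux.
    exact: (rcvg_le (n2_cvg (bdop_cvg (w1_lin l) ux)) hu).
  rewrite -lerN2; apply: (rcvg_le (u := fun n => - Re ⟪xi, u n⟫)).
    by apply: cvgN; exact: (hcvg_rip (y := xi) ux).
  by move=> n; rewrite lerN2.
have bd l : hn (lc (w1 eta) l) <= 1 * hn (lc w0 l).
  rewrite mul1r hn_le2; apply/ler_addgt0Pr => e e0.
  exact: (heta (Some (l, exist _ e e0))).
have [U [bU hU cU]] := family_operator ler01 bd.
have P0 : P 0 by case: hP.
have i00 : i0 0 = 0 by exact: rlin0.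
have i10 : i1 0 = 0 by exact: rlin0.
have w0U h x : P h -> ⟪W (i0 h) xi0, U x⟫ = ⟪W (i1 h) eta, x⟫.
  by move=> Ph; exact: (hU (exist _ h Ph)).
exists U; split=> //.
  exists eta => U0; have := w0U 0 eta P0; rewrite i00 i10 !(weyl0 hW) U0 inner0r => h.
  have := heta None; rewrite /K/= => h1.
  have : eta = 0 by apply/eqP; rewrite -n2_eq0 /n2 -h.
  by move=> e0; move: h1; rewrite e0 inner0r leNgt expR_gt0.
move=> h x Ph; apply/eqP; rewrite -subr_eq0; apply/eqP.
have PN k : P k -> P (- k) by move=> Pk; rewrite -sub0r; exact: PB.
have PD k k' : P k -> P k' -> P (k + k') by case: hP => _ hD _; exact: hD.
apply: (@approx_ortho_eq0 _ _ (range (lc w0))).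
  move=> e e0; have e2 : 0 < e / 2 by rewrite divr_gt0.
  have [_ [s _ <-] h1] := cU (W (i1 h) x) _ e2; have [_ [t _ <-] h2] := cU x _ e2.
  have [t' ht'] : exists t', W (i0 h) (lc w0 t) = lc w0 t'.
    elim: t {h2} => [|[a k] t [t' ht']].
      by exists [::]; rewrite !lc_nil (lin0 (weyl_lin hW _)).
    exists ((a * expIR (- (Im ⟪i0 h, i0 (sval k)⟫ / 2)), exist _ _ (PD _ _ Ph (svalP k))) :: t').
    rewrite /lc !big_cons/= -!/(lc _ _) (linD _ _ (weyl_lin hW _)) (linZ _ _ (weyl_lin hW _)) ht'.
    by congr (_ + _); rewrite /w0/= (weyl_mul hW) scalerA r0.1.
  exists (lc w0 (s ++ [seq (-1 * p.1, p.2) | p <- t'])); first by eexists.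
  rewrite lc_cat lc_scale scaleN1r -ht'.
  have -> : U (W (i1 h) x) - W (i0 h) (U x) - (lc w0 s - W (i0 h) (lc w0 t)) =
    (U (W (i1 h) x) - lc w0 s) - (W (i0 h) (U x) - W (i0 h) (lc w0 t)) by hvec.
  apply: le_lt_trans (hnB _ _) _; rewrite -(linB _ _ (weyl_lin hW _)) (weyl_hn hW); lra.
move=> _ [s _ <-]; rewrite /lc inner_suml big1// => -[a [k Pk]] _ /=.
rewrite innerZl /w0/= innerBr w0U//.
have adj i y v : ⟪y, W i v⟫ = ⟪W (- i) y, v⟫ by rewrite (weyl_adj hW) opprK.
rewrite !adj !(weyl_mul hW) !innerZl.
have rN i : rlin i -> i (- h) = - i h by move=> ri; rewrite -sub0r rlinB// rlin0// sub0r.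
rewrite -(rN _ r1) -(rN _ r0) -r1.1 -r0.1 w0U; last by apply: PD => //; exact: PN.
by rewrite hsym ?subrr ?mulr0//; exact: PN.
Qed.

End Noise.

(** * Symplectomorphisms *)

Section Extension.
Variables (R : realType) (H : hilbertType R).
Implicit Types (x y z h k : H) (K : set H).

Lemma Cextend_split K T h k : standard_subspace K -> K h -> K k ->
  Cextend K T (h + imI *: k) = T h + imI *: T k.
Proof.
move=> [[K0 KD KZ] _ _ K1] Kh Kk; rewrite /Cextend.
case: xgetP => [z _ [h' [k' [Kh' Kk' e ->]]]|/(_ (T h + imI *: T k))[]]; last by exists h, k.
have KB x y : K x -> K y -> K (x - y).
  by move=> hx hy; apply: KD => //; have := KZ (-1) _ hy; rewrite rmorphN rmorph1 scaleN1r.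
have d : h - h' = imI *: (k' - k).
  apply/eqP; rewrite subr_eq scalerBr addrAC; apply/eqP.
  by apply: (addIr (imI *: k)); rewrite subrK e addrC.
have k0 : k' - k = 0 by apply: K1; [exact: KB|rewrite -d; exact: KB].
have h0 : h - h' = 0 by rewrite d k0 scaler0.
by move/eqP: k0; move/eqP: h0; rewrite !subr_eq0 => /eqP -> /eqP ->.
Qed.

Lemma real_adjoint_eq K T h g : real_subspace K -> K g ->
  (forall k, K k -> Re ⟪g, k⟫ = Re ⟪h, T k⟫) -> real_adjoint K T h = g.
Proof.
move=> [K0 KD KZ] Kg hg; rewrite /real_adjoint.
case: xgetP => [g' _ [Kg' hg']|/(_ g)[]//].
apply/eqP; rewrite -subr_eq0 -n2_eq0; apply/eqP.
have Kd : K (g' - g).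
  by apply: KD => //; have := KZ (-1) _ Kg; rewrite rmorphN rmorph1 scaleN1r.
by rewrite -rip_n2 /rip innerBl !reim hg// hg'// subrr.
Qed.

End Extension.

Section SymplecticOperator.
Variables (R : realType) (H : hilbertType R) (K1 K2 : set H) (X j Q : H -> H).
Hypotheses (sd : std_data K1 X j) (st1 : standard_subspace K1) (st2 : standard_subspace K2).
Hypotheses (hQ : symplectomorphism K1 K2 Q) (bQ : bounded_real_on K1 Q).
Implicit Types (x y z h k : H).

Let jl := sdj sd.
Let jK := sdjK sd.
Let jI := sdjI sd.
Let lX : linear X := (sd_bX sd).1.

Lemma symp_rlin (a : R) x y : K1 x -> K1 y -> Q (a%:C%C *: x + y) = a%:C%C *: Q x + Q y.
Proof. by move=> *; have [_ h _] := hQ; exact: h. Qed.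

Lemma symp_D x y : K1 x -> K1 y -> Q (x + y) = Q x + Q y.
Proof. by move=> hx hy; have := symp_rlin 1 hx hy; rewrite rmorph1 !scale1r. Qed.

Lemma symp_0 : Q 0 = 0.
Proof.
have [[k0 _ _] _ _ _] := st1; have := symp_D k0 k0; rewrite addr0 => h.
by apply/eqP; rewrite -(inj_eq (addrI (Q 0))) -h addr0.
Qed.

Lemma symp_Z (a : R) x : K1 x -> Q (a%:C%C *: x) = a%:C%C *: Q x.
Proof.
have [[k0 _ _] _ _ _] := st1; move=> hx.
by have := symp_rlin a hx k0; rewrite symp_0 !addr0.
Qed.

Lemma symp_K x : K1 x -> K2 (Q x).
Proof. by have [[h _ _] _ _] := hQ; exact: h. Qed.

Lemma symp_bound : exists2 M : R, 0 <= M & forall x, K1 x -> hn (Q x) <= M * hn x.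
Proof.
have [M hM] := bQ; exists `|M|; first exact: normr_ge0.
move=> x /hM; rewrite !hn_normE -rmorphM/= lecR => h; apply: le_trans h _.
by rewrite ler_wpM2r ?hn_ge0 ?ler_norm.
Qed.

Definition symp_op z := Q (X (rpart j z)) + imI *: Q (X (ipart j z)).
Local Notation V := symp_op.

Let KXr z : K1 (X (rpart j z)). Proof. by apply: (sd_XK sd); exact: rpart_j. Qed.
Let KXi z : K1 (X (ipart j z)). Proof. by apply: (sd_XK sd); exact: ipart_j. Qed.

Lemma symp_op_real h : j h = h -> V h = Q (X h).
Proof. by move=> jh; rewrite /symp_op rpart_real// ipart_real// (lin0 lX) symp_0 scaler0 addr0. Qed.

Lemma symp_op_K h : j h = h -> K2 (V h).
Proof. by move=> jh; rewrite symp_op_real//; apply/symp_K/(sd_XK sd). Qed.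

Lemma symp_op_linear : linear V.
Proof.
have [rD rZ] := rpart_rlin jl; have [iD iZ] := ipart_rlin jl.
have K1Z (a : R) x : K1 x -> K1 (a%:C%C *: x) by have [[_ _ KZ] _ _ _] := st1; exact: KZ.
apply: rlin_complex; first split.
- move=> x y; rewrite /symp_op rD iD !(linD _ _ lX) !symp_D//; hvec.
- by move=> a x; rewrite /symp_op rZ iZ !(linZ a%:C%C _ lX) !symp_Z// scalerDr !scalerA mulrC.
- move=> x; rewrite /symp_op (rpart_i jl) (ipart_i jl) -scaleN1r (linZ _ _ lX).
  have -> : -1 = (-1)%:C%C :> R[i] by rewrite rmorphN rmorph1.
  rewrite symp_Z// rmorphN rmorph1 scaleN1r scalerDr scalerA imI2 scaleN1r addrC.
  by [].
Qed.

Lemma symp_op_bdop : bdop V.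
Proof.
split; first exact: symp_op_linear.
have [M M0 hM] := symp_bound; have [_ [M' M'0 hM']] := sd_bX sd.
exists (2 * M * M'); first by rewrite !mulr_ge0.
move=> x; apply: le_trans (hnD _ _) _; rewrite hnZ (_ : nc imI = 1) ?mul1r; last first.
  by rewrite /nc sqc_imI sqrtr1.
have MM : 0 <= M * M' by rewrite mulr_ge0.
have h1 : hn (Q (X (rpart j x))) <= M * M' * hn x.
  apply: le_trans (hM _ (KXr x)) _; rewrite -mulrA ler_wpM2l//.
  by apply: le_trans (hM' _) _; rewrite ler_wpM2l// rpart_hn.
have h2 : hn (Q (X (ipart j x))) <= M * M' * hn x.
  apply: le_trans (hM _ (KXi x)) _; rewrite -mulrA ler_wpM2l//.
  by apply: le_trans (hM' _) _; rewrite ler_wpM2l// ipart_hn.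
by rewrite -!mulrA in h1 h2 *; lra.
Qed.

Lemma symp_op_im h k : j h = h -> j k = k -> Im ⟪V h, V k⟫ = Im ⟪X h, X k⟫.
Proof.
by move=> jh jk; rewrite !symp_op_real//; have [_ _ ->] := hQ => //; exact: (sd_XK sd).
Qed.

Lemma real_ext x y : (forall h, j h = h -> ⟪h, x⟫ = ⟪h, y⟫) -> x = y.
Proof.
move=> e; apply: inner_ext => w.
have [a [b [ja jb ->]]] : exists a b, [/\ j a = a, j b = b & w = a + imI *: b].
  by exists (rpart j w), (ipart j w); rewrite rpart_j ?ipart_j ?rpartE.
by rewrite !innerDl !innerZl !e.
Qed.

Variable A : H -> H.
Hypotheses (lA : linear A) (hA : forall x y, ⟪x, A y⟫ = ⟪V x, V y⟫).

(** The symplectic condition makes <h, (A - X^2) k> real for real h and k. *)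
Lemma symp_delta_comm z : j (A z - X (X z)) = A (j z) - X (X (j z)).
Proof.
pose D z := A z - X (X z).
have DD x y : D (x + y) = D x + D y by rewrite /D !(linD _ _ lA, linD _ _ lX); hvec.
have DZ (a : R[i]) x : D (a *: x) = a *: D x.
  by rewrite /D (linZ _ _ lA) !(linZ _ _ lX) scalerBr.
have real k : j k = k -> j (D k) = D k.
  move=> jk; apply: real_ext => h jh.
  have Dr : ⟪h, D k⟫ = (⟪h, D k⟫^*)%C.
    apply: complex_ext; rewrite !reim//.
    rewrite /D innerBr hA -(sd_sX sd) !reim symp_op_im// subrr oppr0.
    by [].
  by rewrite -{1}jh jI Dr -innerC.
rewrite -/(D z) -/(D (j z)) -{1}(rpartE j z) DD DZ (conj_D jl) (conj_Z jl).
rewrite !real ?rpart_j ?ipart_j// -DZ -DD; congr (D _).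
by rewrite -{3}(rpartE j z) (conj_D jl) (conj_Z jl) rpart_j// ipart_j.
Qed.

Lemma symp_gram_real h : j h = h -> j (A h - X (X h) + h) = A h - X (X h) + h.
Proof. by move=> jh; rewrite (conj_D jl) symp_delta_comm jh. Qed.

Lemma symp_gram_rip h k : j h = h -> j k = k -> rip (A h - X (X h) + h) k = rip (V h) (V k).
Proof.
move=> jh jk; rewrite ripDl ripBl -[X in _ + X](sd_rip sd jh jk).
have -> : rip (X (X h)) k = rip (X h) (X k) by rewrite /rip (sd_sX sd).
by rewrite subrK ripC /rip hA -/(rip _ _) ripC.
Qed.

(** On real vectors Re <V h, V k> is the form of A - X^2 plus Re <X h, X k>, and the latter is Re
    <h, k> because X is isometric there. *)
Lemma symp_QdQ z : Cextend K2 (real_adjoint K1 Q) (Cextend K1 Q (X z)) = X (A z - X (X z) + z).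
Proof.
have XE : X z = X (rpart j z) + imI *: X (ipart j z).
  by rewrite -(linZ _ _ lX) -(linD _ _ lX) rpartE.
rewrite {1}XE (Cextend_split Q st1 (KXr z) (KXi z)).
rewrite -!symp_op_real ?rpart_j ?ipart_j//.
rewrite (Cextend_split _ st2); [|exact/symp_op_K/rpart_j|exact/symp_op_K/ipart_j].
have rs1 : real_subspace K1 by have [] := st1.
have ra h : j h = h -> real_adjoint K1 Q (V h) = X (A h - X (X h) + h).
  move=> jh; have jg := symp_gram_real jh.
  apply: real_adjoint_eq => //; first exact: (sd_XK sd).
  move=> _ /(sdK sd)[k jk <-]; rewrite -[LHS]/(rip _ _) (sd_rip sd)// symp_gram_rip//.
  by rewrite (symp_op_real jk).
rewrite !ra ?rpart_j ?ipart_j// -(linZ _ _ lX) -(linD _ _ lX); congr X.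
rewrite -{7 8 9}(rpartE j z) !(linD _ _ lA, linD _ _ lX, linZ _ _ lA, linZ _ _ lX); hvec.
Qed.

(** Under X the operator i R1 is X^2 - 1, which cancels the correction in [symp_QdQ]. *)
Lemma symp_iR_QdQ z : imI *: modular_R K1 (X z) +
  Cextend K2 (real_adjoint K1 Q) (Cextend K1 Q (X z)) = X (A z).
Proof.
rewrite symp_QdQ (_ : imI *: modular_R K1 (X z) = X (X (X z)) - X z).
  rewrite (linD _ _ lX) (linB _ _ lX); hvec.
by rewrite -(sd_iR sd) addrC addKr.
Qed.

End SymplecticOperator.

(** * Operators on the domain of the Tomita operator *)

Section OrthonormalBasis.
Variables (R : realType) (H : hilbertType R).
Implicit Types (x y z : H) (B : set H) (s : seq H).

Definition onb B := (forall e f, B e -> B f -> ⟪e, f⟫ = (e == f)%:R) /\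
  (forall x, (forall e, B e -> ⟪e, x⟫ = 0) -> x = 0).

Lemma onb_exists : exists B, onb B.
Proof.
pose P (A : set H) := forall e f, A e -> A f -> ⟪e, f⟫ = (e == f)%:R.
have [|B [PB maxB]] := @Zorn_bigcup H P.
  move=> F FP tF e f [A FA Ae] [A' FA' Af].
  have [h|h] := tF _ _ FA FA'; first by apply: (FP _ FA'); [exact: h|].
  by apply: (FP _ FA); [|exact: h].
exists B; split=> // x hx; apply/eqP/negPn/negP => x0.
pose u := (hn x)^-1%:C%C *: x.
have u1 : n2 u = 1 by rewrite n2Z sqcC -hn2 -exprMn mulVf ?hn_eq0// expr1n.
have Bu e : B e -> ⟪e, u⟫ = 0 by move=> Be; rewrite innerZr hx// mulr0.
have u0 : u != 0 by rewrite -n2_eq0 u1 oner_neq0.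
have nBu : ~ B u.
  by move=> /[dup] Bu1 /Bu; rewrite inner_n2 u1 => /eqP; rewrite oner_eq0.
apply: (maxB (B `|` [set u])).
  by split; [move=> e Be; left|move=> /(_ u) h; apply: nBu; apply: h; right].
have ne e : B e -> (e == u) = false.
  by move=> Be; apply/eqP => eu; apply: nBu; rewrite -eu.
move=> e f [Be|->] [Bf|->]; first exact: PB.
- by rewrite Bu// ne.
- by rewrite innerC Bu// J0 eq_sym ne.
- by rewrite inner_n2 u1 eqxx.
Qed.

Lemma ons_tnth B s : onb B -> uniq s -> (forall x, x \in s -> B x) -> ons (tnth (in_tuple s)).
Proof.
move=> [oB _] us sB i k; rewrite oB; try by apply: sB; exact: mem_tnth.
have inj : injective (tnth (in_tuple s)) by apply/tuple_uniqP.
by rewrite (inj_eq inj).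
Qed.

Lemma onb_dense B x (e : R) : onb B -> 0 < e ->
  exists s : seq (R[i] * {x | B x}), hn (x - lc sval s) < e.
Proof.
move=> [oB tB] e0; have [//|s|S [_ hS cS]] := @family_operator R H {x | B x} sval sval 1.
  by rewrite mul1r.
have -> : x = S x.
  apply/eqP; rewrite -subr_eq0; apply/eqP; apply: tB => f Bf.
  by rewrite innerBr (hS (exist _ f Bf)) subrr.
by have [_ [s _ <-] h] := cS x _ e0; exists s.
Qed.

Lemma onb_approx B (ys : seq H) (d : R) : onb B -> 0 < d ->
  exists s, [/\ uniq s, forall x, x \in s -> B x &
    forall y, y \in ys -> hn (y - oproj (tnth (in_tuple s)) y) < d].
Proof.
move=> oB d0.
have [t [tB ht]] : exists t : seq H, (forall x, x \in t -> B x) /\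
    forall y, y \in ys -> exists l : seq (R[i] * {x | B x}),
      (forall p, List.In p l -> sval p.2 \in t) /\ hn (y - lc sval l) < d.
  elim: ys => [|y ys [t [tB ht]]]; first by exists [::].
  have [l hl] := onb_dense y oB d0.
  exists ([seq sval p.2 | p <- l] ++ t); split.
    move=> x; rewrite mem_cat => /orP[|/tB//].
    elim: l {hl} => //= p l ih; rewrite inE => /orP[/eqP ->|/ih//].
    exact: svalP.
  move=> z; rewrite inE => /orP[/eqP ->|/ht[l' [h1 h2]]].
    exists l; split=> // p; rewrite mem_cat => pl; apply/orP; left.
    elim: l pl {hl} => //= q l ih [->|/ih h]; rewrite inE ?eqxx//.
    by rewrite h orbT.
  by exists l'; split=> // p /h1; rewrite mem_cat => ->; rewrite orbT.
pose s := undup t; have us : uniq s by exact: undup_uniq.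
have sB x : x \in s -> B x by rewrite mem_undup; exact: tB.
exists s; split=> // y /ht[l [h1 h2]].
have os := ons_tnth oB us sB.
have ol : oproj (tnth (in_tuple s)) (lc sval l) = lc sval l.
  have lo := oproj_linear (tnth (in_tuple s)).
  elim: l h1 {h2} => [|p l ih] h1; first by rewrite lc_nil (lin0 lo).
  rewrite /lc big_cons -/(lc sval l) (linD _ _ lo) (linZ _ _ lo) ih; last by move=> q ql; apply: h1; right.
  congr (_ *: _ + _).
  have /tnthP[i ->] : sval p.2 \in in_tuple s by rewrite mem_undup; apply: h1; left.
  rewrite /oproj (bigD1 i)//= os eqxx scale1r big1 ?addr0// => k /negbTE ki.
  by rewrite os ki scale0r.
apply: le_lt_trans h2; rewrite hn_le2.
have lo := oproj_linear (tnth (in_tuple s)).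
rewrite [leRHS](oproj_pyth (y - lc sval l) os) (linB _ _ lo) ol.
rewrite (_ : y - lc sval l - _ = y - oproj (tnth (in_tuple s)) y); last by hvec.
by rewrite lerDr n2_ge0.
Qed.

(** Finitely many vectors [T (f i)] are almost in the span of finitely many basis vectors; there the
    double sum is exchanged and Bessel is applied to [f]. *)
Lemma onb_hsb B T T' (M : R) : onb B -> adjoint_operators T' T ->
  (forall s, uniq s -> (forall x, x \in s -> B x) -> \sum_(e <- s) n2 (T' e) <= M) -> hsb T M.
Proof.
move=> oB aT hM n f of_; apply/ler_addgt0Pr => e e0.
have n0 : 0 < n%:R + 1 :> R by rewrite ltr_wpDl.
have d0 : 0 < Num.sqrt (e / (n%:R + 1)) by rewrite sqrtr_gt0 divr_gt0.
have [s [us sB hs_]] := onb_approx [seq T (f i) | i <- enum 'I_n] oB d0.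
have os := ons_tnth oB us sB.
have h1 i : n2 (T (f i)) <= n2 (oproj (tnth (in_tuple s)) (T (f i))) + e / (n%:R + 1).
  rewrite {1}(oproj_pyth (T (f i)) os) lerD2l.
  have := hs_ (T (f i)) (map_f _ (mem_enum _ i)).
  rewrite -(@ltr_pXn2r _ 2)// ?nnegrE ?hn_ge0 ?sqrtr_ge0// hn2 sqr_sqrtr => [/ltW//|].
  by rewrite divr_ge0 ?ltW.
apply: le_trans (ler_sum _ (fun i _ => h1 i)) _; rewrite big_split/=.
apply: lerD; last first.
  rewrite sumr_const card_ord -[_ *+ n]mulr_natl mulrA ler_pdivrMr// mulrC; apply: ler_wpM2l; first exact: ltW.
  by rewrite lerDl.
apply: le_trans (hM s us sB); rewrite [leRHS]big_tnth.
under eq_bigr do rewrite oproj_n2//.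
rewrite exchange_big; apply: ler_sum => k _.
apply: le_trans (bessel _ of_); rewrite le_eqVlt; apply/orP; left; apply/eqP.
by apply: eq_bigr => i _; rewrite -aT -sqcJ -innerC.
Qed.

End OrthonormalBasis.

Section OnDomain.
Variables (R : realType) (H : hilbertType R) (K : set H) (X j : H -> H).
Hypothesis sd : std_data K X j.
Implicit Types (x y z : H).
Local Notation D := (complexify K).
Local Notation ip := (inner_s K).
Let lX : linear X := (sd_bX sd).1.

Lemma two_real (r : R) : 2%:R * r%:C%C = (2 * r)%:C%C :> R[i].
Proof. by rewrite realCM rmorph_nat. Qed.

Lemma bounded_on_domain T : bounded_operator_on D ip T ->
  exists T', bdop T' /\ forall z, T (X z) = X (T' z).
Proof.
move=> [TD Tl [M hM]].
have DX z : D (X z) by apply/(sd_complexify sd); exists z.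
have /choice[T' hT'] z : exists w, X w = T (X z).
  by apply/(sd_complexify sd); exact: TD.
exists T'; split=> //; split.
  move=> a x y; apply: (sd_Xinj sd).
  by rewrite (linD _ _ lX) (linZ _ _ lX) !hT' -Tl// (linD _ _ lX) (linZ _ _ lX).
exists (Num.sqrt `|M|); first exact: sqrtr_ge0.
move=> z; have := hM _ (DX z); rewrite -hT' !(sd_inner_s sd) !inner_n2 !two_real -rmorphM/= lecR => h.
rewrite hn_le ?mulr_ge0 ?sqrtr_ge0 ?hn_ge0// exprMn sqr_sqrtr ?normr_ge0// hn2.
have := ler_norm M; have := n2_ge0 z; nra.
Qed.

Lemma positive_sqrt_domain f A S : positive_sqrt_on D ip f S -> (forall z, f (X z) = X (A z)) ->
  exists S', [/\ pos S', forall z, S (X z) = X (S' z) & forall z, S' (S' z) = A z].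
Proof.
move=> [[bS pS] SS] fA; have [S' [bS' hS']] := bounded_on_domain bS.
have DX z : D (X z) by apply/(sd_complexify sd); exists z.
exists S'; split=> //.
  apply/posP; split=> // z; have := pS _ (DX z).
  by rewrite hS' (sd_inner_s sd) pmulr_rge0 ?ltr0n.
by move=> z; apply: (sd_Xinj sd); rewrite -!hS' SS// fA.
Qed.

Lemma domain_operator T' : bdop T' -> exists T, bounded_operator_on D ip T /\
  forall z, T (X z) = X (T' z).
Proof.
move=> [lT' [M M0 hM]]; pose T x := X (T' (xget 0 [set z | X z = x])).
have TX z : T (X z) = X (T' z).
  rewrite /T; case: xgetP => [w _ /= /(sd_Xinj sd) ->//|/(_ z)[]//].
have DX z : D (X z) by apply/(sd_complexify sd); exists z.
exists T; split=> //; split.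
- by move=> _ /(sd_complexify sd)[z <-]; rewrite TX.
- move=> a _ _ /(sd_complexify sd)[z <-] /(sd_complexify sd)[w <-].
  by rewrite -(linZ _ _ lX) -(linD _ _ lX) !TX (linD _ _ lT') (linZ _ _ lT') (linD _ _ lX) (linZ _ _ lX).
- exists (M ^+ 2) => _ /(sd_complexify sd)[z <-].
  rewrite TX !(sd_inner_s sd) !inner_n2 !two_real -rmorphM/= lecR -!hn2.
  have := hM z; rewrite -(@ler_pXn2r _ 2)// ?nnegrE ?hn_ge0 ?mulr_ge0 ?hn_ge0// exprMn; lra.
Qed.

Lemma domain_positive_sqrt f A S' : pos S' -> (forall z, S' (S' z) = A z) ->
  (forall z, f (X z) = X (A z)) ->
  exists S, positive_sqrt_on D ip f S /\ forall z, S (X z) = X (S' z).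
Proof.
move=> pS SS fA; have [bS _ _] := pS; have [S [hS SX]] := domain_operator bS.
exists S; split=> //; split; last first.
  by move=> _ /(sd_complexify sd)[z <-]; rewrite !SX SS fA.
split=> // _ /(sd_complexify sd)[z <-]; rewrite SX (sd_inner_s sd).
by rewrite pmulr_rge0 ?ltr0n//; have [_] := (posP _).1 pS; exact.
Qed.

Let sq2 : (Num.sqrt 2) * (Num.sqrt 2) = 2 :> R.
Proof. by rewrite -expr2 sqr_sqrtr. Qed.

Lemma hs_domain T T' : hs T' -> bdop T' -> (forall z, T (X z) = X (T' z)) ->
  bounded_operator_on D ip T -> hilbert_schmidt_on D ip T.
Proof.
move=> [M hM] bT' TX bT; split=> //.
have s0 : Num.sqrt 2 != 0 :> R by rewrite gt_eqF// sqrtr_gt0.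
have [B oB] := onb_exists H; have [oB1 tB] := oB.
(* The scaling compensates the factor 2 of [sd_inner_s], so that e |-> X (c e) maps orthonormal
   bases to orthonormal bases. *)
pose c : R[i] := (Num.sqrt 2)^-1%:C%C.
have cc : c * (Num.sqrt 2)%:C%C = 1 by rewrite -rmorphM/= mulVf.
have c2 : (Num.sqrt 2)%:C%C * (Num.sqrt 2)%:C%C = 2 :> R[i] by rewrite -rmorphM/= sq2 rmorph_nat.
have c0 : c != 0 by apply: contra_eq_neq cc => ->; rewrite mul0r eq_sym oner_eq0.
pose g e := X (c *: e).
have gI : injective g.
  by move=> e f /(sd_Xinj sd) /(scalerI c0).
exists (g @` B); split.
  split.
  - by move=> _ [e Be <-]; apply/(sd_complexify sd); eexists.
  - move=> _ _ [e Be <-] [f Bf <-]; rewrite (sd_inner_s sd) (inj_eq gI) innerZl innerZr oB1//.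
    rewrite (_ : (c^*)%C = c) ?JC// mulrA [2 * c]mulrC -c2 [c * (_ * _)]mulrA cc mul1r mulrA [_%:C%C * c]mulrC.
    by rewrite cc mul1r.
  - move=> _ /(sd_complexify sd)[z <-] h; rewrite (tB z) ?(lin0 lX)// => e Be.
    have := h (g e) (ex_intro2 _ _ e Be erefl); rewrite (sd_inner_s sd) innerZl => /eqP.
    by rewrite (_ : (c^*)%C = c) ?JC// mulf_eq0 pnatr_eq0/= mulf_eq0 (negbTE c0)/= => /eqP.
apply: (@le_lt_trans _ _ M%:E); last exact: ltry.
apply: ge_ereal_sup => _ [A [/finite_seqP[s ->] AB] <-].
have -> : [set` s] = [set` undup s] by apply/seteqP; split=> x /=; rewrite mem_undup.
rewrite -fsbig_seq ?undup_uniq// sumEFin lee_fin.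
have hA x : x \in undup s -> exists2 e, B e & g e = x.
  by rewrite mem_undup => /AB[e Be <-]; exists e.
pose gi x := (Num.sqrt 2)%:C%C *: xget 0 [set z | X z = x].
have giK e : gi (g e) = e.
  rewrite /gi; case: xgetP => [w _ /= /(sd_Xinj sd) ->|/(_ (c *: e))[]//].
  by rewrite scalerA mulrC cc scale1r.
have Bs x : x \in [seq gi x | x <- undup s] -> B x.
  by move=> /mapP[y /hA[e Be <-] ->]; rewrite giK.
have us : uniq [seq gi x | x <- undup s].
  rewrite map_inj_in_uniq ?undup_uniq// => x y /hA[e _ <-] /hA[f _ <-].
  by rewrite !giK => ->.
have := hM _ _ (ons_tnth oB us Bs); rewrite -(big_tnth _ _ _ xpredT (fun e => n2 (T' e))) big_map.
apply: le_trans; rewrite le_eqVlt; apply/orP; left; apply/eqP.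
rewrite big_seq [RHS]big_seq; apply: eq_bigr => x /hA[e _ <-].
rewrite giK TX (sd_inner_s sd) (linZ _ _ bT'.1) inner_n2 two_real ReC n2Z sqcC exprVn expr2 sq2.
by rewrite mulrA mulfV ?mul1r// pnatr_eq0.
Qed.

Lemma domain_hs T T' : hilbert_schmidt_on D ip T -> adjoint_operators T' T' -> bdop T' ->
  (forall z, T (X z) = X (T' z)) -> hs T'.
Proof.
move=> [_ [E [[ED oE tE] sE]]] aT bT' TX.
have s0 : Num.sqrt 2 != 0 :> R by rewrite gt_eqF// sqrtr_gt0.
pose c : R[i] := (Num.sqrt 2)%:C%C; pose d : R[i] := (Num.sqrt 2)^-1%:C%C.
have c2 : c * c = 2 by rewrite -rmorphM/= sq2 rmorph_nat.
have dc : d * c = 1 by rewrite -rmorphM/= mulVf.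
have d0 : d != 0 by apply: contra_eq_neq dc => ->; rewrite mul0r eq_sym oner_eq0.
have ip_e x y : ip (X (d *: x)) (X (d *: y)) = ⟪x, y⟫.
  rewrite (sd_inner_s sd) innerZl innerZr (_ : (d^*)%C = d) ?JC// -c2.
  transitivity ((d * c) * (d * c) * ⟪x, y⟫); first ring.
  by rewrite dc !mul1r.
have gI : injective (fun e => X (d *: e)).
  by move=> e f /(sd_Xinj sd) /(scalerI d0).
pose B := [set e | E (X (d *: e))].
have oB : onb B.
  split=> [e f Be Bf|x hx]; first by rewrite -ip_e oE// (inj_eq gI).
  have : X (d *: x) = 0.
    apply: tE; first by apply/(sd_complexify sd); eexists.
    move=> y Ey; have /(sd_complexify sd)[w hw] := ED _ Ey.
    have hw' : y = X (d *: (c *: w)) by rewrite scalerA dc scale1r.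
    by rewrite hw' ip_e hx// /B/= -hw'.
  by move=> /(sdXi sd) /eqP; rewrite scaler_eq0 (negbTE d0) => /eqP.
have [M hM] : exists M : R, (\esum_(e in E) (Re (ip (T e) (T e)))%:E <= M%:E)%E.
  move: sE; case: (\esum_(e in E) _)%E => [r _|//|_]; first by exists r.
  by exists 0; rewrite leNye.
exists M; apply: (onb_hsb oB aT) => s us sB; rewrite -lee_fin; apply: le_trans hM.
have us' : uniq [seq X (d *: e) | e <- s] by rewrite map_inj_uniq.
apply: ereal_sup_ubound; exists [set` [seq X (d *: e) | e <- s]].
  split; first by apply/finite_seqP; eexists.
  by move=> x /= /mapP[e es ->]; exact: sB.
rewrite -fsbig_seq// big_map -sumEFin; apply: eq_bigr => e _.
by rewrite TX (linZ _ _ bT'.1) ip_e inner_n2.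
Qed.

End OnDomain.

(** * Isomorphisms from intertwiners *)

Section Intertwiners.
Variables (R : realType) (F : hilbertType R) (I : Type) (inv : I -> I).
Implicit Types (x y v w : F) (U : F -> F) (g : I -> F -> F).

Definition intertwiner g1 g2 U := bdop U /\ forall i x, U (g1 i x) = g2 i (U x).

Definition star_family g := (forall i, bdop (g i)) /\ forall i, adjoint_operators (g i) (g (inv i)).

Lemma intertwiner_adj g1 g2 U U' : (forall i, inv (inv i) = i) -> star_family g1 -> star_family g2 ->
  intertwiner g1 g2 U -> bdop U' -> adjoint_operators U U' -> intertwiner g2 g1 U'.
Proof.
move=> invK [_ a1] [_ a2] [_ hU] bU' aU; split=> // i x; apply: inner_ext => w.
rewrite -aU -{2}(invK i) -a1 -aU hU -{1}(invK i) -a2.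
by [].
Qed.

Lemma intertwiner_comp g1 g2 g3 U V : intertwiner g1 g2 U -> intertwiner g2 g3 V ->
  intertwiner g1 g3 (V \o U).
Proof. by move=> [bU hU] [bV hV]; split=> [|i x] /=; [exact: bdop_comp|rewrite hU hV]. Qed.

Lemma vN_bdop (N : set (F -> F)) a : commutant N a -> bdop a.
Proof. by move=> [/bounded_operatorP]. Qed.

Lemma bicommutant_comm g a C : commutant (commutant (range g)) a -> intertwiner g g C ->
  forall x, a (C x) = C (a x).
Proof.
move=> [_ h] [bC hC] x; have /h/(congr1 (@^~ x)) : commutant (range g) C; last by [].
by split; [apply/bounded_operatorP|move=> _ [i _ <-]; apply/funext => y /=; rewrite hC].
Qed.

Lemma bicommutant_self g i : (forall i, bdop (g i)) -> commutant (commutant (range g)) (g i).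
Proof.
move=> bg; split; first exact/bounded_operatorP.
by move=> S [_ h]; rewrite h//; exists i.
Qed.

Hypothesis invK : forall i, inv (inv i) = i.

(** b is forced by b (U x) = U (a x) and has to be shown bounded. For intertwiners U, U' the
    operator U^* U' commutes with a, with its adjoint, and with the square root b0 of c - a^* a;
    hence c |sum U x|^2 - |sum U (a x)|^2 = |sum U (b0 x)|^2 >= 0. *)
Lemma transfer g1 g2 a : star_family g1 -> star_family g2 ->
  commutant (commutant (range g1)) a ->
  exists b, bdop b /\ forall U x, intertwiner g1 g2 U -> b (U x) = U (a x).
Proof.
move=> s1 s2 Ma; have ba := vN_bdop Ma; have [a' ba' aa] := adj_exists ba.
have pa : pos (a' \o a).
  split; first exact: bdop_comp.
    by move=> x y /=; rewrite -aa (adjC aa).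
  by move=> x; rewrite /rip /= -aa; exact: n2_ge0.
have [c c0 hc] := pos_ub pa.
pose A0 x := c%:C%C *: x - a' (a x).
have pA0 : pos A0.
  split; first by apply: bdopB; [apply: bdopZ; exact: bdop_id|exact: bdop_comp].
    by move=> x y; rewrite /A0 !innE JC (adjC aa) aa.
  by move=> x; rewrite /A0 ripBr ripZr rip_n2 subr_ge0; exact: hc.
have [b0 [pb0 b0b0 b0C]] := sqrt_exists pA0.
have [bb0 sb0 _] := pb0.
pose J := ({U | intertwiner g1 g2 U} * F)%type.
pose w (p : J) := sval p.1 p.2; pose v (p : J) := sval p.1 (a p.2); pose u (p : J) := sval p.1 (b0 p.2).
have key (p q : J) : c%:C%C * ⟪w p, w q⟫ - ⟪v p, v q⟫ = ⟪u p, u q⟫.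
  case: p q => [[Up hp] x] [[Uq hq] y]; rewrite /w /v /u /=.
  have [Up' bp' ap] := adj_exists hp.1; have [Uq' bq' aq] := adj_exists hq.1.
  have hp' := intertwiner_adj invK s1 s2 hp bp' ap.
  have hq' := intertwiner_adj invK s1 s2 hq bq' aq.
  pose C := Up' \o Uq; have hC : intertwiner g1 g1 C by exact: intertwiner_comp hq hp'.
  have hC' : intertwiner g1 g1 (Uq' \o Up) by exact: intertwiner_comp hp hq'.
  have aC := bicommutant_comm Ma hC; have aC' := bicommutant_comm Ma hC'.
  have a'C z : a' (C z) = C (a' z).
    apply: inner_ext => t; rewrite -aa /C /= -!ap.
    have -> : ⟪Up t, Uq (a' z)⟫ = ⟪Uq' (Up t), a' z⟫ by rewrite (adjC aq).
    by rewrite -aa -[Uq' (Up t)]/((Uq' \o Up) t) aC' /= (adjC aq).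
  have A0C z : C (A0 z) = A0 (C z).
    by rewrite /A0 (linB _ _ hC.1.1) (linZ _ _ hC.1.1) aC a'C.
  have bC := b0C C hC.1 A0C.
  rewrite !ap -!/(C _) -[Up' (Uq y)]/(C y) -[Up' (Uq (a y))]/(C (a y)) -[Up' (Uq (b0 y))]/(C (b0 y)).
  by rewrite bC sb0 b0b0 /A0 innerBr innerZr aC aa.
have bd l : hn (lc v l) <= Num.sqrt c * hn (lc w l).
  rewrite hn_le ?mulr_ge0 ?sqrtr_ge0 ?hn_ge0// exprMn sqr_sqrtr; last exact: ltW.
  rewrite hn2 -subr_ge0.
  have -> : c * n2 (lc w l) - n2 (lc v l) = n2 (lc u l); last exact: n2_ge0.
  rewrite !n2_lc mulr_sumr -sumrB; apply: eq_bigr => p _.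
  rewrite mulr_sumr -sumrB; apply: eq_bigr => q _.
  by rewrite -ReZ -!key -ReN -ReD; congr (Re _); ring.
have [S [bS hS _]] := family_operator (sqrtr_ge0 c) bd.
have [b bb ab] := adj_exists bS.
exists b; split=> // U x hU; apply: inner_ext => y.
by rewrite -ab innerC (hS (exist _ U hU, x)) -innerC.
Qed.

Lemma total_ext (T T' : F -> F) (S : set F) : (forall v, (forall s, S s -> ⟪s, v⟫ = 0) -> v = 0) ->
  bdop T -> bdop T' -> (forall s, S s -> T s = T' s) -> T = T'.
Proof.
move=> tS bT bT' h; have [A _ aT] := adj_exists bT; have [A' _ aT'] := adj_exists bT'.
apply/funext => x; apply: inner_extl => y; rewrite aT aT'; congr (⟪_, _⟫).
apply/eqP; rewrite -subr_eq0; apply/eqP; apply: tS => s Ss.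
by rewrite innerBr -aT -aT' h// subrr.
Qed.

Variables (g1 g2 : I -> F -> F).
Hypotheses (s1 : star_family g1) (s2 : star_family g2).
Hypothesis ker : forall v, (forall U, intertwiner g1 g2 U -> U v = 0) -> v = 0.
Hypothesis ran : forall v, (forall U x, intertwiner g1 g2 U -> ⟪U x, v⟫ = 0) -> v = 0.
Local Notation M1 := (commutant (commutant (range g1))).
Local Notation M2 := (commutant (commutant (range g2))).

(** phi a is the operator with phi a U = U a for all intertwiners U. The total joint range makes it
    unique, which yields all algebraic identities; the trivial common kernel makes phi injective. *)
Lemma intertwiners_isomorphism : exists phi, vN_isomorphism M1 M2 phi /\
  forall i, phi (g1 i) = g2 i.
Proof.
have /choice[phi hphi] a : exists b, M1 a -> bdop b /\ forall U x, intertwiner g1 g2 U -> b (U x) = U (a x).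
  case: (pselect (M1 a)) => [Ma|nMa]; last by exists idfun.
  by have [b hb] := transfer s1 s2 Ma; exists b.
pose S : set F := [set y | exists U x, intertwiner g1 g2 U /\ y = U x].
have tS v : (forall s, S s -> ⟪s, v⟫ = 0) -> v = 0.
  by move=> h; apply: ran => U x hU; apply: h; exists U, x.
have phi_uniq a b : M1 a -> bdop b -> (forall U x, intertwiner g1 g2 U -> b (U x) = U (a x)) -> phi a = b.
  move=> Ma bb hb; have [bp hp] := hphi _ Ma; apply: (total_ext tS) => // _ [U [x [hU ->]]].
  by rewrite hp// hb.
have phiM a : M1 a -> M2 (phi a).
  move=> Ma; have [bp hp] := hphi _ Ma; split; first exact/bounded_operatorP.
  move=> c [/bounded_operatorP bc hc]; apply: (total_ext tS); [exact: bdop_comp|exact: bdop_comp|].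
  move=> _ [U [x [hU ->]]] /=; rewrite (hp U)//.
  have hcU : intertwiner g1 g2 (c \o U).
    split; first by apply: bdop_comp => //; exact: hU.1.
    move=> i y /=; rewrite hU.2.
    have e := hc _ (ex_intro2 _ _ i Logic.I erefl : range g2 (g2 i)).
    by have := congr1 (@^~ (U y)) e.
  by have := hp (c \o U) x hcU.
exists phi; split; last first.
  move=> i; apply: phi_uniq; [exact: bicommutant_self s1.1|exact: s2.1|].
  by move=> U x hU; rewrite hU.2.
split.
- split=> //.
  + move=> a a'; rewrite !inE => Ma Ma' e; apply/funext => x.
    apply/eqP; rewrite -subr_eq0; apply/eqP; apply: ker => U hU.
    have [_ h] := hphi _ Ma; have [_ h'] := hphi _ Ma'.
    by rewrite (linB _ _ hU.1.1) -h// -h'// e subrr.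
  (* The preimage of b is its transfer in the reverse direction, through the adjoint
     intertwiners. *)
  + move=> b Mb; have [a [ba ha]] := transfer s2 s1 Mb.
    have Ua U x : intertwiner g1 g2 U -> U (a x) = b (U x).
      move=> hU; suff : U \o a = b \o U by move=> /(congr1 (@^~ x)).
      pose S' : set F := [set y | exists U x, intertwiner g2 g1 U /\ y = U x].
      apply: (@total_ext _ _ S').
      - move=> v hv; apply: ker => V hV; have [V' bV' aV] := adj_exists hV.1.
        have hV' := intertwiner_adj invK s1 s2 hV bV' aV.
        apply/eqP; rewrite -n2_eq0 /n2 aV innerC (hv (V' (V v))) ?J0//.
        by exists V', (V v).
      - by apply: bdop_comp => //; exact: hU.1.
      - by apply: bdop_comp; [exact: vN_bdop Mb|exact: hU.1].
      - move=> _ [V [y [hV ->]]] /=; rewrite ha//.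
        by have /= -> := bicommutant_comm Mb (intertwiner_comp hV hU).
    have Ma : M1 a.
      split; first exact/bounded_operatorP.
      move=> c [/bounded_operatorP bc hc]; apply/funext => x /=.
      have cg i y : c (g1 i y) = g1 i (c y).
        have e := hc _ (ex_intro2 _ _ i Logic.I erefl : range g1 (g1 i)).
        by have := congr1 (@^~ y) e.
      apply/eqP; rewrite -subr_eq0; apply/eqP; apply: ker => U hU.
      have hUc : intertwiner g1 g2 (U \o c).
        split; first by apply: bdop_comp => //; exact: hU.1.
        by move=> i y /=; rewrite cg hU.2.
      by rewrite (linB _ _ hU.1.1) Ua// -[U (c (a x))]/((U \o c) (a x)) Ua// subrr.
    exists a => //; apply: phi_uniq => //; first exact: vN_bdop Mb.
    by move=> U x hU; rewrite Ua.
- move=> c a a' Ma Ma'; have [ba ha] := hphi _ Ma; have [ba' ha'] := hphi _ Ma'.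
  have bs : bdop (fun v => c *: a v + a' v).
    by apply: bdopD; [apply: bdopZ; exact: vN_bdop Ma|exact: vN_bdop Ma'].
  apply: phi_uniq.
  + split; first exact/bounded_operatorP.
    move=> C hC; have [_ h] := Ma; have [_ h'] := Ma'; have bC := vN_bdop hC.
    apply/funext => v /=; rewrite (linD _ _ bC.1) (linZ _ _ bC.1).
    by have := congr1 (@^~ v) (h _ hC); have := congr1 (@^~ v) (h' _ hC) => /= -> ->.
  + by apply: bdopD => //; exact: bdopZ.
  + by move=> U x hU; rewrite ha// ha'// (linD _ _ hU.1.1) (linZ _ _ hU.1.1).
- move=> a a' Ma Ma'; have [ba ha] := hphi _ Ma; have [ba' ha'] := hphi _ Ma'.
  apply: phi_uniq.
  + split; first by apply/bounded_operatorP; apply: bdop_comp; [exact: vN_bdop Ma|exact: vN_bdop Ma'].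
    move=> C hC; have [_ h] := Ma; have [_ h'] := Ma'.
    apply/funext => v /=; have /= -> := congr1 (@^~ v) (h' _ hC).
    by have /= -> := congr1 (@^~ (a' v)) (h _ hC).
  + exact: bdop_comp.
  + by move=> U x hU /=; rewrite ha'// ha.
- move=> a a' Ma Ma' aa; have [ba ha] := hphi _ Ma; have [ba' ha'] := hphi _ Ma'.
  have [b bb ab] := adj_exists ba.
  suff -> : phi a' = b by [].
  apply: (total_ext tS) => // _ [U [x [hU ->]]]; rewrite ha'//.
  apply/eqP; rewrite -subr_eq0; apply/eqP; apply: tS => _ [V [y [hV ->]]].
  have [U' bU' aU] := adj_exists hU.1; have hU' := intertwiner_adj invK s1 s2 hU bU' aU.
  have UV z t : ⟪V z, U t⟫ = ⟪U' (V z), t⟫ by rewrite innerC aU -innerC.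
  have e := bicommutant_comm Ma (intertwiner_comp hV hU'); have /= ey := e y.
  by rewrite innerBr -ab ha// !UV -ey aa subrr.
Qed.

End Intertwiners.

(** * Sufficiency *)

Section UniformBoundedness.
Variables (R : realType) (H : hilbertType R).
Implicit Types (x y z v : H).

(** A gliding hump. Step n moves v by 3^-(n+1) along an element z_n of Z so that the pairing with
    z_n becomes at least 3^-(n+1) |z_n|; all later moves together can undo at most half of it. *)
Lemma uniform_boundedness (K Z : set H) : real_subspace K -> closed K -> Z `<=` K ->
  (forall v, K v -> exists C : R, forall z, Z z -> `|rip v z| <= C) ->
  exists C : R, forall z, Z z -> hn z <= C.
Proof.
move=> [K0 KD KZ] cK ZK wb; apply: contrapT => nb.
have /choice[zf hz] C : exists z, Z z /\ C < hn z.
  apply: contrapT => h; apply: nb; exists C => z Zz; rewrite leNgt; apply/negP => zC.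
  by apply: h; exists z.
pose q n : R := 3^-1 ^+ n.
have q0 n : 0 < q n by rewrite exprn_gt0// invr_gt0.
have qS n : q n.+1 = 3^-1 * q n by rewrite /q exprS.
(* The size ensures that the surviving half of the pairing exceeds n + 1. *)
pose zn n := zf (2 * n.+1%:R / q n.+1).
have znb n : 2 * n.+1%:R < q n.+1 * hn (zn n).
  by rewrite [q _ * _]mulrC -ltr_pdivrMr//; exact: (hz (2 * n.+1%:R / q n.+1)).2.
have zn0 n : 0 < hn (zn n).
  apply: lt_trans (hz _).2; rewrite divr_gt0// mulr_gt0//; exact: ltr0Sn.
pose t n := q n.+1 / hn (zn n).
have t0 n : 0 < t n by rewrite divr_gt0.
(* Whatever the pairing of v with z, it becomes large at v + t z or at v - t z. *)
pose step n v := if t n * n2 (zn n) <= `|rip (v + (t n)%:C%C *: zn n) (zn n)|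
  then v + (t n)%:C%C *: zn n else v - (t n)%:C%C *: zn n.
pose v := fix v n := if n is n'.+1 then step n' (v n') else 0.
have step_far n w : q n.+1 * hn (zn n) <= `|rip (step n w) (zn n)|.
  have -> : q n.+1 * hn (zn n) = t n * n2 (zn n).
    by rewrite -hn2 /t; field; rewrite gt_eqF.
  have e1 : rip (w + (t n)%:C%C *: zn n) (zn n) = rip w (zn n) + t n * n2 (zn n).
    by rewrite ripDl ripZl rip_n2.
  have e2 : rip (w - (t n)%:C%C *: zn n) (zn n) = rip w (zn n) - t n * n2 (zn n).
    by rewrite ripBl ripZl rip_n2.
  have b0 : 0 < t n * n2 (zn n) by rewrite mulr_gt0// -hn2 exprn_gt0.
  rewrite /step; case: ifP => [//|/negbT]; rewrite -ltNge e1 e2.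
  move: (t n * n2 (zn n)) b0 (rip w (zn n)) => b b0 a.
  by rewrite ltr_norml ler_normr => /andP[h1 h2]; apply/orP; right; lra.
have step_near n w : hn (step n w - w) = q n.+1.
  have e : hn ((t n)%:C%C *: zn n) = q n.+1.
    by rewrite hnZ ncC gtr0_norm// /t mulfVK// gt_eqF.
  by rewrite /step; case: ifP => _; rewrite addrAC subrr add0r ?hnN.
have vK n : K (v n).
  elim: n => [|n ih] //=; rewrite /step.
  have Kz : K (zn n) by apply: ZK; exact: (hz _).1.
  case: ifP => _; apply: KD => //; first exact: KZ.
  by have := KZ (- t n) _ Kz; rewrite rmorphN scaleNr.
have near n k : hn (v (k + n)%N - v n) <= 2^-1 * q n - 2^-1 * q (k + n)%N.
  elim: k => [|k ih]; first by rewrite !subrr hn0.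
  apply: le_trans (hn_triangle _ (v (k + n)%N) _) _.
  by rewrite addSn /= step_near; have := qS (k + n)%N; lra.
have near' n m : (n <= m)%N -> hn (v m - v n) <= 2^-1 * q n.
  by move=> /subnK <-; have := near n (m - n)%N; have := q0 (m - n + n)%N; lra.
have q2 n : q n <= 2^-1 ^+ n.
  by rewrite lerXn2r// ?nnegrE ?invr_ge0// lef_pV2 ?posrE// ler_nat.
have [|l hl] := @hcomplete _ _ v.
  move=> e e0; have [N hN] := half_small ler01 e0; exists N => n m Nn Nm.
  have [nm|/ltW mn] := leP n m.
    rewrite hnBC; apply: le_lt_trans (near' _ _ nm) _.
    by have := hN _ Nn; have := q2 n; have := q0 n; lra.
  apply: le_lt_trans (near' _ _ mn) _.
  by have := hN _ Nm; have := q2 m; have := q0 m; lra.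
have Kl : K l by exact: (closed_hcvg cK vK hl).
have lim n : hn (l - v n) <= 2^-1 * q n.
  apply/ler_addgt0Pr => e e0; have [N hN] := (hcvgP _ _).1 hl _ e0.
  have h1 := hN (maxn N n) (leq_maxl _ _); have h2 := near' n (maxn N n) (leq_maxr _ _).
  apply: le_trans (hn_triangle _ (v (maxn N n)) _) _.
  by rewrite hnBC in h1; lra.
have [C hC] := wb _ Kl.
have [N hN] := @inv_nat_small R (`|C| + 1)^-1 (ltac:(by rewrite invr_gt0 ltr_wpDl)).
have hN' : `|C| + 1 < N.+1%:R.
  by have := hN N (leqnn N); rewrite ltf_pV2 ?posrE ?ltr_wpDl.
have h1 := hC _ (hz (2 * N.+1%:R / q N.+1)).1; rewrite -/(zn N) in h1.
have h2 := step_far N (v N); rewrite -[step N (v N)]/(v N.+1) in h2.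
have h3 : `|rip (l - v N.+1) (zn N)| <= 2^-1 * q N.+1 * hn (zn N).
  by apply: le_trans (rip_le _ _) _; rewrite ler_wpM2r ?hn_ge0.
rewrite ripBl in h3.
have h4 : `|rip (v N.+1) (zn N)| <= `|rip l (zn N)| + `|rip l (zn N) - rip (v N.+1) (zn N)|.
  rewrite -{1}(subKr (rip l (zn N)) (rip (v N.+1) (zn N))); exact: ler_normB.
have h5 := ler_norm C; have h6 := znb N.
by move: hN' h1 h2 h3 h4 h5 h6; rewrite -mulrA; lra.
Qed.

End UniformBoundedness.

(** * Real Hilbert-Schmidt operators and their quadratic forms *)

Section RealOperators.
Variables (R : realType) (H : hilbertType R).
Implicit Types (x y z h : H) (B C g : H -> H) (M D : H -> R).

Lemma n2_iI x : n2 (imI *: x) = n2 x.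
Proof. by rewrite n2Z sqc_imI mul1r. Qed.

Lemma rip_iIl x y : rip (imI *: x) y = Im ⟪x, y⟫.
Proof. by rewrite /rip innerZl !reim; ring. Qed.

Lemma linear_rlin B : linear B -> rlin B.
Proof. by move=> lB; split=> *; [exact: linD|exact: linZ]. Qed.

(* For a complex orthonormal e, the e i and imI *: e i form a real orthonormal family. *)
Definition rhs B B' (c : R) := [/\ rlin B /\ rlin B', forall x y, rip (B x) y = rip x (B' y),
  0 <= c /\ forall x, hn (B x) <= c * hn x, forall x, hn (B' x) <= c * hn x &
  forall n (e : 'I_n -> H), ons e -> \sum_i (n2 (B' (e i)) + n2 (B' (imI *: e i))) <= c].

(** A form of finite trace, given as twice the covariance of finitely many random displacements, on
    finitely many h at a time. The factor 2 turns the averaged character into exp (- M / 4). *)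
Definition noisy M := exists c : R, forall s : seq H, exists a : seq H,
  (forall h, h \in s -> M h = 2 * \sum_(b <- a) rip h b ^+ 2) /\ \sum_(b <- a) n2 b <= c.

Definition real_pos g := [/\ rlin g, exists2 c : R, 0 <= c & forall x, hn (g x) <= c * hn x,
  forall x y, rip (g x) y = rip x (g y) & forall x, 0 <= rip x (g x)].

(** A difference of two noise forms. M2 comes with an operator [g], from which [i0] is later
    built. *)
Definition hsform D := exists M2 M3 g, [/\ noisy M2, noisy M3, forall h, D h = M2 h - M3 h,
  real_pos g & forall h, M2 h = rip h (g h)].

Lemma noisyD M M' : noisy M -> noisy M' -> noisy (fun h => M h + M' h).
Proof.
move=> [c hc] [c' hc']; exists (c + c') => s.
have [a [h1 h2]] := hc s; have [a' [h1' h2']] := hc' s.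
exists (a ++ a'); split=> [h hs|]; last by rewrite big_cat lerD.
by rewrite big_cat/= mulrDr -h1// -h1'.
Qed.

(** The displacements are B' e / 2 and B' (i e) / 2 for an orthonormal family e that spans the B h;
    the square 1/4 times the 2 of [noisy] is the factor 1/2. *)
Lemma rhs_noisy B B' (c : R) : rhs B B' c -> noisy (fun h => 2^-1 * n2 (B h)).
Proof.
move=> [[_ rB'] adj _ _ hB']; exists c => s.
have [n [e [oe he]]] := gram_schmidtT [seq B h | h <- s].
pose f b := (2^-1)%:C%C *: B' b.
have n2f b : n2 (f b) = 4^-1 * n2 (B' b).
  by rewrite n2Z sqcC; congr (_ * _); field.
exists ([seq f (e i) | i <- index_enum 'I_n] ++ [seq f (imI *: e i) | i <- index_enum 'I_n]); split.
  move=> h hs; have {}he := he _ (map_f _ hs).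
  rewrite big_cat !big_map/= -big_split/= (n2_ons oe he) !mulr_sumr.
  apply: eq_bigr => i _; rewrite /f !ripZr -!adj (ripC (B h)) (ripC _ (imI *: _)) rip_iIl.
  by rewrite /sqc /rip; field.
rewrite big_cat !big_map/= -big_split/=; apply: le_trans (hB' _ _ oe).
apply: ler_sum => i _; rewrite !n2f; have := n2_ge0 (B' (e i)); have := n2_ge0 (B' (imI *: e i)); lra.
Qed.

Lemma rhsB B B' C C' (c d : R) : rhs B B' c -> rhs C C' d ->
  rhs (fun x => B x - C x) (fun x => B' x - C' x) (2 * c + 2 * d).
Proof.
move=> [[[BD BZ] [BD' BZ']] aB [c0 nB] nB' sB] [[[CD CZ] [CD' CZ']] aC [d0 nC] nC' sC]; split.
- split; split=> *; rewrite ?BD ?CD ?BZ ?CZ ?BD' ?CD' ?BZ' ?CZ'; hvec.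
- by move=> x y; rewrite !ripE aB aC.
- split; first by rewrite addr_ge0 ?mulr_ge0.
  move=> x; apply: le_trans (hnB _ _) _; apply: le_trans (lerD (nB x) (nC x)) _.
  by have := hn_ge0 x; nra.
- move=> x; apply: le_trans (hnB _ _) _; apply: le_trans (lerD (nB' x) (nC' x)) _.
  by have := hn_ge0 x; nra.
- move=> n e oe; apply: le_trans (_ : \sum_i (2 * (n2 (B' (e i)) + n2 (B' (imI *: e i))) +
    2 * (n2 (C' (e i)) + n2 (C' (imI *: e i)))) <= _); last first.
    by rewrite big_split/= -!mulr_sumr lerD// ler_wpM2l// ?sB ?sC.
  apply: ler_sum => i _; have h x := n2_le_2 (B' x) (- C' x).
  have := h (e i); have := h (imI *: e i); rewrite !n2N; lra.
Qed.

Lemma rhs_comp B B' C C' (c d : R) : rhs B B' c -> rlin C -> rlin C' ->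
  (forall x y, rip (C x) y = rip x (C' y)) -> 0 <= d ->
  (forall x, hn (C x) <= d * hn x) -> (forall x, hn (C' x) <= d * hn x) ->
  rhs (B \o C) (C' \o B') (c * d + d ^+ 2 * c).
Proof.
move=> [[[BD BZ] [BD' BZ']] aB [c0 nB] nB' sB] [CD CZ] [CD' CZ'] aC d0 nC nC'; split.
- by split; split=> * /=; rewrite ?BD ?CD ?BZ ?CZ ?BD' ?CD' ?BZ' ?CZ' ?BD ?BZ ?CD' ?CZ'.
- by move=> x y /=; rewrite aB aC.
- split; first by rewrite addr_ge0 ?mulr_ge0 ?sqr_ge0.
  move=> x /=; apply: le_trans (nB _) _; rewrite mulrDl -mulrA.
  apply: le_trans (ler_wpM2l c0 (nC x)) _; rewrite lerDl !mulr_ge0 ?sqr_ge0 ?hn_ge0//.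
- move=> x /=; apply: le_trans (nC' _) _; apply: le_trans (ler_wpM2l d0 (nB' x)) _.
  by rewrite mulrDl mulrCA mulrA lerDl !mulr_ge0 ?sqr_ge0 ?hn_ge0.
- move=> n e oe; apply: le_trans (_ : \sum_i d ^+ 2 * (n2 (B' (e i)) + n2 (B' (imI *: e i))) <= _).
    have h x : n2 (C' x) <= d ^+ 2 * n2 x.
      by rewrite -!hn2 -exprMn ler_pXn2r ?nnegrE ?mulr_ge0 ?hn_ge0.
    by apply: ler_sum => i _ /=; rewrite mulrDr lerD.
  by rewrite -mulr_sumr; apply: le_trans (ler_wpM2l (sqr_ge0 d) (sB _ _ oe)) _; rewrite lerDr mulr_ge0.
Qed.

Lemma rhsZ B B' (a c : R) : rhs B B' c ->
  rhs (fun x => a%:C%C *: B x) (fun x => a%:C%C *: B' x) (`|a| * c + a ^+ 2 * c).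
Proof.
move=> [[[BD BZ] [BD' BZ']] aB [c0 nB] nB' sB].
have ac : 0 <= a ^+ 2 * c by rewrite mulr_ge0 ?sqr_ge0.
have ac' : 0 <= `|a| * c by rewrite mulr_ge0.
split.
- by split; split=> *; rewrite ?BD ?BD' ?BZ ?BZ' ?scalerDr// !scalerA mulrC.
- by move=> x y; rewrite !ripE aB.
- split; first by rewrite addr_ge0.
  move=> x; rewrite hnZ ncC; apply: le_trans (ler_wpM2l (normr_ge0 a) (nB x)) _.
  by rewrite mulrA mulrDl lerDl mulr_ge0 ?hn_ge0.
- move=> x; rewrite hnZ ncC; apply: le_trans (ler_wpM2l (normr_ge0 a) (nB' x)) _.
  by rewrite mulrA mulrDl lerDl mulr_ge0 ?hn_ge0.
- move=> n e oe; under eq_bigr do rewrite !n2Z !sqcC -mulrDr.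
  by rewrite -mulr_sumr; apply: le_trans (ler_wpM2l (sqr_ge0 a) (sB _ _ oe)) _; rewrite lerDr.
Qed.

Lemma hsformD D D' : hsform D -> hsform D' -> hsform (fun h => D h + D' h).
Proof.
move=> [M2 [M3 [g [n2_ n3 e [[gD gZ] [c c0 gc] ga gp] eg]]]].
move=> [M2' [M3' [g' [n2' n3' e' [[gD' gZ'] [c' c0' gc'] ga' gp'] eg']]]].
exists (fun h => M2 h + M2' h), (fun h => M3 h + M3' h), (fun h => g h + g' h); split.
- exact: noisyD.
- exact: noisyD.
- by move=> h; rewrite e e'; ring.
- split.
  + by split=> *; rewrite ?gD ?gD' ?gZ ?gZ'; hvec.
  + exists (c + c'); first exact: addr_ge0.
    by move=> x; apply: le_trans (hnD _ _) _; rewrite mulrDl lerD.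
  + by move=> x y; rewrite !ripE ga ga'.
  + by move=> x; rewrite ripDr addr_ge0.
- by move=> h; rewrite ripDr eg eg'.
Qed.

(** Polarization: the product is (|B h|^2 + |C h|^2) / 2 - |B h - C h|^2 / 2. *)
Lemma rhs_hsform B B' C C' (c d : R) : rhs B B' c -> rhs C C' d ->
  hsform (fun h => rip (B h) (C h)).
Proof.
move=> hB hC; have hBC := rhsB hB hC.
have := hB; have := hC.
move=> [[[CD CZ] [CD' CZ']] aC [d0 nC] nC' sC] [[[BD BZ] [BD' BZ']] aB [c0 nB] nB' sB].
have gq x y : rip (B' (B x)) y = rip (B x) (B y) by rewrite ripC -aB ripC.
have gq' x y : rip (C' (C x)) y = rip (C x) (C y) by rewrite ripC -aC ripC.
exists (fun h => 2^-1 * n2 (B h) + 2^-1 * n2 (C h)), (fun h => 2^-1 * n2 (B h - C h)),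
  (fun h => (2^-1)%:C%C *: (B' (B h) + C' (C h))); split.
- by apply: noisyD; [exact: rhs_noisy hB|exact: rhs_noisy hC].
- exact: rhs_noisy hBC.
- by move=> h; rewrite n2B; field.
- split.
  + by split=> *; rewrite ?BD ?CD ?BZ ?CZ ?BD' ?CD' ?BZ' ?CZ'; hvec.
  + exists (c * c + d * d); first by rewrite addr_ge0 ?mulr_ge0.
    move=> x; rewrite hnZ ncC ger0_norm ?invr_ge0//.
    have h1 : hn (B' (B x) + C' (C x)) <= (c * c + d * d) * hn x.
      apply: le_trans (hnD _ _) _; rewrite mulrDl -!mulrA; apply: lerD.
        by apply: le_trans (nB' _) _; rewrite ler_wpM2l.
      by apply: le_trans (nC' _) _; rewrite ler_wpM2l.
    by have := hn_ge0 (B' (B x) + C' (C x)); lra.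
  + move=> x y; rewrite ripZl ripZr ripDl ripDr !gq !gq' (ripC x) (ripC x) !gq !gq'.
    by rewrite (ripC (B y)) (ripC (C y)).
  + by move=> x; rewrite ripZr ripDr (ripC x) (ripC x) gq gq' !rip_n2 mulr_ge0 ?invr_ge0 ?addr_ge0 ?n2_ge0.
- by move=> h; rewrite ripZr ripDr (ripC h) (ripC h) gq gq' !rip_n2; ring.
Qed.

Lemma hs_rhs T T' : bdop T -> bdop T' -> adjoint_operators T T' -> hs T' -> exists c, rhs T T' c.
Proof.
move=> [lT [m m0 nT]] [lT' [m' m0' nT']] aT [M hM]; have M0 := hsb_ge0 hM.
exists (m + m' + 2 * M); split.
- by split; exact: linear_rlin.
- by move=> x y; rewrite /rip aT.
- split; first by rewrite !addr_ge0 ?mulr_ge0.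
  by move=> x; apply: le_trans (nT x) _; rewrite ler_wpM2r ?hn_ge0// -addrA lerDl addr_ge0 ?mulr_ge0.
- by move=> x; apply: le_trans (nT' x) _; rewrite ler_wpM2r ?hn_ge0// -addrA addrCA lerDl addr_ge0 ?mulr_ge0.
- move=> n e oe; under eq_bigr do rewrite (linZ _ _ lT') n2_iI.
  by rewrite big_split/=; have := hM _ _ oe; lra.
Qed.

Lemma anti_rhs Z (M : R) : (forall (a : R[i]) x y, Z (a *: x + y) = (a^*)%C *: Z x + Z y) ->
  (forall x y, ⟪x, Z y⟫ = ⟪y, Z x⟫) -> hsb Z M -> rhs Z Z (1 + 2 * M).
Proof.
move=> Zl Zs hM; have M0 := hsb_ge0 hM.
have ZZ (a : R) x : Z (a%:C%C *: x) = a%:C%C *: Z x by rewrite (antiZ Zl) JC.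
have rZ : rlin Z by split=> *; [exact: antiD|exact: ZZ].
have nZ x : hn (Z x) <= (1 + 2 * M) * hn x.
  have h := hs_hn x ZZ hM; rewrite hn_le ?mulr_ge0 ?hn_ge0 ?addr_ge0 ?mulr_ge0//.
  rewrite exprMn hn2; apply: le_trans h _; rewrite ler_wpM2r ?n2_ge0//; nra.
split=> //.
- by move=> x y; rewrite ripC /rip Zs.
- by split=> //; rewrite addr_ge0 ?mulr_ge0.
- move=> n e oe; under eq_bigr do rewrite (antiZ Zl) n2Z sqcJ sqc_imI mul1r.
  by rewrite big_split/=; have := hM _ _ oe; lra.
Qed.

Section Complexification.
Variable j : H -> H.
Hypotheses (jl : forall (a : R[i]) x y, j (a *: x + y) = (a^*)%C *: j x + j y)
  (jK : forall x, j (j x) = x) (jI : forall x y, ⟪j x, j y⟫ = ⟪y, x⟫).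

Lemma rip_j x y : j x = x -> rip x (j y) = rip x y.
Proof. by move=> jx; rewrite /rip -{1}jx jI innerC reim. Qed.

Lemma rip_rpart x y : j x = x -> rip x (rpart j y) = rip x y.
Proof. by move=> jx; rewrite /rpart ripZr ripDr rip_j//; field. Qed.

Lemma rip_real_i x y : j x = x -> j y = y -> rip x (imI *: y) = 0.
Proof. by move=> jx jy; rewrite /rip innerZr (real_inner_rip jI jx jy) !reim; ring. Qed.

Lemma rip_split a b c d : j a = a -> j b = b -> j c = c -> j d = d ->
  rip (a + imI *: b) (c + imI *: d) = rip a c + rip b d.
Proof.
move=> ja jb jc jd; rewrite ripDl !ripDr rip_iI rip_real_i// (ripC (imI *: b)) rip_real_i//.
by rewrite addr0 add0r.
Qed.

(** Compress g to the real vectors and extend complex linearly. The form of G is then real on real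
    vectors, so adding G to V^* V leaves the symplectic form unchanged. *)
Lemma real_pos_complexify g : real_pos g -> exists G, [/\ pos G,
  forall h, j h = h -> rip h (G h) = rip h (g h) &
  forall h k, j h = h -> j k = k -> Im ⟪h, G k⟫ = 0].
Proof.
move=> [[gD gZ] [c c0 gc] ga gp].
have [rD rZ] := rpart_rlin jl; have [iD iZ] := ipart_rlin jl.
pose G z := rpart j (g (rpart j z)) + imI *: rpart j (g (ipart j z)).
have Greal h : j h = h -> G h = rpart j (g h).
  move=> jh; rewrite /G (rpart_real jh) (ipart_real jh).
  have g0 : g 0 = 0 by apply: rlin0; split.
  by rewrite g0 (rlin0 (rpart_rlin jl)) scaler0 addr0.
have lG : linear G.
  apply: rlin_complex; first split.
  - by move=> x y; rewrite /G rD iD !gD !rD; hvec.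
  - by move=> a x; rewrite /G rZ iZ !gZ !rZ [RHS]scalerDr; congr (_ + _); rewrite [LHS]scalerA [RHS]scalerA mulrC.
  - move=> x; rewrite /G (rpart_i jl) (ipart_i jl).
    have gN y : rpart j (g (- y)) = - rpart j (g y).
      have -> : - y = (-1)%:C%C *: y by rewrite rmorphN rmorph1 scaleN1r.
      by rewrite gZ rZ rmorphN rmorph1 scaleN1r.
    by rewrite gN scalerDr scalerA imI2 scaleN1r addrC.
have ripG x y : rip x (G y) = rip (rpart j x) (g (rpart j y)) + rip (ipart j x) (g (ipart j y)).
  rewrite -{1}(rpartE j x) /G rip_split ?rpart_j ?ipart_j//.
  by rewrite !rip_rpart ?rpart_j ?ipart_j.
exists G; split.
- split.
  + split=> //; exists (2 * c); first by rewrite mulr_ge0.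
    move=> x; apply: le_trans (hnD _ _) _; rewrite hnZ (_ : nc imI = 1) ?mul1r; last first.
      by rewrite /nc sqc_imI sqrtr1.
    have h1 : hn (rpart j (g (rpart j x))) <= c * hn x.
      apply: le_trans (rpart_hn jI _) _; apply: le_trans (gc _) _.
      by rewrite ler_wpM2l// rpart_hn.
    have h2 : hn (rpart j (g (ipart j x))) <= c * hn x.
      apply: le_trans (rpart_hn jI _) _; apply: le_trans (gc _) _.
      by rewrite ler_wpM2l// ipart_hn.
    by rewrite -mulrA; lra.
  + apply: complex_sa => // x y; rewrite ripC !ripG.
    have sw a b : rip a (g b) = rip b (g a) by rewrite ripC ga.
    by rewrite (sw (rpart j y)) (sw (ipart j y)).
  + by move=> x; rewrite ripG addr_ge0.
- by move=> h jh; rewrite Greal// rip_rpart.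
- by move=> h k jh jk; rewrite Greal// (real_inner_rip jI jh (rpart_j jl jK _)).
Qed.

End Complexification.
End RealOperators.

(** * Small antilinear operators and their resolvents *)

Section SmallRemainder.
Variables (R : realType) (H : hilbertType R).
Implicit Types (x y z h : H).

Lemma oproj_compl_n2 n (e : 'I_n -> H) x : ons e -> n2 (x - oproj e x) <= n2 x.
Proof. by move=> oe; rewrite [leRHS](oproj_pyth x oe) lerDr n2_ge0. Qed.

Lemma oproj_compl_sa n (e : 'I_n -> H) x y : ⟪x - oproj e x, y⟫ = ⟪x, y - oproj e y⟫.
Proof. by rewrite innerBl innerBr (oproj_sa e). Qed.

Lemma ons_catE n m (e : 'I_n -> H) (f : 'I_m -> H) : ons e -> ons f ->
  (forall i k, ⟪e i, f k⟫ = 0) ->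
  exists g : 'I_(n + m) -> H, ons g /\ forall T : H -> H,
    \sum_i n2 (T (g i)) = \sum_i n2 (T (e i)) + \sum_k n2 (T (f k)).
Proof.
move=> oe of_ ef; exists (fun i => match fintype.split i with inl a => e a | inr b => f b end); split.
  move=> i k; case: (splitP i) => a ia; case: (splitP k) => b kb.
  - by rewrite oe; congr (_%:R); rewrite -!val_eqE/= ia kb.
  - rewrite ef; have -> : (i == k) = false; last by [].
    by apply/negbTE; rewrite -val_eqE/= ia kb neq_ltn ltn_addr.
  - rewrite innerC ef J0; have -> : (i == k) = false; last by [].
    by apply/negbTE; rewrite -val_eqE/= ia kb neq_ltn (ltn_addr a (ltn_ord b)) orbT.
  - by rewrite of_; congr (_%:R); rewrite -!val_eqE/= ia kb eqn_add2l.
move=> T; rewrite big_split_ord/=; congr (_ + _); apply: eq_bigr => i _.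
  by case: splitP => [k /= /val_inj ->//|k /= e0]; have := ltn_ord i; rewrite e0 ltnNge leq_addr.
case: splitP => [k /= e0|k /= /addnI /val_inj ->//].
by have := ltn_ord k; rewrite -e0 ltnNge leq_addr.
Qed.

(** Take e that maximizes sum |Z (e i)|^2 up to d. Vectors orthogonal to e can then add at most d,
    so Z is small on the complement of e; compressing on both sides keeps Z symmetric. *)
Lemma hs_small Z (d : R) : (forall (a : R[i]) x y, Z (a *: x + y) = (a^*)%C *: Z x + Z y) ->
  (forall x y, ⟪x, Z y⟫ = ⟪y, Z x⟫) -> hs Z -> 0 < d ->
  exists n (e : 'I_n -> H), ons e /\
    hsb (fun x => Z (x - oproj e x) - oproj e (Z (x - oproj e x))) d.
Proof.
move=> Zl Zs [M hM] d0.
pose S : set R := [set r | exists n (e : 'I_n -> H), ons e /\ r = \sum_i n2 (Z (e i))].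
have hS : has_sup S.
  split; last by exists M => _ [n [e [oe ->]]]; exact: hM.
  exists 0, 0%N, (fun=> 0); split; first by case.
  by rewrite big_ord0.
have [_ [n [e [oe ->]]] hn_] := sup_adherent d0 hS.
exists n, e; split=> // m f of_.
apply: le_trans (_ : \sum_i n2 (Z (f i - oproj e (f i))) <= _).
  by apply: ler_sum => i _; exact: oproj_compl_n2.
pose P : set H := [set x | forall i, ⟪e i, x⟫ = 0].
have Pf i : P (f i - oproj e (f i)).
  by move=> k; rewrite innerBr oprojE// subrr.
have P1 k (g : 'I_k -> H) x : P x -> (forall i, P (g i)) -> P (x - oproj g x).
  move=> Px Pg i; rewrite innerBr Px /oproj inner_sumr big1 ?subrr// => l _.
  by rewrite innerZr Pg mulr0.
have P2 x : P x -> P ((hn x)^-1%:C%C *: x) by move=> Px i; rewrite innerZr Px mulr0.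
have P3 x : x \in [seq f i - oproj e (f i) | i <- enum 'I_m] -> P x.
  by move=> /mapP[i _ ->]; exact: Pf.
have [m' [e' [oe' Pe' he']]] := gram_schmidt P1 P2 P3.
have small : \sum_k n2 (Z (e' k)) <= d.
  have [g [og hg]] := ons_catE oe oe' (fun i k => Pe' k i).
  have : \sum_i n2 (Z (g i)) <= sup S by apply: ub_le_sup; [exact: hS.2|exists (n + m')%N, g].
  by rewrite hg; lra.
have [p [g [og hg]]] := gram_schmidt_fun (fun i => Z (f i - oproj e (f i))).
apply: le_trans small.
apply: le_trans (_ : \sum_l n2 (oproj e' (Z (g l))) <= _).
  under eq_bigr do rewrite (n2_ons og (hg _)).
  rewrite exchange_big; apply: ler_sum => l _.
  apply: le_trans (_ : \sum_i sqc ⟪f i, oproj e' (Z (g l)) - oproj e (oproj e' (Z (g l)))⟫ <= _).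
    rewrite le_eqVlt; apply/orP; left; apply/eqP; apply: eq_bigr => i _.
    rewrite Zs -oproj_compl_sa -(oproj_sa e').
    by rewrite he'//; apply: map_f; rewrite mem_enum.
  apply: le_trans (bessel _ of_) _; exact: oproj_compl_n2.
under eq_bigr do rewrite oproj_n2//.
rewrite exchange_big; apply: ler_sum => k _.
under eq_bigr do rewrite -Zs.
exact: bessel.
Qed.

(** rho = (1 - Z)^-1 = (1 - Z^2)^-1 (1 + Z); Z is antilinear, but Z^2 is complex linear, so
    [inverse_exists] applies to 1 - Z^2. *)
Lemma real_resolvent Z : (forall (a : R[i]) x y, Z (a *: x + y) = (a^*)%C *: Z x + Z y) ->
  (forall x y, ⟪x, Z y⟫ = ⟪y, Z x⟫) -> (forall x, n2 (Z x) <= 4^-1 * n2 x) ->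
  exists rho, [/\ rlin rho, forall x, rho x - Z (rho x) = x,
    forall x y, rip (rho x) y = rip x (rho y) & forall x, hn (rho x) <= 2 * hn x].
Proof.
move=> Zl Zs Zb.
have ZD x y : Z (x + y) = Z x + Z y by exact: antiD.
have ZB x y : Z (x - y) = Z x - Z y by rewrite ZD -scaleN1r (antiZ Zl) JN J1 scaleN1r.
have hZ x : hn (Z x) <= 2^-1 * hn x.
  rewrite hn_le ?mulr_ge0 ?hn_ge0 ?invr_ge0// exprMn hn2 (_ : 2^-1 ^+ 2 = 4^-1)//.
  by field.
have low x : hn x <= 2 * hn (x - Z x).
  have := hn_triangle x (Z x) 0; rewrite !subr0; have := hZ x; lra.
pose A x := x - Z (Z x).
have bA : bdop A.
  apply: bdopB; first exact: bdop_id.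
  split; first by move=> a x y; rewrite !Zl JK.
  exists 1 => // x; rewrite mul1r; have := hZ (Z x); have := hZ x; have := hn_ge0 x; lra.
have ripZZ x : rip x (Z (Z x)) = n2 (Z x) by rewrite /rip Zs.
have [|x|B [bB AB BA]] := @inverse_exists _ H A (2^-1) bA.
- by rewrite invr_gt0.
- by rewrite /A ripBr rip_n2 ripZZ; have := Zb x; have := n2_ge0 x; lra.
have inj x y : x - Z x = y - Z y -> x = y.
  move=> e; apply/eqP; rewrite -subr_eq0 -hn_eq0 eq_le hn_ge0 andbT.
  apply: le_trans (low _) _; rewrite ZB.
  have -> : x - y - (Z x - Z y) = (x - Z x) - (y - Z y) by hvec.
  by rewrite e subrr hn0 mulr0.
have injN x : x + Z x = 0 -> x = 0.
  move=> e; apply/eqP; rewrite -hn_eq0; have := hZ x.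
  have -> : Z x = - x by apply/eqP; rewrite -addr_eq0 addrC e.
  by rewrite hnN eq_le hn_ge0 andbT; have := hn_ge0 x; lra.
pose rho x := B (x + Z x).
have rhoE x : rho x - Z (rho x) = x.
  apply/eqP; rewrite -subr_eq0; apply/eqP; apply: injN.
  have := AB (x + Z x); rewrite -/(rho x) /A => e.
  rewrite !ZB.
  have -> : rho x - Z (rho x) - x + (Z (rho x) - Z (Z (rho x)) - Z x) =
    (rho x - Z (Z (rho x))) - (x + Z x) by hvec.
  by rewrite e subrr.
exists rho; split=> //.
- split=> [x y|a x]; apply: inj; rewrite rhoE.
    by rewrite ZD -{1}(rhoE x) -{1}(rhoE y); hvec.
  by rewrite (antiZ Zl) JC -scalerBr rhoE.
- move=> x y.
  have -> : rip (rho x) y = rip (rho x) (rho y) - rip (rho x) (Z (rho y)) by rewrite -ripBr rhoE.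
  have -> : rip x (rho y) = rip (rho x) (rho y) - rip (Z (rho x)) (rho y) by rewrite -ripBl rhoE.
  by congr (_ - _); rewrite [RHS]ripC /rip Zs.
- by move=> x; apply: le_trans (low _) _; rewrite rhoE.
Qed.

End SmallRemainder.

(** * The squeezing that approximates Y^2 - X^2 *)

Section Squeezing.
Variables (R : realType) (H : hilbertType R) (K : set H) (X j Y : H -> H).
Hypothesis sd : std_data K X j.
Implicit Types (x y z h : H).
Local Notation Xb := (Xbar X j).

Let jl := sdj sd.
Let jK := sdjK sd.
Let jI := sdjI sd.
Let lX : linear X := (sd_bX sd).1.
Let sX := sd_sX sd.
Let sXb := sd_sXb sd.
Let lXb := sd_lXb sd.

Hypothesis pY : pos Y.
Hypothesis Dj : forall z, j (Y (Y z) - X (X z)) = Y (Y (j z)) - X (X (j z)).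
Variable T : H -> H.
Hypotheses (TE : forall x, T x = X x - Y x) (hsT : hs T).

Let lY : linear Y. Proof. by case: pY => -[]. Qed.
Let sY : adjoint_operators Y Y. Proof. by case: pY. Qed.
Let bT : bdop T.
Proof. by apply: bdop_eq (fun x => esym (TE x)); apply: bdopB; [exact: sd_bX sd|case: pY]. Qed.
Let sT : adjoint_operators T T. Proof. by move=> x y; rewrite !TE !innE sX sY. Qed.
Let lT : linear T := bT.1.

Let rsw S (a b : H) : adjoint_operators S S -> rip a (S b) = rip (S a) b.
Proof. by move=> h; rewrite /rip h. Qed.

Let ripj (a b : H) : rip a (j b) = rip b (j a).
Proof. by rewrite ripC /rip (conj_sym jK jI) -/(rip _ _) ripC. Qed.

(* Real parts of quadratic forms on the real vectors do not distinguish an operator from its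
   conjugate by j; since X^2 + Xb^2 = 2, this trades factors X for factors Xb. *)
Let NN x := (4^-1)%:C%C *: Xb (Xb (T (Xb x))) + (2^-1)%:C%C *: X (j (T (j x))) +
  (4^-1)%:C%C *: X (Xb (j (T (j (Xb x))))).

Let two x : X (X x) + Xb (Xb x) = 2%:C%C *: x.
Proof. by rewrite (sd_sq sd) rmorph_nat. Qed.

Lemma squeeze_form N h : N =1 NN -> j h = h ->
  2 * rip (X h) (N (Xb h)) = rip (X h) (T (Xb (Xb h))) + rip (Xb (Xb (X h))) (T h).
Proof.
move=> NE jh; rewrite NE /NN !ripDr !ripZr.
have jXb z : j (Xb z) = X (j z) by exact: (sd_jXb sd).
have jX z : j (X z) = Xb (j z) by exact: (sd_jX sd).
have com z : X (Xb z) = Xb (X z) by exact: (sd_com sd).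
have t1 : rip (X h) (Xb (Xb (T (Xb (Xb h))))) = rip (Xb (Xb (X h))) (T (Xb (Xb h))).
  by rewrite !(rsw _ _ sXb).
have t2 : rip (X h) (X (j (T (j (Xb h))))) = rip (X h) (T (Xb (Xb h))).
  rewrite (rsw _ _ sX) jXb jh ripj !jX jh -(rsw _ _ sT).
  by [].
have t3 : rip (X h) (X (Xb (j (T (j (Xb (Xb h))))))) = rip (Xb (Xb (X h))) (T (X (X h))).
  rewrite (rsw _ _ sX) (rsw _ _ sXb) !jXb jh ripj jXb !jX jh ripC.
  by rewrite !com.
rewrite t1 t2 t3.
have e : T (Xb (Xb h)) + T (X (X h)) = 2%:C%C *: T h.
  by rewrite -(linD _ _ lT) addrC two (linZ _ _ lT).
have : rip (Xb (Xb (X h))) (T (Xb (Xb h))) + rip (Xb (Xb (X h))) (T (X (X h))) =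
    2 * rip (Xb (Xb (X h))) (T h) by rewrite -ripDr e ripZr.
lra.
Qed.

(** D = Y^2 - X^2 = T^2 - X T - T X commutes with j, so it has the same pairing with X^2 h and Xb^2
    h; as X^2 + Xb^2 = 2, h may be replaced by Xb^2 h on one side. *)
Lemma delta_form h : j h = h -> rip h (Y (Y h) - X (X h)) =
  - (rip (X h) (T (Xb (Xb h))) + rip (Xb (Xb (X h))) (T h)) + rip (T h) (T (Xb (Xb h))).
Proof.
move=> jh; pose D z := Y (Y z) - X (X z).
have DD a b : D (a + b) = D a + D b by rewrite /D !(linD _ _ lY, linD _ _ lX); hvec.
have DZ (a : R[i]) b : D (a *: b) = a *: D b.
  by rewrite /D !(linZ _ _ lY) !(linZ _ _ lX) scalerBr.
have jXX z : j (X (X z)) = Xb (Xb (j z)) by rewrite !(sd_jX sd).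
have h1 : rip h (D (X (X h))) = rip h (D (Xb (Xb h))).
  have := Dj (X (X h)); rewrite -!/(D _) jXX jh => <-.
  by rewrite (rip_j jI _ jh).
have h2 : rip h (D h) = rip h (D (Xb (Xb h))).
  have : rip h (D (X (X h))) + rip h (D (Xb (Xb h))) = 2 * rip h (D h).
    by rewrite -ripDr -DD two DZ ripZr.
  rewrite h1; lra.
rewrite -/(D h) h2 /D.
set w := Xb (Xb h).
have -> : Y (Y w) - X (X w) = T (T w) - X (T w) - T (X w).
  rewrite !TE !(linB _ _ lY, linB _ _ lX); hvec.
rewrite !ripBr (rsw _ _ sT) (rsw _ _ sX) (rsw _ (X w) sT).
have -> : rip (T h) (X w) = rip (Xb (Xb (X h))) (T h).
  by rewrite ripC /w !(sd_com sd) ripC.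
by lra.
Qed.

(** With x = X h and r = rho x one has x = r - Z r, as in [squeezed_vacuum]; its exponent |r|^2 - |Z
    r|^2 is |x|^2 + 2 <x, Z x> up to second order. So an antilinear Z0 is sought with 2 <X h, Z0 (X
    h)> equal to the form of Y^2 - X^2 up to second order in T. The operator [NN] supplies it,
    because Xb h = j (X h) for real h. *)
Lemma squeezing_exists : exists Z M, [/\ (forall (a : R[i]) x y, Z (a *: x + y) = (a^*)%C *: Z x + Z y),
  (forall x y, ⟪x, Z y⟫ = ⟪y, Z x⟫), hsb Z M & 16 * M <= 1] /\
  exists rho, [/\ rlin rho, forall x, rho x - Z (rho x) = x, forall x, hn (rho x) <= 2 * hn x &
    exists D, hsform D /\ forall h, j h = h ->
      n2 (rho (X h)) - n2 (Z (rho (X h))) = n2 h + rip h (Y (Y h) - X (X h)) + D h].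
Proof.
have hn_j x : hn (j x) <= 1 * hn x by rewrite mul1r (conj_hn jI).
have [_ [cX cX0 hX]] := sd_bX sd; have [_ [cb cb0 hXb]] := sd_bXb sd.
have ons_j n (e : 'I_n -> H) : ons e -> ons (j \o e).
  by move=> oe i k /=; rewrite jI oe eq_sym.
have hsj S : hs S -> hs (S \o j).
  by move=> [M hM]; exists M => n e oe; exact: (hM _ _ (ons_j _ _ oe)).
have hsR S S' c B : adjoint_operators S S' -> adjoint_operators B B ->
    (forall x, hn (B x) <= c * hn x) -> hs S -> hs (S \o B).
  by move=> aS aB nB hS; exact: (hs_right aB aS nB hS).
have aTb : adjoint_operators (fun x => j (T (j x))) (fun x => j (T (j x))).
  by move=> x y; rewrite (conj_sym jK jI) -sT [RHS]innerC (conj_sym jK jI) -innerC.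
have lTb : linear (fun x => j (T (j x))).
  by move=> a x y; rewrite jl (linD _ _ lT) (linZ _ _ lT) jl JK.
have hsTb : hs (fun x => j (T (j x))) by exact: (hs_left hn_j (hsj _ hsT)).
have [N NE] : exists N, N =1 NN by exists NN.
have hsN : hs N.
  rewrite (funext NE) /NN.
  apply: hsD; first apply: hsD.
  - apply: hsZ; apply: (hs_left hXb); apply: (hs_left hXb).
    exact: (hsR _ _ _ _ sT sXb hXb hsT).
  - by apply: hsZ; apply: (hs_left hX hsTb).
  - apply: hsZ; apply: (hs_left hX); apply: (hs_left hXb).
    exact: (hsR _ _ _ _ aTb sXb hXb hsTb).
have lN : linear N.
  move=> a x y; rewrite !NE /NN lXb (linD _ _ lT) (linZ _ _ lT) !(linD _ _ lXb) !(linZ _ _ lXb).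
  rewrite (lTb a x y) (lTb a (Xb x) (Xb y)) !(linD _ _ lXb) !(linZ _ _ lXb) !(linD _ _ lX) !(linZ _ _ lX).
  by hvec.
have bN : bdop N.
  split=> //; have [M hM] := hsN; exists (1 + M); first by rewrite addr_ge0 ?(hsb_ge0 hM).
  move=> x; rewrite hn_le ?mulr_ge0 ?hn_ge0 ?addr_ge0 ?(hsb_ge0 hM)//.
  apply: le_trans (hs_hn x (fun a x => linZ a%:C%C x lN) hM) _.
  rewrite exprMn hn2 ler_wpM2r ?n2_ge0//; have := hsb_ge0 hM; nra.
have [N' bN' aN] := adj_exists bN.
(* The symmetrization of N j; the sign is that of the linear term in [delta_form]. *)
pose Z0 x := (- 2^-1)%:C%C *: (N (j x) + j (N' x)).
have Z0l (a : R[i]) x y : Z0 (a *: x + y) = (a^*)%C *: Z0 x + Z0 y.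
  rewrite /Z0 jl (linD _ _ lN) (linZ _ _ lN) (linD _ _ bN'.1) (linZ _ _ bN'.1) (conj_D jl) (conj_Z jl).
  by hvec.
have Z0s x y : ⟪x, Z0 y⟫ = ⟪y, Z0 x⟫.
  have jsw a b : ⟪a, j b⟫ = ⟪b, j a⟫ by rewrite innerC (conj_sym jK jI) -innerC.
  rewrite /Z0 !innerZr !innerDr; congr (_ * _).
  by rewrite (jsw x (N' y)) (adjC aN) -(adjC aN x) (jsw (N' x)) addrC.
have hsZ0 : hs Z0.
  apply: hsZ; apply: hsD; first exact: hsj.
  by apply: (hs_left hn_j); exact: hs_adj (adjC aN) hsN.
have Z0form h : j h = h -> 2 * rip (X h) (Z0 (X h)) =
    rip h (Y (Y h) - X (X h)) - rip (T h) (T (Xb (Xb h))).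
  move=> jh; rewrite delta_form// -(squeeze_form NE)// /Z0 ripZr ripDr.
  have -> : rip (X h) (j (N' (X h))) = rip (X h) (N (j (X h))).
    by rewrite ripj /rip (adjC aN).
  by rewrite (sd_jX sd) jh; field.
(* [squeezed_vacuum] asks for 16 M <= 1; this value also gives |Z x| <= |x| / 2 for
   [real_resolvent]. *)
have d0 : 0 < 16^-1 :> R by rewrite invr_gt0.
have [n [e [oe hsm]]] := hs_small Z0l Z0s hsZ0 d0.
pose G x := oproj e x; have lG : linear G by exact: oproj_linear.
have sG : adjoint_operators G G by exact: oproj_sa.
pose Z x := Z0 (x - G x) - G (Z0 (x - G x)).
have Zl (a : R[i]) x y : Z (a *: x + y) = (a^*)%C *: Z x + Z y.
  have e1 : a *: x + y - G (a *: x + y) = a *: (x - G x) + (y - G y).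
    by rewrite (linD _ _ lG) (linZ _ _ lG); hvec.
  by rewrite /Z e1 Z0l (linD _ _ lG) (linZ _ _ lG); hvec.
have Zs x y : ⟪x, Z y⟫ = ⟪y, Z x⟫ by rewrite /Z -!oproj_compl_sa Z0s.
have Zb x : n2 (Z x) <= 4^-1 * n2 x.
  have ZZ (a : R) z : Z (a%:C%C *: z) = a%:C%C *: Z z by rewrite (antiZ Zl) JC.
  have := hs_hn x ZZ hsm; have := n2_ge0 x; lra.
exists Z, (16^-1); split; first by split=> //; rewrite mulfV.
have [rho [rr rE ra rb]] := real_resolvent Zl Zs Zb.
exists rho; split=> //.
have [M0 hM0] := hsZ0.
have rZ0 := anti_rhs Z0l Z0s hM0; have rZ := anti_rhs Zl Zs hsm.
have rlX := linear_rlin lX.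
have radj (S : H -> H) : adjoint_operators S S -> forall x y, rip (S x) y = rip x (S y).
  by move=> h x y; rewrite /rip h.
have [cT rT] := hs_rhs bT bT sT hsT.
have hsG : hs G.
  exists n%:R => m f of_; under eq_bigr do rewrite /G oproj_n2//.
  rewrite exchange_big; apply: le_trans (_ : \sum_(k < n) 1 <= _).
    apply: ler_sum => k _; apply: le_trans (_ : n2 (e k) <= _); last by rewrite /n2 oe eqxx.
    by apply: le_trans (bessel (e k) of_); apply: ler_sum => i _; rewrite -sqcJ -innerC.
  by rewrite sumr_const card_ord.
have bG : bdop G by exact: oproj_bdop.
have [cG rG] := hs_rhs bG bG sG hsG.
have rTX2 := rhs_comp (rhs_comp rT (linear_rlin lXb) (linear_rlin lXb) (radj _ sXb) cb0 hXb hXb)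
  (linear_rlin lXb) (linear_rlin lXb) (radj _ sXb) cb0 hXb hXb.
have rGX := rhs_comp rG rlX rlX (radj _ sX) cX0 hX hX.
have rZ0X := rhs_comp rZ0 rlX rlX (radj _ sX) cX0 hX hX.
have hG x : hn (G x) <= 1 * hn x by rewrite mul1r; exact: oproj_hn.
have rZ0GX := rhs_comp (rhs_comp rZ0 (linear_rlin lG) (linear_rlin lG) (radj _ sG) ler01 hG hG)
  rlX rlX (radj _ sX) cX0 hX hX.
have rZX := rhs_comp rZ rlX rlX (radj _ sX) cX0 hX hX.
have rZrX := rhs_comp (rhs_comp rZ rr rr ra (ler0n _ 2) rb rb) rlX rlX (radj _ sX) cX0 hX hX.
(* Each summand pairs two Hilbert-Schmidt operators: the term quadratic in T, the corrections for
   the finite rank projection G, and the second order of the resolvent. *)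
exists (fun h => rip ((-1)%:C%C *: T (Xb (Xb h))) (T h) +
  (rip ((-4)%:C%C *: G (X h)) (Z0 (X h)) + (rip (2%:C%C *: G (X h)) (Z0 (G (X h))) +
   rip (2%:C%C *: Z (X h)) (Z (rho (X h)))))); split.
  apply: hsformD; first exact: (rhs_hsform (rhsZ (-1) rTX2) rT).
  apply: hsformD; first exact: (rhs_hsform (rhsZ (-4) rGX) rZ0X).
  apply: hsformD; first exact: (rhs_hsform (rhsZ 2 rGX) rZ0GX).
  exact: (rhs_hsform (rhsZ 2 rZX) rZrX).
move=> h jh; set x := X h; set r := rho x.
have rx : r = x + Z r by rewrite -[X in _ = X + _](rE x) subrK.
have Z0D a b : Z0 (a + b) = Z0 a + Z0 b by exact: antiD.
have Z0B a b : Z0 (a - b) = Z0 a - Z0 b by rewrite Z0D -scaleN1r (antiZ Z0l) JN J1 scaleN1r.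
have e1 : rip x (Z r) = rip x (Z x) + rip (Z x) (Z r).
  by rewrite {1}rx (antiD Zl) ripDr; congr (_ + _); rewrite /rip Zs -/(rip _ _) ripC.
have e2 : n2 r = n2 x + n2 (Z r) + 2 * rip x (Z r) by rewrite {1}rx n2D.
have s1 : n2 r - n2 (Z r) = n2 x + 2 * rip x (Z x) + 2 * rip (Z x) (Z r).
  by rewrite e2 e1; ring.
have s2 : rip x (Z x) = rip x (Z0 x) - 2 * rip (G x) (Z0 x) + rip (G x) (Z0 (G x)).
  have Z0sw a b : rip a (Z0 b) = rip b (Z0 a) by rewrite /rip Z0s.
  rewrite /Z ripBr (rsw _ _ sG) Z0B !ripBr (Z0sw x (G x)); ring.
have nx : n2 x = n2 h := sd_n2 sd jh.
have z0 := Z0form h jh; rewrite -/x in z0.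
rewrite s1 s2 nx !ripZl (ripC (T (Xb (Xb h)))).
move: z0; rewrite -/r; lra.
Qed.

End Squeezing.

(** * Displacements that realize a given linear functional *)

Section Displacements.
Variables (R : realType) (H : hilbertType R) (K1 K2 : set H) (X j Q : H -> H).
Hypotheses (sd : std_data K1 X j) (st1 : standard_subspace K1) (st2 : standard_subspace K2).
Hypotheses (hQ : symplectomorphism K1 K2 Q) (bQ : bounded_real_on K1 Q).
Implicit Types (x y z h k : H).

Let jl := sdj sd.
Let jK := sdjK sd.
Let jI := sdjI sd.
Let lX : linear X := (sd_bX sd).1.
Local Notation V := (symp_op X j Q).

Lemma displace_std a : exists d, (forall h, j h = h -> Im ⟪X h, d⟫ = rip h a) /\ n2 d <= n2 a.
Proof.
exists (imI *: X (rpart j a)); split.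
  move=> h jh; have jr := rpart_j jl jK a.
  rewrite innerZr !reim mul0r mul1r add0r -/(rip _ _) (sd_rip sd jh jr).
  by rewrite rip_rpart.
by rewrite n2_iI (sd_n2 sd (rpart_j jl jK a)) -hn_le2 rpart_hn.
Qed.

Variable A : H -> H.
Hypotheses (bA : bdop A) (hA : forall x y, ⟪x, A y⟫ = ⟪V x, V y⟫).

Let lA : linear A := bA.1.
Let Gm z := A z - X (X z) + z.

Let bG : bdop Gm.
Proof.
apply: bdopD; last exact: bdop_id.
by apply: bdopB => //; apply: (bdop_comp (sd_bX sd) (sd_bX sd)).
Qed.

Let sG : adjoint_operators Gm Gm.
Proof.
have sA x y : ⟪A x, y⟫ = ⟪x, A y⟫ by rewrite innerC hA -innerC hA.
by move=> x y; rewrite /Gm !innE sA !(sd_sX sd).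
Qed.

Let Gj z : j (Gm z) = Gm (j z).
Proof. by rewrite /Gm (conj_D jl) (symp_delta_comm sd st1 hQ lA hA). Qed.

Let Gr z : rpart j (Gm z) = Gm (rpart j z).
Proof. by rewrite /rpart (linZ _ _ bG.1) (linD _ _ bG.1) Gj. Qed.

Let Grip h k : j h = h -> j k = k -> rip (Gm h) k = rip (V h) (V k).
Proof. exact: (symp_gram_rip sd hA). Qed.

Let V_inj h : j h = h -> V h = 0 -> h = 0.
Proof.
move=> jh; rewrite (symp_op_real sd st1 hQ jh) => Q0.
have [[_ inj _] _ _] := hQ; have [[k0 _ _] _ _ _] := st1.
apply: (sdXi sd); apply: inj; rewrite ?inE//; first exact: (sd_XK sd).
by rewrite Q0 (symp_0 st1 hQ).
Qed.

Let G_inj z : Gm z = 0 -> z = 0.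
Proof.
have real h : j h = h -> Gm h = 0 -> h = 0.
  move=> jh G0; apply: V_inj => //; apply/eqP; rewrite -n2_eq0 -rip_n2 -Grip//.
  by rewrite G0 rip0l.
move=> z0; rewrite -(rpartE j z).
have r0 : rpart j z = 0 by apply: real; [exact: rpart_j|rewrite -Gr z0 (rlin0 (rpart_rlin jl))].
have i0 : ipart j z = 0.
  apply: real; first exact: ipart_j.
  rewrite /ipart !(linZ _ _ bG.1) (linB _ _ bG.1) -Gj z0 (conj_0 jl) subrr.
  by rewrite !scaler0.
by rewrite r0 i0 scaler0 addr0.
Qed.

(** The bounded inverse of Q by duality: for real y with |Gm y| <= 1 the vectors V y are pointwise
    bounded on K2, since <V y, V h> = <Gm y, h> and Q is onto. So |V y| <= C |Gm y|, which gives |Gm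
    y| <= C |V (Gm y)|, and the range of Gm is dense. *)
Lemma symp_op_low : exists2 c : R, 0 < c & forall h, j h = h -> hn h <= c * hn (V h).
Proof.
have [rs2 c2 _ _] := st2.
have [|v K2v|C hC] := @uniform_boundedness R H K2
    [set V y | y in [set y | j y = y /\ hn (Gm y) <= 1]] rs2 c2.
- by move=> _ [y [jy _] <-]; exact: (symp_op_K sd st1 hQ).
- have [[_ _ sur] _ _] := hQ; have [k /(sdK sd)[h jh <-] hk] := sur _ K2v.
  exists (hn h) => _ [y [jy Gy] <-].
  rewrite -hk -(symp_op_real sd st1 hQ jh) ripC -Grip// ripC.
  apply: le_trans (rip_le _ _) _; rewrite -[leRHS]mulr1 ler_wpM2l ?hn_ge0//.
have bound y : j y = y -> hn (V y) <= C * hn (Gm y).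
  move=> jy; have [g0|g0] := eqVneq (hn (Gm y)) 0.
    move/eqP: g0; rewrite hn_eq0 => /eqP /G_inj ->.
    by rewrite (lin0 (symp_op_linear sd st1 hQ)) hn0 (lin0 bG.1) hn0 mulr0.
  have g1 : 0 < hn (Gm y) by rewrite lt_neqAle hn_ge0 eq_sym g0.
  have := hC (V ((hn (Gm y))^-1%:C%C *: y)).
  rewrite (linZ _ _ (symp_op_linear sd st1 hQ)) hnZ ncC ger0_norm ?invr_ge0 ?hn_ge0//.
  rewrite ler_pdivrMl// mulrC; apply.
  exists ((hn (Gm y))^-1%:C%C *: y); last by rewrite (linZ _ _ (symp_op_linear sd st1 hQ)).
  split; first by rewrite (conj_Zr jl) jy.
  by rewrite (linZ _ _ bG.1) hnZ ncC ger0_norm ?invr_ge0 ?hn_ge0// mulVf.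
have [lV [M M0 hM]] := symp_op_bdop sd st1 hQ bQ.
pose c := Num.max C 0 + 1.
have c0 : 0 < c by rewrite ltr_wpDl// le_max lexx orbT.
have Cc : C <= c by rewrite /c; have : C <= Num.max C 0 by [rewrite le_max lexx]; lra.
exists c => // h jh; apply/ler_addgt0Pr => e e0.
have p0 : 0 < c * M + 1 by rewrite ltr_wpDl ?mulr_ge0// ltW.
have [z hz] := sa_injective_dense bG sG G_inj h (divr_gt0 e0 p0).
have jr := rpart_j jl jK z; set y := rpart j z in jr.
have hy : hn (h - Gm y) * (c * M + 1) < e.
  rewrite -ltr_pdivlMr//; apply: le_lt_trans hz.
  rewrite -{1}(rpart_real jh) /y -Gr -(rlinB _ _ (rpart_rlin jl)).
  exact: rpart_hn.
have jG : j (Gm y) = Gm y by rewrite Gj jr.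
have h1 : hn (Gm y) <= c * hn (V (Gm y)).
  have [g0|g0] := eqVneq (hn (Gm y)) 0; first by rewrite g0 mulr_ge0 ?hn_ge0 ?ltW.
  have g1 : 0 < hn (Gm y) by rewrite lt_neqAle hn_ge0 eq_sym g0.
  rewrite -(ler_pM2r g1) -expr2 hn2 -rip_n2 Grip//.
  apply: le_trans (ler_norm _) (le_trans (rip_le _ _) _).
  apply: le_trans (ler_wpM2r (hn_ge0 _) (bound y jr)) _.
  by rewrite mulrAC ler_wpM2r ?hn_ge0// ler_wpM2r ?hn_ge0.
have h2 : hn h <= hn (Gm y) + hn (h - Gm y).
  have -> : hn h = hn (Gm y + (h - Gm y)) by congr hn; rewrite addrC subrK.
  exact: hnD.
have h3 : hn (V (Gm y)) <= hn (V h) + M * hn (h - Gm y).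
  have -> : hn (V (Gm y)) = hn (V h - V (h - Gm y)).
    by congr hn; rewrite -(linB _ _ lV); congr V; hvec.
  by apply: le_trans (hnB _ _) _; rewrite lerD2l.
have h4 := ler_wpM2l (ltW c0) h3.
by move: hy h1 h2 h4; rewrite mulrDr mulr1 mulrA => *; nra.
Qed.

(** By [symp_op_low] the operator Gm is invertible; d = i V w with Gm w the real part of a. *)
Lemma displace_symp : exists2 c : R, 0 <= c & forall a, exists d,
  (forall h, j h = h -> Im ⟪V h, d⟫ = rip h a) /\ n2 d <= c * n2 a.
Proof.
have [c c0 hc] := symp_op_low.
have [lV [M M0 hM]] := symp_op_bdop sd st1 hQ bQ.
have d0 : 0 < (c ^+ 2)^-1 by rewrite invr_gt0 exprn_gt0.
have low h : j h = h -> (c ^+ 2)^-1 * n2 h <= rip h (Gm h).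
  move=> jh; rewrite ripC Grip// rip_n2 ler_pdivrMl ?exprn_gt0// -!hn2 -exprMn.
  have ch : 0 <= c * hn (V h) by rewrite mulr_ge0 ?hn_ge0//; exact: ltW.
  by rewrite ler_pXn2r ?nnegrE ?hn_ge0//; exact: hc.
have [|B [bB GB BG]] := inverse_exists bG d0.
  move=> z; have jr := rpart_j jl jK z; have ji := ipart_j jl jK z.
  rewrite -(rpartE j z) -rip_n2 (linD _ _ bG.1) (linZ _ _ bG.1).
  rewrite !(rip_split jI)// ?Gj ?jr ?ji// !rip_n2 mulrDr lerD//; exact: low.
have [_ [b b0 hb]] := bB.
exists ((M * b) ^+ 2); first exact: sqr_ge0.
move=> a; have ja := rpart_j jl jK a; pose w := B (rpart j a).
have jw : j w = w.
  by rewrite /w -[LHS]BG -Gj GB ja.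
exists (imI *: V w); split.
  move=> h jh; rewrite innerZr !reim mul0r mul1r add0r -/(rip _ _) -Grip//.
  by rewrite ripC -(rip_rpart jI a jh) ripC /rip sG GB.
rewrite n2_iI -!hn2 -exprMn ler_pXn2r ?nnegrE ?mulr_ge0 ?hn_ge0//.
apply: le_trans (hM _) _; rewrite -mulrA ler_wpM2l//.
by apply: le_trans (hb _) _; rewrite ler_wpM2l// rpart_hn.
Qed.

End Displacements.

(** * From common intertwiners to the isomorphism *)

Section Construction.
Variables (R : realType) (H : hilbertType R) (F : fock_space H) (W : H -> F -> F).
Hypothesis hW : weyl_operators W.
Variables (K1 K2 : set H) (X j Q : H -> H).
Hypotheses (sd : std_data K1 X j) (st1 : standard_subspace K1) (st2 : standard_subspace K2).
Hypotheses (hQ : symplectomorphism K1 K2 Q) (bQ : bounded_real_on K1 Q).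
Implicit Types (x y z h k : H).

Let jl := sdj sd.
Let jK := sdjK sd.
Let jI := sdjI sd.
Let lX : linear X := (sd_bX sd).1.
Local Notation V := (symp_op X j Q).
Let lV : linear V := symp_op_linear sd st1 hQ.
Local Notation vac := (vac F).

Variables (A Y : H -> H).
Hypotheses (bA : bdop A) (hA : forall x y, ⟪x, A y⟫ = ⟪V x, V y⟫).
Hypotheses (pY : pos Y) (YY : forall x, Y (Y x) = A x) (hsT : hs (fun x => X x - Y x)).

Let P : set H := [set h | j h = h].

Let hP : real_subspace P.
Proof.
split; first exact: (conj_0 jl).
- by move=> x y jx jy; rewrite /P/= (conj_D jl) jx jy.
- by move=> a x jx; rewrite /P/= (conj_Zr jl) jx.
Qed.

(** On real h the squeezed covariance is |V h|^2 + M2 h - M3 h and the vacuum covariance of W (V h)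
    is |V h|^2. Noise M3 for the first and M2 for the second brings both to |i0 h|^2. *)
Lemma common_intertwiners : exists i0 U1 U2, [/\ bdop i0,
  [/\ bdop U1, exists x : F, U1 x <> 0 & forall h (x : F), P h -> U1 (W (X h) x) = W (i0 h) (U1 x)] &
  [/\ bdop U2, exists x : F, U2 x <> 0 & forall h (x : F), P h -> U2 (W (V h) x) = W (i0 h) (U2 x)]].
Proof.
have Dj z : j (Y (Y z) - X (X z)) = Y (Y (j z)) - X (X (j z)).
  by rewrite !YY (symp_delta_comm sd st1 hQ bA.1 hA).
have [Z [M [[Zl Zs hZ M1] [rho [rr rE rb [D [[M2 [M3 [g [nM2 nM3 DE gpos M2E]]]] SE]]]]]]] :=
  squeezing_exists sd pY Dj (fun x => erefl (X x - Y x)) hsT.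
have [G [pG Gg GIm]] := real_pos_complexify jl jK jI gpos.
have pA : pos A.
  split=> //; first by move=> x y; rewrite innerC hA -innerC hA.
  by move=> x; rewrite /rip hA; exact: n2_ge0.
have [bG sG posG] := pG; have [_ sA posA] := pA.
have pAG : pos (fun x => A x + G x).
  split; first exact: bdopD.
    exact: adjD.
  by move=> x; rewrite ripDr addr_ge0.
(* G has a real form on real vectors, so [i0] keeps the symplectic form of V while its square norm
   gains M2. *)
have [i0 [[bi0 si0 _] i0i0 _]] := sqrt_exists pAG.
have n2i0 h : P h -> n2 (i0 h) = n2 (V h) + M2 h.
  move=> jh; rewrite -rip_n2 /rip si0 i0i0 -/(rip _ _) ripDr Gg// M2E.
  by rewrite /rip hA.
have sym h k : P h -> P k -> Im ⟪X h, X k⟫ = Im ⟪i0 h, i0 k⟫.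
  move=> jh jk; rewrite si0 i0i0 innerDr hA reim GIm// addr0.
  by rewrite (symp_op_im sd st1 hQ).
have rlX := linear_rlin lX; have rlV := linear_rlin lV; have rl0 := linear_rlin bi0.1.
have n2V h : P h -> n2 (V h) = n2 h + rip h (Y (Y h) - X (X h)).
  move=> jh; rewrite ripBr YY /rip hA -(sd_sX sd) -/(n2 _) -/(n2 _) (sd_n2 sd jh).
  by rewrite addrC subrK.
have [E [E0 hE]] := squeezed_vacuum hW Zs hZ M1 Zl.
have E1 : hn E != 0 by rewrite hn_eq0; apply/eqP.
pose xi := (hn E)^-1%:C%C *: E.
have hxi r : ⟪xi, W (r - Z r) xi⟫ = (expR (- ((n2 r - n2 (Z r)) / 4)))%:C%C.
  rewrite /xi (linZ _ _ (weyl_lin hW _)) innerZl innerZr hE JC -!rmorphM/=; congr (_%:C)%C.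
  by rewrite -hn2; field.
have [c3 hc3] := nM3; have [c2 hc2] := nM2.
have x1 h : P h -> ⟪xi, W (X h) xi⟫ =
    (expR (- ((n2 (rho (X h)) - n2 (Z (rho (X h)))) / 4)))%:C%C.
  by move=> _; have := hxi (rho (X h)); rewrite rE.
have v1 h : P h -> ⟪vac, W (i0 h) vac⟫ =
    (expR (- ((n2 (rho (X h)) - n2 (Z (rho (X h))) + M3 h) / 4)))%:C%C.
  move=> Ph; rewrite (vac_weyl hW) n2i0// SE// n2V// DE.
  by congr ((expR (- (_ / 4)))%:C)%C; ring.
have d1 a : exists d, (forall h, P h -> Im ⟪X h, d⟫ = rip h a) /\
    expR (- (1 * n2 a)) <= Re ⟪xi, W d xi⟫.
  have [d [hd nd]] := displace_std sd a; exists d; split=> //.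
  have := hxi (rho d); rewrite rE => ->; rewrite ReC ler_expR.
  have := rb d; rewrite -(@ler_pXn2r _ 2)// ?nnegrE ?mulr_ge0 ?hn_ge0// exprMn !hn2.
  have := n2_ge0 (Z (rho d)); lra.
have [U1 [bU1 nU1 hU1]] := noise_intertwiner hW hP rlX rl0 sym x1 v1 hc3 d1 ler01.
have v2 h : P h -> ⟪vac, W (i0 h) vac⟫ = (expR (- ((n2 (V h) + M2 h) / 4)))%:C%C.
  by move=> Ph; rewrite (vac_weyl hW) n2i0.
have [c c0 hc] := displace_symp sd st1 st2 hQ bQ bA hA.
have d2 a : exists d, (forall h, P h -> Im ⟪V h, d⟫ = rip h a) /\
    expR (- (c * n2 a)) <= Re ⟪vac, W d vac⟫.
  have [d [hd nd]] := hc a; exists d; split=> //.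
  by rewrite (vac_weyl hW) ReC ler_expR; have := n2_ge0 d; lra.
have sym2 h k : P h -> P k -> Im ⟪V h, V k⟫ = Im ⟪i0 h, i0 k⟫.
  by move=> Ph Pk; rewrite -sym// (symp_op_im sd st1 hQ).
have [U2 [bU2 nU2 hU2]] :=
  noise_intertwiner hW hP rlV rl0 sym2 (fun h _ => vac_weyl hW (V h)) v2 hc2 d2 c0.
by exists i0, U1, U2; split.
Qed.

Lemma rip_iIr x y : rip x (imI *: y) = - Im ⟪x, y⟫.
Proof. by rewrite /rip innerZr !reim; ring. Qed.

(** Moving W (i1 h) past W x and W (i2 h) past W y produces two phases, which cancel by the
    condition on x and y. *)
Lemma shifted_intertwiner i1 i2 U x y : bdop U ->
  (forall h (u : F), P h -> U (W (i1 h) u) = W (i2 h) (U u)) ->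
  (forall h, P h -> Im ⟪i2 h, y⟫ = - Im ⟪i1 h, x⟫) ->
  bdop (W y \o (U \o W x)) /\
  forall h (u : F), P h -> (W y \o (U \o W x)) (W (i1 h) u) = W (i2 h) ((W y \o (U \o W x)) u).
Proof.
move=> bU hU hxy; split.
  by apply: bdop_comp; [exact: weyl_bdop|apply: bdop_comp => //; exact: weyl_bdop].
move=> h u Ph /=.
rewrite (weyl_commute hW x) (linZ _ _ bU.1) hU// (linZ _ _ (weyl_lin hW _)).
rewrite (weyl_commute hW y) scalerA -expIRD.
have -> : - Im ⟪x, i1 h⟫ - Im ⟪y, i2 h⟫ = 0; last by rewrite expIR0 scale1r.
by rewrite (innerC (i1 h)) (innerC (i2 h)) !reim hxy//; ring.
Qed.

Let irr (u v : F) : (forall z, ⟪u, W z v⟫ = 0) -> u = 0 \/ v = 0.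
Proof.
move=> h; apply: (@weyl_irreducible _ _ _ _ hW setT) => //.
by apply/dense_hn => x e e0; exists x => //; rewrite subrr hn0.
Qed.

(** By irreducibility U2^* W z U1 is nonzero for some z. The phases caused by W z are a linear
    functional of h, which a displacement W y on the left removes. *)
Lemma nonzero_intertwiner : exists U : F -> F, [/\ bdop U, exists x : F, U x <> 0 &
  forall h (x : F), P h -> U (W (X h) x) = W (V h) (U x)].
Proof.
have [i0 [U1 [U2 [[li0 bi0'] [bU1 [x1 nx1] hU1] [bU2 [x2 nx2] hU2]]]]] := common_intertwiners.
have [i0' bi0 ai0] := adj_exists (conj li0 bi0' : bdop i0).
have [U2' bU2' aU2] := adj_exists bU2.
have hU2' h (x : F) : P h -> U2' (W (i0 h) x) = W (V h) (U2' x).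
  move=> Ph; have PN : P (- h) by rewrite /P/= (conj_N jl) Ph.
  apply: inner_ext => w; rewrite -aU2.
  have -> : ⟪U2 w, W (i0 h) x⟫ = ⟪W (i0 (- h)) (U2 w), x⟫.
    by rewrite (linN _ li0) (weyl_adj hW) opprK.
  by rewrite -hU2// aU2 (linN _ lV) (weyl_adj hW) opprK.
have [z hz] : exists z, ⟪U2 x2, W z (U1 x1)⟫ <> 0.
  apply: contrapT => h; have [] : U2 x2 = 0 \/ U1 x1 = 0; last by [].
    by apply: irr => z; apply: contrapT => hz; apply: h; exists z.
  by [].
have [c c0 hc] := displace_symp sd st1 st2 hQ bQ bA hA.
have [y [hy _]] := hc (i0' (imI *: z)).
have [|bU hU] := @shifted_intertwiner i0 V U2' z y bU2' hU2'.
  by move=> h Ph; rewrite hy// /rip -ai0 -/(rip _ _) rip_iIr.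
exists ((W y \o (U2' \o W z)) \o U1); split; first exact: bdop_comp.
  exists x1 => /= e; apply: hz; rewrite aU2.
  have -> : U2' (W z (U1 x1)) = 0; last by rewrite inner0r.
  by apply/eqP; rewrite -hn_eq0 -(weyl_hn hW y) e hn0.
by move=> h x Ph; rewrite /= hU1//; exact: hU.
Qed.

(** The displaced operators W y U0 W x are intertwiners, with every x or every y allowed. So a
    vector in their common kernel, or orthogonal to their ranges, is 0 by irreducibility. *)
Lemma weyl_isomorphism : exists phi : (F -> F) -> (F -> F),
  vN_isomorphism (weyl_algebra W K1) (weyl_algebra W K2) phi /\
  forall h, K1 h -> phi (W h) = W (Q h).
Proof.
have [U0 [bU0 [x0 nx0] hU0]] := nonzero_intertwiner.
have [U0' bU0' aU0] := adj_exists bU0.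
have [Vs bVs aV] := adj_exists (symp_op_bdop sd st1 hQ bQ).
(* The families are indexed by all of H through [rpart], with negation as the involution of
   indices. *)
have Pr h : P (rpart j h) by exact: rpart_j.
pose g1 h := W (X (rpart j h)); pose g2 h := W (V (rpart j h)).
have rN h : rpart j (- h) = - rpart j h.
  by rewrite -sub0r (rlinB _ _ (rpart_rlin jl)) (rlin0 (rpart_rlin jl)) sub0r.
have s1 : star_family (fun h : H => - h) g1.
  split=> [h|]; first exact: (weyl_bdop hW).
  by move=> h x y; rewrite /g1 rN (linN _ lX) (weyl_adj hW).
have s2 : star_family (fun h : H => - h) g2.
  split=> [h|]; first exact: (weyl_bdop hW).
  by move=> h x y; rewrite /g2 rN (linN _ lV) (weyl_adj hW).
have mk x y : (forall h, P h -> Im ⟪V h, y⟫ = - Im ⟪X h, x⟫) ->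
    intertwiner g1 g2 (W y \o (U0 \o W x)).
  move=> hxy; have [b h] := shifted_intertwiner bU0 hU0 hxy.
  by split=> // i u; exact: h.
have [c c0 hc] := displace_symp sd st1 st2 hQ bQ bA hA.
have ker v : (forall U, intertwiner g1 g2 U -> U v = 0) -> v = 0.
  move=> hv; have [e|//] : U0' (U0 x0) = 0 \/ v = 0.
    apply: irr => x; have [y [hy _]] := hc (X (imI *: x)).
    have /mk/hv /= e : forall h, P h -> Im ⟪V h, y⟫ = - Im ⟪X h, x⟫.
      by move=> h Ph; rewrite hy// /rip -(sd_sX sd) -/(rip _ _) rip_iIr.
    rewrite (adjC aU0); have -> : U0 (W x v) = 0; last by rewrite inner0r.
    by apply/eqP; rewrite -hn_eq0 -(weyl_hn hW y) e hn0.
  exfalso; apply: nx0; apply/eqP; rewrite -n2_eq0 /n2 aU0 e inner0r.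
  by rewrite eqxx.
have ran v : (forall U (x : F), intertwiner g1 g2 U -> ⟪U x, v⟫ = 0) -> v = 0.
  move=> hv; have [//|//] : v = 0 \/ U0 x0 = 0.
  apply: irr => y; have [x [hx _]] := displace_std sd (Vs (imI *: y)).
  have /mk/hv e : forall h, P h -> Im ⟪V h, y⟫ = - Im ⟪X h, x⟫.
    by move=> h Ph; rewrite hx// /rip -aV -/(rip _ _) rip_iIr opprK.
  by have := e (W (- x) x0); rewrite /= (weylK hW) innerC => /(congr1 conjc); rewrite JK J0.
have [phi [iso hphi]] := intertwiners_isomorphism (@opprK H) s1 s2 ker ran.
have Vr h : P h -> V h = Q (X h) by exact: (symp_op_real sd st1 hQ).
have e1 : range g1 = [set W h | h in K1].
  apply/seteqP; split=> [_ [h _ <-]|_ [h /(sdK sd)[z jz <-] <-]].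
    by exists (X (rpart j h)) => //; apply: (sd_XK sd); exact: rpart_j.
  by exists z => //; rewrite /g1 rpart_real.
have e2 : range g2 = [set W h | h in K2].
  apply/seteqP; split=> [_ [h _ <-]|_ [h K2h <-]].
    by exists (V (rpart j h)) => //; apply: (symp_op_K sd st1 hQ); exact: rpart_j.
  have [[_ _ sur] _ _] := hQ; have [k /(sdK sd)[z jz <-] hk] := sur _ K2h.
  by exists z => //; rewrite /g2 rpart_real// Vr// hk.
exists phi; split; first by rewrite /weyl_algebra -e1 -e2.
move=> _ /(sdK sd)[z jz <-].
by have := hphi z; rewrite /g1 /g2 rpart_real// Vr.
Qed.

End Construction.

Lemma hilbert_schmidt_isomorphism (R : realType) (H : hilbertType R) (F : fock_space H)
    (W : H -> F -> F) (K1 K2 : set H) (Q A B : H -> H) :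
  weyl_operators W -> standard_subspace K1 -> standard_subspace K2 ->
  symplectomorphism K1 K2 Q -> bounded_real_on K1 Q ->
  positive_sqrt_on (complexify K1) (inner_s K1) (fun x => x + imI *: modular_R K1 x) A ->
  positive_sqrt_on (complexify K1) (inner_s K1) (fun x => imI *: modular_R K1 x +
    Cextend K2 (real_adjoint K1 Q) (Cextend K1 Q x)) B ->
  hilbert_schmidt_on (complexify K1) (inner_s K1) (fun x => A x - B x) ->
  exists phi : (F -> F) -> (F -> F),
    vN_isomorphism (weyl_algebra W K1) (weyl_algebra W K2) phi /\
    forall h, K1 h -> phi (W h) = W (Q h).
Proof.
move=> hW st1 st2 hQ bQ sA sB hsAB.
have [X [j sd]] := standard_data st1; have bV := symp_op_bdop sd st1 hQ bQ.
have [Vs bVs aV] := adj_exists bV.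
pose G := Vs \o symp_op X j Q.
have bG : bdop G by exact: bdop_comp.
have hG x y : ⟪x, G y⟫ = ⟪symp_op X j Q x, symp_op X j Q y⟫ by rewrite aV.
have [X' [pX' AX X'X']] := positive_sqrt_domain sd sA (sd_iR sd).
have [Y [pY BY YY]] := positive_sqrt_domain sd sB (symp_iR_QdQ sd st1 st2 hQ bG.1 hG).
have X'E := sqrt_unique pX' (sdX sd) X'X'.
have [bX sX _] := sdX sd; have [bY sY _] := pY.
apply: (weyl_isomorphism hW sd st1 st2 hQ bQ bG hG pY YY).
apply: (domain_hs sd hsAB).
- by move=> x y; rewrite innerBl innerBr sX sY.
- exact: bdopB.
- by move=> z; rewrite AX BY X'E (linB _ _ bX.1).
Qed.

(** * Necessity *)

Section InverseOperators.
Variables (R : realType) (F : hilbertType R).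
Implicit Types (A B : F -> F) (x y v : F).

Lemma rcvg_ge (u : nat -> R) (l b : R) : u @ \oo --> l -> (forall n, b <= u n) -> b <= l.
Proof.
move=> /rcvgP h ub; apply/ler_addgt0Pr => e /h[N /(_ N (leqnn N))].
by have := ub N; rewrite ltr_distl => h1 /andP[h2 h3]; lra.
Qed.

Lemma pos_inverse A B : pos A -> bdop B -> (forall x, A (B x) = x) -> pos B.
Proof.
move=> [_ sA pA] bB AB; split=> // [x y|x]; first by rewrite -{2}(AB x) sA AB.
by rewrite -{1}(AB x) ripC.
Qed.

(** Inversion reverses order, by Cauchy-Schwarz for the form of B at x and A (B' x). *)
Lemma inverse_le A A' B B' : pos B -> (forall x, B (A x) = x) -> (forall x, A' (B' x) = x) ->
  (forall x, 0 <= rip x (B' x)) -> (forall x, rip x (A x) <= rip x (A' x)) ->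
  forall x, rip x (B' x) <= rip x (B x).
Proof.
move=> pB BA AB' pB' hA x.
have h : rip x (B' x) ^+ 2 <= rip x (B x) * rip x (B' x).
  have := pos_CS x (A (B' x)) pB; rewrite BA => /le_trans; apply.
  apply: ler_wpM2l; first by case: pB.
  by rewrite ripC; apply: le_trans (hA _) _; rewrite AB' ripC.
have [q0|q0] := eqVneq (rip x (B' x)) 0; first by rewrite q0; case: pB.
have q1 : 0 < rip x (B' x) by rewrite lt_neqAle eq_sym q0 pB'.
by rewrite -(ler_pM2r q1) -expr2.
Qed.

(** Split v = z v + (v - z v). From A >= 1 + s z^2 come z B z <= 1 / s for the first part and B <= 1
    for the second. *)
Lemma inverse_bound A B z (s : R) v : 0 < s -> adjoint_operators z z -> pos B ->
  (forall x, A (B x) = x) -> (forall u, n2 u + s * n2 (z u) <= rip u (A u)) ->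
  rip v (B v) <= 2 / s * n2 v + 2 * n2 (v - z v).
Proof.
move=> s0 az pB AB hA; have [[lB _] sB B0] := pB.
have sqle (r c : R) : 0 <= r -> 0 <= c -> r ^+ 2 <= c * r -> r <= c.
  move=> r0 c0; have [->//|rn] := eqVneq r 0.
  by rewrite expr2 ler_pM2r// lt_neqAle eq_sym rn.
have h1 w : rip w (B w) <= n2 w.
  apply: sqle; [exact: B0|exact: n2_ge0|].
  apply: le_trans (rip_CS _ _) _; apply: ler_wpM2l; first exact: n2_ge0.
  have := hA (B w); rewrite AB ripC; have := mulr_ge0 (ltW s0) (n2_ge0 (z (B w))); lra.
have h2 : rip (z v) (B (z v)) <= s^-1 * n2 v.
  have e : rip (z v) (B (z v)) = rip (z (B (z v))) v by rewrite ripC /rip az.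
  apply: sqle; [exact: B0|by rewrite mulr_ge0 ?invr_ge0 ?n2_ge0// ltW|].
  rewrite {1}e; apply: le_trans (rip_CS _ _) _.
  rewrite mulrAC mulrC [X in _ <= X]mulrC; apply: ler_wpM2l; first exact: n2_ge0.
  rewrite ler_pdivlMl//.
  have := hA (B (z v)); rewrite AB ripC; have := n2_ge0 (B (z v)); lra.
have key p q : rip (p + q) (B (p + q)) <= 2 * rip p (B p) + 2 * rip q (B q).
  by have := B0 (p - q); rewrite (linB _ _ lB) (linD _ _ lB) !ripE; lra.
have := key (z v) (v - z v); rewrite addrC subrK -mulrA.
by have := h1 (v - z v); move: h2; lra.
Qed.

(** The quadratic forms converge by monotonicity, and [pos_n2] for the positive differences turns
    this into strong convergence. *)
Lemma decreasing_limit (b : nat -> F -> F) : (forall n, pos (b n)) ->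
  (forall n m x, (n <= m)%N -> rip x (b m x) <= rip x (b n x)) ->
  exists B, [/\ pos B, forall n x, rip x (B x) <= rip x (b n x) & forall x, b ^~ x @ \oo --> B x].
Proof.
move=> pb mb; have [c c0 hc] := pos_ub (pb 0%N).
have cauchy x : exists l : F, b ^~ x @ \oo --> l.
  apply: hcomplete => e e0.
  have [l hl] : exists l : R, (fun n => rip x (b n x)) @ \oo --> l.
    apply/cvg_ex; apply: nonincreasing_is_cvgn; first by move=> n m; exact: mb.
    by exists 0 => _ [n _ <-]; case: (pb n).
  have d0 : 0 < e ^+ 2 / (4 * c) by rewrite divr_gt0 ?exprn_gt0 ?mulr_gt0.
  have /rcvgP/(_ _ d0)[N hN] := hl; exists N.
  suff key n m : (N <= n)%N -> (n <= m)%N -> hn (b n x - b m x) < e.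
    move=> n m Nn Nm; have [nm|/ltnW mn] := leqP n m; first exact: key.
    by rewrite -hnN opprB; exact: key.
  move=> Nn nm; have pd : pos (fun y => b n y - b m y).
    have [bn sn _] := pb n; have [bm sm _] := pb m; split; first exact: bdopB.
      by move=> y z; rewrite innerBl innerBr sn sm.
    by move=> y; rewrite ripBr subr_ge0 mb.
  have := pos_n2 x pd (ltW c0); rewrite ripBr => h.
  have {}h : n2 (b n x - b m x) <= c * (rip x (b n x) - rip x (b m x)).
    apply: h => y; rewrite ripBr; apply: le_trans (hc y).
    by have := mb _ _ y (leq0n n); case: (pb m) => _ _ /(_ y); lra.
  have h1 := hN n Nn; have h2 := hN m (leq_trans Nn nm).
  have h3 : rip x (b n x) - rip x (b m x) < 2 * (e ^+ 2 / (4 * c)).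
    by move: h1 h2; rewrite !ltr_norml; lra.
  rewrite -(@ltr_pXn2r _ 2)// ?nnegrE ?hn_ge0 ?(ltW e0)// hn2.
  apply: le_lt_trans h _; rewrite -ltr_pdivlMl//; apply: lt_le_trans h3 _.
  rewrite (_ : _ * _ = c^-1 * e ^+ 2 / 2); last by field; rewrite gt_eqF.
  by have := mulr_ge0 (ltW (_ : 0 < c^-1)) (sqr_ge0 e); rewrite invr_gt0 => /(_ c0); lra.
have [B hB] := choice cauchy; exists B.
have lB : linear B.
  move=> a x y; apply: (@hcvg_unique _ _ (fun n => b n (a *: x + y))) => //.
  rewrite (_ : (fun n => _) = (fun n => a *: b n x + b n y)).
    by apply: cvgD; [apply: cvgZr; exact: hB|exact: hB].
  by apply/funext => n; have [[ln _] _ _] := pb n; rewrite (linD _ _ ln) (linZ _ _ ln).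
have pB x : 0 <= rip x (B x) by apply: (rcvg_ge (@hcvg_rip _ _ _ _ x (hB x))) => n; case: (pb n).
have n2B x : n2 (B x) <= (c ^+ 2) * n2 x.
  apply: (rcvg_le (n2_cvg (hB x))) => n.
  have := pos_n2 x (pb n) (ltW c0) (fun y => le_trans (mb _ _ y (leq0n n)) (hc y)).
  move/le_trans; apply; rewrite expr2 -mulrA ler_pM2l//.
  exact: le_trans (mb _ _ x (leq0n n)) (hc x).
split=> //; last first.
  move=> n x; apply: (rcvg_le (u := fun m => rip x (b (m + n)%N x))); last by move=> m; apply: mb; rewrite leq_addl.
  by have := @hcvg_rip _ _ _ _ x (hB x); rewrite -(cvg_shiftn n).
split.
- split=> //; exists c; first exact: ltW.
  by move=> x; rewrite hn_le ?mulr_ge0 ?hn_ge0 ?(ltW c0)// exprMn hn2.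
- move=> x y; apply: (@ccvg_unique _ (fun n => ⟪b n x, y⟫)).
    by apply: ccvg_inner => //; exact: hcvg_const.
  apply: (@ccvg_eq _ (fun n => ⟪x, b n y⟫)); first by move=> n; have [_ -> _] := pb n.
  by apply: ccvg_inner => //; exact: hcvg_const.
- by [].
Qed.

End InverseOperators.

Section Bicommutant.
Variables (R : realType) (F : hilbertType R) (S : set (F -> F)).
Implicit Types (A B a b : F -> F).
Local Notation M := (commutant (commutant S)).

Lemma bicommutantP a : M a <-> bdop a /\ forall C, commutant S C -> forall x, a (C x) = C (a x).
Proof.
split=> [[/bounded_operatorP ba h]|[/bounded_operatorP ba h]]; split=> // C hC.
  by move=> x; have /(congr1 (@^~ x)) := h _ hC.
by apply/funext => x; exact: h.
Qed.

Lemma bicommutant_id : M (fun x => x).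
Proof. by apply/bicommutantP; split=> //; exact: bdop_id. Qed.

Lemma bicommutant_lin (c : R[i]) a b : M a -> M b -> M (fun x => c *: a x + b x).
Proof.
move=> /bicommutantP[ba ha] /bicommutantP[bb hb]; apply/bicommutantP; split.
  by apply: bdopD => //; exact: bdopZ.
by move=> C hC x; have bC := vN_bdop hC; rewrite ha// hb// (linD _ _ bC.1) (linZ _ _ bC.1).
Qed.

Lemma bicommutant_comp a b : M a -> M b -> M (a \o b).
Proof.
move=> /bicommutantP[ba ha] /bicommutantP[bb hb]; apply/bicommutantP; split; first exact: bdop_comp.
by move=> C hC x /=; rewrite hb// ha.
Qed.

Lemma bicommutant0 : M (fun=> 0).
Proof.
by apply/bicommutantP; split=> [|C hC x]; [exact: bdop0|rewrite (lin0 (vN_bdop hC).1)].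
Qed.

Lemma bicommutant_inverse A B : M A -> bdop B -> (forall x, A (B x) = x) -> (forall x, B (A x) = x) ->
  M B.
Proof.
move=> /bicommutantP[bA hA] bB AB BA; apply/bicommutantP; split=> // C hC x.
by rewrite -{1}(AB x) -hA.
Qed.

Lemma bicommutant_sqrt A : M A -> pos A -> exists B, [/\ pos B, M B & forall x, B (B x) = A x].
Proof.
move=> /bicommutantP[bA hA] pA; have [B [pB BB cB]] := sqrt_exists pA.
exists B; split=> //; apply/bicommutantP; split=> [|C hC x]; first by case: pB.
by rewrite cB//; [exact: vN_bdop hC|move=> y; rewrite hA].
Qed.

Lemma bicommutant_limit (b : nat -> F -> F) B : (forall n, M (b n)) -> bdop B ->
  (forall x, b ^~ x @ \oo --> B x) -> M B.
Proof.
move=> hb bB lb; apply/bicommutantP; split=> // C hC x.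
apply: (@hcvg_unique _ _ (fun n => b n (C x))) => //.
rewrite (_ : (fun n => _) = C \o b ^~ x); first exact: (bdop_cvg (vN_bdop hC)).
by apply/funext => n /=; have /bicommutantP[_ ->] := hb n.
Qed.

End Bicommutant.

(** * A variance inequality for isomorphisms of von Neumann algebras *)

Section Isomorphisms.
Variables (R : realType) (F : hilbertType R) (S1 S2 : set (F -> F)) (phi : (F -> F) -> F -> F).
Local Notation M1 := (commutant (commutant S1)).
Local Notation M2 := (commutant (commutant S2)).
Hypothesis iso : vN_isomorphism M1 M2 phi.
Implicit Types (a b y : F -> F).

Lemma iso_in a : M1 a -> M2 (phi a).
Proof. by have [[h _ _] _ _ _] := iso; exact: h. Qed.

Lemma iso_inj a b : M1 a -> M1 b -> phi a = phi b -> a = b.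
Proof. by have [[_ h _] _ _ _] := iso => Ma Mb; apply: h; exact: mem_set. Qed.

Lemma iso_lin (c : R[i]) a b : M1 a -> M1 b ->
  phi (fun x => c *: a x + b x) = fun x => c *: phi a x + phi b x.
Proof. by have [_ h _ _] := iso; exact: h. Qed.

Lemma iso_comp a b : M1 a -> M1 b -> phi (a \o b) = phi a \o phi b.
Proof. by have [_ _ h _] := iso; exact: h. Qed.

Lemma iso_0 : phi (fun=> 0) = fun=> 0.
Proof.
have -> : (fun=> 0) = (fun x : F => -1 *: (fun=> 0 : F) x + (fun=> 0) x).
  by apply/funext => x /=; rewrite scaler0 addr0.
rewrite iso_lin; try exact: bicommutant0.
by apply/funext => x; rewrite scaleN1r addNr scaler0 addr0.
Qed.

Lemma iso_id : phi (fun x => x) = fun x => x.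
Proof.
have [[_ _ sur] _ _ _] := iso; have [a Ma ae] := sur _ (bicommutant_id S2).
rewrite -{2}ae -[phi (fun x => x)]/(phi (fun x => x) \o (fun x => x)) -{2}ae.
by rewrite -iso_comp//; exact: bicommutant_id.
Qed.

Lemma iso_sa a : M1 a -> adjoint_operators a a -> adjoint_operators (phi a) (phi a).
Proof. by have [_ _ _ h] := iso => Ma; exact: h. Qed.

(** The square root of a lies in the algebra, so phi a is the square of a self-adjoint operator. *)
Lemma iso_pos a : M1 a -> pos a -> pos (phi a).
Proof.
move=> Ma pa; have [b [[_ sb _] Mb bb]] := bicommutant_sqrt Ma pa.
split; first exact: vN_bdop (iso_in Ma).
  by apply: iso_sa => //; case: pa.
move=> x; have -> : a = b \o b by apply/funext => y; rewrite /= bb.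
by rewrite iso_comp// /rip /= -(iso_sa Mb sb) -/(n2 _) n2_ge0.
Qed.

Lemma iso_le a b : M1 a -> M1 b -> adjoint_operators a a -> adjoint_operators b b ->
  (forall x, rip x (a x) <= rip x (b x)) -> forall x, rip x (phi a x) <= rip x (phi b x).
Proof.
move=> Ma Mb sa sb hab x; have Mab := bicommutant_lin (-1) Ma Mb.
have pab : pos (fun x => -1 *: a x + b x).
  split; first exact: vN_bdop Mab.
    by move=> u v; rewrite !innE !conjE sa sb.
  by move=> u; rewrite scaleN1r ripDr ripNr addrC subr_ge0.
have [_ _ /(_ x)] := iso_pos Mab pab; rewrite iso_lin// scaleN1r ripDr ripNr.
by rewrite addrC subr_ge0.
Qed.

Variable v : F.
Hypotheses (v1 : n2 v = 1) (sep : forall a, M2 a -> a v = 0 -> a = fun=> 0).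

(* Otherwise there are self-adjoint y_n with n2 (y_n v) and n2 (v - phi y_n v) at most
   4^-n. The inverses of 1 + sum_(n < N) 2^n y_n^2 decrease to some B >= 0 in M1 with
   <v, B v> >= 1 / 3, whereas <v, phi B v> = 0, so that phi B = 0. *)
Lemma iso_separation : exists2 e : R, 0 < e & forall y, M1 y -> adjoint_operators y y ->
  e < n2 (y v) + n2 (v - phi y v).
Proof.
apply: contrapT => hne.
have /choice[y hy] (n : nat) : exists y, [/\ M1 y, adjoint_operators y y &
    n2 (y v) + n2 (v - phi y v) <= 4^-1 ^+ n].
  apply: contrapT => h; apply: hne; exists (4^-1 ^+ n) => [|y My sy]; first by rewrite exprn_gt0.
  by rewrite ltNge; apply/negP => le; apply: h; exists y.
have My n : M1 (y n) by case: (hy n).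
have sy n : adjoint_operators (y n) (y n) by case: (hy n).
(* The weights 2^n grow, yet are summable against 4^-n: <v, a N v> stays below 3. *)
pose a := fix a N x := if N is n.+1 then (2 ^+ n)%:C%C *: y n (y n x) + a n x else x : F.
have Ma N : M1 (a N).
  elim: N => [|n ih]; first exact: bicommutant_id.
  by apply: (@bicommutant_lin _ _ _ _ (y n \o y n)) => //; exact: bicommutant_comp.
have sa N : adjoint_operators (a N) (a N).
  by elim: N => [//|n ih] x z /=; rewrite !innE !conjE ih !sy.
have ripa N x : rip x (a N x) = n2 x + \sum_(n < N) 2 ^+ n * n2 (y n x).
  elim: N => [|n ih] /=; first by rewrite big_ord0 addr0.
  rewrite ripDr ripZr ih big_ord_recr /= [RHS]addrA [RHS]addrC; congr (_ * _ + _).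
  by rewrite /rip -sy.
have sum0 N x : 0 <= \sum_(n < N) 2 ^+ n * n2 (y n x).
  by apply: sumr_ge0 => n _; rewrite mulr_ge0 ?exprn_ge0 ?n2_ge0.
have a1 N x : 1 * n2 x <= rip x (a N x) by rewrite mul1r ripa lerDl.
have pa N : pos (a N).
  split; [exact: vN_bdop (Ma N)|exact: sa|move=> x].
  by apply: le_trans (a1 N x); rewrite mul1r n2_ge0.
have /choice[b hb] N := inverse_exists (vN_bdop (Ma N)) ltr01 (a1 N).
have pb N : pos (b N) by have [bb ab _] := hb N; exact: pos_inverse (pa N) bb ab.
have Mb N : M1 (b N) by have [bb ab ba] := hb N; exact: bicommutant_inverse (Ma N) bb ab ba.
have mb n m x : (n <= m)%N -> rip x (b m x) <= rip x (b n x).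
  move=> nm; have [_ _ ba] := hb n; have [_ ab _] := hb m.
  apply: (inverse_le (pb n) ba ab) => [z|z]; first by case: (pb m).
  rewrite !ripa lerD2l -!(big_mkord xpredT (fun n => 2 ^+ n * n2 (y n z))).
  rewrite [X in _ <= X](big_cat_nat (n := n))//= lerDl.
  by apply: sumr_ge0 => i _; rewrite mulr_ge0 ?exprn_ge0 ?n2_ge0.
have [B [pB Bb lB]] := decreasing_limit pb mb.
have MB : M1 B by apply: bicommutant_limit Mb _ lB; case: pB.
have av N : rip v (a N v) <= 3.
  have h : \sum_(n < N) 2 ^+ n * n2 (y n v) <= 2 * (1 - 2^-1 ^+ N).
    elim: N => [|n ih]; first by rewrite big_ord0 expr0 subrr mulr0.
    rewrite big_ord_recr /=.
    have h1 : n2 (y n v) <= 4^-1 ^+ n.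
      by have [_ _] := hy n; have := n2_ge0 (v - phi (y n) v); lra.
    have := ler_wpM2l (exprn_ge0 n (ler0n R 2)) h1.
    rewrite -exprMn (_ : 2 * 4^-1 = 2^-1); last by field.
    by rewrite exprS; move: ih; lra.
  by rewrite ripa v1; have := exprn_ge0 N (_ : 0 <= 2^-1 :> R); rewrite invr_ge0 ler0n => /(_ isT); lra.
(* Cauchy-Schwarz for the form of [b N] at v and [a N v]: 1 <= <v, b N v> <v, a N v>. *)
have bv N : 3^-1 <= rip v (b N v).
  have [bb ab ba] := hb N; have := pos_CS v (a N v) (pb N).
  rewrite ba -/(n2 v) [rip v v]v1 expr1n => h.
  have h0 : 0 <= rip v (b N v) by case: (pb N).
  have := ler_wpM2l h0 (av N); rewrite [rip v (a N v)]ripC; lra.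
have Bv : 3^-1 <= rip v (B v).
  by apply: (rcvg_ge (@hcvg_rip _ _ _ _ v (lB v))).
have sb N : adjoint_operators (b N) (b N) by case: (pb N).
have sB : adjoint_operators B B by case: pB.
(* Only the term of index N in [a N.+1] is kept: [phi (y N)] almost fixes v and carries the weight
   2^N, so [inverse_bound] applies with s = 2^N. *)
have phiB N : rip v (phi B v) <= 4 * 2^-1 ^+ N.
  apply: le_trans (iso_le MB (Mb N.+1) sB (sb _) (Bb _) v) _.
  have [_ ab _] := hb N.+1.
  have pab x : phi (a N.+1) (phi (b N.+1) x) = x.
    rewrite -[LHS]/((phi (a N.+1) \o phi (b N.+1)) x) -iso_comp//.
    by rewrite (_ : _ \o _ = fun x => x) ?iso_id//; apply/funext => z; exact: ab.
  have Myy := bicommutant_comp (My N) (My N).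
  have Mc := bicommutant_lin (2 ^+ N)%:C%C Myy (bicommutant_id S1).
  have hA u : n2 u + 2 ^+ N * n2 (phi (y N) u) <= rip u (phi (a N.+1) u).
    have -> : n2 u + 2 ^+ N * n2 (phi (y N) u) =
        rip u (phi (fun x => (2 ^+ N)%:C%C *: (y N \o y N) x + x) u).
      rewrite (iso_lin _ Myy (bicommutant_id S1)) iso_comp// iso_id ripDr ripZr addrC.
      by rewrite /= /rip -(iso_sa (My N) (sy N)).
    apply: iso_le => // [p q|x]; first by rewrite /= !innE !conjE !sy.
    rewrite /= !ripDr lerD2l rip_n2 -[n2 x]mul1r.
    exact: a1.
  have s0 : 0 < 2 ^+ N :> R by rewrite exprn_gt0.
  have := inverse_bound v s0 (iso_sa (My N) (sy N)) (iso_pos (Mb N.+1) (pb N.+1)) pab hA.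
  move/le_trans; apply; rewrite v1 mulr1.
  have h1 : n2 (v - phi (y N) v) <= 4^-1 ^+ N.
    by have [_ _] := hy N; have := n2_ge0 (y N v); lra.
  have h2 : 4^-1 ^+ N <= 2^-1 ^+ N :> R.
    by apply: lerXn2r; rewrite ?nnegrE ?invr_ge0 ?ler0n//; lra.
  have -> : 2 / 2 ^+ N = 2 * 2^-1 ^+ N :> R by rewrite exprVn.
  lra.
have pphi := iso_pos MB pB.
have /(pos_eq0 pphi)/(sep (iso_in MB)) : rip v (phi B v) = 0.
  apply/eqP; rewrite eq_le; have [_ _ ->] := pphi; rewrite andbT.
  apply: (rcvg_ge (u := fun N => 4 * 2^-1 ^+ N)) => //.
  rewrite -[0](mulr0 (4 : R)); apply: cvgM; first exact: cvg_cst.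
  apply: cvg_expr.
  by rewrite ger0_norm; lra.
rewrite -iso_0 => /(iso_inj MB (bicommutant0 S1)) B0.
by move: Bv; rewrite B0 rip0r; lra.
Qed.

(** Apply [iso_separation] to (y - m1) / (m2 - m1): it almost kills v if y has small variance around
    m1, and its image almost fixes v if phi y has small variance around m2. *)
Lemma iso_variance : exists2 C : R, 0 < C & forall y (m1 m2 : R), M1 y -> adjoint_operators y y ->
  (m1 - m2) ^+ 2 <= C * (n2 (y v - m1%:C%C *: v) + n2 (phi y v - m2%:C%C *: v)).
Proof.
have [e e0 he] := iso_separation; exists e^-1; first by rewrite invr_gt0.
move=> y m1 m2 My sy; rewrite ler_pdivlMl//.
have [->|m0] := eqVneq m1 m2.
  by rewrite subrr expr0n mulr0 addr_ge0 ?n2_ge0.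
have d0 : m2 - m1 != 0 by rewrite subr_eq0 eq_sym.
pose c := (m2 - m1)^-1.
pose z x := c%:C%C *: y x + ((- (c * m1))%:C%C *: x + 0).
have M0 := bicommutant0 S1; have Mi := bicommutant_id S1.
have Mw := bicommutant_lin (- (c * m1))%:C%C Mi M0.
have Mz : M1 z by exact: bicommutant_lin My Mw.
have sz : adjoint_operators z z by move=> p q; rewrite /z !addr0 !innE !conjE sy.
have := he _ Mz sz.
have -> : z v = c%:C%C *: (y v - m1%:C%C *: v).
  by rewrite /z addr0 scalerBr scalerA rmorphN/= scaleNr rmorphM.
have -> : v - phi z v = (- c)%:C%C *: (phi y v - m2%:C%C *: v).
  rewrite /z iso_lin// iso_lin// iso_id iso_0 addr0.
  have e1 : c * m2 = 1 + c * m1 by rewrite -[1](mulVf d0) /c; ring.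
  rewrite scalerBr scalerA -rmorphM mulNr e1 !rmorphN/= !scaleNr rmorphD scalerDl scale1r.
  by rewrite opprD !opprK addrCA addrA; hvec.
rewrite !n2Z !sqcC sqrrN -mulrDr /c exprVn.
rewrite ltr_pdivlMl ?exprn_even_gt0// mulrC => /ltW; rewrite -[m2 - m1]opprB sqrrN//.
Qed.

End Isomorphisms.

(** * Boundedness of Q *)

Section Necessity.
Variables (R : realType) (H : hilbertType R) (F : fock_space H) (W : H -> F -> F).
Hypothesis hW : weyl_operators W.
Variable K2 : set H.
Hypothesis st2 : standard_subspace K2.
Implicit Types (x y h k : H).
Local Notation vac := (vac F).
Local Notation coh := (coherent F).

(* The operators W z, z in the symplectic complement j X j (real vectors) of K2 = X (real
   vectors), commute with A(K2) and generate a dense subspace from the vacuum. *)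
Lemma weyl_separating (a : F -> F) : weyl_algebra W K2 a -> a vac = 0 -> a = fun=> 0.
Proof.
have [X [j sd]] := standard_data st2; have jl := sdj sd; have jK := sdjK sd.
have lXb := sd_lXb sd.
pose L : set H := [set z | exists2 w, j w = w & z = Xbar X j w].
have rL : real_subspace L.
  split; first by exists 0; [exact: (conj_0 jl)|rewrite (lin0 lXb)].
  - move=> _ _ [w jw ->] [w' jw' ->]; exists (w + w'); first by rewrite (conj_D jl) jw jw'.
    by rewrite (linD _ _ lXb).
  - move=> c _ [w jw ->]; exists (c%:C%C *: w); first by rewrite (conj_Zr jl) jw.
    by rewrite (linZ _ _ lXb).
have dL : dense (complexify L).
  apply/dense_hn => x e e0.
  have [y hy] := sa_injective_dense (sd_bXb sd) (sd_sXb sd) (sd_Xbi sd) x e0.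
  exists (Xbar X j y) => //; exists (Xbar X j (rpart j y)), (Xbar X j (ipart j y)); split.
  - by exists (rpart j y) => //; exact: rpart_j.
  - by exists (ipart j y) => //; exact: ipart_j.
  - by rewrite -(linZ _ _ lXb) -(linD _ _ lXb) rpartE.
have Lc z k : L z -> K2 k -> Im ⟪z, k⟫ = 0.
  move=> [w jw ->] /(sdK sd)[w' jw' <-]; rewrite (sd_sXb sd) (real_inner_rip (sdjI sd) jw) ?ImC//.
  by rewrite /Xbar jK -(sdC sd) jw'.
move=> /bicommutantP[ba ca] av; have [a' ba' aa] := adj_exists ba.
have a'0 w : a' w = 0.
  apply: (weyl_total hW rL dL) => z Lz; rewrite (adjC aa) ca.
    by rewrite av (lin0 (weyl_lin hW _)) inner0r.
  split; first by apply/bounded_operatorP; exact: weyl_bdop.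
  move=> _ [k K2k <-]; apply/funext => u /=.
  by rewrite (weyl_commute hW) Lc// oppr0 expIR0 scale1r.
by apply/funext => u; apply: inner_extl => w; rewrite aa a'0 inner0r inner0l.
Qed.

Variables (K1 : set H) (Q : H -> H) (phi : (F -> F) -> F -> F).
Hypotheses (st1 : standard_subspace K1) (hQ : symplectomorphism K1 K2 Q).
Hypotheses (iso : vN_isomorphism (weyl_algebra W K1) (weyl_algebra W K2) phi)
  (hphi : forall h, K1 h -> phi (W h) = W (Q h)).

Let QZ (c : R) h : K1 h -> Q (c%:C%C *: h) = c%:C%C *: Q h.
Proof. by move=> Kh; exact: (symp_Z st1 hQ). Qed.

Let K1Z (c : R) h : K1 h -> K1 (c%:C%C *: h).
Proof. by have [[_ _ KZ] _ _ _] := st1; exact: KZ. Qed.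

Definition cosines (s : seq (R * H)) (u : F) : F :=
  \sum_(p <- s) p.1%:C%C *: (W p.2 u + W (- p.2) u).

Lemma cosines_sa s : adjoint_operators (cosines s) (cosines s).
Proof.
move=> u v; rewrite /cosines inner_suml inner_sumr; apply: eq_bigr => p _.
by rewrite !innE !conjE !(weyl_adj hW) opprK addrC.
Qed.

Lemma cosines_iso s : (forall p, p \in s -> K1 p.2) -> weyl_algebra W K1 (cosines s) /\
  phi (cosines s) = cosines [seq (p.1, Q p.2) | p <- s].
Proof.
elim: s => [|p s ih] hs.
  have -> : cosines [::] = fun=> 0 by apply/funext => u; rewrite /cosines big_nil.
  by split; [exact: bicommutant0|exact: iso_0 iso].
have [|Ms phis] := ih; first by move=> q qs; apply: hs; rewrite inE qs orbT.
have Kp : K1 p.2 by apply: hs; rewrite inE eqxx.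
have pN : - p.2 = (-1)%:C%C *: p.2 by rewrite rmorphN scaleN1r.
have KN : K1 (- p.2) by rewrite pN; exact: K1Z.
have M h : K1 h -> weyl_algebra W K1 (W h).
  move=> Kh; split; first by apply/bounded_operatorP; exact: weyl_bdop.
  by move=> S [_ hS]; rewrite hS//; exists h.
have M2 := bicommutant_lin 1 (M _ Kp) (M _ KN).
have -> : cosines (p :: s) = fun u => p.1%:C%C *: (1 *: W p.2 u + W (- p.2) u) + cosines s u.
  by apply/funext => u; rewrite /cosines big_cons scale1r.
split; first exact: bicommutant_lin.
rewrite (iso_lin iso _ M2 Ms) (iso_lin iso _ (M _ Kp) (M _ KN)) !hphi// phis.
apply/funext => u; rewrite /cosines /= big_cons/= scale1r {1}pN QZ//.
by rewrite rmorphN scaleN1r.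
Qed.

Lemma weyl_variance : exists2 C : R, 0 < C & forall s (m1 m2 : R), (forall p, p \in s -> K1 p.2) ->
  (m1 - m2) ^+ 2 <= C * (n2 (cosines s vac - m1%:C%C *: vac) +
    n2 (cosines [seq (p.1, Q p.2) | p <- s] vac - m2%:C%C *: vac)).
Proof.
have [C C0 hC] := iso_variance iso (n2_vac F) weyl_separating.
exists C => // s m1 m2 /cosines_iso[Ms <-].
by apply: hC => //; exact: cosines_sa.
Qed.

Lemma weyl_vac_dist h : hn (W h vac - vac) <= hn h.
Proof.
rewrite -(@ler_pXn2r _ 2)// ?nnegrE ?hn_ge0// !hn2 n2B -(hn2 (W h vac)) (weyl_hn hW) hn2 n2_vac.
rewrite ripC /rip vac_weyl// ReC.
have := expR_ge1Dx (- (n2 h / 4)); have := n2_ge0 h; lra.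
Qed.

(** The vectors of the orbit are nearly orthogonal. Leaving f free up to the sign of differences
    covers both exponentials of a cosine. *)
Lemma weyl_orbit_n2 n k (c : R) : 0 <= c ->
  (forall i j : 'I_n, i != j -> expR (- (n2 ((i%:R - j%:R : R)%:C%C *: k) / 4)) <= c) ->
  forall f : 'I_n -> R, (forall i j, f i - f j = i%:R - j%:R \/ f i - f j = j%:R - i%:R) ->
  n2 (\sum_(i < n) W ((f i)%:C%C *: k) vac) <= n%:R + n%:R ^+ 2 * c.
Proof.
move=> c0 hc f hf; rewrite /n2 inner_suml Re_sum.
apply: (@le_trans _ _ (\sum_(i < n) (1 + n%:R * c))); last first.
  by rewrite sumr_const card_ord -[_ *+ n]mulr_natl mulrDr mulr1 mulrA expr2.
apply: ler_sum => i _; rewrite inner_sumr Re_sum.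
have e j : Re ⟪W ((f i)%:C%C *: k) vac, W ((f j)%:C%C *: k) vac⟫ =
    expR (- (n2 ((j%:R - i%:R : R)%:C%C *: k) / 4)).
  rewrite (inner_weyl hW) innerZl innerZr inner_n2 JC -!rmorphM/= mul0r expIR0 mul1r.
  rewrite -scalerBl -rmorphB /= vac_weyl// ?ReC !n2Z !sqcC.
  have -> // : (f j - f i) ^+ 2 = (j%:R - i%:R) ^+ 2.
  by case: (hf j i) => ->//; rewrite -sqrrN opprB.
rewrite (bigD1 i)//= e subrr scale0r n2_0 mul0r oppr0 expR0 lerD2l.
apply: (@le_trans _ _ (\sum_(j < n | j != i) c)).
  by apply: ler_sum => j ji; rewrite e; exact: hc.
rewrite sumr_const -[_ *+ _]mulr_natl ler_wpM2r// ler_nat.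
by apply: leq_trans (max_card _) _; rewrite card_ord.
Qed.

(** If Q is unbounded, choose h tiny with |Q h| of fixed size. The average of the first N cosines of
    multiples of h almost fixes the vacuum, while for Q h the N vectors are nearly orthogonal and
    their average is small. The variance inequality with means 1 and 0 gives 1 <= C (1/(4C) + 1/N +
    1/(4C)) < 1. *)
Lemma isomorphism_bounded : bounded_real_on K1 Q.
Proof.
have [C C0 hC] := weyl_variance.
apply: contrapT => hne.
have p4 : 0 < (4 * C)^-1 by rewrite invr_gt0 mulr_gt0.
have [n /(_ n (leqnn n)) nC] := inv_nat_small p4.
(* N > 4 C makes the diagonal contribution 1 / N small. *)
set N := n.+1 in nC.
have N0 : 0 < N%:R :> R by rewrite ltr0n.
have N1 : 1 <= N%:R :> R by rewrite ler1n.
have [h0 Kh0 hh0] : exists2 h, K1 h & 8 * C * N%:R * hn h < hn (Q h).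
  apply: contrapT => hn0; apply: hne; exists (8 * C * N%:R) => h Kh.
  rewrite !hn_normE -rmorphM/= lecR leNgt; apply/negP => lt; apply: hn0.
  by exists h.
have Q0 : 0 < hn (Q h0) by apply: le_lt_trans hh0; rewrite !mulr_ge0 ?hn_ge0// ltW.
(* Normalized so that |k|^2 = 16 C: then exp (- |k|^2 / 4) <= 1 / (4 C), and the choice of [h0]
   leaves N^2 |h|^2 <= 1 / (4 C). *)
pose t := Num.sqrt (16 * C) / hn (Q h0).
pose h := t%:C%C *: h0; pose k := t%:C%C *: Q h0.
have Kh : K1 h by exact: K1Z.
have t2 : t ^+ 2 = 16 * C / n2 (Q h0).
  by rewrite /t expr_div_n sqr_sqrtr ?hn2// mulr_ge0// ltW.
have q0 : 0 < n2 (Q h0) by rewrite -hn2 exprn_gt0.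
have nk : n2 k = 16 * C by rewrite n2Z sqcC t2 divfK// gt_eqF.
have nh : N%:R ^+ 2 * n2 h <= (4 * C)^-1.
  rewrite n2Z sqcC t2.
  have : (8 * C * N%:R * hn h0) ^+ 2 <= hn (Q h0) ^+ 2.
    by rewrite ler_pXn2r ?nnegrE ?hn_ge0 ?(ltW hh0)// !mulr_ge0 ?hn_ge0 ?(ltW C0).
  rewrite exprMn !hn2 => hh.
  rewrite (_ : _ * _ = (8 * C * N%:R) ^+ 2 * n2 h0 / n2 (Q h0) * (4 * C)^-1); last first.
    by field; rewrite !gt_eqF.
  by rewrite ler_piMl ?invr_ge0 ?mulr_ge0 ?(ltW C0)// ler_pdivrMr// mul1r.
(* [cosines] adds W h and W (- h), that is twice a cosine, hence 2 N. *)
pose a : R := (2 * N%:R)^-1.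
have a0 : 0 <= a by rewrite invr_ge0 mulr_ge0.
pose s := [seq (a, (i.+1%:R : R)%:C%C *: h) | i : 'I_N].
have Ks p : p \in s -> K1 p.2 by move=> /mapP[i _ ->] /=; exact: K1Z.
have sumE (f : R * H -> F) : \sum_(p <- s) f p = \sum_(i < N) f (a, (i.+1%:R : R)%:C%C *: h).
  by rewrite /s big_image.
have := hC s 1 0 Ks; rewrite subr0 expr1n scale1r scale0r subr0.
have -> : cosines [seq (p.1, Q p.2) | p <- s] vac =
    a%:C%C *: (\sum_(i < N) W ((i.+1%:R : R)%:C%C *: k) vac) +
    a%:C%C *: (\sum_(i < N) W ((- (i.+1%:R) : R)%:C%C *: k) vac).
  rewrite /cosines big_map sumE -scalerDr -big_split scaler_sumr; apply: eq_bigr => i _ /=.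
  by rewrite !QZ// rmorphN scaleNr.
have h1 : n2 (cosines s vac - vac) <= (4 * C)^-1.
  apply: le_trans nh; rewrite -hn2 -[n2 h]hn2 -exprMn.
  rewrite ler_pXn2r ?nnegrE ?hn_ge0 ?mulr_ge0 ?hn_ge0//.
  have -> : cosines s vac - vac = \sum_(i < N) a%:C%C *:
      ((W ((i.+1%:R : R)%:C%C *: h) vac - vac) + (W (- ((i.+1%:R : R)%:C%C *: h)) vac - vac)).
    rewrite /cosines sumE.
    rewrite [X in _ - X](_ : vac = \sum_(i < N) a%:C%C *: (vac + vac)); last first.
      rewrite sumr_const card_ord -scaler_nat -mulr2n -[vac *+ 2]scaler_nat !scalerA.
      have -> : N%:R * a%:C%C * 2%:R = 1 :> R[i]; last by rewrite scale1r.
      rewrite -!(rmorph_nat (@real_complex R)) -!rmorphM/= /a (_ : _ * _ = 1)//.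
      by field; rewrite gt_eqF.
    rewrite -sumrB; apply: eq_bigr => i _ /=; rewrite -scalerBr; congr (_ *: _).
    by rewrite addrACA opprD.
  apply: le_trans (hn_sum _ _ _) _.
  apply: (@le_trans _ _ (\sum_(i < N) hn h)); last by rewrite sumr_const card_ord -[hn h *+ _]mulr_natl.
  apply: ler_sum => i _; rewrite hnZ ncC ger0_norm//.
  have b1 := weyl_vac_dist ((i.+1%:R : R)%:C%C *: h).
  have b2 := weyl_vac_dist (- ((i.+1%:R : R)%:C%C *: h)).
  rewrite hnN in b2; rewrite hnZ ncC ger0_norm ?ler0n// in b1 b2.
  have b3 := hnD (W ((i.+1%:R : R)%:C%C *: h) vac - vac) (W (- ((i.+1%:R : R)%:C%C *: h)) vac - vac).
  have b4 : i.+1%:R * hn h <= N%:R * hn h by rewrite ler_wpM2r ?hn_ge0// ler_nat.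
  rewrite /a invfM mulrAC ler_pdivrMr// [2^-1 * _]mulrC ler_pdivrMr//; lra.
have dk i j (ij : i != j :> 'I_N) : expR (- (n2 ((i%:R - j%:R : R)%:C%C *: k) / 4)) <= (4 * C)^-1.
  have d1 : 1 <= (i%:R - j%:R : R) ^+ 2.
    have [lt|lt|/val_inj e] := ltngtP i j; last by rewrite e eqxx in ij.
      rewrite -sqrrN opprB -natrB 1?ltnW// -natrX ler1n expn_gt0 subn_gt0 lt//.
    by rewrite -natrB 1?ltnW// -natrX ler1n expn_gt0 subn_gt0 lt.
  rewrite n2Z sqcC nk expRN lef_pV2 ?posrE ?expR_gt0 ?mulr_gt0//.
  have := ler_wpM2r (ltW C0) d1; have := expR_ge1Dx ((i%:R - j%:R) ^+ 2 * (16 * C) / 4); lra.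
have c0 : 0 <= (4 * C)^-1 by rewrite invr_ge0 mulr_ge0// ltW.
have u1 : n2 (\sum_(i < N) W ((i.+1%:R : R)%:C%C *: k) vac) <= N%:R + N%:R ^+ 2 * (4 * C)^-1.
  apply: (weyl_orbit_n2 c0 dk (f := fun i => i.+1%:R)) => i j; left; rewrite -!natr1; ring.
have u2 : n2 (\sum_(i < N) W ((- (i.+1%:R) : R)%:C%C *: k) vac) <= N%:R + N%:R ^+ 2 * (4 * C)^-1.
  apply: (weyl_orbit_n2 c0 dk (f := fun i => - (i.+1%:R))) => i j; right; rewrite -!natr1; ring.
move: u1 u2; set u := \sum_(i < N) _; set w := \sum_(i < N) _ => u1 u2.
have h2 : n2 (a%:C%C *: u + a%:C%C *: w) <= N%:R^-1 + (4 * C)^-1.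
  apply: le_trans (n2_le_2 _ _) _; rewrite !n2Z !sqcC.
  have a2 : 4 * a ^+ 2 = N%:R^-1 ^+ 2 by rewrite /a; field; rewrite gt_eqF.
  have := ler_wpM2l (sqr_ge0 a) u1; have := ler_wpM2l (sqr_ge0 a) u2.
  have -> : N%:R^-1 + (4 * C)^-1 = 4 * a ^+ 2 * (N%:R + N%:R ^+ 2 / (4 * C)).
    by rewrite a2; field; rewrite !gt_eqF.
  lra.
have {h1 h2} : C * (n2 (cosines s vac - vac) + n2 (a%:C%C *: u + a%:C%C *: w)) < C * (4 * (4 * C)^-1).
  by rewrite ltr_pM2l//; move: h1 h2 nC; lra.
have -> : C * (4 * (4 * C)^-1) = 1 by field; rewrite gt_eqF.
by move=> lt1 /(lt_le_trans lt1); rewrite ltxx.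
Qed.

End Necessity.

(** * Observables of second order *)

Section SecondOrder.
Variables (R : realType) (H : hilbertType R) (F : fock_space H) (W : H -> F -> F).
Hypothesis hW : weyl_operators W.
Implicit Types (x y h k : H).
Local Notation vac := (vac F).
Local Notation coh := (coherent F).

(** The second difference quotient of t |-> coh (t x) at 0; its limit is twice the two-particle
    component. *)
Definition coh2 (t : R) x : F :=
  (t ^+ 2)^-1%:C%C *: (coh (t%:C%C *: x) + coh ((- t)%:C%C *: x) - 2%:C%C *: vac).

Lemma coh2_dist t x : t != 0 ->
  n2 (coh2 t x - 2%:C%C *: cn F 2 x) <= 2 * n2 x ^+ 2 * (expR (t ^+ 2 * n2 x) - 1).
Proof.
move=> t0; set u := coh (t%:C%C *: x); set w := coh ((- t)%:C%C *: x); set q := cn F 2 x.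
have cc (a b : R) : rip (coh (a%:C%C *: x)) (coh (b%:C%C *: x)) = expR (a * b * n2 x).
  have e : ⟪a%:C%C *: x, b%:C%C *: x⟫ = (a * b * n2 x)%:C%C.
    by rewrite innerZl innerZr inner_n2 JC mulrA -!rmorphM.
  by rewrite /rip (inner_coherent hW) e cexpC ReC.
have vc y : rip vac (coh y) = 1 by rewrite /rip vac_coherent.
have qc (a : R) : rip q (coh (a%:C%C *: x)) = a ^+ 2 * n2 x ^+ 2 / 2.
  rewrite /rip inner_cn_coherent inner_cn innerZr inner_n2 expr2 -!rmorphM/=.
  have -> : 2`! = 2%N by [].
  by field.
have qv : rip q vac = 0 by rewrite /rip inner_cn_coherent inner_cn inner0r expr0n mulr0.
have nq : n2 q = n2 x ^+ 2 / 2 by rewrite n2_cn.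
have -> : n2 (coh2 t x - 2%:C%C *: q) = (t ^+ 2)^-1 ^+ 2 *
    (2 * (expR (t ^+ 2 * n2 x) + expR (- (t ^+ 2 * n2 x)) - 2)) - 2 * n2 x ^+ 2.
  have key (r : R) (b c d e : F) : n2 (r%:C%C *: (b + c - 2%:C%C *: d) - 2%:C%C *: e) =
      r ^+ 2 * (rip b b + rip c c + 2 * rip b c + 4 * n2 d - 4 * rip d b - 4 * rip d c) -
      4 * r * (rip e b + rip e c - 2 * rip e d) + 4 * n2 e.
    by rewrite -!rip_n2 !ripE (ripC c b) (ripC b d) (ripC c d) (ripC b e) (ripC c e) (ripC d e); ring.
  rewrite /coh2 key !vc !qc qv nq !cc n2_vac sqrrN.
  have -> : t * - t * n2 x = - (t ^+ 2 * n2 x) by ring.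
  have -> : - t * - t * n2 x = t ^+ 2 * n2 x by ring.
  by rewrite -expr2; field.
set a := t ^+ 2 * n2 x.
have a0 : 0 <= a by rewrite mulr_ge0 ?sqr_ge0 ?n2_ge0.
have h : expR a + expR (- a) - 2 <= a ^+ 2 * expR a.
  have -> : expR a + expR (- a) - 2 = (1 - expR (- a)) ^+ 2 * expR a.
    have e : expR (- a) * expR a = 1 by rewrite -expRD addNr expR0.
    have -> : (1 - expR (- a)) ^+ 2 * expR a =
      expR a - 2 * (expR (- a) * expR a) + expR (- a) * (expR (- a) * expR a) by ring.
    by rewrite e; ring.
  have b1 : 0 <= 1 - expR (- a) by rewrite subr_ge0 -expR0 ler_expR oppr_le0.
  have b2 : 1 - expR (- a) <= a by have := expR_ge1Dx (- a); lra.
  by rewrite ler_wpM2r ?expR_ge0// ler_pXn2r ?nnegrE.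
have e : (t ^+ 2)^-1 ^+ 2 * a ^+ 2 = n2 x ^+ 2 by rewrite /a; field.
have := ler_wpM2l (sqr_ge0 (t ^+ 2)^-1) h; rewrite mulrA e; lra.
Qed.

Let tn (n : nat) : R := n.+1%:R^-1.

Let tn0 n : tn n != 0. Proof. by rewrite invr_eq0 pnatr_eq0. Qed.

Let tau_cvg (c : R) : (fun n => tn n ^+ 2 * c) @ \oo --> (0 : R).
Proof.
rewrite -[0](mul0r c); apply: cvgM; last exact: cvg_cst.
rewrite -[0](mulr0 (0 : R)); under eq_cvg do rewrite expr2.
by apply: cvgM; exact: cvg_harmonic.
Qed.

Let exp_cvg (c : R) : (fun n => expR (tn n ^+ 2 * c)) @ \oo --> (1 : R).
Proof.
by rewrite -[X in _ --> X]expR0; exact: (cvg_comp _ _ (tau_cvg c) (@continuous_expR R 0)).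
Qed.

Lemma coh2_cvg x : (fun n => coh2 (tn n) x) @ \oo --> 2%:C%C *: cn F 2 x.
Proof.
apply/hcvgP => e e0.
have h : (fun n => 2 * n2 x ^+ 2 * (expR (tn n ^+ 2 * n2 x) - 1)) @ \oo --> (0 : R).
  rewrite -[0](mulr0 (2 * n2 x ^+ 2)); apply: cvgM; first exact: cvg_cst.
  rewrite -[0](subrr (1 : R)); apply: cvgB; [exact: exp_cvg|exact: cvg_cst].
have /rcvgP/(_ _ (exprn_gt0 2 e0))[N hN] := h; exists N => n /hN; rewrite subr0 => lt.
rewrite -(@ltr_pXn2r _ 2)// ?nnegrE ?hn_ge0 ?(ltW e0)// hn2.
by apply: le_lt_trans (coh2_dist x (tn0 n)) _; apply: le_lt_trans lt; exact: ler_norm.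
Qed.

Let quot_cvg (c : R) : (fun n => (expR (tn n ^+ 2 * c) - 1) / tn n ^+ 2) @ \oo --> c.
Proof.
have h : (fun n => c * expR (tn n ^+ 2 * c)) @ \oo --> c.
  by rewrite -[X in _ --> X]mulr1; apply: cvgM; [exact: cvg_cst|exact: exp_cvg].
apply/rcvgP => e e0; have /rcvgP/(_ _ e0)[N hN] := h; exists N => n /hN; apply: le_lt_trans.
have p : 0 < tn n ^+ 2 by rewrite exprn_gt0// invr_gt0.
have h1 : c <= (expR (tn n ^+ 2 * c) - 1) / tn n ^+ 2.
  by rewrite ler_pdivlMr//; have := expR_ge1Dx (tn n ^+ 2 * c); lra.
have h2 : (expR (tn n ^+ 2 * c) - 1) / tn n ^+ 2 <= c * expR (tn n ^+ 2 * c).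
  rewrite ler_pdivrMr//; have := expR_ge1Dx (- (tn n ^+ 2 * c)) => h2.
  have := ler_wpM2l (expR_ge0 (tn n ^+ 2 * c)) h2; rewrite -expRD subrr expR0; lra.
by rewrite !ger0_norm ?subr_ge0 ?lerD2r// (le_trans h1).
Qed.

Lemma lc_cvg (s : seq (R * H)) (c : R * H -> nat -> R) (V : R * H -> nat -> F)
    (l : R * H -> R) (L : R * H -> F) :
  (forall p, c p @ \oo --> l p) -> (forall p, V p @ \oo --> L p) ->
  (fun n => \sum_(p <- s) (c p n)%:C%C *: V p n) @ \oo --> \sum_(p <- s) (l p)%:C%C *: L p.
Proof.
move=> hc hV; elim: s => [|p s ih].
  rewrite big_nil; under eq_cvg do rewrite big_nil.
  exact: hcvg_const.
rewrite big_cons; under eq_cvg do rewrite big_cons.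
apply: cvgD ih; apply: cvgZ => //.
apply/cvgrPdist_lt => e e0.
have e1 : 0 < Re e by move: e0; rewrite ltcE => /andP[].
have /rcvgP/(_ _ e1)[N hN] := hc p; exists N => // n /hN.
rewrite distrC -rmorphB/= normcE ncC => lt.
by rewrite (_ : e = (Re e)%:C%C) ?ltcR//; apply: complex_ext; rewrite ?ReC ?ImC//; move: e0; rewrite ltcE => /andP[/eqP].
Qed.

Variables (K1 K2 : set H) (Q : H -> H) (phi : (F -> F) -> F -> F).
Hypotheses (st1 : standard_subspace K1) (st2 : standard_subspace K2) (hQ : symplectomorphism K1 K2 Q).
Hypotheses (iso : vN_isomorphism (weyl_algebra W K1) (weyl_algebra W K2) phi)
  (hphi : forall h, K1 h -> phi (W h) = W (Q h)).

(** The weight exp (t^2 b / 4) is meant to cancel the Gaussian factor of W (t f); what is left of it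
    yields the difference of the means. *)
Lemma cosines_second (s : seq (R * H)) (b : R * H -> R) t (f : H -> H) :
  cosines W [seq (p.1 * expR (t ^+ 2 * b p / 4) / t ^+ 2, t%:C%C *: f p.2) | p <- s] vac -
    (\sum_(p <- s) p.1 * expR (t ^+ 2 * ((b p - n2 (f p.2)) / 4)) / t ^+ 2 * 2)%:C%C *: vac =
  \sum_(p <- s) (p.1 * expR (t ^+ 2 * ((b p - n2 (f p.2)) / 4)))%:C%C *: coh2 t (iskap (f p.2)).
Proof.
rewrite /cosines big_map rmorph_sum scaler_suml -sumrB; apply: eq_bigr => p _ /=.
have e (r : R) : W (r%:C%C *: f p.2) vac =
    (expR (- (r ^+ 2 * n2 (f p.2) / 4)))%:C%C *: coh (r%:C%C *: iskap (f p.2)).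
  by rewrite (weyl_vac hW) n2Z sqcC /iskap !scalerA [r%:C%C * _]mulrC.
rewrite -scaleNr -rmorphN !e sqrrN -scalerDr scalerA -rmorphM/=.
have -> : p.1 * expR (t ^+ 2 * b p / 4) / t ^+ 2 * expR (- (t ^+ 2 * n2 (f p.2) / 4)) =
    p.1 * expR (t ^+ 2 * ((b p - n2 (f p.2)) / 4)) / t ^+ 2.
  have -> : t ^+ 2 * ((b p - n2 (f p.2)) / 4) = t ^+ 2 * b p / 4 + - (t ^+ 2 * n2 (f p.2) / 4) by ring.
  by rewrite expRD [LHS]mulrAC !mulrA.
rewrite /coh2 scalerA -rmorphM/= rmorphM [in RHS]scalerBr scalerA.
by congr (_ - _); rewrite [RHS]scalerA -!rmorphM.
Qed.

(* Apply the variance bound to multiples of the observables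
   sum_k c_k e^(t^2 |h_k|^2 / 4) (W (t h_k) + W (- t h_k)) / t^2 and let t tend to 0. *)
Lemma quadratic_variance : exists2 C : R, 0 < C & forall s : seq (R * H), (forall p, p \in s -> K1 p.2) ->
  (\sum_(p <- s) p.1 * (n2 p.2 - n2 (Q p.2))) ^+ 2 <=
  C * (n2 (\sum_(p <- s) p.1%:C%C *: cn F 2 p.2) + n2 (\sum_(p <- s) p.1%:C%C *: cn F 2 (Q p.2))).
Proof.
have [C C0 hC] := weyl_variance hW st2 st1 hQ iso hphi.
exists (4 * C) => [|s hs]; first by rewrite mulr_gt0.
(* The vacuum components of the observable and of its image. Their 1 / t^2 parts cancel in the
   difference, which converges to a multiple of the trace sought. *)
pose m n (f : H -> H) := \sum_(p <- s) p.1 * expR (tn n ^+ 2 * ((n2 p.2 - n2 (f p.2)) / 4)) / tn n ^+ 2 * 2.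
pose v n (f : H -> H) := \sum_(p <- s) (p.1 * expR (tn n ^+ 2 * ((n2 p.2 - n2 (f p.2)) / 4)))%:C%C *: coh2 (tn n) (iskap (f p.2)).
have step n : (m n idfun - m n Q) ^+ 2 <= C * (n2 (v n idfun) + n2 (v n Q)).
  pose s' := [seq (p.1 * expR (tn n ^+ 2 * n2 p.2 / 4) / tn n ^+ 2, (tn n)%:C%C *: p.2) | p <- s].
  have hs' p : p \in s' -> K1 p.2.
    by move=> /mapP[q qs ->] /=; have [[_ _ KZ] _ _ _] := st1; apply: KZ; exact: hs.
  have := hC s' (m n idfun) (m n Q) hs'.
  rewrite (cosines_second s (fun p => n2 p.2) (tn n) idfun).
  have -> : [seq (p.1, Q p.2) | p <- s'] =
      [seq (p.1 * expR (tn n ^+ 2 * n2 p.2 / 4) / tn n ^+ 2, (tn n)%:C%C *: Q p.2) | p <- s].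
    rewrite -map_comp; apply/eq_in_map => p ps /=.
    by rewrite (symp_Z st1 hQ)//; exact: hs.
  by rewrite (cosines_second s (fun p => n2 p.2) (tn n) Q).
have vl (f : H -> H) : (fun n => v n f) @ \oo --> \sum_(p <- s) p.1%:C%C *: (2%:C%C *: cn F 2 (iskap (f p.2))).
  apply: (@lc_cvg s (fun p n => p.1 * expR (tn n ^+ 2 * ((n2 p.2 - n2 (f p.2)) / 4)))
    (fun p n => coh2 (tn n) (iskap (f p.2)))).
    by move=> p; rewrite -[X in _ --> X]mulr1; apply: cvgM; [exact: cvg_cst|exact: exp_cvg].
  by move=> p; exact: coh2_cvg.
have vn (f : H -> H) : n2 (\sum_(p <- s) p.1%:C%C *: (2%:C%C *: cn F 2 (iskap (f p.2)))) =
    n2 (\sum_(p <- s) p.1%:C%C *: cn F 2 (f p.2)).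
  rewrite -[RHS]n2N -sumrN; congr n2; apply: eq_bigr => p _.
  rewrite /iskap cn_scale -scalerN; congr (_ *: _).
  rewrite scalerA -[RHS]scaleN1r; congr (_ *: _).
  rewrite exprMn expr2 imI2 -rmorphXn/= exprVn sqr_sqrtr ?ler0n//.
  by apply: complex_ext; rewrite !reim; field.
have ml : (fun n => m n idfun - m n Q) @ \oo --> \sum_(p <- s) - (p.1 * ((n2 p.2 - n2 (Q p.2)) / 2)).
  have -> : (fun n => m n idfun - m n Q) = fun n => \sum_(p <- s)
      - (p.1 * 2) * ((expR (tn n ^+ 2 * ((n2 p.2 - n2 (Q p.2)) / 4)) - 1) / tn n ^+ 2).
    apply/funext => n; rewrite /m -sumrB; apply: eq_bigr => p _ /=.
    by rewrite subrr mul0r mulr0 expR0; ring.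
  apply: (@rcvg_sum _ _ s (fun p n => - (p.1 * 2) * ((expR (tn n ^+ 2 * ((n2 p.2 - n2 (Q p.2)) / 4)) - 1) / tn n ^+ 2))) => p.
  have -> : - (p.1 * ((n2 p.2 - n2 (Q p.2)) / 2)) = - (p.1 * 2) * ((n2 p.2 - n2 (Q p.2)) / 4) by field.
  by apply: cvgM; [exact: cvg_cst|exact: quot_cvg].
have hl : (fun n => C * (n2 (v n idfun) + n2 (v n Q)) - (m n idfun - m n Q) ^+ 2) @ \oo -->
    C * (n2 (\sum_(p <- s) p.1%:C%C *: cn F 2 p.2) + n2 (\sum_(p <- s) p.1%:C%C *: cn F 2 (Q p.2))) -
    (\sum_(p <- s) - (p.1 * ((n2 p.2 - n2 (Q p.2)) / 2))) ^+ 2.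
  apply: cvgB; last by rewrite expr2; under eq_cvg do rewrite expr2; exact: cvgM.
  apply: cvgM; first exact: cvg_cst.
  rewrite -(vn idfun) -(vn Q); apply: cvgD; apply: n2_cvg; exact: vl.
have := rcvg_ge hl (fun n => _ : 0 <= _).
rewrite subr_ge0 => h; have {}h := h (fun n => eq_ind_r is_true (step n) (subr_ge0 _ _)).
have -> : \sum_(p <- s) p.1 * (n2 p.2 - n2 (Q p.2)) =
    -2 * \sum_(p <- s) - (p.1 * ((n2 p.2 - n2 (Q p.2)) / 2)).
  by rewrite mulr_sumr; apply: eq_bigr => p _; field.
rewrite exprMn sqrrN -mulrA; apply: le_trans (ler_wpM2l _ h); last by rewrite ler0n.
by rewrite (_ : 2 ^+ 2 = 4)//; ring.
Qed.

End SecondOrder.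

(** * Finite-dimensional spectral decomposition and traces *)

Section FiniteTraces.
Variables (R : realType) (H : hilbertType R).
Implicit Types (x y : H) (B C : H -> H).
Local Open Scope sesquilinear_scope.

(** The spectral theorem for the matrix of B in the family f; the clause on [oproj] says that the
    eigenvectors span the same space. *)
Lemma diagonalization n (f : 'I_n -> H) B : ons f -> linear B -> adjoint_operators B B ->
  (forall x, oproj f (B x) = B x) ->
  exists (e : 'I_n -> H) (l : 'I_n -> R), [/\ ons e, oproj e =1 oproj f &
    forall k, B (e k) = (l k)%:C%C *: e k].
Proof.
move=> of_ lB sB fB; pose M : 'M[R[i]]_n := \matrix_(i, k) ⟪f i, B (f k)⟫.
have MM : M ^t* = M by apply/matrixP => i k; rewrite !mxE -[Num.conj _]/(_^*)%C -innerC sB.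
have /orthomx_spectralP/= ME : M \is normalmx by apply/normalmxP; rewrite MM.
have uP := spectral_unitarymx M; rewrite (invmx_unitary uP) in ME.
move: ME uP; set P := spectralmx M; set d := spectral_diag M => ME uP.
have UU := unitarymxP uP; have UU' : P ^t* *m P = 1%:M by rewrite -(invmx_unitary uP) mulVmx// unitarymx_unit.
have MU : M *m P ^t* = P ^t* *m diag_mx d by rewrite {1}ME -(mulmxA (_ *m _) P) UU mulmx1.
pose U i k : R[i] := (P ^t*) i k; pose e k := \sum_i U i k *: f i.
have UE i k : U i k = (P k i)^*%C by rewrite /U !mxE.
have fe i k : ⟪f i, e k⟫ = U i k by exact: ons_inner_sum.
have Be k : B (e k) = d 0 k *: e k.
  rewrite -fB /oproj [in RHS]/e scaler_sumr; apply: eq_bigr => i _; rewrite scalerA; congr (_ *: _).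
  have /matrixP/(_ i k) := MU; rewrite mul_mx_diag [in LHS]mxE [in RHS]mxE => h.
  rewrite mulrC [RHS](esym h).
  rewrite /e (lin_sum _ _ _ lB) inner_sumr; apply: eq_bigr => l _.
  by rewrite (linZ _ _ lB) innerZr [M i l]mxE mulrC.
have oe : ons e.
  move=> k l; rewrite /e ons_inner//.
  have /matrixP/(_ k l) := UU; rewrite !mxE => <- .
  by apply: eq_bigr => i _; rewrite !UE conjcK !mxE.
exists e, (fun k => Re (d 0 k)); split=> //.
  move=> x; rewrite /oproj.
  under eq_bigr => k _ do rewrite {1}/e inner_suml.
  under eq_bigr => k _ do rewrite scaler_suml.
  under eq_bigr => k _ do under eq_bigr => j _ do rewrite innerZl.
  under eq_bigr => k _ do under eq_bigr => j _ do rewrite /e scaler_sumr.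
  rewrite exchange_big; apply: eq_bigr => j _ /=; rewrite exchange_big /=.
  rewrite (bigD1 j)//= [X in _ + X]big1 ?addr0 => [|i ij].
    under eq_bigr do rewrite scalerA -mulrA [⟪_, _⟫ * _]mulrC mulrA.
    rewrite -scaler_suml -mulr_suml; congr (_ *: _).
    have /matrixP/(_ j j) := UU'; rewrite !mxE eqxx => h.
    rewrite -[RHS]mul1r; congr (_ * _); transitivity (true%:R : R[i]); last by [].
    rewrite -h; apply: eq_bigr => k _.
    by rewrite -/(U j k) UE conjcK mulrC.
  under eq_bigr do rewrite scalerA -mulrA [⟪_, _⟫ * _]mulrC mulrA.
  rewrite -scaler_suml -mulr_suml (_ : \sum_k _ = 0) ?mul0r ?scale0r//.
  have /matrixP/(_ i j) := UU'; rewrite !mxE (negbTE ij) => h.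
  transitivity (false%:R : R[i]); last by [].
  by rewrite -h; apply: eq_bigr => k _; rewrite -/(U i k) [U j k]UE conjcK mulrC.
move=> k; rewrite Be; congr (_ *: _); apply: complex_ext; rewrite ?ReC ?ImC//.
have := sB (e k) (e k); rewrite Be innerZl innerZr oe eqxx !mulr1 => /(congr1 (@complex.Im R)).
by rewrite ImJ => h; lra.
Qed.

Lemma trace_ons n m (e : 'I_n -> H) (f : 'I_m -> H) C : ons e -> ons f -> oproj e =1 oproj f ->
  linear C -> \sum_i ⟪e i, C (e i)⟫ = \sum_i ⟪f i, C (f i)⟫.
Proof.
move=> oe of_ ef lC.
have h i : ⟪e i, C (e i)⟫ = \sum_j ⟪f j, ⟪e i, f j⟫ *: C (e i)⟫.
  rewrite -{1}(ons_fix i oe) ef /oproj inner_suml; apply: eq_bigr => k _.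
  by rewrite innerZl -innerC innerZr.
under eq_bigr do rewrite h.
rewrite exchange_big; apply: eq_bigr => j _ /=.
rewrite -inner_sumr; congr ⟪_, _⟫.
by under eq_bigr do rewrite -(linZ _ _ lC); rewrite -(lin_sum _ _ _ lC) -[\sum_i _]/(oproj e (f j)) ef ons_fix.
Qed.

(** The double sum is the squared norm of the sum of w_b (x) u_b; it is bounded componentwise in an
    orthonormal family for u. *)
Lemma gram_tensor n (w u : 'I_n -> H) (M : R) :
  (forall x : 'I_n -> R[i], n2 (\sum_i x i *: w i) <= M * \sum_i sqc (x i)) ->
  0 <= Re (\sum_b \sum_e ⟪w b, w e⟫ * ⟪u b, u e⟫) <= M * \sum_e n2 (u e).
Proof.
move=> hM; have [m [g [og gu]]] := gram_schmidt_fun u.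
have -> : Re (\sum_b \sum_e ⟪w b, w e⟫ * ⟪u b, u e⟫) = \sum_i n2 (\sum_e ⟪g i, u e⟫ *: w e).
  rewrite -Re_sum; congr (complex.Re _).
  have h b e : ⟪w b, w e⟫ * ⟪u b, u e⟫ = \sum_i ⟪⟪g i, u b⟫ *: w b, ⟪g i, u e⟫ *: w e⟫.
    rewrite (inner_ons _ (gu e)) mulr_sumr; apply: eq_bigr => i _.
    by rewrite innerZl innerZr; ring.
  under eq_bigr do under eq_bigr do rewrite h.
  under eq_bigr do rewrite exchange_big.
  rewrite exchange_big; apply: eq_bigr => i _ /=; rewrite inner_suml; apply: eq_bigr => b _.
  by rewrite inner_sumr.
apply/andP; split; first by apply: sumr_ge0 => i _; exact: n2_ge0.
have -> : \sum_e n2 (u e) = \sum_i \sum_e sqc ⟪g i, u e⟫.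
  by rewrite exchange_big; apply: eq_bigr => e _; exact: n2_ons.
by rewrite mulr_sumr; apply: ler_sum => i _; exact: hM.
Qed.

End FiniteTraces.

(** * Norms of symmetric two-particle vectors *)

Section SymmetricTensorBound.
Variables (R : realType) (H : hilbertType R) (F : fock_space H).

Definition cn_polar (x y : H) : F := cn F 2 (x + y) - cn F 2 (x - y).

Lemma inner_cn_polar x y z w : ⟪cn_polar x y, cn_polar z w⟫ =
  4%:C%C * (⟪x, z⟫ * ⟪y, w⟫ + ⟪x, w⟫ * ⟪y, z⟫).
Proof.
rewrite /cn_polar innerBl !innerBr !inner_cn; set r := (_%:C)%C.
have -> : 4%:C%C = r * 8%:R.
  have -> : r = (2^-1)%:C%C by [].
  by apply: complex_ext; rewrite !reim /=; field.
rewrite !(innerDl, innerDr, innerNl, innerNr); ring.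
Qed.

Lemma cn_polar_sym x y : cn_polar x y = cn_polar y x.
Proof.
have cN z : cn F 2 (- z) = cn F 2 z by rewrite -scaleN1r cn_scale expr2 mulrNN mulr1 scale1r.
by rewrite /cn_polar [y + x]addrC -[y - x]opprB cN.
Qed.

(** Symmetrization contracts: the squared norm is 4 (T c c + T c c'), with c' the transpose, and
    positivity of T at c - c' bounds the mixed term by T c c. Then [gram_tensor] applies to T c
    c. *)
Lemma sym_tensor_bound n (z : 'I_n -> H) (c : 'I_n -> 'I_n -> R[i]) (M : R) :
  (forall x : 'I_n -> R[i], n2 (\sum_i x i *: z i) <= M * \sum_i sqc (x i)) ->
  n2 (\sum_(p : 'I_n * 'I_n) c p.1 p.2 *: cn_polar (z p.1) (z p.2)) <=
  8 * (M * \sum_b n2 (\sum_a c a b *: z a)).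
Proof.
move=> hM.
pose T (c c' : 'I_n -> 'I_n -> R[i]) := \sum_(p : 'I_n * 'I_n) \sum_(q : 'I_n * 'I_n)
  (c q.1 p.1)^*%C * c' q.2 p.2 * (⟪z q.1, z q.2⟫ * ⟪z p.1, z p.2⟫).
pose tr (c : 'I_n -> 'I_n -> R[i]) a b := c b a.
have Tflip c1 c2 : T (tr c1) (tr c2) = T c1 c2.
  rewrite /T exchange_big; apply: eq_bigr => p _; apply: eq_bigr => q _ /=.
  by rewrite /tr; congr (_ * _); rewrite mulrC.
have Tpos c1 : 0 <= Re (T c1 c1) <= M * \sum_b n2 (\sum_a c1 a b *: z a).
  have := gram_tensor (fun b => \sum_a c1 a b *: z a) hM.
  rewrite (_ : \sum_b \sum_e _ = T c1 c1)//.
  rewrite pair_bigA; apply: eq_bigr => p _ /=.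
  rewrite -[RHS](pair_bigA _ (fun a d =>
    (c1 a p.1)^*%C * c1 d p.2 * (⟪z a, z d⟫ * ⟪z p.1, z p.2⟫))) /=.
  rewrite inner_suml mulr_sumr; apply: eq_bigr => a _.
  rewrite inner_sumr mulr_sumr; apply: eq_bigr => d _; rewrite innerZl innerZr; ring.
have e1 : n2 (\sum_(p : 'I_n * 'I_n) c p.1 p.2 *: cn_polar (z p.1) (z p.2)) =
    4 * (Re (T c c) + Re (T c (tr c))).
  have h1 : \sum_(x : 'I_n * 'I_n) \sum_(y : 'I_n * 'I_n)
      (c x.1 x.2)^*%C * c y.1 y.2 * (⟪z x.1, z y.1⟫ * ⟪z x.2, z y.2⟫) = T c c.
    rewrite /T !pair_bigA /= (reindex (fun t => ((t.2.1, t.1.1), (t.2.2, t.1.2)))) //=.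
    by exists (fun t => ((t.1.2, t.2.2), (t.1.1, t.2.1))) => -[[a b] [d e]].
  have h2 : \sum_(x : 'I_n * 'I_n) \sum_(y : 'I_n * 'I_n)
      (c x.1 x.2)^*%C * c y.1 y.2 * (⟪z x.1, z y.2⟫ * ⟪z x.2, z y.1⟫) = T c (tr c).
    rewrite /T !pair_bigA /= (reindex (fun t => ((t.2.1, t.1.1), (t.1.2, t.2.2)))) //=.
    by exists (fun t => ((t.1.2, t.2.1), (t.1.1, t.2.2))) => -[[a b] [d e]].
  rewrite -ReD -h1 -h2.
  have -> (a : R[i]) : 4 * Re a = Re (4%:C%C * a) by rewrite !reim; ring.
  congr (complex.Re _).
  rewrite inner_suml -big_split mulr_sumr; apply: eq_bigr => x _ /=.
  rewrite inner_sumr -big_split mulr_sumr; apply: eq_bigr => y _ /=.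
  rewrite innerZl innerZr inner_cn_polar; ring.
have /andP[_ hb] := Tpos c.
have /andP[hs _] := Tpos (fun a b => c a b - tr c a b).
have e2 : T (fun a b => c a b - tr c a b) (fun a b => c a b - tr c a b) =
    T c c - T c (tr c) - (T (tr c) c - T (tr c) (tr c)).
  rewrite /T -!sumrB; apply: eq_bigr => p _; rewrite -!sumrB; apply: eq_bigr => q _.
  rewrite !conjE; ring.
have e3 : T (tr c) c = T c (tr c) by rewrite -Tflip.
rewrite e2 e3 Tflip !reim in hs.
by rewrite e1; move: hb hs; lra.
Qed.

End SymmetricTensorBound.

Section Compression.
Variables (R : realType) (H : hilbertType R).
Implicit Types (x y : H) (A S B C : H -> H).

Lemma pos_compression n (f : 'I_n -> H) A : ons f -> pos A -> pos (oproj f \o (A \o oproj f)).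
Proof.
move=> of_ [bA sA pA]; have bf := oproj_bdop of_; split.
- by apply: bdop_comp => //; exact: bdop_comp.
- by move=> x y /=; rewrite oproj_sa sA oproj_sa.
- by move=> x /=; rewrite /rip -oproj_sa -/(rip _ _).
Qed.

(** S vanishes orthogonally to f, because |S x|^2 sees only the projection of x; being self-adjoint,
    it also has its range in the span of f. *)
Lemma compression_sqrt n (f : 'I_n -> H) A S : ons f -> pos S ->
  (forall x, S (S x) = oproj f (A (oproj f x))) ->
  (forall x, oproj f (S x) = S x) /\ forall x, oproj f x = x -> n2 (S x) = rip x (A x).
Proof.
move=> of_ [bS sS _] SS.
have n2S x : n2 (S x) = rip (oproj f x) (A (oproj f x)).
  by rewrite /n2 sS SS -oproj_sa.
split=> [x|x fx]; last by rewrite n2S fx.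
apply: inner_ext => z; rewrite -oproj_sa -!(sS _ x).
apply/eqP; rewrite -subr_eq0 -innerBl -(linB _ _ bS.1).
suff -> : S (oproj f z - z) = 0 by rewrite inner0l.
by apply/eqP; rewrite -n2_eq0 n2S (linB _ _ (oproj_linear f)) oproj_idem// subrr rip0l.
Qed.

End Compression.

(** * The Lyapunov equation for two positive operators *)

Section FiniteEstimate.
Variables (R : realType) (H : hilbertType R).
Variables (n : nat) (f : 'I_n -> H) (X Y : H -> H).
Hypotheses (of_ : ons f) (pX : pos X) (pY : pos Y).
Hypotheses (fX : forall x, oproj f (X x) = X x) (fY : forall x, oproj f (Y x) = Y x).
Hypothesis Xi : forall x, oproj f x = x -> X x = 0 -> x = 0.
Implicit Types (x y g : H).

Let lX : linear X. Proof. by case: pX => -[]. Qed.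
Let lY : linear Y. Proof. by case: pY => -[]. Qed.
Let sX : adjoint_operators X X. Proof. by case: pX. Qed.
Let sY : adjoint_operators Y Y. Proof. by case: pY. Qed.
Let lf : linear (oproj f) := oproj_linear f.

Let P x := X x + Y x.
Let T x := X x - Y x.

Let lP : linear P.
Proof. by move=> a x y; rewrite /P lX lY; hvec. Qed.
Let lT : linear T.
Proof. by move=> a x y; rewrite /T lX lY; hvec. Qed.
Let sP : adjoint_operators P P.
Proof. by move=> x y; rewrite /P !innE sX sY. Qed.
Let sT : adjoint_operators T T.
Proof. by move=> x y; rewrite /T !innE sX sY. Qed.
Let fP x : oproj f (P x) = P x.
Proof. by rewrite /P (linD _ _ lf) fX fY. Qed.
Let fT x : oproj f (T x) = T x.
Proof. by rewrite /T (linB _ _ lf) fX fY. Qed.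

Let P_gt0 g : oproj f g = g -> n2 g = 1 -> 0 < rip g (P g).
Proof.
move=> fg g1; have [_ _ X0] := pX; have [_ _ Y0] := pY.
rewrite /P ripDr lt_neqAle addr_ge0// andbT; apply/eqP => e.
have e0 : rip g (X g) = 0 by apply/eqP; rewrite eq_le X0 andbT; have := Y0 g; lra.
by move: g1; rewrite (Xi fg (pos_eq0 pX e0)) n2_0 => /eqP; rewrite eq_sym oner_eq0.
Qed.

Let T_le g : `|rip g (T g)| <= rip g (P g).
Proof.
have [_ _ X0] := pX; have [_ _ Y0] := pY.
by rewrite /T /P ripBr ripDr ler_norml; have := X0 g; have := Y0 g; lra.
Qed.

(* In an eigenbasis of P = X + Y, the solution c of P c + c P = 2 T has entries
   2 T_kl / (p_k + p_l). Its eigenvalues lie in [-1, 1] because - P <= T <= P. *)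
Lemma lyapunov_solution : exists C, [/\ linear C, adjoint_operators C C,
  forall x, oproj f (C x) = C x,
  \sum_i ⟪f i, C (X (X (f i)) - Y (Y (f i)))⟫ = (\sum_i n2 (T (f i)))%:C%C &
  \sum_i (n2 (X (C (f i))) + n2 (Y (C (f i)))) <= 5 / 2 * \sum_i n2 (T (f i))].
Proof.
have [e [p [oe ef Pe]]] := diagonalization of_ lP sP fP.
have fe k : oproj f (e k) = e k by rewrite -ef ons_fix.
have n2e k : n2 (e k) = 1 by rewrite /n2 oe eqxx.
have p0 k : 0 < p k.
  have := P_gt0 (fe k) (n2e k).
  by rewrite Pe ripZr rip_n2 n2e mulr1.
pose c k l : R[i] := (2 / (p k + p l))%:C%C * ⟪e k, T (e l)⟫.
pose C x := \sum_k (\sum_l c k l * ⟪e l, x⟫) *: e k.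
have lC : linear C.
  move=> a x y; rewrite /C scaler_sumr -big_split; apply: eq_bigr => k _ /=.
  rewrite scalerA -scalerDl; congr (_ *: _); rewrite mulr_sumr -big_split.
  by apply: eq_bigr => l _ /=; rewrite innerDr innerZr; ring.
have eC k x : ⟪e k, C x⟫ = \sum_l c k l * ⟪e l, x⟫ by exact: ons_inner_sum.
have cJ k l : (c k l)^*%C = c l k by rewrite /c JM JC -innerC sT addrC.
have eCe k l : ⟪e k, C (e l)⟫ = c k l.
  rewrite eC (bigD1 l)//= oe eqxx mulr1 big1 ?addr0// => i il.
  by rewrite oe (negbTE il) mulr0.
have sC : adjoint_operators C C.
  move=> x y; rewrite [in LHS]/C [in RHS]/C inner_suml inner_sumr.
  under eq_bigr do rewrite scaler_suml inner_suml.
  under [RHS]eq_bigr do rewrite scaler_suml inner_sumr.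
  rewrite exchange_big; apply: eq_bigr => k _; apply: eq_bigr => l _ /=.
  by rewrite innerZl innerZr JM cJ -innerC mulrAC.
have fC x : oproj f (C x) = C x.
  rewrite /C (lin_sum _ _ _ lf); apply: eq_bigr => k _.
  by rewrite (linZ _ _ lf) fe.
have ePx k x : ⟪e k, P x⟫ = (p k)%:C%C * ⟪e k, x⟫ by rewrite -sP Pe innerZl JC.
have ext u v : oproj f u = u -> oproj f v = v -> (forall k, ⟪e k, u⟫ = ⟪e k, v⟫) -> u = v.
  by move=> fu fv h; rewrite -fu -fv -!ef /oproj; apply: eq_bigr => k _; rewrite h.
have eqC x : oproj f x = x -> P (C x) + C (P x) = 2%:C%C *: T x.
  move=> fx; have key k l : ⟪e k, P (C (e l)) + C (P (e l))⟫ = 2%:C%C * ⟪e k, T (e l)⟫.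
    rewrite innerDr ePx eCe Pe (linZ _ _ lC) innerZr eCe -mulrDl -rmorphD/= /c mulrA -rmorphM/=.
    have -> : (p k + p l) * (2 / (p k + p l)) = 2; last by [].
    by field; rewrite gt_eqF// addr_gt0.
  have le l : P (C (e l)) + C (P (e l)) = 2%:C%C *: T (e l).
    apply: ext => [||k]; last by rewrite key innerZr.
      by rewrite (linD _ _ lf) fP fC.
    by rewrite (linZ _ _ lf) fT.
  rewrite -fx -ef /oproj (lin_sum _ _ _ lC) (lin_sum _ _ _ lP) (lin_sum _ _ _ lP) (lin_sum _ _ _ lC).
  rewrite (lin_sum _ _ _ lT) scaler_sumr -big_split; apply: eq_bigr => k _ /=.
  by rewrite !(linZ _ _ lC, linZ _ _ lP, linZ _ _ lT) -scalerDr le !scalerA mulrC.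
have [g [lam [og gf Cg]]] := diagonalization of_ lC sC fC.
have fg k : oproj f (g k) = g k by rewrite -gf ons_fix.
have n2g k : n2 (g k) = 1 by rewrite /n2 og eqxx.
(* At an eigenvector g of C the equation reads <g, T g> = lam <g, P g>. *)
have lam1 k : lam k ^+ 2 <= 1.
  have Pg := P_gt0 (fg k) (n2g k).
  have h : rip (g k) (T (g k)) = lam k * rip (g k) (P (g k)).
    have := congr1 (fun x => rip (g k) x) (eqC _ (fg k)); rewrite ripDr ripZr.
    have -> : rip (g k) (C (P (g k))) = lam k * rip (g k) (P (g k)).
      by rewrite /rip -sC Cg innerZl JC; apply: ReZ.
    by rewrite Cg (linZ _ _ lP) ripZr; lra.
  have := T_le (g k); rewrite h normrM (gtr0_norm Pg) ger_pMl// => hl.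
  by rewrite -[lam k ^+ 2]real_normK ?num_real// expr_le1.
have trT m (u : 'I_m -> H) : ons u -> oproj u =1 oproj f ->
    forall D, linear D -> adjoint_operators D D -> forall E, linear E -> adjoint_operators E E ->
    \sum_i n2 (D (E (u i))) = \sum_i n2 (D (E (f i))).
  move=> ou uf D lD sD E lE sE.
  have lED : linear (fun x => E (D (D (E x)))) by move=> a x y; rewrite lE !lD lE.
  have h k (v : 'I_k -> H) : \sum_i n2 (D (E (v i))) = Re (\sum_i ⟪v i, E (D (D (E (v i))))⟫).
    by rewrite Re_sum; apply: eq_bigr => i _; rewrite /n2 sD sE.
  by rewrite !h (trace_ons ou of_ uf lED).
have lid : linear (fun x : H => x) by [].
have sid : adjoint_operators (fun x : H => x) (fun x : H => x) by [].
set tau := \sum_i n2 (T (f i)).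
have te : \sum_k n2 (T (e k)) = tau by exact: (trT _ _ oe ef _ lT sT _ lid sid).
have tg : \sum_k n2 (T (g k)) = tau by exact: (trT _ _ og gf _ lT sT _ lid sid).
exists C; split=> //.
(* By cyclicity the trace of C (T P + P T) / 2 is that of (P C + C P) T / 2, that is, of T^2. *)
- have XY x : X (X x) - Y (Y x) = (2^-1)%:C%C *: (T (P x) + P (T x)).
    have -> : T (P x) + P (T x) = 2%:C%C *: (X (X x) - Y (Y x)).
      rewrite /T /P (linB _ _ lX) (linB _ _ lY) (linD _ _ lX) (linD _ _ lY).
      by rewrite -[2%:C%C]/(1 + 1)%:C%C rmorphD/= scalerDl scale1r; hvec.
    by rewrite scalerA -rmorphM/= mulVf ?scale1r// pnatr_eq0.
  have lXY : linear (fun x => C (X (X x) - Y (Y x))).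
    move=> a x y; rewrite !lX !lY -lC; congr C; hvec.
  rewrite -(trace_ons oe of_ ef lXY) -te rmorph_sum; apply: eq_bigr => k _ /=.
  rewrite XY -sC innerZr innerDr -(sP (C (e k))) Pe (linZ _ _ lT) -[(p k)%:C%C *: T (e k)]/(_ *: _).
  rewrite innerZr.
  have -> : (p k)%:C%C * ⟪C (e k), T (e k)⟫ = ⟪C (P (e k)), T (e k)⟫.
    by rewrite Pe (linZ _ _ lC) innerZl JC.
  rewrite addrC -innerDl eqC// innerZl JC mulrA -rmorphM/= mulVf ?pnatr_eq0// mul1r.
  exact: inner_n2.
(* The parallelogram law passes to P C and T C. The factors 2 p_k / (p_k + p_l) are at most 2 and
   the eigenvalues of C at most 1 in modulus, which gives (4 + 1) / 2. *)
- have -> : \sum_i (n2 (X (C (f i))) + n2 (Y (C (f i)))) =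
      2^-1 * (\sum_i n2 (P (C (f i))) + \sum_i n2 (T (C (f i)))).
    rewrite -big_split mulr_sumr; apply: eq_bigr => i _ /=.
    by have := parallelogram (X (C (f i))) (Y (C (f i))); rewrite /P /T; lra.
  have h1 : \sum_i n2 (P (C (f i))) <= 4 * tau.
    rewrite -(trT _ _ oe ef _ lP sP _ lC sC) -te mulr_sumr; apply: ler_sum => l _.
    rewrite (n2_ons oe); last by rewrite ef fP.
    rewrite (n2_ons oe (x := T (e l))); last by rewrite ef fT.
    rewrite mulr_sumr; apply: ler_sum => k _; rewrite ePx eCe /c mulrA -rmorphM/= sqcM sqcC.
    apply: ler_wpM2r; first exact: sqc_ge0.
    have q0 : 0 < p k + p l by rewrite addr_gt0.
    have b0 : 0 <= p k * (2 / (p k + p l)) by rewrite mulr_ge0 ?divr_ge0// ltW.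
    have b2 : p k * (2 / (p k + p l)) <= 2.
      by rewrite mulrA ler_pdivrMr//; have := p0 l; lra.
    have -> : 4 = 2 * 2 :> R by ring.
    by rewrite expr2; exact: ler_pM.
  have h2 : \sum_i n2 (T (C (f i))) <= tau.
    rewrite -(trT _ _ og gf _ lT sT _ lC sC) -tg; apply: ler_sum => k _.
    by rewrite Cg (linZ _ _ lT) n2Z sqcC ler_piMl ?n2_ge0.
  by move: h1 h2; lra.
Qed.

End FiniteEstimate.

(** * Square roots of compressions *)

Section SquareRootApproximation.
Variables (R : realType) (H : hilbertType R).
Implicit Types (A S B : H -> H) (x y : H).

(** The rate is that of the scalar iteration [sq_tau], so N depends on c and e alone. *)
Lemma pos_sqrt_approx (c e : R) : 0 < c -> 0 < e -> exists N, forall A S, pos A ->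
  (forall x, rip x (A x) <= c * n2 x) -> pos S -> (forall x, S (S x) = A x) ->
  forall x, hn (S x - (Num.sqrt c)%:C%C *: (x - sq_it (fun y => y - (c^-1)%:C%C *: A y) N x)) <= e * hn x.
Proof.
move=> c0 e0; have s0 : 0 < Num.sqrt c by rewrite sqrtr_gt0.
have [N hN] := sq_tau_cauchy (divr_gt0 e0 (mulr_gt0 (ltr0n _ 2) s0)); exists N => A S pA hc pS SS x.
have [S' [pS' S'S' _ app]] := pos_sqrt pA c0 hc.
have -> : S x = S' x by apply: sqrt_unique => // y; rewrite SS S'S'.
have [M hM] := app _ (divr_gt0 e0 (ltr0n _ 2)).
pose B y := y - (c^-1)%:C%C *: A y.
have bB : bdop B by have [bA _ _] := pA; apply: bdopB; [exact: bdop_id|exact: bdopZ].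
have hB y : hn (B y) <= hn y by exact: pos_complement_contraction.
pose m := maxn N M; have Nm : (N <= m)%N by exact: leq_maxl.
have h1 := hM m x (leq_maxr N M).
have h2 := sq_it_diff bB.1 hB x Nm.
have h3 := hN N m (leqnn N) Nm.
rewrite (_ : S' x - _ = (S' x - (Num.sqrt c)%:C%C *: (x - sq_it B m x)) +
  (Num.sqrt c)%:C%C *: (sq_it B N x - sq_it B m x)); last by hvec.
apply: le_trans (hnD _ _) _; rewrite hnZ ncC (gtr0_norm s0) -[hn (sq_it B N x - _)]hnN opprB.
have h4 := ler_wpM2r (hn_ge0 x) (ltW h3).
have h5 := ler_wpM2l (ltW s0) (le_trans h2 h4).
have e1 : Num.sqrt c * (e / (2 * Num.sqrt c) * hn x) = e / 2 * hn x.
  by field; rewrite gt_eqF.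
by move: h1 h5; rewrite -/B e1; lra.
Qed.

Definition krylov n (f : 'I_n -> H) B m x :=
  forall k, (k <= m)%N -> oproj f (iter k B x) = iter k B x.

(** [sq_it B p] is a polynomial in B of degree at most 2^p, so it cannot tell B from its compression
    on vectors whose first iterates stay in the span of f. *)
Lemma krylov_sq_it n (f : 'I_n -> H) B B' : linear B ->
  (forall x, oproj f x = x -> oproj f (B x) = B x -> B' x = B x) ->
  forall p m x, krylov f B (m + 2 ^ p) x -> sq_it B' p x = sq_it B p x /\ krylov f B m (sq_it B p x).
Proof.
move=> lB hB; have lf := oproj_linear f.
have lit k : linear (iter k B) by elim: k => [//|k ih] a x y /=; rewrite ih lB.
have kD m x y : krylov f B m x -> krylov f B m y -> krylov f B m (x + y).
  by move=> hx hy k km; rewrite (linD _ _ (lit k)) (linD _ _ lf) hx// hy.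
have kZ m (a : R[i]) x : krylov f B m x -> krylov f B m (a *: x).
  by move=> hx k km; rewrite (linZ _ _ (lit k)) (linZ _ _ lf) hx.
have kS m m' x : (m' <= m)%N -> krylov f B m x -> krylov f B m' x.
  by move=> mm hx k km; apply: hx; exact: leq_trans mm.
have kB m x : krylov f B m.+1 x -> krylov f B m (B x).
  by move=> hx k km; rewrite -iterSr; exact: hx.
elim=> [|p ih] m x hx /=.
  by split=> // k _; rewrite (lin0 (lit k)) (lin0 lf).
have h1 : krylov f B (m + 2 ^ p + 2 ^ p) x by rewrite -addnA addnn -mul2n -expnS.
have [e1 k1] := ih _ _ h1; have [e2 k2] := ih _ _ k1.
have kx : krylov f B m.+1 x.
  by apply: kS hx; rewrite -addn1 leq_add2l expn_gt0.
rewrite e1 e2 (hB x); [|exact: (kx 0%N)|exact: (kx 1%N)].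
by split=> //; apply: kZ; apply: kD => //; exact: kB.
Qed.

(** Both roots are close to the same polynomial applied to x. *)
Lemma sqrt_krylov (c e : R) : 0 < c -> 0 < e -> exists N, forall n (f : 'I_n -> H) A S S',
  ons f -> pos A -> (forall x, rip x (A x) <= c * n2 x) -> pos S -> (forall x, S (S x) = A x) ->
  pos S' -> (forall x, S' (S' x) = oproj f (A (oproj f x))) ->
  forall x, krylov f (fun y => y - (c^-1)%:C%C *: A y) N x -> hn (S' x - S x) <= e * hn x.
Proof.
move=> c0 e0; have [N hN] := pos_sqrt_approx c0 (divr_gt0 e0 (ltr0n _ 2)).
exists (2 ^ N)%N => n f A S S' of_ pA hc pS SS pS' SS' x kx.
have h1 := hN _ _ pA hc pS SS x.
have hc' y : rip y (oproj f (A (oproj f y))) <= c * n2 y.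
  rewrite /rip -oproj_sa; apply: le_trans (hc _) _; rewrite ler_pM2l//.
  by rewrite -hn_le2 oproj_hn.
have h2 := hN _ _ (pos_compression of_ pA) hc' pS' SS' x.
have lB : linear (fun y => y - (c^-1)%:C%C *: A y).
  by have [bA _ _] := pA; apply: (bdopB (bdop_id H) (bdopZ _ bA)).1.
have cn0 : (c^-1)%:C%C != 0 :> R[i] by rewrite -(rmorph0 (@real_complex R)) (inj_eq (@complexI R)) invr_eq0 gt_eqF.
have [|e1 _] := @krylov_sq_it n f _ (fun y => y - (c^-1)%:C%C *: oproj f (A (oproj f y))) lB _ N 0 x kx.
  move=> y fy; rewrite (linB _ _ (oproj_linear f)) (linZ _ _ (oproj_linear f)) fy.
  by move=> ->.
rewrite /= e1 in h2.
rewrite -[S' x](subrK ((Num.sqrt c)%:C%C *: (x - sq_it (fun y => y - (c^-1)%:C%C *: A y) N x))) -addrA.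
apply: le_trans (hnD _ _) _; rewrite -[hn (_ - S x)]hnN opprB.
by move: h1 h2; lra.
Qed.

Variable j : H -> H.
Hypotheses (jl : forall (a : R[i]) x y, j (a *: x + y) = (a^*)%C *: j x + j y)
  (jK : forall x, j (j x) = x) (jI : forall x y, ⟪j x, j y⟫ = ⟪y, x⟫).

Lemma real_gram_schmidt (s : seq H) : exists n (f : 'I_n -> H),
  [/\ ons f, forall i, j (f i) = f i & forall x, x \in s -> oproj f x = x].
Proof.
have [n e x jx je|x jx|x|n [f [of_ jf fs]]] := @gram_schmidt R H [set x | j x = x] _ _
    ([seq rpart j x | x <- s] ++ [seq ipart j x | x <- s]).
- rewrite /= (conj_B jl) jx /oproj (conj_sum jl); congr (_ - _); apply: eq_bigr => i _.
  by rewrite (conj_Z jl) je (real_inner_rip jI (je i) jx) JC.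
- by rewrite /= (conj_Zr jl) jx.
- by rewrite mem_cat => /orP[] /mapP[y _ ->]; [exact: rpart_j|exact: ipart_j].
exists n, f; split=> // x xs; have lf := oproj_linear f.
rewrite -{1}(rpartE j x) (linD _ _ lf) (linZ _ _ lf) !fs ?rpartE//.
  by rewrite mem_cat map_f ?orbT.
by rewrite mem_cat map_f.
Qed.

End SquareRootApproximation.

(** * The uniform Hilbert-Schmidt bound *)

Section NecessityEstimate.
Variables (R : realType) (H : hilbertType R) (F : fock_space H).
Variables (K : set H) (X j V A : H -> H).
Hypotheses (sd : std_data K X j) (bV : bdop V) (bA : bdop A).
Hypothesis hA : forall x y, ⟪x, A y⟫ = ⟪V x, V y⟫.
Hypothesis him : forall h k, j h = h -> j k = k -> Im ⟪V h, V k⟫ = Im ⟪X h, X k⟫.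
Variable C : R.
Hypothesis C0 : 0 < C.
Hypothesis hC : forall s : seq (R * H), (forall p, p \in s -> j p.2 = p.2) ->
  (\sum_(p <- s) p.1 * (n2 (X p.2) - n2 (V p.2))) ^+ 2 <=
  C * (n2 (\sum_(p <- s) p.1%:C%C *: cn F 2 (X p.2)) + n2 (\sum_(p <- s) p.1%:C%C *: cn F 2 (V p.2))).
Implicit Types (x y h k : H).

Let jl := sdj sd.
Let lX : linear X := (sd_bX sd).1.

Section Polarization.
Variables (n : nat) (f : 'I_n -> H) (B : H -> H).
Hypotheses (of_ : ons f) (sB : adjoint_operators B B) (fB : forall x, oproj f (B x) = B x).

(** The polarized form of the observable with the real part of the matrix of B as coefficients; for
    real f its vectors are real, as [hC] requires. *)
Definition polar_family : seq (R * H) :=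
  [seq (Re ⟪f p.1, B (f p.2)⟫ / 4, f p.1 + f p.2) | p : 'I_n * 'I_n] ++
  [seq (- (Re ⟪f p.1, B (f p.2)⟫ / 4), f p.1 - f p.2) | p : 'I_n * 'I_n].

Lemma polar_family_sum (U : nmodType) (g : R * H -> U) : \sum_(q <- polar_family) g q =
  \sum_(p : 'I_n * 'I_n) (g (Re ⟪f p.1, B (f p.2)⟫ / 4, f p.1 + f p.2) +
    g (- (Re ⟪f p.1, B (f p.2)⟫ / 4), f p.1 - f p.2)).
Proof. by rewrite big_split big_cat !big_image. Qed.

(** The vectors [cn_polar] are symmetric and the matrix of B is hermitian, so the imaginary parts of
    its entries cancel and [sym_tensor_bound] applies to the full matrix. *)
Lemma polar_family_n2 Z (m : R) : linear Z -> (forall x, hn (Z x) <= m * hn x) ->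
  n2 (\sum_(q <- polar_family) q.1%:C%C *: cn F 2 (Z q.2)) <=
  m ^+ 2 / 2 * \sum_b n2 (Z (B (f b))).
Proof.
move=> lZ hZ; rewrite polar_family_sum.
pose c a b := ⟪f a, B (f b)⟫.
pose S := \sum_(p : 'I_n * 'I_n) c p.1 p.2 *: cn_polar F (Z (f p.1)) (Z (f p.2)).
have cJ a b : (c a b)^*%C = c b a by rewrite /c -innerC sB.
have SJ : S = \sum_(p : 'I_n * 'I_n) (c p.1 p.2)^*%C *: cn_polar F (Z (f p.1)) (Z (f p.2)).
  rewrite /S (reindex (fun p => (p.2, p.1)))/=; last by exists (fun p => (p.2, p.1)) => -[].
  by apply: eq_bigr => p _; rewrite cJ cn_polar_sym.
have -> : \sum_(p : 'I_n * 'I_n) ((Re ⟪f p.1, B (f p.2)⟫ / 4)%:C%C *: cn F 2 (Z (f p.1 + f p.2)) +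
    (- (Re ⟪f p.1, B (f p.2)⟫ / 4))%:C%C *: cn F 2 (Z (f p.1 - f p.2))) = (4^-1)%:C%C *: S.
  have -> : S = (2^-1)%:C%C *: (S + S) by rewrite scalerDr -scalerDl two_half scale1r.
  rewrite {2}SJ -big_split scalerA scaler_sumr; apply: eq_bigr => p _ /=.
  rewrite (linD _ _ lZ) (linB _ _ lZ) rmorphN scaleNr -scalerBr -/(cn_polar F _ _) -scalerDl scalerA.
  by congr (_ *: _); rewrite -/(c _ _); apply: complex_ext; rewrite !reim; field.
rewrite n2Z sqcC.
have hM (x : 'I_n -> R[i]) : n2 (\sum_i x i *: Z (f i)) <= m ^+ 2 * \sum_i sqc (x i).
  rewrite -(ons_n2 _ of_) -hn2 -[X in _ <= _ * X]hn2 -exprMn.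
  have := hZ (\sum_i x i *: f i); rewrite (lin_sum _ _ _ lZ).
  under eq_bigr do rewrite (linZ _ _ lZ).
  by move=> h; rewrite lerXn2r ?nnegrE ?hn_ge0//; apply: le_trans h; exact: hn_ge0.
have := sym_tensor_bound F c hM.
have -> : \sum_b n2 (\sum_a c a b *: Z (f a)) = \sum_b n2 (Z (B (f b))).
  apply: eq_bigr => b _; rewrite -[in RHS](fB (f b)) /oproj (lin_sum _ _ _ lZ).
  by under [in RHS]eq_bigr do rewrite (linZ _ _ lZ).
by rewrite -/S; lra.
Qed.

Lemma polar_family_dist (Z : H -> H) : linear Z ->
  \sum_(q <- polar_family) q.1 * n2 (Z q.2) =
  \sum_a \sum_b Re ⟪f a, B (f b)⟫ * rip (Z (f a)) (Z (f b)).
Proof.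
move=> lZ; rewrite polar_family_sum pair_bigA; apply: eq_bigr => p _ /=.
by rewrite (linD _ _ lZ) (linB _ _ lZ) n2D n2B; field.
Qed.

End Polarization.

(** With B from the Lyapunov equation both sides of the variance bound involve the same quantity:
    tau^2 <= M tau, with M independent of the compression. *)
Lemma compressed_bound : exists2 M : R, 0 <= M & forall n (f : 'I_n -> H) S S', ons f ->
  (forall i, j (f i) = f i) -> pos S -> (forall x, S (S x) = oproj f (X (X (oproj f x)))) ->
  pos S' -> (forall x, S' (S' x) = oproj f (A (oproj f x))) ->
  \sum_i n2 (S (f i) - S' (f i)) <= M.
Proof.
have [_ [m m0 hm]] := sd_bX sd; have [lV [m' m'0 hm']] := bV.
pose M := C * ((m ^+ 2 + m' ^+ 2) / 2 * (5 / 2)).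
have M0 : 0 <= M by rewrite !mulr_ge0 ?divr_ge0 ?addr_ge0 ?sqr_ge0 ?(ltW C0).
exists M => // n f S S' of_ jf pS SS pS' SS'.
have [fS nS] := compression_sqrt (A := X \o X) of_ pS SS.
have [fS' nS'] := compression_sqrt of_ pS' SS'.
have nX x : oproj f x = x -> n2 (S x) = n2 (X x) by move=> /nS ->; rewrite /rip /= -(sd_sX sd).
have nV x : oproj f x = x -> n2 (S' x) = n2 (V x) by move=> /nS' ->; rewrite /rip hA.
have Si x : oproj f x = x -> S x = 0 -> x = 0.
  by move=> /nX e e0; apply: (sdXi sd); apply/eqP; rewrite -n2_eq0 -e e0 n2_0.
have [B [lB sB fB trB costB]] := lyapunov_solution of_ pS pS' fS fS' Si.
set tau := \sum_i n2 (S (f i) - S' (f i)) in trB costB *.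
have jp p : p \in polar_family f B -> j p.2 = p.2.
  by rewrite mem_cat => /orP[] /mapP[q _ ->] /=; [rewrite (conj_D jl) !jf|rewrite (conj_B jl) !jf].
have := hC jp.
have -> : \sum_(p <- polar_family f B) p.1 * (n2 (X p.2) - n2 (V p.2)) = tau.
  under eq_bigr do rewrite mulrBr.
  rewrite sumrB !polar_family_dist// -sumrB.
  have -> : tau = Re (\sum_i ⟪f i, B (S (S (f i)) - S' (S' (f i)))⟫) by rewrite trB.
  rewrite Re_sum; apply: eq_bigr => i _; rewrite -sumrB.
  rewrite SS SS' ons_fix// -(linB _ _ (oproj_linear f)) /oproj (lin_sum _ _ _ lB) inner_sumr Re_sum.
  apply: eq_bigr => k _; rewrite (linZ _ _ lB) innerZr.
  (* The symplectic forms agree, so this entry is real and only the real part of the matrix of B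
     enters the trace. *)
  have -> : ⟪f k, X (X (f i)) - A (f i)⟫ = (rip (X (f i)) (X (f k)) - rip (V (f i)) (V (f k)))%:C%C.
    rewrite innerBr hA -(sd_sX sd); apply: complex_ext; rewrite !reim ?him ?subrr//.
    by rewrite (ripC (X (f i))) (ripC (V (f i))).
  by rewrite ReZ; ring.
have p1 := polar_family_n2 of_ sB fB lX hm.
have p2 := polar_family_n2 of_ sB fB lV hm'.
have cost : \sum_b n2 (X (B (f b))) + \sum_b n2 (V (B (f b))) <= 5 / 2 * tau.
  rewrite -big_split; apply: le_trans costB; apply: ler_sum => i _.
  by rewrite nX// nV.
have s1 : 0 <= \sum_b n2 (X (B (f b))) by apply: sumr_ge0 => i _; exact: n2_ge0.
have s2 : 0 <= \sum_b n2 (V (B (f b))) by apply: sumr_ge0 => i _; exact: n2_ge0.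
have key : n2 (\sum_(p <- polar_family f B) p.1%:C%C *: cn F 2 (X p.2)) +
    n2 (\sum_(p <- polar_family f B) p.1%:C%C *: cn F 2 (V p.2)) <=
    (m ^+ 2 + m' ^+ 2) / 2 * (5 / 2 * tau).
  have a0 : 0 <= (m ^+ 2 + m' ^+ 2) / 2 by rewrite divr_ge0 ?addr_ge0 ?sqr_ge0.
  apply: le_trans (ler_wpM2l a0 cost).
  have q1 := mulr_ge0 (sqr_ge0 m) s2; have q2 := mulr_ge0 (sqr_ge0 m') s1.
  by move: p1 p2; lra.
move=> h; have {}h : tau ^+ 2 <= M * tau.
  apply: le_trans h _; apply: le_trans (ler_wpM2l (ltW C0) key) _.
  by rewrite /M -!mulrA.
have t0 : 0 <= tau by apply: sumr_ge0 => i _; exact: n2_ge0.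
have [->//|tn] := eqVneq tau 0.
by rewrite -(@ler_pM2r _ tau) -?expr2// lt_neqAle eq_sym tn.
Qed.

(** To test on m orthonormal vectors, compress to a space of real vectors that contains enough of
    their iterates under X^2 and A; there the compressed roots almost agree with X and Y. *)
Lemma sqrt_difference_hs Y : pos Y -> (forall x, Y (Y x) = A x) -> hs (fun x => X x - Y x).
Proof.
move=> pY YY; have [M M0 hM] := compressed_bound.
have pX := sdX sd; have [bX sX _] := pX; have [bY sY _] := pY.
pose XX := X \o X.
have pXX : pos XX by exact: pos_comp.
have pA : pos A.
  split=> // [x y|x]; first by rewrite -!YY sY sY.
  by rewrite -YY /rip -sY -/(n2 _) n2_ge0.
have [c1 c10 hc1] := pos_ub pXX; have [c2 c20 hc2] := pos_ub pA.
pose c := c1 + c2; have c0 : 0 < c by rewrite addr_gt0.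
have hX x : rip x (XX x) <= c * n2 x.
  by apply: le_trans (hc1 x) _; rewrite ler_wpM2r ?n2_ge0// lerDl ltW.
have hAc x : rip x (A x) <= c * n2 x.
  by apply: le_trans (hc2 x) _; rewrite ler_wpM2r ?n2_ge0// lerDr ltW.
exists (2 * M + 8) => m g og.
(* The m errors of size 8 e^2 then add up to at most 8. *)
pose e : R := m.+1%:R^-1; have e0 : 0 < e by rewrite invr_gt0.
have [N hN] := sqrt_krylov H c0 e0.
pose kry (D : H -> H) := [seq iter k (fun y => y - (c^-1)%:C%C *: D y) (g a) | k : nat <- iota 0 N.+1, a : 'I_m <- enum 'I_m].
have [n [f [of_ jf fs]]] := real_gram_schmidt jl (sdjK sd) (sdjI sd) (kry XX ++ kry A).
have hk (D : H -> H) a : {subset kry D <= kry XX ++ kry A} -> krylov f (fun y => y - (c^-1)%:C%C *: D y) N (g a).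
  move=> sub k kN; apply: fs; apply: sub; apply/allpairsP; exists (k, a).
  by split=> //; [rewrite mem_iota|rewrite mem_enum].
have [S [pS SS _]] := sqrt_exists (pos_compression of_ pXX).
have [S' [pS' SS' _]] := sqrt_exists (pos_compression of_ pA).
have n1 a : hn (g a) = 1 by rewrite /hn /n2 og eqxx sqrtr1.
have dX a : hn (S (g a) - X (g a)) <= e.
  have := hN n f XX X S of_ pXX hX pX (fun x => erefl) pS SS (g a).
  by rewrite n1 mulr1; apply; apply: hk => x xk; rewrite mem_cat; apply/orP; left.
have dY a : hn (S' (g a) - Y (g a)) <= e.
  have := hN n f A Y S' of_ pA hAc pY YY pS' SS' (g a).
  by rewrite n1 mulr1; apply; apply: hk => x xk; rewrite mem_cat; apply/orP; right.
have tr : \sum_a n2 (S (g a) - S' (g a)) <= M.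
  apply: le_trans (hM n f S S' of_ jf pS SS pS' SS').
  have [fS _] := compression_sqrt of_ pS SS; have [fS' _] := compression_sqrt of_ pS' SS'.
  have [_ sS _] := pS; have [_ sS' _] := pS'.
  have e1 a : n2 (S (g a) - S' (g a)) = \sum_i sqc ⟪g a, S (f i) - S' (f i)⟫.
    rewrite (n2_ons of_); last by rewrite (linB _ _ (oproj_linear f)) fS fS'.
    apply: eq_bigr => i _; rewrite innerBr -sS -sS' -innerBl innerC.
    by rewrite /sqc ReJ ImJ sqrrN.
  under eq_bigr do rewrite e1.
  by rewrite exchange_big; apply: ler_sum => i _; exact: bessel.
have step a : n2 (X (g a) - Y (g a)) <= 2 * n2 (S (g a) - S' (g a)) + 8 * e ^+ 2.
  rewrite (_ : X (g a) - Y (g a) = (S (g a) - S' (g a)) + ((S' (g a) - Y (g a)) - (S (g a) - X (g a)))); last by hvec.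
  apply: le_trans (n2_le_2 _ _) _; rewrite lerD2l.
  have h : hn ((S' (g a) - Y (g a)) - (S (g a) - X (g a))) <= 2 * e.
    by apply: le_trans (hnB _ _) _; have := dX a; have := dY a; lra.
  by move: h; rewrite hn_le ?mulr_ge0 ?(ltW e0)// exprMn; lra.
apply: le_trans (ler_sum _ (fun a _ => step a)) _.
rewrite big_split -mulr_sumr; apply: lerD; first by rewrite ler_pM2l.
rewrite sumr_const card_ord -[_ *+ m]mulr_natl mulrCA ger_pMr//.
rewrite /e expr2 mulrA ler_pdivrMr// mul1r ler_pdivrMr//.
apply: (@le_trans _ _ m.+1%:R); first by rewrite ler_nat.
by rewrite ler_peMr// ler1n.
Qed.

End NecessityEstimate.

Lemma isomorphism_hilbert_schmidt (R : realType) (H : hilbertType R) (F : fock_space H)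
    (W : H -> F -> F) (K1 K2 : set H) (Q : H -> H) (phi : (F -> F) -> (F -> F)) :
  weyl_operators W -> standard_subspace K1 -> standard_subspace K2 -> symplectomorphism K1 K2 Q ->
  vN_isomorphism (weyl_algebra W K1) (weyl_algebra W K2) phi ->
  (forall h, K1 h -> phi (W h) = W (Q h)) ->
  bounded_real_on K1 Q /\ exists A B : H -> H,
   [/\ positive_sqrt_on (complexify K1) (inner_s K1) (fun x => x + imI *: modular_R K1 x) A,
       positive_sqrt_on (complexify K1) (inner_s K1) (fun x => imI *: modular_R K1 x +
         Cextend K2 (real_adjoint K1 Q) (Cextend K1 Q x)) B &
       hilbert_schmidt_on (complexify K1) (inner_s K1) (fun x => A x - B x)].
Proof.
move=> hW st1 st2 hQ iso hphi.
have bQ := isomorphism_bounded hW st2 st1 hQ iso hphi; split=> //.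
have [X [j sd]] := standard_data st1; have bV := symp_op_bdop sd st1 hQ bQ.
set V := symp_op X j Q in bV; have [Vs bVs aV] := adj_exists bV.
pose G := Vs \o V; have bG : bdop G by exact: bdop_comp.
have hG x y : ⟪x, G y⟫ = ⟪V x, V y⟫ by rewrite aV.
have pG : pos G.
  split=> // [x y|x]; first by rewrite hG innerC hG -innerC.
  by rewrite /rip hG -/(n2 _) n2_ge0.
have [Y [pY YY _]] := sqrt_exists pG; have [bY sY _] := pY; have [bX sX _] := sdX sd.
have [C C0 hC] := quadratic_variance hW st1 st2 hQ iso hphi.
have hC' (s : seq (R * H)) : (forall p, p \in s -> j p.2 = p.2) ->
    (\sum_(p <- s) p.1 * (n2 (X p.2) - n2 (V p.2))) ^+ 2 <=
    C * (n2 (\sum_(p <- s) p.1%:C%C *: cn F 2 (X p.2)) + n2 (\sum_(p <- s) p.1%:C%C *: cn F 2 (V p.2))).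
  move=> js; have := hC [seq (p.1, X p.2) | p <- s]; rewrite !big_map /=.
  have e p : p \in s -> V p.2 = Q (X p.2) by move=> /js; exact: (symp_op_real sd st1 hQ).
  have -> : \sum_(p <- s) p.1 * (n2 (X p.2) - n2 (V p.2)) = \sum_(p <- s) p.1 * (n2 (X p.2) - n2 (Q (X p.2))).
    by apply: eq_big_seq => p /e ->.
  have -> : \sum_(p <- s) p.1%:C%C *: cn F 2 (V p.2) = \sum_(p <- s) p.1%:C%C *: cn F 2 (Q (X p.2)).
    by apply: eq_big_seq => p /e ->.
  apply=> _ /mapP[p ps ->] /=; apply: (sd_XK sd); exact: js.
have hsT := sqrt_difference_hs sd bV bG hG (fun h k jh jk => symp_op_im sd st1 hQ jh jk) C0 hC' pY YY.
have [A [sA AX]] := domain_positive_sqrt (f := fun x => x + imI *: modular_R K1 x) sd (sdX sd)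
  (fun x => erefl) (sd_iR sd).
have [B [sB BX]] := domain_positive_sqrt (f := fun x => imI *: modular_R K1 x +
  Cextend K2 (real_adjoint K1 Q) (Cextend K1 Q x)) sd pY YY (symp_iR_QdQ sd st1 st2 hQ bG.1 hG).
have TX z : A (X z) - B (X z) = X (X z - Y z) by rewrite AX BX (linB _ _ bX.1).
exists A, B; split=> //.
apply: (hs_domain sd hsT (bdopB bX bY) TX).
have [T [[TD Tl [M hM]] TT]] := domain_operator sd (bdopB bX bY).
(* Off the domain the values of A and B are arbitrary, so boundedness is transferred from T on the
   domain only. *)
have e x : complexify K1 x -> A x - B x = T x.
  by move=> /(sd_complexify sd)[z <-]; rewrite TT TX.
split=> [x Dx|a x y Dx Dy|]; first by rewrite e//; exact: TD.
  have Daxy : complexify K1 (a *: x + y).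
    move: Dx Dy => /(sd_complexify sd)[z <-] /(sd_complexify sd)[w <-].
    by apply/(sd_complexify sd); exists (a *: z + w); exact: bX.1.
  by rewrite !e//; exact: Tl.
by exists M => x Dx; rewrite e//; exact: hM.
Qed.

Theorem theorem2p5 (R : realType) (H : hilbertType R) (F : fock_space H)
    (W : H -> F -> F)
    (K1 K2 : set H) (Q : H -> H) :
  weyl_operators W ->
  standard_subspace K1 ->
  standard_subspace K2 ->
  symplectomorphism K1 K2 Q ->
  (exists phi : (F -> F) -> (F -> F),
     vN_isomorphism (weyl_algebra W K1) (weyl_algebra W K2) phi /\
     forall h, K1 h -> phi (W h) = W (Q h))
  <->
  (bounded_real_on K1 Q /\
   let D := complexify K1 in
   let ip := inner_s K1 in
   let iR1 := fun x => imI *: modular_R K1 x in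
   let QdQ := fun x => Cextend K2 (real_adjoint K1 Q) (Cextend K1 Q x) in
   exists A B : H -> H,
     [/\ positive_sqrt_on D ip (fun x => x + iR1 x) A,
         positive_sqrt_on D ip (fun x => iR1 x + QdQ x) B &
         hilbert_schmidt_on D ip (fun x => A x - B x)]).
Proof.
move=> hW st1 st2 hQ; split=> [[phi [iso hphi]]|[bQ [A [B [sA sB hsAB]]]]].
  exact: isomorphism_hilbert_schmidt iso hphi.
exact: hilbert_schmidt_isomorphism sA sB hsAB.
Qed.
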